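(* Let $N\in\mathbb{N}$, $2<p<\infty$, $s\in\{1,\ldots,5\}$, and let $\mathcal{L}$, $q\in[p,\infty]$, $Q:\mathbb{R}^N\to\mathbb{R}$ and $(\mathcal{R}_k)_{k\in\mathcal{I}_s}$ be such that the conditions (A1), (A2), (A3) formulated in the context hold for all $k\in\mathcal{I}_s$. Then the nonlinear wave equation $$\partial_{tt}U+\mathcal{L}U=Q(x)|U|^{p-2}U\quad\text{on }\mathbb{R}\times\mathbb{R}^N$$ admits an unbounded sequence of $2\pi$-periodic real-valued distributional breather solutions $U_j\in L^q(\mathbb{R}^N,L^p_s(\mathbb{T}))$, $j\in\mathbb{N}_0$. That is, $\sup_{j}\|U_j\|_{L^q(\mathbb{R}^N,L^p(\mathbb{T}))}=\infty$ and each $U=U_j$ satisfies $$\int_{\mathbb{T}\times\mathbb{R}^N}U\,(\partial_{tt}+\mathcal{L})\Phi\,\mathrm{d}(t,x)=\int_{\mathbb{T}\times\mathbb{R}^N}Q(x)|U|^{p-2}U\,\Phi\,\mathrm{d}(t,x)\qquad\text{for all }\Phi\in C_c^\infty(\mathbb{R}^N,C^\infty(\mathbb{T})).$$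
   Context: Notation. $\mathbb{T}=\mathbb{R}/2\pi\mathbb{Z}\simeq[0,2\pi]$. $r'$ denotes the Hölder conjugate exponent of $r$. Functions in $L^r(\mathbb{R}^N)$ are real-valued; real linear operators such as $\mathcal{R}_k$ are extended to complex-valued functions by $\mathcal{R}_k(f+\mathrm{i}g)=\mathcal{R}_kf+\mathrm{i}\mathcal{R}_kg$. The norm of $L^q(\mathbb{R}^N,L^p(\mathbb{T}))$ is $\|W\|_{L^q(\mathbb{R}^N,L^p(\mathbb{T}))}=\big\|\,\|W(\cdot,x)\|_{L^p(\mathbb{T})}\big\|_{L^q(\mathbb{R}^N)}$ for functions $W=W(t,x)$ on $\mathbb{T}\times\mathbb{R}^N$. $L^q(\mathbb{R}^N,L^p_s(\mathbb{T}))$ is the subspace of real-valued elements having the time symmetry indexed by $s$: $s=1$: no additional symmetry; $s=2$: $U(t,x)=U(-t,x)$; $s=3$: $U(t,x)=-U(-t,x)$; $s=4$: $U(t+\pi,x)=U(t,x)$; $s=5$: $U(t+\pi,x)=-U(t,x)$. Index sets: $\mathcal{I}_1=\mathcal{I}_2=\mathbb{Z}$, $\mathcal{I}_3=\mathbb{Z}\setminus\{0\}$, $\mathcal{I}_4=2\mathbb{Z}$, $\mathcal{I}_5=2\mathbb{Z}+1$. $C_c^\infty(\mathbb{R}^N,C^\infty(\mathbb{T}))$ is the set of smooth functions $\Phi:\mathbb{T}\times\mathbb{R}^N\to\mathbb{R}$, $2\pi$-periodic in time, for which there is a compact $K\subset\mathbb{R}^N$ with $\operatorname{supp}\Phi(t,\cdot)\subset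 K$ for all $t\in\mathbb{T}$. $\mathcal{L}\Phi$ means that $\mathcal{L}$ is applied to $\Phi(t,\cdot)$ for each $t$. Conditions (for $k\in\mathcal{I}_s$): (A1) For some $m\in\mathbb{N}$, $\mathcal{L}$ is a (real) linear map that is bounded from $W^{m,\infty}(K)$ to $L^{q'}(\mathbb{R}^N)$ for every compact $K\subset\mathbb{R}^N$, meaning that it acts on functions $\phi\in W^{m,\infty}(\mathbb{R}^N)$ supported in $K$ and $\|\mathcal{L}\phi\|_{L^{q'}(\mathbb{R}^N)}\le C_K\|\phi\|_{W^{m,\infty}(K)}$. There are bounded linear operators $\mathcal{R}_k:L^{q'}(\mathbb{R}^N)\to L^q(\mathbb{R}^N)$ (with $q\in[p,\infty]$) that are symmetric, i.e. $\int_{\mathbb{R}^N}\mathcal{R}_kf\cdot g\,\mathrm{d}x=\int_{\mathbb{R}^N}f\cdot\mathcal{R}_kg\,\mathrm{d}x$ for all $f,g\in L^{q'}(\mathbb{R}^N)$, and satisfy $\mathcal{R}_k=\mathcal{R}_{-k}$, $\|\mathcal{R}_k\|\le C(k^2+1)^{-\alpha/2}$ for some $\alpha>1-\frac2p$ and $C>0$ independent of $k$, and $$\int_{\mathbb{R}^N}\mathcal{R}_kf\cdot(\mathcal{L}-k^2)\phi\,\mathrm{d}x=\int_{\mathbb{R}^N}f\phi\,\mathrm{d}x\qquad\text{for all }f\in L^{q'}(\mathbb{R}^N),\ \phi\in C_c^\infty(\mathbb{R}^N).$$ (A2) $Q\in L^{q/(q-p)}(\mathbb{R}^N)$ (with $q/(q-p):=\infty$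 if $q=p$ and $:=1$ if $q=\infty$), $Q\ge0$, $Q\not\equiv0$, and the linear operators $v\mapsto\mathcal{R}^Q_k[v]:=Q^{1/p}\,\mathcal{R}_k[Q^{1/p}v]$ are compact from $L^{p'}(\mathbb{R}^N)$ to $L^p(\mathbb{R}^N)$. (A3) There are $\omega_k\in L^{p'}(\mathbb{R}^N)$ with $\int_{\mathbb{R}^N}\omega_k\,\mathcal{R}^Q_k[\omega_k]\,\mathrm{d}x>0$. *)

(* Defs.v *)
From HB Require Import structures.
From mathcomp Require Import all_boot all_order all_algebra.
From mathcomp Require Import all_classical all_reals all_analysis.

Set Implicit Arguments.
Unset Strict Implicit.
Unset Printing Implicit Defensive.
Import Order.TTheory GRing.Theory Num.Theory.
Import numFieldNormedType.Exports.

Local Open Scope classical_set_scope.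
Local Open Scope ring_scope.

Definition measure_rV_display : measure_display -> measure_display.
Proof. exact. Qed.

(* The product sigma-algebra on row vectors; for real entries this is the Borel
   sigma-algebra of the topology on 'rV[R]_n. *)
Section measurable_rV.
Context d (T : measurableType d) (n : nat).

Let coors : 'I_n -> 'rV[T]_n -> T := fun i v => v ord0 i.

Let rV_set0 : g_sigma_preimage coors set0.
Proof. exact: sigma_algebra0. Qed.

Let rV_setC A : g_sigma_preimage coors A -> g_sigma_preimage coors (~` A).
Proof. exact: sigma_algebraC. Qed.

Let rV_bigcup (F : _^nat) : (forall i, g_sigma_preimage coors (F i)) ->
  g_sigma_preimage coors (\bigcup_i (F i)).
Proof. exact: sigma_algebra_bigcup. Qed.

HB.instance Definition _ := @isMeasurable.Build (measure_rV_display d)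
  'rV[T]_n (g_sigma_preimage coors) rV_set0 rV_setC rV_bigcup.

Lemma measurable_rV_coord (i : 'I_n) :
  measurable_fun [set: 'rV[T]_n] (fun v : 'rV[T]_n => v ord0 i).
Proof.
move=> _ Y mY; rewrite setTI; apply: sub_sigma_algebra => /=.
rewrite -bigcup_seq/=; exists i => /=; first by rewrite mem_index_enum.
by exists Y => //; rewrite setTI.
Qed.

Lemma measurable_fun_rVP d' (S : measurableType d') (f : S -> 'rV[T]_n) :
  measurable_fun [set: S] f <->
  forall i, measurable_fun [set: S] (fun x => f x ord0 i).
Proof.
split=> [mf i|mf].
  exact: (measurableT_comp (measurable_rV_coord i) mf).
have H : g_sigma_preimage (fun i => coors i \o f) `<=` measurable.
  apply: smallest_sub; first exact: sigma_algebra_measurable.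
  rewrite -bigcup_seq/=; apply: bigcup_sub => i _ A [B mB <-].
  exact: (mf i).
move=> _ A mA; rewrite setTI; apply: H; rewrite g_sigma_preimage_comp.
by exists A => //; rewrite setTI.
Qed.

End measurable_rV.

Section lebesgue_rV.
Context {R : realType}.

Definition rV_cons n (z : measurableTypeR R * 'rV[R]_n) : 'rV[R]_n.+1 :=
  \row_i oapp (z.2 ord0) z.1 (unlift ord0 i).

Lemma measurable_rV_cons n : measurable_fun setT (@rV_cons n).
Proof.
apply/measurable_fun_rVP => i.
case: (unliftP ord0 i) => [j|] ->.
- rewrite (_ : (fun _ => _) = (fun v : 'rV[R]_n => v ord0 j) \o snd).
    apply: measurableT_comp => //; exact: measurable_rV_coord.
  by apply/funext => z /=; rewrite mxE liftK.
- rewrite (_ : (fun _ => _) = fst) //.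
  by apply/funext => z /=; rewrite mxE unlift_none.
Qed.

HB.instance Definition _ n :=
  isMeasurableFun.Build _ _ _ _ (@rV_cons n) (@measurable_rV_cons n).

Definition rV_uncons n (v : 'rV[R]_n.+1) : measurableTypeR R * 'rV[R]_n :=
  (v ord0 ord0, \row_j v ord0 (lift ord0 j)).

Lemma rV_consK n : cancel (@rV_cons n) (@rV_uncons n).
Proof.
move=> [x v]; congr pair; first by rewrite mxE unlift_none.
by apply/rowP => j; rewrite !mxE liftK.
Qed.

Lemma measurable_rV_uncons n : measurable_fun setT (@rV_uncons n).
Proof.
apply/measurable_fun_pairP; split; first exact: measurable_rV_coord.
apply/measurable_fun_rVP => j.
rewrite (_ : (fun _ => _) = fun v : 'rV[R]_n.+1 => v ord0 (lift ord0 j)).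
  exact: measurable_rV_coord.
by apply/funext => v /=; rewrite mxE.
Qed.

Section step.
Variables (n : nat) (mu : {sigma_finite_measure set 'rV[R]_n -> \bar R}).

Definition lebesgue_rV_step : set 'rV[R]_n.+1 -> \bar R :=
  pushforward (lebesgue_measure \x mu)%E (@rV_cons n).

Let step0 : lebesgue_rV_step set0 = 0%E.
Proof. exact: measure0. Qed.

Let step_ge0 A : (0 <= lebesgue_rV_step A)%E.
Proof. exact: measure_ge0. Qed.

Let step_sigma_additive : semi_sigma_additive lebesgue_rV_step.
Proof. exact: measure_semi_sigma_additive. Qed.

HB.instance Definition _ := isMeasure.Build _ _ _ lebesgue_rV_step
  step0 step_ge0 step_sigma_additive.

Let step_sigma_finite : sigma_finite setT lebesgue_rV_step.
Proof.
have /sigma_finiteP[F [FT ndF Foo]] := sigma_finiteT (@lebesgue_measure R).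
have /sigma_finiteP[G [GT ndG Goo]] := sigma_finiteT mu.
exists (fun k => @rV_uncons n @^-1` (F k `*` G k)).
  rewrite -preimage_bigcup (_ : \bigcup_k _ = setT) ?preimage_setT//.
  apply/seteqP; split => // -[x v] _.
  have [[i _ Fix] [j _ Gjv]] : (\bigcup_k F k) x /\ (\bigcup_k G k) v.
    by rewrite -FT -GT.
  exists (maxn i j) => //; split => /=.
  - by move: x Fix; exact/subsetPset/ndF/leq_maxl.
  - by move: v Gjv; exact/subsetPset/ndG/leq_maxr.
move=> k; have [mF Fk] := Foo k; have [mG Gk] := Goo k; split.
  rewrite -[X in measurable X]setTI; apply: measurable_rV_uncons => //.
  exact: measurableX.
rewrite /lebesgue_rV_step /pushforward -comp_preimage.
rewrite (_ : _ \o _ = id); last by apply/funext => z; exact: rV_consK.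
by rewrite product_measure1E// lte_mul_pinfty// ge0_fin_numE.
Qed.

HB.instance Definition _ := Measure_isSigmaFinite.Build _ _ _
  lebesgue_rV_step step_sigma_finite.

End step.

Fixpoint lebesgue_rV n : {sigma_finite_measure set 'rV[R]_n -> \bar R} :=
  if n is m.+1 then lebesgue_rV_step (lebesgue_rV m) else \d_(0 : 'rV[R]_0).

Lemma lebesgue_rV_box n (A : 'I_n -> set R) :
  (forall i, measurable (A i)) ->
  lebesgue_rV n [set v : 'rV[R]_n | forall i, A i (v ord0 i)] =
  (\prod_(i < n) lebesgue_measure (A i))%E.
Proof.
elim: n A => [|n IHn] A mA.
  have -> : [set v : 'rV[R]_0 | forall i, A i (v ord0 i)] = setT.
    by apply/seteqP; split => // v _ [].
  by rewrite big_ord0 /= diracT.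
rewrite big_ord_recl -IHn// -product_measure1E; [|exact: mA|]; last first.
  rewrite (_ : mkset _ = \bigcap_(i in [set: 'I_n])
      ((fun v : 'rV[R]_n => v ord0 i) @^-1` A (lift ord0 i))).
    apply: fin_bigcap_measurable => // i _.
    by rewrite -[X in measurable X]setTI; exact: measurable_rV_coord.
  by apply/seteqP; split => [v Av i _|v Av i]; [exact: Av|exact: Av].
rewrite (_ : A ord0 `*` _ =
    @rV_cons n @^-1` [set v : 'rV[R]_n.+1 | forall i, A i (v ord0 i)])//.
apply/esym/seteqP; split => [[x v]|[x v] [/= Ax Av]] /=.
  move=> H; split => /=; first by have := H ord0; rewrite mxE unlift_none.
  by move=> i; have := H (lift ord0 i); rewrite mxE liftK.
by move=> i; rewrite mxE; case: (unliftP ord0 i) => [j|] -> //=.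
Qed.

End lebesgue_rV.

Section period_measure.
Context {R : realType}.

Let measurable_period :
  measurable (`[0, 2 * pi]%classic : set (measurableTypeR R)).
Proof. exact: measurable_itv. Qed.

Let period_finite :
  (lebesgue_measure (`[0%R, (2 * pi)%R]%classic : set (measurableTypeR R)) < +oo)%E.
Proof. by rewrite lebesgue_measure_itv/=; case: ifP => _; rewrite ?ltry. Qed.

(* T = R/2piZ is represented by the real line with Lebesgue measure restricted
   to one period; functions on T are 2pi-periodic functions on R. *)
Definition period_measure :
    {finite_measure set (measurableTypeR R) -> \bar R} :=
  mfrestr measurable_period period_finite.

End period_measure.

Section calculus.
Context {R : realType}.

Definition iter_derive (V : normedModType R) (s : seq V) (f : V -> R) : V -> R :=
  foldr (fun v (g : V -> R) x => 'D_v g x) f s.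

(* For finite-dimensional V this is C^oo. *)
Definition smooth (V : normedModType R) (f : V -> R) :=
  forall s : seq V,
    continuous (iter_derive s f) /\
    forall x v, derivable (iter_derive s f) x v.

Context {N : nat}.
Local Notation E := 'rV[R]_N.
Local Notation leb := (lebesgue_rV N).

Definition test_fun (phi : E -> R) :=
  smooth phi /\
  exists2 K : set E, compact K & forall x, ~ K x -> phi x = 0.

Definition spacetime_test_fun (Phi : R * E -> R) :=
  [/\ smooth Phi,
      forall t x, Phi (t + 2 * pi, x) = Phi (t, x) &
      exists2 K : set E, compact K & forall t x, ~ K x -> Phi (t, x) = 0].

Definition basis_vec (i : 'I_N) : E := delta_mx ord0 i.

(* Lists of coordinate directions play the role of multi-indices: the list s
   stands for the derivative of order size s along its entries. *)
Definition weak_derivative (s : seq 'I_N) (phi g : E -> R) :=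
  forall psi, test_fun psi ->
    \int[leb]_x (phi x * iter_derive (map basis_vec s) psi x) =
    (-1) ^+ size s * \int[leb]_x (g x * psi x).

Definition sobolev_infty (m : nat) (phi : E -> R) :=
  phi \in Lfun leb +oo%E /\
  forall s, (size s <= m)%N ->
    exists2 g, g \in Lfun leb +oo%E & weak_derivative s phi g.

(* Weak derivatives are a.e. unique, so this is the maximum over all orders at
   most m of the essential suprema of the derivatives. *)
Definition sobolev_infty_norm (m : nat) (phi : E -> R) : \bar R :=
  ereal_sup [set 'N[leb]_+oo%E[EFin \o g]%E | g in
    [set g | g \in Lfun leb +oo%E /\
      exists2 s, (size s <= m)%N & weak_derivative s phi g]].

Definition sobolev_supported (m : nat) (K : set E) (phi : E -> R) :=
  sobolev_infty m phi /\ {ae leb, forall x, ~ K x -> phi x = 0}.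

End calculus.

(* An operator between spaces of a.e. classes is given by a map on
   representatives that is linear up to null sets; compatibility with a.e.
   equality follows from linearity and boundedness. *)
Section operators.
Context {R : realType} {N : nat}.
Local Notation E := 'rV[R]_N.
Local Notation leb := (lebesgue_rV N).
Implicit Types (r : \bar R) (T : (E -> R) -> (E -> R)).

Definition bounded_linear r1 r2 T :=
  [/\ forall f, f \in Lfun leb r1 -> T f \in Lfun leb r2,
      forall (a : R) f g, f \in Lfun leb r1 -> g \in Lfun leb r1 ->
        T (fun x => a * f x + g x) = (fun x => a * T f x + T g x) %[ae leb] &
      exists C : R, forall f, f \in Lfun leb r1 ->
        ('N[leb]_r2[EFin \o T f] <= C%:E * 'N[leb]_r1[EFin \o f])%E].

Definition symmetric_op r T :=
  forall f g, f \in Lfun leb r -> g \in Lfun leb r ->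
    \int[leb]_x (T f x * g x) = \int[leb]_x (f x * T g x).

Definition compact_op r1 r2 T :=
  (forall f, f \in Lfun leb r1 -> T f \in Lfun leb r2) /\
  forall v : nat -> E -> R,
    (forall n, v n \in Lfun leb r1) ->
    (exists M : R, forall n, ('N[leb]_r1[EFin \o v n] <= M%:E)%E) ->
    exists sigma : nat -> nat, {homo sigma : i j / (i < j)%N >-> (i < j)%N} /\
    exists2 g, g \in Lfun leb r2 &
      (fun n => 'N[leb]_r2[EFin \o (T (v (sigma n)) \- g)%R]%E) @ \oo --> 0%E.

(* Boundedness from W^{m,oo}(K) to L^r for each compact K. *)
Definition locally_bounded_linear (m : nat) r T :=
  forall K : set E, compact K ->
  [/\ forall phi, sobolev_supported m K phi -> T phi \in Lfun leb r,
      forall (a : R) phi psi,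
        sobolev_supported m K phi -> sobolev_supported m K psi ->
        T (fun x => a * phi x + psi x) =
          (fun x => a * T phi x + T psi x) %[ae leb] &
      exists C : R, forall phi, sobolev_supported m K phi ->
        ('N[leb]_r[EFin \o T phi] <= C%:E * sobolev_infty_norm m phi)%E].

End operators.

(* I_1 = I_2 = Z, and only s = 1, ..., 5 is meaningful. *)
Definition freq (s : nat) : set int :=
  match s with
  | 3 => [set k | k != 0]
  | 4 => [set k | (2 %| k)%Z]
  | 5 => [set k | ~~ (2 %| k)%Z]
  | _ => setT
  end.

Section wave.
Context {R : realType} {N : nat}.
Local Notation E := 'rV[R]_N.
Local Notation leb := (lebesgue_rV N).
Local Notation conj := hoelder_conjugate.
Implicit Types (p : R) (q : \bar R) (L : (E -> R) -> (E -> R)) (Q : E -> R).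
Implicit Type Rk : int -> (E -> R) -> (E -> R).

Definition cond_A1 (s : nat) p q L Rk :=
  [/\ exists2 m : nat, (0 < m)%N & locally_bounded_linear m (conj q) L,
      forall k, freq s k ->
        [/\ bounded_linear (conj q) q (Rk k),
            symmetric_op (conj q) (Rk k) &
            forall f, f \in Lfun leb (conj q) -> Rk k f = Rk (- k) f %[ae leb]],
      exists2 alpha : R, 1 - 2 / p < alpha &
      exists2 C : R, 0 < C &
        forall k f, freq s k -> f \in Lfun leb (conj q) ->
          ('N[leb]_q[EFin \o Rk k f] <=
           (C * (k%:~R ^+ 2 + 1) `^ (- (alpha / 2)))%:E *
           'N[leb]_(conj q)[EFin \o f])%E &
      forall k f phi, freq s k -> f \in Lfun leb (conj q) -> test_fun phi ->
        \int[leb]_x (Rk k f x * (L phi x - k%:~R ^+ 2 * phi x)) =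
        \int[leb]_x (f x * phi x)].

(* The exponent q / (q - p), read as oo for q = p and as 1 for q = oo. *)
Definition weight_exponent p q : \bar R :=
  if q is r%:E then if r == p then +oo%E else (r / (r - p))%:E else 1%E.

Definition weighted p Q (T : (E -> R) -> (E -> R)) (v : E -> R) : E -> R :=
  fun x => Q x `^ p^-1 * T (fun y => Q y `^ p^-1 * v y) x.

Definition cond_A2 (s : nat) p q Q Rk :=
  [/\ Q \in Lfun leb (weight_exponent p q),
      {ae leb, forall x, 0 <= Q x},
      ~ {ae leb, forall x, Q x = 0} &
      forall k, freq s k ->
        compact_op (conj p%:E) p%:E (weighted p Q (Rk k))].

Definition cond_A3 (s : nat) p Q Rk :=
  forall k, freq s k -> exists2 w, w \in Lfun leb (conj p%:E) &
    0 < \int[leb]_x (w x * weighted p Q (Rk k) w x).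

Local Notation spacetime := (measurableTypeR R * 'rV[R]_N)%type.
Local Notation stm := (period_measure \x lebesgue_rV N)%E.

Definition mixed_norm p q (W : R * E -> R) : \bar R :=
  'N[leb]_q[(fun x => 'N[period_measure]_p%:E[(fun t => (W (t, x))%:E)])]%E.

Definition time_symmetric (s : nat) (U : R * E -> R) : Prop :=
  match s with
  | 2 => {ae stm, forall z : spacetime, U (z.1, z.2) = U (- z.1, z.2)}
  | 3 => {ae stm, forall z : spacetime, U (z.1, z.2) = - U (- z.1, z.2)}
  | 4 => {ae stm, forall z : spacetime, U (z.1 + pi, z.2) = U (z.1, z.2)}
  | 5 => {ae stm, forall z : spacetime, U (z.1 + pi, z.2) = - U (z.1, z.2)}
  | _ => True
  end.

Definition mixed_space (s : nat) p q (U : R * E -> R) :=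
  [/\ measurable_fun [set: spacetime] U,
      forall t x, U (t + 2 * pi, x) = U (t, x),
      (mixed_norm p q U < +oo)%E &
      time_symmetric s U].

Definition dtt (Phi : R * E -> R) (z : R * E) : R :=
  derive1n 2 (fun t : R => Phi (t, z.2)) z.1.

(* L only determines L (Phi (t, .)) up to a null set for each t, so L Phi is a
   jointly measurable function Psi with these slices; by Fubini it is unique up
   to a null set. *)
Definition spacetime_version L (Phi Psi : R * E -> R) :=
  measurable_fun [set: spacetime] Psi /\
  forall t, {ae leb, forall x, Psi (t, x) = L (fun y => Phi (t, y)) x}.

(* Integrability of both sides is part of the claim because \int is total. *)
Definition distributional_solution p L Q (U : R * E -> R) :=
  forall Phi, spacetime_test_fun Phi ->
  exists2 Psi, spacetime_version L Phi Psi &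
    let lhs := fun z : spacetime => U z * (dtt Phi z + Psi z) in
    let rhs := fun z : spacetime =>
      Q z.2 * `|U z| `^ (p - 2) * U z * Phi z in
    [/\ stm.-integrable setT (EFin \o lhs),
        stm.-integrable setT (EFin \o rhs) &
        \int[stm]_z lhs z = \int[stm]_z rhs z].

End wave.

(* Main.v *)
(* Fix m and use only the time frequencies k_j = m(2j+1), with profiles e_j(t) = cos(k_j t),
   or sin(k_j t) when s = 3. For V in L^{p'}(T x R^N) with Fourier coefficients c_j(V), put
   U = sum_j R_{k_j}[Q^{1/p} c_j(V)] e_j and A V = Q^{1/p} U. On the dyadic block
   j ~ 2^n, interpolation between L^2 and L^oo in time costs a factor 2^{n(1-2/p)}, whereas the R_k
   gain 2^{-n alpha}; hence the blocks sum geometrically, and A : L^{p'} -> L^p is symmetric, compact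
   and of norm O(m^{-alpha}). The form of A is positive somewhere by (A3), so that maximising it on
   the unit ball of L^{p'} gives V <> 0 with A V = |V|^{p'-2} V: a maximising sequence almost solves
   the Euler-Lagrange equation and therefore converges strongly by compactness. Inverting the duality
   map, V = |Q^{1/p} U|^{p-2} Q^{1/p} U and Q^{1/p} V = Q |U|^{p-2} U. Since U changes sign under
   t |-> t + pi/m and is even or odd in t, the same holds for V, so only the e_j occur in V, and
   (A1) shows that U solves the equation weakly. Pairing with a test function converges by the
   Dirichlet kernel, as test functions are Lipschitz in time. Finally 1 <= |A| |V|^{2-p'} forces
   |V|, and with it |U|, to infinity as m -> oo. *)
Require Import Defs.
From HB Require Import structures.
From mathcomp Require Import all_boot all_order all_algebra.
From mathcomp Require Import all_classical all_reals all_analysis.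
From mathcomp Require Import measurable_realfun ess_sup_inf.
From mathcomp Require Import ring lra zify.
Set Implicit Arguments.
Unset Strict Implicit.
Unset Printing Implicit Defensive.
Import Order.TTheory GRing.Theory Num.Theory.
Import numFieldNormedType.Exports.
Local Open Scope classical_set_scope.
Local Open Scope ring_scope.

(** * Lebesgue norms *)

(** Weak compactness of the unit ball is avoided: near maximality alone yields a quantitative
    Euler-Lagrange residual, and compactness of [A] then gives strong convergence through the
    duality maps. All operators act on representatives rather than on classes. The series for U is
    therefore turned into a function by a total limit [flim], chosen odd, so that the symmetries in
    time hold at every point, even where the series diverges. Likewise [L] applied to a test
    function is given at each time only up to a null set and must be replaced by one jointly
    measurable function; its Lipschitz dependence on time makes this possible. In time V is merely
    of class L^r with r = p/(p-1) < 2, so the partial sums are moved onto the test function, where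
    they stay uniformly bounded. The last estimate comes from |V|^(r-1) = |A V| <= |A| |V|; the same
    quantity |A V| is at most a constant times |U|, which carries the growth of V over to U. *)

Section Lnorm_facts.
Context d (T : measurableType d) (R : realType).
Variable mu : {measure set T -> \bar R}.
Local Open Scope ereal_scope.

Lemma measurable_fun_poweR (f : T -> \bar R) (q : R) :
  measurable_fun [set: T] f -> measurable_fun [set: T] (fun x => f x `^ q).
Proof. exact: (measurableT_comp (measurable_poweR _)). Qed.

Lemma ge0_le_poweR (r : R) (x y : \bar R) : (0 <= r)%R -> 0 <= x -> x <= y ->
  x `^ r <= y `^ r.
Proof.
by move=> r0 x0 xy; apply: gt0_ler_poweR => //; rewrite in_itv /= leey andbT// (le_trans x0).
Qed.

Lemma LfunP' (q : \bar R) (f : T -> R) : f \in Lfun mu q <->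
  measurable_fun [set: T] f /\ 'N[mu]_q[EFin \o f] < +oo.
Proof.
split=> [|[mf Nf]].
  by rewrite inE => /andP[]; rewrite !inE /= => mf Nf.
by rewrite inE; apply/andP; split; rewrite inE.
Qed.

Lemma Lnorm_le_ae (q : \bar R) (f g : T -> \bar R) : 1 <= q ->
  measurable_fun [set: T] f -> measurable_fun [set: T] g ->
  {ae mu, forall x, `|f x| <= `|g x|} -> 'N[mu]_q[f] <= 'N[mu]_q[g].
Proof.
case: q => [q||] q1 mf mg fg; [|
  by rewrite unlock; case: ifP => // _; exact: le_ess_sup|by rewrite leeNy_eq in q1].
have q0 : (0 < q)%R by rewrite (lt_le_trans ltr01).
have Im h : measurable_fun [set: T] h ->
    measurable_fun [set: T] (fun x => `|h x| `^ q).
  move=> mh; apply: measurable_fun_poweR.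
  exact: measurableT_comp.
rewrite unlock /= ge0_le_poweR ?invr_ge0 ?(ltW q0)//.
  by apply: integral_ge0 => x _; exact: poweR_ge0.
apply: ae_ge0_le_integral => //; try by move=> x _; exact: poweR_ge0.
- exact: Im.
- exact: Im.
apply: filterS fg => x fgx _.
by rewrite ge0_le_poweR ?(ltW q0).
Qed.

Lemma eq_Lnorm_ae (q : \bar R) (f g : T -> \bar R) : 1 <= q ->
  measurable_fun [set: T] f -> measurable_fun [set: T] g ->
  {ae mu, forall x, f x = g x} -> 'N[mu]_q[f] = 'N[mu]_q[g].
Proof.
move=> q1 mf mg fg; apply/eqP; rewrite eq_le; apply/andP; split;
  by apply: Lnorm_le_ae => //; apply: filterS fg => x ->.
Qed.

Lemma Lnorm_lty_ae (q : \bar R) (f : T -> \bar R) : 1 <= q ->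
  measurable_fun [set: T] f -> 'N[mu]_q[f] < +oo ->
  {ae mu, forall x, f x \is a fin_num}.
Proof.
case: q => [q||] q1 mf; last by rewrite leeNy_eq in q1.
  have q0 : (0 < q)%R by rewrite (lt_le_trans ltr01).
  rewrite unlock /= => /lty_poweRy -/(_ _)/wrap[|Nf].
    by rewrite gt_eqF ?invr_gt0.
  have : mu.-integrable [set: T] (fun x => `|f x| `^ q).
    apply/integrableP; split.
      apply: measurable_fun_poweR.
      exact: measurableT_comp.
    rewrite (eq_integral (fun x => `|f x| `^ q))// => x _.
    by rewrite gee0_abs ?poweR_ge0.
  move=> /(integrable_ae measurableT); apply: filterS => x /(_ I).
  rewrite [in X in X -> _]fin_numE => /andP[_]; apply: contraNT.
  by case: (f x) => [r||] //= _; rewrite (gt_eqF q0).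
(* The norm for [+oo] is 0 by convention when the whole space is null; in that case the whole space
   serves as exceptional set. *)
rewrite unlock; case: ifP => [mu0 fy|/negbT mu0 _].
  apply: filterS (ess_sup_ge mu (abse \o f)) => x /= fx.
  by rewrite fin_num_abs (le_lt_trans fx).
have /eqP : mu [set: T] = 0.
  by apply/eqP; rewrite eq_le measure_ge0 andbT leNgt.
move=> /eqP muT; exists [set: T]; split => //.
Qed.

(** Two finite norms make both functions finite almost everywhere, so that [fine] may be inserted
    and Minkowski's inequality for real functions applies; an infinite norm makes the bound
    trivial. *)
Lemma Lnorm_addD (q : \bar R) (f g : T -> \bar R) : 1 <= q ->
  measurable_fun [set: T] f -> measurable_fun [set: T] g ->
  (forall x, 0 <= f x) -> (forall x, 0 <= g x) ->
  'N[mu]_q[(fun x => f x + g x)] <= 'N[mu]_q[f] + 'N[mu]_q[g].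
Proof.
move=> q1 mf mg f0 g0.
have [Nf|] := ltP 'N[mu]_q[f] +oo; last first.
  by rewrite leye_eq => /eqP ->; rewrite addye ?leey// gt_eqF// (lt_le_trans _ (Lnorm_ge0 _ _ _)).
have [Ng|] := ltP 'N[mu]_q[g] +oo; last first.
  by rewrite leye_eq => /eqP ->; rewrite addey ?leey// gt_eqF// (lt_le_trans _ (Lnorm_ge0 _ _ _)).
have mff : measurable_fun [set: T] (fun x => fine (f x)) by exact: measurableT_comp.
have mfg : measurable_fun [set: T] (fun x => fine (g x)) by exact: measurableT_comp.
have af := Lnorm_lty_ae q1 mf Nf; have ag := Lnorm_lty_ae q1 mg Ng.
have mE (h : T -> R) : measurable_fun [set: T] h -> measurable_fun [set: T] (EFin \o h).
  by move=> mh; exact/measurable_EFinP.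
rewrite (@eq_Lnorm_ae _ _ (EFin \o ((fun x => fine (f x)) \+ (fun x => fine (g x)))%R))//.
- rewrite (@eq_Lnorm_ae _ f (EFin \o (fun x => fine (f x))))//; [|exact: mE|]; last first.
    by apply: filterS af => x fx /=; rewrite fineK.
  rewrite (@eq_Lnorm_ae _ g (EFin \o (fun x => fine (g x))))//; [|exact: mE|]; last first.
    by apply: filterS ag => x fx /=; rewrite fineK.
  exact: eminkowski.
- exact: emeasurable_funD.
- by apply: mE; exact: measurable_funD.
- by apply: filterS2 af ag => x fx gx /=; rewrite EFinD !fineK.
Qed.

Lemma Lnorm_sum (q : \bar R) (f : (T -> \bar R)^nat) n : 1 <= q ->
  (forall i, measurable_fun [set: T] (f i)) -> (forall i x, 0 <= f i x) ->
  'N[mu]_q[(fun x => \sum_(0 <= i < n) f i x)] <= \sum_(0 <= i < n) 'N[mu]_q[f i].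
Proof.
move=> q1 mf f0; elim: n => [|n IH].
  rewrite big_nil (_ : (fun _ => _) = cst 0).
    by rewrite Lnorm0// gt_eqF// (lt_le_trans lte01).
  by apply/funext => x; rewrite big_nil.
rewrite big_nat_recr//=.
rewrite (_ : (fun _ => _) = fun x => \sum_(0 <= i < n) f i x + f n x); last first.
  by apply/funext => x; rewrite big_nat_recr.
apply: le_trans (leeD2r _ IH); apply: Lnorm_addD => //.
  by apply: emeasurable_sum.
by move=> x; apply: sume_ge0 => i _.
Qed.

(** For a real exponent the q-th powers of the partial sums increase, and monotone convergence
    carries the bound [Lnorm_sum] to the limit. For [+oo] the countably many essential bounds hold
    off one null set. *)
Lemma Lnorm_nneseries (q : \bar R) (f : (T -> \bar R)^nat) : 1 <= q ->
  (forall i, measurable_fun [set: T] (f i)) -> (forall i x, 0 <= f i x) ->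
  'N[mu]_q[(fun x => \sum_(0 <= i <oo) f i x)] <= \sum_(0 <= i <oo) 'N[mu]_q[f i].
Proof.
move=> q1 mf f0.
set B := leRHS.
have BP n : 'N[mu]_q[(fun x => \sum_(0 <= i < n) f i x)] <= B.
  apply: (le_trans (Lnorm_sum n q1 mf f0)).
  by apply: nneseries_lim_ge => i _ _; exact: Lnorm_ge0.
have mS n : measurable_fun [set: T] (fun x => \sum_(0 <= i < n) f i x).
  exact: emeasurable_sum.
have S0 n x : 0 <= \sum_(0 <= i < n) f i x by apply: sume_ge0.
have B0 : 0 <= B by apply: nneseries_ge0 => i _ _; exact: Lnorm_ge0.
have nd x : nondecreasing_seq (fun n => \sum_(0 <= i < n) f i x).
  by apply: ereal_nondecreasing_series => i _ _.
have cvx x : (fun n => \sum_(0 <= i < n) f i x) @ \oo --> \sum_(0 <= i <oo) f i x.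
  by apply: is_cvg_nneseries => i _ _.
have {}supS x : \sum_(0 <= i <oo) f i x = ereal_sup (range (fun n => \sum_(0 <= i < n) f i x)).
  by apply/cvg_lim => //; exact: ereal_nondecreasing_cvgn.
case: q q1 @B BP B0 => [q||] q1 B BP B0; last by rewrite leeNy_eq in q1.
  2: {
  move: BP; rewrite unlock; case: ifP => // mu0 BP.
  apply/ess_supP.
  have : {ae mu, forall x, forall n, `|\sum_(0 <= i < n) f i x| <= B}.
    apply/ae_foralln => n; by move/ess_supP: (BP n).
  apply: filterS => x Bx /=; rewrite gee0_abs; last by apply: nneseries_ge0.
  rewrite supS; apply: ge_ereal_sup => _ [n _ <-].
  by rewrite -[leLHS]gee0_abs. }
have q0 : (0 < q)%R by rewrite (lt_le_trans ltr01).
have qn0 : (q != 0)%R by rewrite gt_eqF.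
pose g n x := (\sum_(0 <= i < n) f i x) `^ q.
have mg n : measurable_fun [set: T] (g n).
  by apply: measurable_fun_poweR.
have g0 n x : 0 <= g n x by exact: poweR_ge0.
have ndg x : nondecreasing_seq (g ^~ x).
  move=> i j ij; apply: ge0_le_poweR; rewrite ?invr_ge0 ?(ltW q0)//;
  try exact: poweR_ge0; try (by apply: integral_ge0 => x' _; exact: poweR_ge0); try exact: nneseries_ge0.
  - exact: nd.
(* Only this inequality between the power of the sum and the limit of the powers is needed; after
   taking q-th roots it says that a supremum bounds every partial sum. *)
have leg x : (\sum_(0 <= i <oo) f i x) `^ q <= limn (g ^~ x).
  have -> : limn (g ^~ x) = ereal_sup (range (g ^~ x)).
    by apply/cvg_lim => //; exact: ereal_nondecreasing_cvgn.
  set h := ereal_sup _.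
  have h0 : 0 <= h by apply: le_trans (g0 0%N x) _; apply: ereal_sup_ubound; exists 0%N.
  have hS : \sum_(0 <= i <oo) f i x <= h `^ q^-1.
    rewrite supS; apply: ge_ereal_sup => _ [n _ <-].
    have -> : \sum_(0 <= i < n) f i x = (g n x) `^ q^-1.
      by rewrite /g -poweRrM divff// poweRe1.
    apply: ge0_le_poweR; rewrite ?invr_ge0 ?(ltW q0)//;
  try exact: poweR_ge0; try (by apply: integral_ge0 => x' _; exact: poweR_ge0); try exact: nneseries_ge0.
    - by apply: ereal_sup_ubound; exists n.
  have -> : h = (h `^ q^-1) `^ q by rewrite -poweRrM mulVf// poweRe1.
  apply: ge0_le_poweR; rewrite ?invr_ge0 ?(ltW q0)//;
  try exact: poweR_ge0; try (by apply: integral_ge0 => x' _; exact: poweR_ge0); try exact: nneseries_ge0.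
have -> : B = (B `^ q) `^ q^-1 by rewrite -poweRrM divff// poweRe1.
rewrite unlock /=.
apply: ge0_le_poweR; rewrite ?invr_ge0 ?(ltW q0)//;
  try exact: poweR_ge0; try (by apply: integral_ge0 => x' _; exact: poweR_ge0); try exact: nneseries_ge0.
apply: (@le_trans _ _ (\int[mu]_x limn (g ^~ x))).
  apply: ge0_le_integral => //.
  - by move=> x _; exact: poweR_ge0.
  - apply: measurable_fun_poweR.
    by apply: measurableT_comp => //; exact: ge0_emeasurable_sum.
  - apply: (emeasurable_fun_cvg g) => // x _.
    by apply: ereal_nondecreasing_is_cvgn.
  - by move=> x _; rewrite gee0_abs ?leg//; apply: nneseries_ge0.
rewrite monotone_convergence//.
apply: lime_le; first apply: ereal_nondecreasing_is_cvgn.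
  by move=> i j ij; apply: ge0_le_integral => // x _; exact: ndg.
apply: nearW => n.
have := BP n; rewrite unlock /= => BPn.
have -> : \int[mu]_x g n x = ((\int[mu]_x `|\sum_(0 <= i < n) f i x| `^ q) `^ q^-1) `^ q.
  rewrite -poweRrM mulVf// poweRe1; last by apply: integral_ge0 => x _; exact: poweR_ge0.
  by apply: eq_integral => x _; rewrite gee0_abs.
apply: ge0_le_poweR; rewrite ?invr_ge0 ?(ltW q0)//;
  try exact: poweR_ge0; try (by apply: integral_ge0 => x' _; exact: poweR_ge0); try exact: nneseries_ge0.
Qed.
End Lnorm_facts.

Section Lnorm_real.
Context d (T : measurableType d) (R : realType).
Variable mu : {measure set T -> \bar R}.
Implicit Types f g : T -> R.

(** [fine] sends an infinite norm to 0, so this is the norm on [Lfun] only, through [lpnE]. *)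
Definition lpn (q : \bar R) f : R := fine 'N[mu]_q[EFin \o f].

Lemma lpn_ge0 q f : 0 <= lpn q f.
Proof. by rewrite fine_ge0 ?Lnorm_ge0. Qed.

Lemma lpnE q f : f \in Lfun mu q -> 'N[mu]_q[EFin \o f]%E = (lpn q f)%:E.
Proof.
by move=> /LfunP'[mf Nf]; rewrite /lpn fineK// ge0_fin_numE ?Lnorm_ge0.
Qed.

Lemma Lfun_meas q f : f \in Lfun mu q -> measurable_fun [set: T] f.
Proof. by case/LfunP'. Qed.

Lemma Lfun_emeas q f : f \in Lfun mu q -> measurable_fun [set: T] (EFin \o f).
Proof. by case/LfunP' => mf _; exact/measurable_EFinP. Qed.

Lemma Lfun_le q f g : (1 <= q)%E -> measurable_fun [set: T] f ->
  g \in Lfun mu q -> {ae mu, forall x, `|f x| <= `|g x|} -> f \in Lfun mu q.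
Proof.
move=> q1 mf /LfunP'[mg Ng] fg; apply/LfunP'; split => //.
by apply: le_lt_trans Ng; apply: Lnorm_le_ae => //; exact/measurable_EFinP.
Qed.

Lemma lpn_le q f g : (1 <= q)%E -> measurable_fun [set: T] f ->
  g \in Lfun mu q -> {ae mu, forall x, `|f x| <= `|g x|} -> lpn q f <= lpn q g.
Proof.
move=> q1 mf gL fg; have fL := Lfun_le q1 mf gL fg.
rewrite -lee_fin -!lpnE//; apply: Lnorm_le_ae => //.
  exact/measurable_EFinP.
exact: Lfun_emeas gL.
Qed.

Lemma Lfun_ae q f g : (1 <= q)%E -> measurable_fun [set: T] f ->
  g \in Lfun mu q -> {ae mu, forall x, f x = g x} -> f \in Lfun mu q.
Proof. by move=> q1 mf gL fg; apply: (Lfun_le q1 mf gL); apply: filterS fg => x ->. Qed.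

Lemma lpn_ae q f g : (1 <= q)%E -> measurable_fun [set: T] f ->
  g \in Lfun mu q -> {ae mu, forall x, f x = g x} -> lpn q f = lpn q g.
Proof.
move=> q1 mf gL fg; have fL := Lfun_ae q1 mf gL fg.
apply/eqP; rewrite eq_le; apply/andP; split; apply: lpn_le => //;
  try exact: Lfun_meas gL; by apply: filterS fg => x ->.
Qed.

Lemma Lfun_scal q f (a : R) : (1 <= q)%E ->
  f \in Lfun mu q -> (fun x => a * f x) \in Lfun mu q.
Proof.
move=> q1 fL; have := Lfun_submod_closed mu q1.
case=> /= z0 /(_ a f (fun _ => 0)) h.
have -> : (fun x => a * f x) = a *: f + (fun _ => 0 : R).
  by apply/funext => x /=; rewrite addr0.
by apply: h.
Qed.

Lemma Lfun_add q f g : (1 <= q)%E ->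
  f \in Lfun mu q -> g \in Lfun mu q -> (fun x => f x + g x) \in Lfun mu q.
Proof. by move=> q1 fL gL; apply: (Lfun_addr_closed mu q1).2. Qed.

Lemma Lfun0 q : (1 <= q)%E -> (fun _ : T => 0 : R) \in Lfun mu q.
Proof. by move=> q1; apply: (Lfun_addr_closed mu q1).1. Qed.

Lemma Lfun_sub q f g : (1 <= q)%E ->
  f \in Lfun mu q -> g \in Lfun mu q -> (fun x => f x - g x) \in Lfun mu q.
Proof.
move=> q1 fL gL; have -> : (fun x => f x - g x) = (fun x => f x + (-1) * g x).
  by apply/funext => x; rewrite mulN1r.
by apply: Lfun_add => //; exact: Lfun_scal.
Qed.

Lemma lpnZ q f (a : R) : (1 <= q)%E ->
  f \in Lfun mu q -> lpn q (fun x => a * f x) = `|a| * lpn q f.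
Proof.
move=> q1 fL; apply: EFin_inj; rewrite EFinM -lpnE; last exact: Lfun_scal.
rewrite -lpnE//.
by have := @LnormZ _ _ _ mu q q1 (Lfun_Sub q1 fL) a.
Qed.

Lemma lpnD q f g : (1 <= q)%E ->
  f \in Lfun mu q -> g \in Lfun mu q ->
  lpn q (fun x => f x + g x) <= lpn q f + lpn q g.
Proof.
move=> q1 fL gL; rewrite -lee_fin EFinD -!lpnE//; last exact: Lfun_add.
by apply: eminkowski => //; [exact: Lfun_meas fL|exact: Lfun_meas gL].
Qed.

Lemma lpnB q f g : (1 <= q)%E ->
  f \in Lfun mu q -> g \in Lfun mu q ->
  lpn q (fun x => f x - g x) <= lpn q f + lpn q g.
Proof.
move=> q1 fL gL; have -> : (fun x => f x - g x) = (fun x => f x + (-1) * g x).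
  by apply/funext => x; rewrite mulN1r.
apply: (le_trans (lpnD q1 fL (Lfun_scal _ q1 gL))).
by rewrite lpnZ// normrN1 mul1r.
Qed.

Lemma lpn_eq0 q f : (1 <= q)%E -> f \in Lfun mu q -> lpn q f = 0 ->
  {ae mu, forall x, f x = 0}.
Proof.
move=> q1 fL f0; have : ('N[mu]_q[EFin \o f] = 0)%E by rewrite lpnE// f0.
move=> /Lnorm_eq0_eq0 -/(_ (Lfun_emeas fL) (lt_le_trans lte01 q1)).
by apply: filterS => x /(_ I) [].
Qed.

Lemma lpn_powR (q : R) f : 0 < q -> f \in Lfun mu q%:E ->
  (\int[mu]_x (`|f x| `^ q)%:E)%E = (lpn q%:E f `^ q)%:E.
Proof.
move=> q0 fL; by rewrite -poweR_EFin -lpnE// powR_Lnorm// gt_eqF.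
Qed.

Lemma Lfun_powRP (q : R) f : 0 < q -> measurable_fun [set: T] f ->
  (f \in Lfun mu q%:E) <-> ((\int[mu]_x (`|f x| `^ q)%:E) < +oo)%E.
Proof.
move=> q0 mf; split=> [/(lpn_powR q0) ->|]; first exact: ltry.
rewrite -(powR_Lnorm mu (EFin \o f)); last by rewrite gt_eqF.
by move=> /lty_poweRy -/(_ (lt0r_neq0 q0)) ?; apply/LfunP'.
Qed.

Lemma Lfun1P f : f \in Lfun mu 1%E <-> mu.-integrable [set: T] (EFin \o f).
Proof. exact: Lfun1_integrable. Qed.

Lemma Lfun_infty f : f \in Lfun mu +oo%E ->
  {ae mu, forall x, `|f x| <= lpn +oo%E f}.
Proof.
move=> fL; have := lpnE fL; rewrite unlock; case: ifP => [mu0 fE|/negbT mu0 _].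
  apply: filterS (ess_sup_ge mu (abse \o (EFin \o f))) => x /=.
  by rewrite fE lee_fin.
have muT : mu [set: T] = 0%E.
  by apply/eqP; rewrite eq_le measure_ge0 andbT leNgt.
by exists [set: T]; split.
Qed.

Lemma integrable_infty_mul f g : f \in Lfun mu +oo%E -> g \in Lfun mu 1%E ->
  mu.-integrable [set: T] (EFin \o (f \* g)) /\
  (\int[mu]_x `|f x * g x|%:E <= (lpn +oo%E f * lpn 1%E g)%:E)%E.
Proof.
move=> fL gL; have fM := Lfun_infty fL.
have mfg : measurable_fun [set: T] (f \* g) by apply: measurable_funM; [exact: Lfun_meas fL|exact: Lfun_meas gL].
have le : (\int[mu]_x `|f x * g x|%:E <= (lpn +oo%E f * lpn 1%E g)%:E)%E.
  apply: (@le_trans _ _ (\int[mu]_x ((lpn +oo%E f)%:E * `|g x|%:E))%E).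
    apply: ae_ge0_le_integral => //.
    - by do 2 apply: measurableT_comp => //.
    - by move=> x _; rewrite -EFinM lee_fin mulr_ge0// lpn_ge0.
    - apply: measurable_funeM; do 2 apply: measurableT_comp => //; exact: Lfun_meas gL.
    - apply: filterS fM => x fx _; rewrite -EFinM lee_fin normrM ler_wpM2r//.
  rewrite ge0_integralZl_EFin ?lpn_ge0//; last first.
    by do 2 apply: measurableT_comp => //; exact: Lfun_meas gL.
  by rewrite EFinM -(lpnE gL) Lnorm1.
split => //; apply/integrableP; split; first exact/measurable_EFinP.
exact: le_lt_trans le (ltry _).
Qed.

(** The end points 1 and [+oo] go through [integrable_infty_mul], with the two factors exchanged at
    1; real exponents above 1 use Hoelder's inequality proper. *)
Lemma hoelder_Lfun q f g : (1 <= q)%E ->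
  f \in Lfun mu q -> g \in Lfun mu (hoelder_conjugate q) ->
  mu.-integrable [set: T] (EFin \o (f \* g)) /\
  (\int[mu]_x `|f x * g x|%:E <= (lpn q f * lpn (hoelder_conjugate q) g)%:E)%E.
Proof.
case: q => [q||] q1 fL gL; last by rewrite leeNy_eq in q1.
- have [q1'|] := eqVneq q 1.
    rewrite q1' in fL gL *; rewrite hoelder_conjugate1 in gL *.
    have [h1 h2] := integrable_infty_mul gL fL; split.
      by apply: eq_integrable h1 => // x _ /=; rewrite mulrC.
    by rewrite mulrC; under eq_integral do rewrite mulrC.
  move=> qn1; rewrite lee_fin in q1.
  have q0 : 0 < q by rewrite (lt_le_trans ltr01).
  have qgt1 : 1 < q by rewrite lt_neqAle eq_sym qn1.
  have cE : @hoelder_conjugate R q%:E = (q / (q - 1))%:E.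
    rewrite /hoelder_conjugate /= eqe (gt_eqF q0) -EFinD inver subr_eq0 (negbTE qn1).
    by rewrite -EFinM.
  rewrite cE in gL *.
  have c0 : 0 < q / (q - 1) by rewrite divr_gt0// subr_gt0.
  have mf := Lfun_meas fL; have mg := Lfun_meas gL.
  have := hoelder mu mf mg q0 c0; rewrite Lnorm1 !lpnE//= => hh.
  have le : (\int[mu]_x `|f x * g x|%:E <= (lpn q%:E f * lpn (q / (q - 1))%:E g)%:E)%E.
    apply: hh; rewrite invf_div -{1}(mul1r q^-1) -mulrDl addrC subrK divff//.
    by rewrite gt_eqF.
  split => //; apply/integrableP; split; first exact/measurable_EFinP/measurable_funM.
  exact: le_lt_trans le (ltry _).
- by rewrite hoelder_conjugatey in gL *; exact: integrable_infty_mul.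
Qed.

Lemma hoelder_Rint q f g : (1 <= q)%E ->
  f \in Lfun mu q -> g \in Lfun mu (hoelder_conjugate q) ->
  `|\int[mu]_x (f x * g x)| <= lpn q f * lpn (hoelder_conjugate q) g.
Proof.
move=> q1 fL gL; have [fg le] := hoelder_Lfun q1 fL gL.
apply: (le_trans (le_normr_Rintegral measurableT fg)).
rewrite -lee_fin /Rintegral fineK//.
rewrite ge0_fin_numE; last exact: integral_ge0.
exact: le_lt_trans le (ltry _).
Qed.

End Lnorm_real.

(** * Mixed norms and geometrically convergent sequences *)

Section flim.
Context {R : realType}.
Implicit Types u : nat -> R.

(* A total limit: the mean of the upper and lower limits. It is odd in u for
   every sequence, convergent or not. *)
Definition flim u : R :=
  (fine (limn_esup (EFin \o u)) + fine (limn_einf (EFin \o u))) / 2.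

Lemma cvg_flim u l : u @ \oo --> l -> flim u = l.
Proof.
move=> ul; have ul' : (EFin \o u) @ \oo --> l%:E by apply/fine_cvgP; split; [exact: nearW|exact: ul].
rewrite /flim !(cvg_limn_einf_sup ul') /=; lra.
Qed.

Lemma flimN u : flim (fun n => - u n) = - flim u.
Proof.
rewrite /flim.
have -> : EFin \o (fun n => - u n) = (\- (EFin \o u))%E by [].
rewrite limn_esupN limn_einfN !fineN; lra.
Qed.

Lemma measurable_flim d (T : measurableType d) (F : nat -> T -> R) :
  (forall n, measurable_fun [set: T] (F n)) ->
  measurable_fun [set: T] (fun z => flim (F ^~ z)).
Proof.
move=> mF; apply: measurable_funM => //; apply: measurable_funD;
  apply: measurableT_comp => //.
- by apply: measurable_fun_limn_esup => n; exact/measurable_EFinP.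
- have -> : (fun x => limn_einf (EFin \o F^~ x)) =
      (fun x => (- limn_esup (\- (EFin \o F^~ x)))%E).
    by apply/funext => x; rewrite limn_esupN oppeK.
  apply: measurableT_comp => //.
  apply: measurable_fun_limn_esup => n; apply: measurableT_comp => //.
  exact/measurable_EFinP.
Qed.
End flim.

Section banach_norm.
Context d (T : measurableType d) (R : realType).
Variable mu : {measure set T -> \bar R}.
Local Open Scope ereal_scope.

(** The properties shared by L^q norms and mixed norms that a completeness proof consumes: [bn_sum]
    bounds the sum of all increments, and [bn_fin] makes that sum finite almost everywhere. *)
Record banach_norm (Nm : (T -> \bar R) -> \bar R) : Prop := BanachNorm {
  bn_ge0 : forall f, 0 <= Nm f ;
  bn_le : forall f g, measurable_fun [set: T] f -> measurable_fun [set: T] g ->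
    (forall x, 0 <= f x) -> (forall x, f x <= g x) -> Nm f <= Nm g ;
  bn_D : forall f g, measurable_fun [set: T] f -> measurable_fun [set: T] g ->
    (forall x, 0 <= f x) -> (forall x, 0 <= g x) ->
    Nm (fun x => f x + g x) <= Nm f + Nm g ;
  bn_sum : forall f : (T -> \bar R)^nat,
    (forall i, measurable_fun [set: T] (f i)) -> (forall i x, 0 <= f i x) ->
    Nm (fun x => \sum_(0 <= i <oo) f i x) <= \sum_(0 <= i <oo) Nm (f i) ;
  bn_fin : forall f, measurable_fun [set: T] f -> (forall x, 0 <= f x) ->
    Nm f < +oo -> {ae mu, forall x, f x \is a fin_num} }.

Lemma geometric_nneseries (C rho : R) n : (0 <= C)%R -> (0 <= rho < 1)%R ->
  \sum_(0 <= k <oo) (C * rho ^+ (n + k))%:E <= (C * rho ^+ n / (1 - rho))%:E.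
Proof.
move=> C0 /andP[r0 r1].
have r1' : (0 < 1 - rho)%R by rewrite subr_gt0.
apply: lime_le; first apply: is_cvg_nneseries => k _ _.
  by rewrite lee_fin mulr_ge0// exprn_ge0.
apply: nearW => K; rewrite sumEFin lee_fin.
under eq_bigr do rewrite exprD mulrA.
rewrite -mulr_sumr ler_wpM2l ?mulr_ge0 ?exprn_ge0//.
rewrite -div1r ler_pdivlMr// mulrC big_mkord -opprB mulNr -subrX1 opprB.
by rewrite gerBl exprn_ge0.
Qed.

(** * Completeness along geometrically Cauchy sequences *)

Section riesz_fischer.
Variables (Nm : (T -> \bar R) -> \bar R) (NmP : banach_norm Nm).
Variables (F : nat -> T -> R) (C rho : R).
Hypothesis mF : forall n, measurable_fun [set: T] (F n).
Hypothesis C0 : (0 <= C)%R.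
Hypothesis rho01 : (0 <= rho < 1)%R.
Hypothesis NF : forall n,
  Nm (fun z => `|(F n.+1 z - F n z)%:E|) <= (C * rho ^+ n)%:E.

Let tl n z := \sum_(0 <= k <oo) `|(F (n + k).+1 z - F (n + k)%N z)%:E|.

Let md n : measurable_fun [set: T] (fun z => `|(F n.+1 z - F n z)%:E|).
Proof.
apply: measurableT_comp => //; apply/measurable_EFinP.
exact: measurable_funB.
Qed.

Let mtl n : measurable_fun [set: T] (tl n).
Proof. by apply: ge0_emeasurable_sum => [k z _ _|k _]; [exact: abse_ge0|exact: md]. Qed.

Let tl_ge0 n z : 0 <= tl n z.
Proof. by apply: nneseries_ge0 => k _ _; exact: abse_ge0. Qed.

Let Ntl n : Nm (tl n) <= (C * rho ^+ n / (1 - rho))%:E.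
Proof.
apply: (le_trans (bn_sum NmP _ _)) => [k|k z|]; [exact: md|exact: abse_ge0|].
apply: le_trans (geometric_nneseries n C0 rho01).
by apply: lee_nneseries => k *; [exact: (bn_ge0 NmP)|exact: NF].
Qed.

Let telF n k z : (\sum_(0 <= i < k) (F (n + i).+1 z - F (n + i)%N z) = F (n + k)%N z - F n z)%R.
Proof.
elim: k => [|k IH]; first by rewrite big_nil addn0 subrr.
by rewrite big_nat_recr//= IH addnS addrC addrA subrK.
Qed.

Let tl_cvg n z : tl n z < +oo -> (F ^~ z) @ \oo --> flim (F ^~ z).
Proof.
move=> tz.
have : cvgn (series (fun k => F (n + k).+1 z - F (n + k)%N z)%R).
  by apply: normed_cvg; apply: nnseries_is_cvg => [k|]; [exact: normr_ge0|exact: tz].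
have -> : series (fun k => F (n + k).+1 z - F (n + k)%N z)%R =
    (fun k => F (n + k)%N z - F n z)%R.
  by apply/funext => k; exact: telF.
move=> c1.
have c2 : cvgn (fun k => F (k + n)%N z).
  have -> : (fun k => F (k + n)%N z) = (fun k => (F (n + k)%N z - F n z) + F n z)%R.
    by apply/funext => k; rewrite subrK addnC.
  by apply: is_cvgD => //; exact: is_cvg_cst.
have c3 : cvgn (F ^~ z) by move: c2 => /cvg_ex[l]; rewrite (cvg_shiftn n (F ^~ z)) => Fl; apply/cvg_ex; exists l.
by rewrite (cvg_flim c3).
Qed.

Let tl_le n z : `|(flim (F ^~ z) - F n z)%:E| <= tl n z.
Proof.
have [tz|] := ltP (tl n z) +oo; last by rewrite leye_eq => /eqP ->; rewrite leey.
have Fz := tl_cvg tz.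
have Fz' : (fun k => `|F (k + n)%N z - F n z|%:E) @ \oo --> `|(flim (F ^~ z) - F n z)%:E|.
  apply/fine_cvgP; split; first exact: nearW.
  apply: cvg_norm; apply: cvgB; last exact: cvg_cst.
  by rewrite (cvg_shiftn n (F ^~ z)).
rewrite -(cvg_lim _ Fz')//; apply: lime_le; first by apply/cvg_ex; eexists; exact: Fz'.
apply: nearW => k.
apply: le_trans (nneseries_lim_ge k _); last by move=> i *; exact: abse_ge0.
rewrite [leRHS](_ : _ = (\sum_(0 <= i < k) `|F (n + i).+1 z - F (n + i)%N z|)%:E); last first.
  by rewrite -sumEFin.
rewrite lee_fin addnC -telF.
exact: ler_norm_sum.
Qed.

(** The sum [tl 0] of the absolute increments has finite norm and is thus finite almost everywhere;
    where it is finite the telescoping series converges absolutely. *)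
Lemma riesz_fischer_cvg : {ae mu, forall z, (F ^~ z) @ \oo --> flim (F ^~ z)}.
Proof.
have := bn_fin NmP (mtl 0) (tl_ge0 0) (le_lt_trans (Ntl 0) (ltry _)).
by apply: filterS => z tz; apply: (@tl_cvg 0); rewrite ltey_eq tz.
Qed.

(** The distance to the limit is at most the tail [tl n] at every point, trivially so where the tail
    is infinite. Hence the monotonicity [bn_le], which is pointwise, suffices. *)
Lemma riesz_fischer_le n :
  Nm (fun z => `|(flim (F ^~ z) - F n z)%:E|) <= (C * rho ^+ n / (1 - rho))%:E.
Proof.
apply: le_trans (Ntl n); apply: (bn_le NmP) => //.
apply: measurableT_comp => //; apply/measurable_EFinP; apply: measurable_funB => //.
exact: measurable_flim.
Qed.

Lemma riesz_fischer_lty : Nm (fun z => `|(F 0%N z)%:E|) < +oo ->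
  Nm (fun z => `|(flim (F ^~ z))%:E|) < +oo.
Proof.
move=> F0.
have mf : measurable_fun [set: T] (fun z => `|(flim (F ^~ z))%:E|).
  by apply: measurableT_comp => //; apply/measurable_EFinP; exact: measurable_flim.
have m0 : measurable_fun [set: T] (fun z => `|(F 0%N z)%:E|).
  by apply: measurableT_comp => //; apply/measurable_EFinP.
have m1 : measurable_fun [set: T] (fun z => `|(flim (F ^~ z) - F 0%N z)%:E|).
  apply: measurableT_comp => //; apply/measurable_EFinP; apply: measurable_funB => //.
  exact: measurable_flim.
apply: (@le_lt_trans _ _ (Nm (fun z => `|(flim (F ^~ z) - F 0%N z)%:E| + `|(F 0%N z)%:E|))).
  apply: (bn_le NmP) => //; first exact: emeasurable_funD.
  move=> z; rewrite -EFinD lee_fin.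
  by rewrite -{1}(subrK (F 0%N z) (flim (F ^~ z))) ler_normD.
apply: le_lt_trans (bn_D NmP m1 m0 _ _) _ => //.
by rewrite lte_add_pinfty//; exact: le_lt_trans (riesz_fischer_le 0) (ltry _).
Qed.

End riesz_fischer.

Lemma banach_norm_Lnorm q : 1 <= q -> banach_norm (fun f => 'N[mu]_q[f]).
Proof.
move=> q1; split.
- by move=> f; exact: Lnorm_ge0.
- move=> f g mf mg f0 fg; apply: Lnorm_le_ae => //; apply: aeW => x.
  by rewrite !gee0_abs// (le_trans _ (fg x)).
- by move=> f g mf mg f0 g0; exact: Lnorm_addD.
- by move=> f mf f0; exact: Lnorm_nneseries.
- by move=> f mf f0; exact: Lnorm_lty_ae.
Qed.
End banach_norm.

Lemma LnormE d (T : measurableType d) (R : realType)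
    (mu : {measure set T -> \bar R}) (p : R) (f : T -> \bar R) :
  ('N[mu]_p%:E[f] = (\int[mu]_x `|f x| `^ p) `^ p^-1)%E.
Proof. by rewrite unlock. Qed.

(** * Norms with separate exponents in time and in space *)

Section mixed.
Context d1 d2 (T : measurableType d1) (X : measurableType d2) (R : realType).
Variable m1 : {sigma_finite_measure set T -> \bar R}.
Variable m2 : {sigma_finite_measure set X -> \bar R}.
Local Open Scope ereal_scope.

Definition mixN (p : R) (q : \bar R) (W : T * X -> \bar R) :=
  'N[m2]_q[(fun x => 'N[m1]_p%:E[(fun t => W (t, x))])].

Lemma measurable_inner (p : R) (W : T * X -> \bar R) : measurable_fun [set: T * X] W ->
  measurable_fun [set: X] (fun x => 'N[m1]_p%:E[(fun t => W (t, x))]).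
Proof.
move=> mW; rewrite unlock; apply: measurable_fun_poweR.
apply: (@measurable_fun_fubini_tonelli_G _ _ _ _ _ m1 (fun z => `|W z| `^ p)).
  by apply: measurable_fun_poweR; exact: measurableT_comp.
by move=> z; exact: poweR_ge0.
Qed.

Lemma measurable_slice (W : T * X -> \bar R) x : measurable_fun [set: T * X] W ->
  measurable_fun [set: T] (fun t => W (t, x)).
Proof. by move=> mW; apply: measurableT_comp => //; exact: measurable_pair2. Qed.

(** By uniqueness the product measure equals the iteration in the other order, whose integrand is
    the measure of the sections in time and vanishes almost everywhere. *)
Lemma ae_section (A : set (T * X)) : measurable A ->
  {ae m2, forall x, m1 (ysection A x) = 0} -> (m1 \x m2) A = 0.
Proof.
move=> mA A0.
have -> : (m1 \x m2) A = (m1 \x^ m2) A.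
  by apply: product_measure_unique => //= ? ? ? ?; rewrite product_measure2E.
rewrite /product_measure2.
rewrite (ae_eq_integral (cst 0)) ?integral0//.
  exact: measurable_fun_ysection.
by apply: filterS A0 => x.
Qed.

(** Each property holds for the inner norm at every x and is then fed into the same property of the
    outer norm; finiteness almost everywhere in the product comes from [ae_section]. *)
Lemma banach_norm_mixN (p : R) q : (1 <= p)%R -> 1 <= q ->
  banach_norm (m1 \x m2) (mixN p q).
Proof.
move=> p1 q1.
have p1' : 1 <= p%:E by [].
have q0 := lt_le_trans lte01 q1.
split.
- by move=> f; exact: Lnorm_ge0.
- move=> f g mf mg f0 fg; apply: Lnorm_le_ae => //; try exact: measurable_inner.
  apply: aeW => x; rewrite !gee0_abs ?Lnorm_ge0//.
  apply: Lnorm_le_ae => //; try exact: measurable_slice.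
  by apply: aeW => t; rewrite !gee0_abs// (le_trans _ (fg _)).
- move=> f g mf mg f0 g0.
  have := Lnorm_addD m2 q1 (measurable_inner p mf) (measurable_inner p mg)
    (fun x => Lnorm_ge0 _ _ _) (fun x => Lnorm_ge0 _ _ _).
  apply: le_trans.
  apply: Lnorm_le_ae => //.
  + by apply: (@measurable_inner p (fun z => f z + g z)); exact: emeasurable_funD.
  + by apply: emeasurable_funD; exact: measurable_inner.
  apply: aeW => x; rewrite !gee0_abs ?adde_ge0 ?Lnorm_ge0//.
  by apply: Lnorm_addD => //; exact: measurable_slice.
- move=> f mf f0.
  have := Lnorm_nneseries m2 q1 (fun i => measurable_inner p (mf i))
    (fun i x => Lnorm_ge0 _ _ _).
  apply: le_trans.
  apply: Lnorm_le_ae => //.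
  + apply: (@measurable_inner p (fun z => \sum_(0 <= i <oo) f i z)).
    exact: ge0_emeasurable_sum.
  + apply: ge0_emeasurable_sum => [k z _ _|k _]; first exact: Lnorm_ge0.
    exact: measurable_inner.
  apply: aeW => x; rewrite !gee0_abs ?Lnorm_ge0//; last first.
    by apply: nneseries_ge0 => k _ _; exact: Lnorm_ge0.
  by apply: Lnorm_nneseries => // i; exact: measurable_slice.
- move=> f mf f0 Nf.
  have mA : measurable [set z | f z \is a fin_num].
    rewrite -[X in measurable X]setTI; exact: emeasurable_fin_num.
  exists (~` [set z | f z \is a fin_num]); split; [exact: measurableC| |by []].
  apply: ae_section; first exact: measurableC.
  apply: filterS (Lnorm_lty_ae q1 (measurable_inner _ mf) Nf) => x.
  rewrite fin_numE => /andP[_ fx].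
  have : 'N[m1]_p%:E[(fun t => f (t, x))] < +oo by rewrite ltey.
  move=> /(Lnorm_lty_ae p1' (measurable_slice _ mf))[B [mB B0 Bs]].
  apply: (subset_measure0 _ mB) => //; first by apply: measurable_ysection; exact: measurableC.
  by move=> t /= ft; apply: Bs => /=; move: ft; rewrite /ysection /= inE.
Qed.

Lemma mixN_diag (p : R) (W : T * X -> \bar R) : (1 <= p)%R ->
  measurable_fun [set: T * X] W -> mixN p p%:E W = 'N[m1 \x m2]_p%:E[W].
Proof.
move=> p1 mW; have p0 : (0 < p)%R by rewrite (lt_le_trans ltr01).
rewrite /mixN !LnormE; congr (_ `^ _).
rewrite fubini_tonelli2//; last 2 first.
- by apply: measurable_fun_poweR; exact: measurableT_comp.
- by move=> z; exact: poweR_ge0.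
apply: eq_integral => x _; rewrite gee0_abs ?Lnorm_ge0// poweR_Lnorm//.
by rewrite gt_eqF.
Qed.

(** Hoelder's inequality in time at each x, then in space for the two inner norms, which are finite
    almost everywhere and are replaced by their [fine] parts. *)
Lemma mixed_hoelder (p p' : R) q (W V : T * X -> R) : (0 < p)%R -> (0 < p')%R ->
  (p^-1 + p'^-1 = 1)%R -> 1 <= q ->
  measurable_fun [set: T * X] W -> measurable_fun [set: T * X] V ->
  mixN p q (EFin \o W) < +oo -> mixN p' (hoelder_conjugate q) (EFin \o V) < +oo ->
  \int[m1 \x m2]_z `|W z * V z|%:E <=
    mixN p q (EFin \o W) * mixN p' (hoelder_conjugate q) (EFin \o V).
Proof.
move=> p0 p'0 pp q1 mW mV NW NV.
have q1' := hoelder_conj_ge1 q1.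
have p1 : (1 <= p)%R.
  by rewrite -invf_le1// -pp lerDl invr_ge0 ltW.
have p1' : (1 <= p')%R.
  by rewrite -invf_le1// -pp lerDr invr_ge0 ltW.
have mW' : measurable_fun [set: T * X] (EFin \o W) by exact/measurable_EFinP.
have mV' : measurable_fun [set: T * X] (EFin \o V) by exact/measurable_EFinP.
rewrite fubini_tonelli2//=; last first.
  by do 2 apply: measurableT_comp => //; exact: measurable_funM.
have aW := Lnorm_lty_ae q1 (measurable_inner p mW') NW.
have aV := Lnorm_lty_ae q1' (measurable_inner p' mV') NV.
set w := fun x => 'N[m1]_p%:E[(fun t => (EFin \o W) (t, x))] in aW.
set v := fun x => 'N[m1]_p'%:E[(fun t => (EFin \o V) (t, x))] in aV.
have mw : measurable_fun [set: X] w by exact: measurable_inner.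
have mv : measurable_fun [set: X] v by exact: measurable_inner.
have mfw : measurable_fun [set: X] (fine \o w) by exact: measurableT_comp.
have mfv : measurable_fun [set: X] (fine \o v) by exact: measurableT_comp.
have wE : mixN p q (EFin \o W) = 'N[m2]_q[EFin \o (fine \o w)].
  apply: eq_Lnorm_ae => //; first exact/measurable_EFinP.
  by apply: filterS aW => x wx /=; rewrite fineK.
have vE : mixN p' (hoelder_conjugate q) (EFin \o V) =
    'N[m2]_(hoelder_conjugate q)[EFin \o (fine \o v)].
  apply: eq_Lnorm_ae => //; first exact/measurable_EFinP.
  by apply: filterS aV => x vx /=; rewrite fineK.
have wL : fine \o w \in Lfun m2 q by apply/LfunP'; rewrite -wE.
have vL : fine \o v \in Lfun m2 (hoelder_conjugate q) by apply/LfunP'; rewrite -vE.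
have [_ le] := hoelder_Lfun q1 wL vL.
rewrite wE vE (lpnE wL) (lpnE vL) -EFinM; apply: le_trans le.
apply: ae_ge0_le_integral => //.
- by move=> x _; apply: integral_ge0.
- apply: (@measurable_fun_fubini_tonelli_G _ _ _ _ _ m1 (fun z => `|W z * V z|%:E)) => //.
  by do 2 apply: measurableT_comp => //; exact: measurable_funM.
- by do 2 apply: measurableT_comp => //; exact: measurable_funM.
apply: filterS2 aW aV => x wx vx _.
rewrite ger0_norm ?mulr_ge0 ?fine_ge0 ?Lnorm_ge0//.
rewrite EFinM !fineK//.
have mWx : measurable_fun [set: T] (fun t => W (t, x)).
  by apply: measurableT_comp => //; exact: measurable_pair2.
have mVx : measurable_fun [set: T] (fun t => V (t, x)).
  by apply: measurableT_comp => //; exact: measurable_pair2.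
by have := hoelder m1 mWx mVx p0 p'0 pp; rewrite Lnorm1.
Qed.

End mixed.

(** * A dual variational principle *)

Section signed_power.
Context {R : realType}.
Implicit Types r s x y a b : R.

(* The duality map |x|^(r-2) x of L^r. *)
Definition spow r x : R := `|x| `^ (r - 1) * Num.sg x.

Lemma powR1E r : 1 `^ r = 1 :> R.
Proof. by rewrite powR1. Qed.

Lemma spow0 r : spow r 0 = 0.
Proof. by rewrite /spow sgr0 mulr0. Qed.

Lemma spowN r x : spow r (- x) = - spow r x.
Proof. by rewrite /spow normrN sgrN mulrN. Qed.

Lemma spow_ge0 r x : 0 <= x -> spow r x = if x == 0 then 0 else x `^ (r - 1).
Proof.
rewrite le_eqVlt => /predU1P[<-|x0]; first by rewrite eqxx spow0.
by rewrite (gt_eqF x0) /spow gtr0_norm// gtr0_sg// mulr1.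
Qed.

Lemma spow_pos r x : 1 < r -> 0 <= x -> spow r x = x `^ (r - 1).
Proof.
move=> r1 x0; rewrite spow_ge0//; case: eqVneq => [->|//].
by rewrite powR0// subr_eq0 gt_eqF.
Qed.

Lemma norm_spow r x : 1 < r -> `|spow r x| = `|x| `^ (r - 1).
Proof.
move=> r1; rewrite /spow normrM (ger0_norm (powR_ge0 _ _)) normr_sg.
have [->|x0] := eqVneq x 0; last by rewrite mulr1.
by rewrite normr0 mulr0 powR0// subr_eq0 gt_eqF.
Qed.

Lemma spow_mul r x : 1 < r -> spow r x * x = `|x| `^ r.
Proof.
move=> r1; rewrite /spow -mulrA -normrEsg mulrC mulr_powRB1//.
exact: lt_trans r1.
Qed.

Lemma spow_abs r x : spow r x = `|x| `^ (r - 2) * x.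
Proof.
have [->|x0] := eqVneq x 0; first by rewrite spow0 mulr0.
rewrite /spow; have -> : r - 1 = (r - 2) + 1 by ring.
rewrite powRD; last by rewrite normr_eq0 x0 implybT.
by rewrite powRr1// -mulrA [_ * Num.sg x]mulrC -numEsg.
Qed.

Lemma spow_scale r a x : 0 <= a -> 1 < r -> spow r (a * x) = a `^ (r - 1) * spow r x.
Proof.
move=> a0 r1; rewrite /spow normrM (ger0_norm a0) powRM// sgrM.
move: a0; rewrite le_eqVlt => /predU1P[<-|a0].
  by rewrite sgr0 powR0 ?subr_eq0 ?gt_eqF// !mul0r.
by rewrite (gtr0_sg a0) mul1r mulrA.
Qed.

(** The relation (r - 1)(s - 1) = 1 characterises conjugate exponents: the duality maps of L^r and
    of its dual are inverse to each other. *)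
Lemma spowK r s : 1 < r -> 1 < s -> (r - 1) * (s - 1) = 1 -> cancel (spow r) (spow s).
Proof.
move=> r1 s1 rs x; rewrite {1}/spow norm_spow// -powRrM rs powRr1//.
rewrite /spow sgrM sgr_id; have [->|x0] := eqVneq x 0.
  by rewrite normr0 mul0r.
rewrite (gtr0_sg (powR_gt0 _ _)) ?normr_gt0// mul1r.
by rewrite mulrC -numEsg.
Qed.

Lemma measurable_spow r : measurable_fun [set: R] (spow r).
Proof.
apply: measurable_funM.
  apply: (@measurableT_comp _ _ _ _ _ _ (@powR R ^~ (r - 1))) => //.
have -> : (@Num.sg R) = (fun x : R => (0 < x)%R%:R - (x < 0)%R%:R).
  apply/funext => x; case: (ltgtP x 0) => [x0|x0|->]; rewrite ?sgr0 ?ltxx ?subrr//.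
  - by rewrite ltr0_sg// sub0r.
  - by rewrite gtr0_sg// subr0.
have mb (f : R -> bool) : measurable_fun [set: R] f ->
    measurable_fun [set: R] (fun x => (f x)%:R : R).
  move=> mf; have -> : (fun x => (f x)%:R : R) = \1_[set x | f x].
    by apply/funext => x; rewrite indicE; congr (nat_of_bool _)%:R; apply/idP/idP; rewrite inE.
  apply: measurable_indic; rewrite -[X in measurable X]setTI; exact: mf.
by apply: measurable_funB; apply: mb; apply: measurable_fun_ltr.
Qed.

(** With [spow_mul] this reads |y|^r >= |x|^r + r spow(x) (y - x), the convexity of |.|^r. It is
    Young's inequality for |x|^(r-1) and |y| with the exponents r/(r-1) and r. *)
Lemma young_spow r x y : 1 < r -> r * (spow r x * y) <= (r - 1) * `|x| `^ r + `|y| `^ r.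
Proof.
move=> r1; have r0 : 0 < r by exact: lt_trans r1.
have r10 : 0 < r - 1 by rewrite subr_gt0.
have le : spow r x * y <= `|x| `^ (r - 1) * `|y|.
  by rewrite (le_trans (ler_norm _))// normrM norm_spow.
have pq : (r / (r - 1))^-1 + r^-1 = 1.
  by rewrite invf_div -[X in _ + X]mul1r -mulrDl subrK divff// gt_eqF.
have := conjugate_powR (powR_ge0 `|x| (r - 1)) (normr_ge0 y) (divr_gt0 r0 r10) r0 pq.
rewrite -powRrM mulrCA divff ?gt_eqF// mulr1 => le2.
have := le_trans le le2; rewrite -(ler_pM2l r0) => /le_trans; apply.
rewrite mulrDr [X in _ + X](_ : _ = `|y| `^ r); last by rewrite mulrCA divff ?gt_eqF// mulr1.
rewrite lerD2r le_eqVlt; apply/orP; left; apply/eqP; field.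
by rewrite !gt_eqF.
Qed.

(** A ratio z/(x+y) in [0,1] is at most its s-th power; the two ratios for z = x and z = y add up to
    1. *)
Lemma powR_subadd s x y : 0 <= s <= 1 -> 0 <= x -> 0 <= y ->
  (x + y) `^ s <= x `^ s + y `^ s.
Proof.
move=> /andP[s0 s1] x0 y0.
have [xy0|xy0] := eqVneq (x + y) 0.
  by rewrite xy0; move/eqP: xy0; rewrite paddr_eq0// => /andP[/eqP-> _]; rewrite lerDl powR_ge0.
have xyp : 0 < x + y by rewrite lt_neqAle eq_sym xy0 addr_ge0.
have key z : 0 <= z <= x + y -> z / (x + y) * (x + y) `^ s <= z `^ s.
  move=> /andP[]; rewrite le_eqVlt => /predU1P[<- _|z0 zxy]; first by rewrite !mul0r powR_ge0.
  have -> : z `^ s = (z / (x + y)) `^ s * (x + y) `^ s.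
    by rewrite -powRM ?divrK ?unitfE// ?divr_ge0 ?ltW.
  rewrite ler_wpM2r ?powR_ge0// ger1_powR// divr_gt0//=.
  by rewrite ler_pdivrMr// mul1r.
have := lerD (key x _) (key y _); rewrite x0 y0 lerDl lerDr x0 y0 /= => /(_ isT isT).
by rewrite -mulrDl -mulrDl divff// mul1r.
Qed.

(** By oddness two cases remain. Equal signs follow from subadditivity of the power r - 1. For
    opposite signs each of the two powers is at most |x - y|^(r-1), which is the source of the
    factor 2. *)
Lemma spow_hoelder r x y : 1 < r -> r <= 2 ->
  `|spow r x - spow r y| <= 2 * `|x - y| `^ (r - 1).
Proof.
move=> r1 r2.
have r01 : 0 <= r - 1 <= 1 by apply/andP; split; lra.
have pos (u v : R) : 0 <= v -> v <= u -> `|spow r u - spow r v| <= 2 * `|u - v| `^ (r - 1).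
  move=> v0 vu; have u0 := le_trans v0 vu.
  rewrite !spow_pos// [X in 2 * X `^ _]ger0_norm ?subr_ge0//.
  rewrite ger0_norm; last first.
    by rewrite subr_ge0 ge0_ler_powR ?nnegrE//; case/andP: r01.
  have := powR_subadd r01 (_ : 0 <= u - v) v0; rewrite subr_ge0 => /(_ vu).
  rewrite subrK => h; rewrite lerBlDr (le_trans h)// lerD2r mulrDl mul1r lerDl powR_ge0//.
have mix (u v : R) : 0 <= u -> v <= 0 -> `|spow r u - spow r v| <= 2 * `|u - v| `^ (r - 1).
  move=> u0 v0; rewrite -[v]opprK spowN opprK.
  have nv : 0 <= - v by rewrite oppr_ge0.
  rewrite !spow_pos// opprK.
  rewrite (ger0_norm (addr_ge0 (powR_ge0 _ _) (powR_ge0 _ _))).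
  rewrite ger0_norm; last by rewrite subr_ge0 (le_trans v0).
  rewrite mulrDl mul1r; case/andP: r01 => ? _.
  by apply: lerD; apply: ge0_ler_powR => //; rewrite ?nnegrE; lra.
have ge (u v : R) : v <= u -> `|spow r u - spow r v| <= 2 * `|u - v| `^ (r - 1).
  move=> vu; have [v0|/ltW v0] := lerP 0 v; first exact: pos.
  have [u0|/ltW u0] := lerP 0 u; first exact: mix.
  have := @pos (- v) (- u); rewrite !spowN oppr_ge0 lerN2 => /(_ u0 vu).
  have -> : - v - - u = u - v by ring.
  by have -> : - spow r v - - spow r u = spow r u - spow r v by ring.
case/orP: (le_total y x) => xy; first exact: ge.
by rewrite distrC [`|x - y|]distrC ge.
Qed.

(** Convexity at the point a + b bounds |a + b|^r by |a|^r with the slope taken at a + b, and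
    [spow_hoelder] moves the slope to a. For r <= 2 the remainder |b|^r takes the place of a
    quadratic Taylor term. *)
Lemma powR_expand r a b : 1 < r -> r <= 2 ->
  `|a + b| `^ r <= `|a| `^ r + r * (spow r a * b) + 2 * r * `|b| `^ r.
Proof.
move=> r1 r2; have r0 : 0 < r by exact: lt_trans r1.
have Y := young_spow (a + b) a r1.
have E := spow_mul (a + b) r1.
have H : r * (spow r (a + b) * b - spow r a * b) <= 2 * r * `|b| `^ r.
  rewrite -mulrBl [2 * r]mulrC -mulrA ler_pM2l// (le_trans (ler_norm _))// normrM.
  have := spow_hoelder (a + b) a r1 r2; rewrite [a + b - a]addrC addKr => h.
  rewrite -(mulr_powRB1 (normr_ge0 b) r0) [`|b| * _]mulrC mulrA.
  by rewrite ler_wpM2r.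
have E' : r * (spow r (a + b) * a) = r * `|a + b| `^ r - r * (spow r (a + b) * b).
  by rewrite -E; ring.
move: Y H; rewrite E'.
set P := _ `^ r; set Q := spow r (a + b) * b.
set S := spow r a * b; set T := `|a| `^ r; set B := `|b| `^ r.
clearbody P Q S T B; move=> Y H; lra.
Qed.

(** For nonnegative arguments this is the tangent inequality for the exponent s - 1, with s = 2 set
    apart because [young_spow] asks for an exponent above 1; oddness and a direct estimate for
    opposite signs give the rest. *)
Lemma spow_lipschitz s x y : 2 <= s ->
  `|spow s x - spow s y| <= (s - 1) * `|x - y| * Num.max `|x| `|y| `^ (s - 2).
Proof.
move=> s2; have s1 : 1 < s by lra.
have pos (u v : R) : 0 <= v -> v <= u ->
    `|spow s u - spow s v| <= (s - 1) * `|u - v| * Num.max `|u| `|v| `^ (s - 2).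
  move=> v0 vu; have u0 := le_trans v0 vu.
  rewrite (ger0_norm u0) (ger0_norm v0) max_l// !spow_pos//.
  rewrite [X in (_ - _) * X]ger0_norm ?subr_ge0//.
  rewrite ger0_norm; last by rewrite subr_ge0 ge0_ler_powR ?nnegrE//; lra.
  have [s2'|s2'] := eqVneq s 2.
    have -> : s - 1 = 1 by lra.
    have -> : s - 2 = 0 by lra.
    by rewrite !powRr1// powRr0 mul1r mulr1.
  have s11 : 1 < s - 1 by rewrite lt_neqAle; apply/andP; split; [apply: contra_neq s2' => ?|]; lra.
  have := young_spow u v s11; rewrite spow_pos// (ger0_norm u0) (ger0_norm v0).
  have -> : s - 1 - 1 = s - 2 by ring.
  have uE : u `^ (s - 1) = u * u `^ (s - 2).
    have -> : s - 2 = s - 1 - 1 by ring.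
    rewrite mulr_powRB1//; lra.
  rewrite uE; set P := u `^ _; set Q := v `^ _ => Y.
  rewrite -subr_ge0; have -> : (s - 1) * (u - v) * P - (u * P - Q) = ((s - 2) * (u * P) + Q) - (s - 1) * (P * v) by ring.
  by rewrite subr_ge0.
have mix (u v : R) : 0 <= u -> v <= 0 ->
    `|spow s u - spow s v| <= (s - 1) * `|u - v| * Num.max `|u| `|v| `^ (s - 2).
  move=> u0 v0; have [w w0 ->] : exists2 w, 0 <= w & v = - w.
    by exists (- v); rewrite ?oppr_ge0 ?opprK.
  rewrite spowN !opprK normrN (ger0_norm w0) (ger0_norm u0).
  rewrite (ger0_norm (addr_ge0 u0 w0)) !spow_pos//.
  rewrite (ger0_norm (addr_ge0 (powR_ge0 _ _) (powR_ge0 _ _))).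
  set m := Num.max _ _; have m0 : 0 <= m by rewrite le_max u0.
  have E (z : R) : 0 <= z -> z <= m -> z `^ (s - 1) <= z * m `^ (s - 2).
    move=> z0 zm; rewrite -(@mulr_powRB1 _ z (s - 1))//; last lra.
    rewrite ler_wpM2l//; have -> : s - 1 - 1 = s - 2 by ring.
    by apply: ge0_ler_powR; rewrite ?nnegrE//; lra.
  have um : u <= m by rewrite le_max lexx.
  have wm : w <= m by rewrite le_max lexx orbT.
  apply: (le_trans (lerD (E _ u0 um) (E _ w0 wm))).
  by rewrite -mulrDl ler_wpM2r ?powR_ge0//; nra.
have ge (u v : R) : v <= u -> `|spow s u - spow s v| <= (s - 1) * `|u - v| * Num.max `|u| `|v| `^ (s - 2).
  move=> vu; have [v0|/ltW v0] := lerP 0 v; first exact: pos.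
  have [u0|/ltW u0] := lerP 0 u; first exact: mix.
  have := @pos (- v) (- u); rewrite !spowN oppr_ge0 lerN2 !normrN maxC => /(_ u0 vu).
  have -> : - v - - u = u - v by ring.
  by have -> : - spow s v - - spow s u = spow s u - spow s v by ring.
case/orP: (le_total y x) => xy; first exact: ge.
by rewrite distrC [`|x - y|]distrC maxC ge.
Qed.

(** Two cases: |x - y| is at most del times the larger of |x| and |y|, or exceeds it. Integrated,
    this yields continuity of the duality map from L^p to L^r, with del left free to be coupled to
    the distance. *)
Lemma spow_unif r p x y (del : R) : 2 <= p -> r * (p - 1) = p -> 0 < r -> 0 < del ->
  `|spow p x - spow p y| `^ r <= (p - 1) `^ r *
   (del `^ r * (`|x| `^ p + `|y| `^ p) + del `^ (r - p) * `|x - y| `^ p).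
Proof.
move=> p2 rp r0 d0; have p10 : 0 <= p - 1 by lra.
set M := Num.max `|x| `|y|; have M0 : 0 <= M by rewrite le_max normr_ge0.
have Mp : M `^ p <= `|x| `^ p + `|y| `^ p.
  rewrite /M; case: (leP `|x| `|y|) => _; rewrite ?lerDl ?lerDr powR_ge0//.
apply: (@le_trans _ _ ((p - 1) `^ r * (`|x - y| `^ r * M `^ (p - r)))).
  have -> : p - r = (p - 2) * r by rewrite -{1}rp; ring.
  rewrite powRrM mulrA -!powRM// ?mulr_ge0 ?powR_ge0//.
  apply: ge0_ler_powR; rewrite ?nnegrE ?mulr_ge0 ?powR_ge0//; first exact: ltW.
  exact: spow_lipschitz.
rewrite ler_wpM2l ?powR_ge0//.
have pr : 0 <= p - r by nra.
have [le|/ltW le] := lerP `|x - y| (del * M).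
  apply: (@le_trans _ _ (del `^ r * M `^ p)).
    have -> : del `^ r * M `^ p = (del * M) `^ r * M `^ (p - r).
      rewrite powRM ?(ltW d0)// -mulrA; congr (_ * _).
      have [->|Mn0] := eqVneq M 0.
        by rewrite (@powR0 _ p) ?(@powR0 _ r) ?mul0r// gt_eqF//; lra.
      by rewrite -powRD ?Mn0 ?implybT//; congr (_ `^ _); ring.
    rewrite ler_wpM2r ?powR_ge0//; apply: ge0_ler_powR; rewrite ?nnegrE ?mulr_ge0 ?(ltW d0) ?(ltW r0)//.
  rewrite (@le_trans _ _ (del `^ r * (`|x| `^ p + `|y| `^ p)))//.
    by rewrite ler_wpM2l ?powR_ge0.
  by rewrite lerDl mulr_ge0 ?powR_ge0.
apply: (@le_trans _ _ (del `^ (r - p) * `|x - y| `^ p)); last first.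
  by rewrite lerDr mulr_ge0 ?addr_ge0 ?powR_ge0.
have Mle : M <= `|x - y| / del by rewrite ler_pdivlMr// mulrC.
apply: (@le_trans _ _ (`|x - y| `^ r * (`|x - y| / del) `^ (p - r))).
  rewrite ler_wpM2l ?powR_ge0//; apply: ge0_ler_powR; rewrite ?nnegrE// divr_ge0// ltW//.
rewrite powRM ?invr_ge0 ?(ltW d0)// -powR_inv1 ?(ltW d0)// -powRrM.
have -> : -1 * (p - r) = r - p by ring.
rewrite mulrA mulrC le_eqVlt; apply/orP; left; apply/eqP; congr (_ * _).
have [->|n0] := eqVneq `|x - y| 0.
  by rewrite (@powR0 _ p) ?(@powR0 _ r) ?mul0r// gt_eqF//; lra.
by rewrite -powRD ?n0 ?implybT//; congr (_ `^ _); ring.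
Qed.

End signed_power.

Lemma powRVK (R : realType) (x a : R) : 0 <= x -> 0 < a -> (x `^ a) `^ a^-1 = x.
Proof. by move=> x0 a0; rewrite -powRrM divff ?gt_eqF// powRr1. Qed.

(** * Maximisers of a compact quadratic form *)

Section variational.
Context d (S : measurableType d) (R : realType).
Variable mu : {measure set S -> \bar R}.
Variables (r p C : R) (A : (S -> R) -> S -> R).
Hypotheses (r1 : 1 < r) (p2 : 2 < p) (rp : p^-1 + r^-1 = 1).

Let r0 : 0 < r. Proof. exact: lt_trans r1. Qed.
Let p0 : 0 < p. Proof. exact: lt_trans p2. Qed.
Let p1 : 1 < p. Proof. by move: p2; lra. Qed.
Let rpE : r * (p - 1) = p.
Proof.
move: rp => /(congr1 (fun x => x * (r * p))).
rewrite mulrDl mul1r (mulrC r p) mulrA mulVf ?gt_eqF// mul1r.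
rewrite [p * r]mulrC mulrA mulVf ?gt_eqF// mul1r => h.
by rewrite mulrBr mulr1 -h; ring.
Qed.
Let prE : p * (r - 1) = r. Proof. by move: rpE; lra. Qed.
Let rp1 : (r - 1) * (p - 1) = 1. Proof. by move: rpE; lra. Qed.
Let r2 : r < 2. Proof. by move: rpE r0 p2; nra. Qed.
Let conjp : @hoelder_conjugate R p%:E = r%:E.
Proof. by apply/esym/hoelder_conjugateP; [by rewrite ltNyr|by rewrite eqe gt_eqF|]; rewrite !inver !gt_eqF// -EFinD rp. Qed.
Let r1e : (1 <= r%:E)%E. Proof. by rewrite lee_fin ltW. Qed.
Let p1e : (1 <= p%:E)%E. Proof. by rewrite lee_fin ltW. Qed.

Local Notation Lr := (Lfun mu r%:E).
Local Notation Lp := (Lfun mu p%:E).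
Local Notation nr := (lpn mu r%:E).
Local Notation np := (lpn mu p%:E).

Lemma lpn_pow (s : R) (f : S -> R) : 0 < s -> f \in Lfun mu s%:E ->
  lpn mu s%:E f `^ s = \int[mu]_x (`|f x| `^ s).
Proof. by move=> s0 fL; rewrite /Rintegral lpn_powR. Qed.

Lemma lpn_le_pow (s K : R) (f : S -> R) : 0 < s -> 0 <= K -> f \in Lfun mu s%:E ->
  \int[mu]_x (`|f x| `^ s) <= K -> lpn mu s%:E f <= K `^ s^-1.
Proof.
move=> s0 K0 fL; rewrite -lpn_pow// => h.
rewrite -(powRr1 (lpn_ge0 mu s%:E f)) -(divff (lt0r_neq0 s0)) powRrM.
by rewrite ge0_ler_powR ?nnegrE ?powR_ge0 ?invr_ge0 ?(ltW s0).
Qed.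

Lemma integrable_pow (s : R) (f : S -> R) : 1 <= s -> f \in Lfun mu s%:E ->
  mu.-integrable [set: S] (EFin \o (fun x => `|f x| `^ s)).
Proof. by move=> s1 fL; exact: Lfun_integrable. Qed.

Lemma spow_Lfun (s t : R) (f : S -> R) : 1 < s -> 1 < t -> t * (s - 1) = s ->
  f \in Lfun mu s%:E -> (fun x => spow s (f x)) \in Lfun mu t%:E /\
  lpn mu t%:E (fun x => spow s (f x)) `^ t = lpn mu s%:E f `^ s.
Proof.
move=> s1 t1 ts fL; have t0 : 0 < t by exact: lt_trans t1.
have s0 : 0 < s by exact: lt_trans s1.
have mf : measurable_fun [set: S] (fun x => spow s (f x)).
  by apply: measurableT_comp; [exact: measurable_spow|exact: Lfun_meas fL].
have E x : `|spow s (f x)| `^ t = `|f x| `^ s by rewrite norm_spow// -powRrM mulrC ts.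
have L : (fun x => spow s (f x)) \in Lfun mu t%:E.
  apply/(Lfun_powRP _ t0) => //; under eq_integral do rewrite E.
  by rewrite lpn_powR// ltry.
split; first exact: L.
rewrite (lpn_pow t0 L) (lpn_pow s0 fL).
by apply: eq_Rintegral => x _; exact: E.
Qed.

Hypothesis AL : forall f, f \in Lr -> A f \in Lp.
Hypothesis Alin : forall (a : R) f g, f \in Lr -> g \in Lr ->
  {ae mu, forall x, A (fun x => a * f x + g x) x = a * A f x + A g x}.
Hypothesis C0 : 0 <= C.
Hypothesis Abd : forall f, f \in Lr -> np (A f) <= C * nr f.
Hypothesis Asym : forall f g, f \in Lr -> g \in Lr ->
  \int[mu]_x (A f x * g x) = \int[mu]_x (f x * A g x).

Let b f g := \int[mu]_x (A f x * g x).

Let int_pr f g : f \in Lp -> g \in Lr -> mu.-integrable [set: S] (EFin \o (fun x => f x * g x)).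
Proof.
move=> fL gL; have gL' : g \in Lfun mu (hoelder_conjugate p%:E) by rewrite conjp.
by have [] := hoelder_Lfun p1e fL gL'.
Qed.

Let hold f g : f \in Lp -> g \in Lr -> `|\int[mu]_x (f x * g x)| <= np f * nr g.
Proof.
move=> fL gL; have gL' : g \in Lfun mu (hoelder_conjugate p%:E) by rewrite conjp.
by have := hoelder_Rint p1e fL gL'; rewrite conjp.
Qed.

Let b_bd f g : f \in Lr -> g \in Lr -> `|b f g| <= C * nr f * nr g.
Proof.
move=> fL gL; apply: (le_trans (hold (AL fL) gL)).
by rewrite ler_wpM2r ?lpn_ge0// Abd.
Qed.

Let bD f g (t : R) : f \in Lr -> g \in Lr ->
  b (fun x => t * g x + f x) (fun x => t * g x + f x) =
  t ^+ 2 * b g g + 2 * t * b f g + b f f.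
Proof.
move=> fL gL; have tgL := Lfun_scal t r1e gL.
have hL := Lfun_add r1e tgL fL.
rewrite /b.
have -> : \int[mu]_x (A (fun x => t * g x + f x) x * (t * g x + f x)) =
    \int[mu]_x ((t ^+ 2 * (A g x * g x) + t * (A g x * f x)) + (t * (A f x * g x) + A f x * f x)).
  rewrite /Rintegral; congr fine; apply: ae_eq_integral => //.
  - exact/measurable_EFinP/measurable_funM/(Lfun_meas hL)/(Lfun_meas (AL hL)).
  - have mM u v : u \in Lp -> v \in Lr -> measurable_fun [set: S] (fun x => u x * v x).
      by move=> uL vL; apply: measurable_funM; [exact: Lfun_meas uL|exact: Lfun_meas vL].
    apply/measurable_EFinP; apply: measurable_funD; apply: measurable_funD;
      last exact: mM (AL fL) fL; apply: measurable_funM => //.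
    + exact: mM (AL gL) gL.
    + exact: mM (AL gL) fL.
    + exact: mM (AL fL) gL.
  - apply: filterS (Alin t gL fL) => x -> _; congr EFin; ring.
have I1 := int_pr (AL gL) gL; have I2 := int_pr (AL gL) fL.
have I3 := int_pr (AL fL) gL; have I4 := int_pr (AL fL) fL.
have Z (a : R) u : mu.-integrable [set: S] (EFin \o u) -> mu.-integrable [set: S] (EFin \o (fun x => a * u x)).
  by move=> iu; have := integrableZl measurableT a iu; apply: eq_integrable.
have D u v : mu.-integrable [set: S] (EFin \o u) -> mu.-integrable [set: S] (EFin \o v) ->
    mu.-integrable [set: S] (EFin \o (fun x => u x + v x)).
  by move=> iu iv; have := integrableD measurableT iu iv; apply: eq_integrable.
rewrite RintegralD//; [|exact: D (Z _ _ I1) (Z _ _ I2)|exact: D (Z _ _ I3) I4].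
rewrite RintegralD//; [|exact: Z|exact: Z].
rewrite RintegralD//; [|exact: Z].
rewrite !RintegralZl//.
have -> : \int[mu]_x (A g x * f x) = \int[mu]_x (A f x * g x).
  rewrite (Asym gL fL); by apply: eq_Rintegral => x _; rewrite mulrC.
ring.
Qed.

Let M := sup [set b f f | f in [set f | f \in Lr /\ nr f <= 1]].

Let M_has_sup : has_sup [set b f f | f in [set f | f \in Lr /\ nr f <= 1]].
Proof.
split.
  exists (b (fun=> 0) (fun=> 0)), (fun=> 0) => //; split; first exact: Lfun0.
  have -> : nr (fun=> 0) = nr (fun x => 0 * (fun=> 0 : R) x) by congr (lpn _ _ _); apply/funext => x; rewrite mul0r.
  by rewrite lpnZ ?Lfun0// normr0 mul0r.
exists C => _ [f [fL f1] <-]; apply: (le_trans (ler_norm _)).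
apply: (le_trans (b_bd fL fL)).
rewrite -mulrA -[leRHS]mulr1 ler_wpM2l// mulr_ile1 ?lpn_ge0//.
Qed.

Let b_le f : f \in Lr -> b f f <= M * nr f ^+ 2.
Proof.
move=> fL; have [n0|n0] := eqVneq (nr f) 0.
  rewrite n0 expr0n mulr0 (le_trans (ler_norm _))// (le_trans (b_bd fL fL))//.
  by rewrite n0 mulr0.
have np : 0 < nr f by rewrite lt_neqAle eq_sym n0 lpn_ge0.
have iL := Lfun_scal (nr f)^-1 r1e fL.
have E : b (fun x => (nr f)^-1 * f x) (fun x => (nr f)^-1 * f x) = (nr f)^-1 ^+ 2 * b f f.
  have := @bD (fun=> 0) f (nr f)^-1 (Lfun0 _ r1e) fL.
  have -> : (fun x => (nr f)^-1 * f x + 0) = (fun x => (nr f)^-1 * f x).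
    by apply/funext => x; rewrite addr0.
  have z0 g : g \in Lr -> b (fun=> 0) g = 0.
    move=> gL; apply/eqP; rewrite -normr_le0; apply: (le_trans (b_bd (Lfun0 _ r1e) gL)).
    have -> : nr (fun=> 0) = nr (fun x => 0 * (fun=> 0 : R) x) by congr (lpn _ _ _); apply/funext => x; rewrite mul0r.
    by rewrite lpnZ ?Lfun0// normr0 mul0r mulr0 mul0r.
  by rewrite !z0 ?Lfun0// !mulr0 !addr0.
have : b (fun x => (nr f)^-1 * f x) (fun x => (nr f)^-1 * f x) <= M.
  apply: (sup_upper_bound M_has_sup); exists (fun x => (nr f)^-1 * f x) => //; split => //.
  by rewrite lpnZ// (ger0_norm (_ : 0 <= (nr f)^-1)) ?invr_ge0 ?(ltW np)// mulVf.
rewrite E exprVn mulrC ler_pdivrMr ?exprn_gt0//.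
Qed.

Hypothesis Acpt : forall v : nat -> S -> R, (forall n, v n \in Lr) ->
  (forall n, nr (v n) <= 1) ->
  exists sigma : nat -> nat, {homo sigma : i j / (i < j)%N >-> (i < j)%N} /\
  exists2 g, g \in Lp & np (fun x => A (v (sigma n)) x - g x) @[n --> \oo] --> 0.
Variable W0 : S -> R.
Hypothesis W0L : W0 \in Lr.
Hypothesis W0pos : 0 < \int[mu]_x (A W0 x * W0 x).

Let M_gt0 : 0 < M.
Proof.
have := lt_le_trans W0pos (b_le W0L); rewrite pmulr_lgt0//.
rewrite lt_neqAle sqr_ge0 andbT eq_sym expf_eq0 /=.
apply/negP => /eqP n0; move: (lt_le_trans W0pos (b_le W0L)).
by rewrite n0 expr0n /= mulr0 ltxx.
Qed.

(** The defect is written as a square because [near_critical] takes it in the form t^2. Passing to a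
    subsequence only improves it, as [sg n] is at least n. *)
Let max_seq : exists V : nat -> S -> R, exists Z : S -> R,
  [/\ forall n, V n \in Lr, forall n, nr (V n) <= 1,
      forall n, M - n.+1%:R^-1 ^+ 2 <= b (V n) (V n), Z \in Lp &
      np (fun x => A (V n) x - Z x) @[n --> \oo] --> 0].
Proof.
have ex n : exists f, [/\ f \in Lr, nr f <= 1 & M - n.+1%:R^-1 ^+ 2 <= b f f].
  have e0 : 0 < n.+1%:R^-1 ^+ 2 :> R by rewrite exprn_gt0// invr_gt0 ltr0Sn.
  have [_ [f [fL f1] <-] /ltW le] := sup_adherent e0 M_has_sup.
  by exists f.
have [v /(_ _)/and3P vP] : {v : nat -> S -> R & forall n, [&& v n \in Lr, nr (v n) <= 1 & M - n.+1%:R^-1 ^+ 2 <= b (v n) (v n)]}.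
  apply: (@choice _ _ (fun n f => [&& f \in Lr, nr f <= 1 & M - n.+1%:R^-1 ^+ 2 <= b f f])) => n.
  by have [f [? ? ?]] := ex n; exists f; apply/and3P.
have [sg [sgh [Z ZL vZ]]] := Acpt (fun n => let: And3 h _ _ := vP n in h) (fun n => let: And3 _ h _ := vP n in h).
exists (fun n => v (sg n)), Z; split => //.
- by move=> n; have [] := vP (sg n).
- by move=> n; have [] := vP (sg n).
- move=> n; have [_ _] := vP (sg n); apply: le_trans.
  rewrite lerD2l lerN2 lerXn2r ?nnegrE ?invr_ge0//.
  rewrite lef_pV2 ?posrE ?ltr0Sn// ler_nat ltnS.
  elim: n => [//|n IH]; exact: leq_ltn_trans IH (sgh _ _ (ltnSn n)).
Qed.

(** V is perturbed to V + t W, where W is the dual of the residual. The form grows by 2 t b(V, W) up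
    to order t^2, while M |V + t W|^2 grows by 2 t M a up to orders t^r and t^(2/r). As the form
    never exceeds M |.|^2, a defect of at most t^2 bounds the difference of the two linear terms,
    and this difference is 2 t times |D|^p. *)
Let near_critical : exists2 gam : R, 0 < gam & exists2 K : R, 0 <= K &
  forall V (t : R), V \in Lr -> nr V <= 1 -> 0 < t -> t <= 1 -> M - t ^+ 2 <= b V V ->
  np (fun x => A V x - M * spow r (V x)) `^ p <= K * t `^ gam.
Proof.
(* The exponents that remain after division by t: 1 from the terms of order t^2, r - 1 from the
   remainder of |V + t W|^r, and 2/r - 1 from raising that quantity to the power 2/r. *)
pose gam : R := Num.min 1 (Num.min (r - 1) (2 / r - 1)).
have br : 1 < 2 / r by rewrite ltr_pdivlMr// mul1r.
have br2 : 2 / r <= 2 by rewrite ler_pdivrMr// ler_peMr// ltW.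
have gam0 : 0 < gam by rewrite !lt_min ltr01 !subr_gt0 r1 br.
(* [E1] will bound |W|^r = |D|^p, [E2] will bound |W|, and t times [E3] will bound the increment [h]
   of |V|^r along the perturbation. *)
have M0 := ltW M_gt0.
pose E1 := (C + M) `^ p; pose E2 := E1 `^ r^-1.
have E10 : 0 <= E1 by exact: powR_ge0.
have E20 : 0 <= E2 by exact: powR_ge0.
pose E3 := r * E2 + 2 * r * E1.
have E30 : 0 <= E3 by rewrite addr_ge0// ?mulr_ge0// ltW.
pose K := (1 + C * E2 ^+ 2) + 4 * M * E1 + 4 / r * M * E3 `^ (2 / r).
exists gam => //; exists K.
  have r0' := ltW r0.
  by rewrite /K !addr_ge0// ?mulr_ge0// ?invr_ge0// ?powR_ge0// ?sqr_ge0.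
move=> V t VL V1 t0 t1 bV.
have t01 : 0 < t <= 1 by rewrite t0.
have tgam x : gam <= x -> t `^ x <= t `^ gam by move=> gx; exact: ger_powR.
have [JL JE] := spow_Lfun r1 p1 prE VL.
have J1 : np (fun x => spow r (V x)) <= 1.
  have : np (fun x => spow r (V x)) `^ p <= 1.
    rewrite JE -[leRHS](powR1E r); apply: ge0_ler_powR; rewrite ?nnegrE ?lpn_ge0//; exact: ltW.
  move=> h; rewrite -(powR1E p^-1) -[leLHS](@powRVK _ _ p) ?lpn_ge0//.
  by apply: ge0_ler_powR; rewrite ?nnegrE ?powR_ge0 ?invr_ge0 ?(ltW p0).
have MJL := Lfun_scal M p1e JL.
have DL := Lfun_sub p1e (AL VL) MJL.
set D := (fun x => A V x - M * spow r (V x)) in DL *.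
have DE0 : np D <= C + M.
  apply: (le_trans (lpnB p1e (AL VL) MJL)); apply: lerD.
    by apply: (le_trans (Abd VL)); rewrite -[leRHS]mulr1 ler_wpM2l.
  by rewrite lpnZ// (ger0_norm M0) -[leRHS]mulr1 ler_wpM2l.
have [WL WE] := spow_Lfun p1 r1 rpE DL.
set W := (fun x => spow p (D x)) in WL WE.
have WE1 : nr W `^ r <= E1.
  rewrite WE; apply: ge0_ler_powR; rewrite ?nnegrE ?lpn_ge0 ?addr_ge0//; exact: ltW.
have WE2 : nr W <= E2.
  by apply: lpn_le_pow => //; rewrite -lpn_pow.
pose a := \int[mu]_x (spow r (V x) * W x).
have aE : `|a| <= E2.
  apply: (le_trans (hold JL WL)); rewrite -[leRHS]mul1r ler_pM ?lpn_ge0//.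
(* [W] is the image of [D] under the duality map, so that pairing the two returns |D|^p. *)
have DW : np D `^ p = b V W - M * a.
  rewrite lpn_pow// /a /b -RintegralZl//; last exact: int_pr.
  have := integrableZl measurableT M (int_pr JL WL) => i2.
  rewrite -RintegralB//; last exact: int_pr (AL VL) WL.
  by apply: eq_Rintegral => x _; rewrite -(spow_mul _ p1) -/(W x) /D; ring.
have tWL := Lfun_scal t r1e WL; have TL := Lfun_add r1e tWL VL.
set T := (fun x => t * W x + V x) in TL.
pose h := r * t * a + 2 * r * t `^ r * E1.
have tr : t `^ r <= t.
  have := ger_powR t01 (ltW r1); rewrite powRr1//; exact: ltW.
have hE : `|h| <= t * E3.
  rewrite /h /E3; apply: (le_trans (ler_normD _ _)); rewrite mulrDr; apply: lerD.
    rewrite !normrM (gtr0_norm r0) (gtr0_norm t0) [r * t]mulrC -mulrA ler_wpM2l ?(ltW t0)// ler_wpM2l// ltW//.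
  rewrite ger0_norm; last by rewrite !mulr_ge0 ?powR_ge0// ltW.
  have -> : 2 * r * t `^ r * E1 = t `^ r * (2 * r * E1) by ring.
  by rewrite ler_wpM2r// !mulr_ge0// ltW.
have NT : nr T `^ r <= 1 + h.
  rewrite lpn_pow//.
  have I1 := integrable_pow (ltW r1) VL; have I2 := integrable_pow (ltW r1) WL.
  have I3 := int_pr JL WL.
  have ZI (c : R) u : mu.-integrable [set: S] (EFin \o u) -> mu.-integrable [set: S] (EFin \o (fun x => c * u x)).
    by move=> iu; have := integrableZl measurableT c iu; apply: eq_integrable.
  have DI u v : mu.-integrable [set: S] (EFin \o u) -> mu.-integrable [set: S] (EFin \o v) ->
      mu.-integrable [set: S] (EFin \o (fun x => u x + v x)).
    by move=> iu iv; have := integrableD measurableT iu iv; apply: eq_integrable.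
  have V1' : \int[mu]_x (`|V x| `^ r) <= 1.
    rewrite -lpn_pow// -[leRHS](powR1E r); apply: ge0_ler_powR; rewrite ?nnegrE ?lpn_ge0//; exact: ltW.
  apply: (@le_trans _ _ (\int[mu]_x ((`|V x| `^ r + (r * t) * (spow r (V x) * W x)) + (2 * r * t `^ r) * `|W x| `^ r))).
    apply: le_Rintegral => //; first exact: integrable_pow (ltW r1) TL.
    - by apply: (@DI); [apply: (@DI) => //; exact: ZI|exact: ZI].
    - move=> x _; rewrite /T addrC; have := powR_expand (V x) (t * W x) r1 (ltW r2).
      rewrite normrM (gtr0_norm t0) powRM ?(ltW t0)// => /le_trans; apply.
      rewrite le_eqVlt; apply/orP; left; apply/eqP; ring.
  rewrite RintegralD//; [|by apply: (@DI) => //; exact: ZI|exact: ZI].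
  rewrite RintegralD//; [|exact: ZI].
  rewrite !RintegralZl// -/a /h addrA lerD ?lerD2r//.
  rewrite ler_wpM2l ?mulr_ge0 ?powR_ge0 ?(ltW r0)// -lpn_pow//.
have h1 : 0 <= 1 + h by rewrite (le_trans _ NT) ?powR_ge0.
(* The step from |T|^r to |T|^2 is the power 2/r, which lies in (1, 2]; [powR_expand] at the base
   point 1 keeps the term linear in h exact. *)
have NT2 : nr T ^+ 2 <= 1 + 2 / r * h + 2 * (2 / r) * (t * E3) `^ (2 / r).
  have -> : nr T ^+ 2 = (nr T `^ r) `^ (2 / r).
    by rewrite -powRrM mulrCA divff ?gt_eqF// mulr1 powR_mulrn ?lpn_ge0.
  apply: (@le_trans _ _ ((1 + h) `^ (2 / r))).
    by apply: ge0_ler_powR; rewrite ?nnegrE ?powR_ge0// divr_ge0// ltW.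
  have := powR_expand 1 h br br2; rewrite normr1 powR1 (ger0_norm h1) => /le_trans; apply.
  have br0 : 0 <= 2 / r by rewrite divr_ge0// ltW.
  have tE0 : 0 <= t * E3 by rewrite mulr_ge0// ltW.
  rewrite spow_pos// powR1 mul1r lerD2l; apply: ler_wpM2l; first by rewrite mulr_ge0.
  exact: ge0_ler_powR.
have bW : - (C * E2 ^+ 2) <= b W W.
  have := b_bd WL WL; rewrite ler_norml => /andP[h2 _]; apply: le_trans h2.
  rewrite lerN2 -mulrA -expr2 ler_wpM2l// lerXn2r ?nnegrE ?lpn_ge0//.
have main := le_trans _ (ler_wpM2l M0 NT2).
have {}main := main _ (b_le TL).
rewrite (bD t VL WL) in main.
have trE : t `^ r = t * t `^ (r - 1) by rewrite mulr_powRB1// ltW.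
have tbE : (t * E3) `^ (2 / r) = t * t `^ (2 / r - 1) * E3 `^ (2 / r).
  by rewrite powRM ?(ltW t0)// mulr_powRB1 ?(ltW t0)// divr_gt0.
have g1 : t <= t `^ gam.
  by rewrite -{1}(powRr1 (ltW t0)); apply: tgam; rewrite /gam ge_min lexx.
have g2 : t `^ (r - 1) <= t `^ gam by apply: tgam; rewrite /gam !ge_min lexx orbT.
have g3 : t `^ (2 / r - 1) <= t `^ gam by apply: tgam; rewrite /gam !ge_min lexx !orbT.
have tg0 : 0 <= t `^ gam by exact: powR_ge0.
rewrite DW.
rewrite tbE /h trE in main.
(* The linear term of M |T|^2 is exactly 2 t M a; together with 2 t b(V, W) it forms the residual,
   and only remainders are left. *)
have q1 : M * (2 / r * (r * t * a + 2 * r * (t * t `^ (r - 1)) * E1)) = 2 * t * (M * a) + t * (4 * M * E1 * t `^ (r - 1)).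
  by field; rewrite gt_eqF.
have main2 : 2 * t * (b V W - M * a) <= t * (t * (1 + C * E2 ^+ 2) + 4 * M * E1 * t `^ (r - 1) + 4 / r * M * E3 `^ (2 / r) * t `^ (2 / r - 1)).
  have : t ^+ 2 * b W W >= t ^+ 2 * - (C * E2 ^+ 2) by rewrite ler_wpM2l// sqr_ge0.
  move: main bV q1.
  set x1 := t `^ (r - 1); set x2 := t `^ (2 / r - 1); set x3 := E3 `^ _.
  move=> main bV q1 k1; rewrite (mulrDr M) (mulrDr M) mulr1 q1 in main.
  have -> : t * (t * (1 + C * E2 ^+ 2) + 4 * M * E1 * x1 + 4 / r * M * x3 * x2) =
    t ^+ 2 + t ^+ 2 * (C * E2 ^+ 2) + t * (4 * M * E1 * x1) + M * (2 * (2 / r) * (t * x2 * x3)).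
    by field; rewrite gt_eqF.
  move: main bV k1; rewrite mulrN mulrBr.
  set y1 := t ^+ 2 * b W W; set y2 := 2 * t * b V W; set y3 := M * (2 * _ * _).
  set y4 := 2 * t * (M * a); set y5 := t * (4 * _ * _ * _); set y6 := t ^+ 2 * (C * _).
  lra.
have main3 : 2 * (b V W - M * a) <= K * t `^ gam.
  rewrite -(ler_pM2l t0) mulrA [t * 2]mulrC (le_trans main2)// ler_wpM2l ?(ltW t0)//.
  rewrite /K (mulrDl _ _ (t `^ gam)) (mulrDl _ _ (t `^ gam)).
  apply: lerD; first apply: lerD.
  - by rewrite mulrC ler_wpM2l// addr_ge0// mulr_ge0// sqr_ge0.
  - by rewrite ler_wpM2l// !mulr_ge0.
  - by rewrite ler_wpM2l// !mulr_ge0 ?powR_ge0 ?invr_ge0// ltW.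
have D0 : 0 <= b V W - M * a by rewrite -DW powR_ge0.
apply: le_trans main3; lra.
Qed.

Lemma cvg0_powR (u : nat -> R) (a : R) : 0 < a -> (forall n, 0 <= u n) ->
  u n @[n --> \oo] --> 0 -> u n `^ a @[n --> \oo] --> 0.
Proof.
move=> a0 u0 ucv; apply/cvgrPdist_lt => e e0.
have ea : 0 < e `^ a^-1 by exact: powR_gt0.
move/cvgrPdist_lt: ucv => /(_ _ ea); apply: filterS => n.
rewrite !sub0r !normrN (ger0_norm (u0 n)) (ger0_norm (powR_ge0 _ _)) => h.
have -> : e = (e `^ a^-1) `^ a by rewrite -powRrM mulVf ?gt_eqF// powRr1// ltW.
by apply: gt0_ltr_powR; rewrite ?nnegrE ?powR_ge0.
Qed.

Lemma squeeze0 (u v : nat -> R) : (forall n, 0 <= u n <= v n) ->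
  v n @[n --> \oo] --> 0 -> u n @[n --> \oo] --> 0.
Proof.
move=> uv v0; apply: (@squeeze_cvgr _ _ _ _ (fun=> 0) v) => //; last exact: cvg_cst.
exact: nearW.
Qed.

Let A0 : {ae mu, forall x, A (fun=> 0) x = 0}.
Proof.
apply: (lpn_eq0 p1e (AL (Lfun0 _ r1e))); apply/eqP; rewrite eq_le lpn_ge0 andbT.
apply: (le_trans (Abd (Lfun0 _ r1e))).
have -> : nr (fun=> 0) = nr (fun x => 0 * (fun=> 0 : R) x) by congr (lpn _ _ _); apply/funext => x; rewrite mul0r.
by rewrite lpnZ ?Lfun0// normr0 mul0r mulr0.
Qed.

(** Since A V_n converges and the residuals vanish, spow r V_n converges in L^p. The inverse duality
    map carries this to strong convergence of V_n in L^r, and continuity of A identifies A at the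
    limit. The multiplier M is finally scaled away. *)
Lemma dual_ground_state : exists V : S -> R,
  [/\ V \in Lr, ~ {ae mu, forall x, V x = 0} &
      {ae mu, forall x, A V x = spow r (V x)}].
Proof.
have [V [Z [VL V1 bV ZL AZ]]] := max_seq.
have [gam g0 [K K0 nc]] := near_critical.
have M0 := M_gt0.
pose t n : R := n.+1%:R^-1.
have t0 n : 0 < t n by rewrite invr_gt0 ltr0Sn.
have t1 n : t n <= 1 by rewrite invf_le1 ?ltr0Sn// ler1n.
have tcv : t n @[n --> \oo] --> 0 by exact: cvg_harmonic.
have JL n : (fun x => spow r (V n x)) \in Lp by have [] := spow_Lfun r1 p1 prE (VL n).
have MJL n := Lfun_scal M p1e (JL n).
have DL n : (fun x => A (V n) x - M * spow r (V n x)) \in Lp by exact: Lfun_sub (AL (VL n)) (MJL n).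
have Dcv : np (fun x => A (V n) x - M * spow r (V n x)) @[n --> \oo] --> 0.
  apply: (@squeeze0 _ (fun n => (K * t n `^ gam) `^ p^-1)).
    move=> n; rewrite lpn_ge0 /= -[leLHS](@powRVK _ _ p) ?lpn_ge0//.
    apply: ge0_ler_powR; rewrite ?nnegrE ?powR_ge0 ?invr_ge0 ?(ltW p0) ?mulr_ge0 ?powR_ge0//.
    exact: nc (VL n) (V1 n) (t0 n) (t1 n) (bV n).
  apply: cvg0_powR; rewrite ?invr_gt0//; first by move=> n; rewrite mulr_ge0// powR_ge0.
  rewrite -(mulr0 K); apply: cvgMr; apply: cvg0_powR => // n; exact: ltW.
pose Y x := M^-1 * Z x.
have YL : Y \in Lp by exact: Lfun_scal.
pose y n := np (fun x => spow r (V n x) - Y x).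
have y0 n : 0 <= y n by exact: lpn_ge0.
have ycv : y n @[n --> \oo] --> 0.
  apply: (@squeeze0 _ (fun n => M^-1 * (np (fun x => A (V n) x - Z x) + np (fun x => A (V n) x - M * spow r (V n x))))).
    move=> n; rewrite y0 /= /y.
    have L2 := Lfun_sub p1e (AL (VL n)) ZL.
    have -> : (fun x => spow r (V n x) - Y x) =
        (fun x => M^-1 * ((A (V n) x - Z x) - (A (V n) x - M * spow r (V n x)))).
      by apply/funext => x; rewrite /Y; field; rewrite gt_eqF.
    rewrite lpnZ//; last exact: Lfun_sub.
    by rewrite (ger0_norm (_ : 0 <= M^-1)) ?invr_ge0 ?(ltW M0)// ler_wpM2l ?invr_ge0 ?(ltW M0)// lpnB.
  rewrite -(mulr0 M^-1); apply: cvgMr; rewrite -(addr0 0); exact: cvgD.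
pose Vi x := spow p (Y x).
have ViL : Vi \in Lr by have [] := spow_Lfun p1 r1 rpE YL.
have ViE x : spow r (Vi x) = Y x by rewrite /Vi spowK// mulrC.
have VE n x : V n x = spow p (spow r (V n x)) by rewrite spowK.
have dL n : (fun x => V n x - Vi x) \in Lr by exact: Lfun_sub.
have vcv : nr (fun x => V n x - Vi x) @[n --> \oo] --> 0.
  (* Adding [t n] keeps this positive where [y n] may vanish, since a negative power of it occurs
     below. *)
  pose w n := y n + t n.
  have w0 n : 0 < w n by rewrite ltr_wpDl.
  have wcv : w n @[n --> \oo] --> 0 by rewrite -(addr0 0); exact: cvgD.
  pose B := 1 + np Y `^ p.
  have B0 : 0 <= B by rewrite addr_ge0// powR_ge0.
  apply: (@squeeze0 _ (fun n => ((p - 1) `^ r * (w n `^ (r / 2) * B + w n `^ ((r + p) / 2))) `^ r^-1)).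
    move=> n; rewrite lpn_ge0 /=; apply: lpn_le_pow => //.
      by rewrite mulr_ge0 ?addr_ge0 ?mulr_ge0 ?powR_ge0.
    have I1 := integrable_pow (ltW p1) (JL n); have I2 := integrable_pow (ltW p1) YL.
    have L3 := Lfun_sub p1e (JL n) YL.
    have I3 := integrable_pow (ltW p1) L3.
    have ZI (c : R) u : mu.-integrable [set: S] (EFin \o u) -> mu.-integrable [set: S] (EFin \o (fun x => c * u x)).
      by move=> iu; have := integrableZl measurableT c iu; apply: eq_integrable.
    have DI u v : mu.-integrable [set: S] (EFin \o u) -> mu.-integrable [set: S] (EFin \o v) ->
        mu.-integrable [set: S] (EFin \o (fun x => u x + v x)).
      by move=> iu iv; have := integrableD measurableT iu iv; apply: eq_integrable.
    (* The square root of the distance makes both terms of [spow_unif] vanish: del^r = w^(r/2), and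
       del^(r-p) y^p is at most w^((r+p)/2). *)
    pose del := w n `^ 2^-1.
    have del0 : 0 < del by exact: powR_gt0.
    apply: (@le_trans _ _ (\int[mu]_x ((p - 1) `^ r * (del `^ r * (`|spow r (V n x)| `^ p + `|Y x| `^ p) + del `^ (r - p) * `|spow r (V n x) - Y x| `^ p)))).
      apply: le_Rintegral => //; first exact: integrable_pow (ltW r1) (dL n).
        by apply: (@ZI); apply: (@DI); apply: (@ZI) => //; exact: DI.
      by move=> x _; rewrite {1}(VE n x) /Vi; apply: spow_unif => //; exact: ltW.
    rewrite RintegralZl//; last by apply: (@DI); apply: (@ZI) => //; exact: DI.
    rewrite ler_wpM2l ?powR_ge0// RintegralD//; [|by apply: (@ZI); exact: DI|exact: ZI].
    rewrite RintegralZl//; last exact: DI.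
    rewrite RintegralZl// RintegralD// -!lpn_pow// -/(y n).
    apply: lerD.
      rewrite /del -powRrM [2^-1 * r]mulrC ler_wpM2l ?powR_ge0// lerD2r.
      have [_ ->] := spow_Lfun r1 p1 prE (VL n).
      rewrite -[leRHS](powR1E r); apply: ge0_ler_powR; rewrite ?nnegrE ?lpn_ge0//; exact: ltW.
    rewrite /del -powRrM; apply: (@le_trans _ _ (w n `^ (2^-1 * (r - p)) * w n `^ p)).
      rewrite ler_wpM2l ?powR_ge0//; apply: ge0_ler_powR; rewrite ?nnegrE ?(ltW p0)// ?(ltW (w0 n))//.
      by rewrite lerDl ltW.
    rewrite -powRD; last by rewrite (gt_eqF (w0 n)) implybT.
    rewrite le_eqVlt; apply/orP; left; apply/eqP; congr (_ `^ _); by field.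
  apply: cvg0_powR; rewrite ?invr_gt0//.
    by move=> n; rewrite mulr_ge0 ?addr_ge0 ?mulr_ge0 ?powR_ge0.
  rewrite -[X in _ --> X](mulr0 ((p - 1) `^ r)); apply: cvgMr.
  rewrite -[X in _ --> X](addr0 0); apply: cvgD.
    rewrite -[X in _ --> X](mul0r B); apply: cvgMl; apply: cvg0_powR => //; first by rewrite divr_gt0.
    by move=> n; exact: ltW.
  by apply: cvg0_powR => //; [rewrite divr_gt0// addr_gt0|move=> n; exact: ltW].
have AVi : {ae mu, forall x, A Vi x = Z x}.
  have L4 := Lfun_sub p1e (AL ViL) ZL.
  suff : np (fun x => A Vi x - Z x) = 0.
    move=> /(lpn_eq0 p1e L4); apply: filterS => x /eqP; rewrite subr_eq0 => /eqP//.
  apply/eqP; rewrite eq_le lpn_ge0 andbT.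
  have ccv : C * nr (fun x => V n x - Vi x) + np (fun x => A (V n) x - Z x) @[n --> \oo] --> 0.
    rewrite -[X in _ --> X](addr0 0); apply: cvgD => //.
    by rewrite -[X in _ --> X](mulr0 C); apply: cvgMr.
  apply: (cvgr_to_ge ccv); apply: nearW => n.
  have L5 : (fun x => -1 * V n x + Vi x) \in Lr by apply: Lfun_add => //; exact: Lfun_scal.
  have E5 : nr (fun x => -1 * V n x + Vi x) = nr (fun x => V n x - Vi x).
    have -> : (fun x => -1 * V n x + Vi x) = (fun x => -1 * (V n x - Vi x)).
      by apply/funext => x; ring.
    by rewrite lpnZ// normrN1 mul1r.
  have L6 := Lfun_sub p1e (AL (VL n)) ZL.
  have L7 := Lfun_add p1e (AL L5) L6.
  have -> : np (fun x => A Vi x - Z x) = np (fun x => A (fun x => -1 * V n x + Vi x) x + (A (V n) x - Z x)).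
    apply: lpn_ae => //; first exact: Lfun_meas L4.
    by apply: filterS (Alin (-1) (VL n) ViL) => x ->; ring.
  apply: (le_trans (lpnD p1e (AL L5) L6)); rewrite lerD2r.
  by apply: (le_trans (Abd L5)); rewrite E5.
have Vin0 : ~ {ae mu, forall x, Vi x = 0}.
  move=> Vi0.
  (* If the limit were 0, the norms of V_n would tend to 0 and with them b(V_n, V_n), whose defect
     from M > 0 tends to 0. *)
  have nE n : nr (V n) = nr (fun x => V n x - Vi x).
    apply: lpn_ae => //; first exact: Lfun_meas (VL n).
    by apply: filterS Vi0 => x ->; rewrite subr0.
  have ccv : t n + C * nr (fun x => V n x - Vi x) @[n --> \oo] --> 0.
    rewrite -[X in _ --> X](addr0 0); apply: cvgD => //.
    by rewrite -[X in _ --> X](mulr0 C); apply: cvgMr.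
  suff : M <= 0 by rewrite leNgt M0.
  apply: (cvgr_to_ge ccv); apply: nearW => n.
  have := bV n; rewrite lerBlDr => /le_trans; apply.
  rewrite addrC; apply: lerD.
    by rewrite -/(t n) expr2 -[leRHS]mulr1 ler_wpM2l// ltW.
  apply: (le_trans (ler_norm _)); apply: (le_trans (b_bd (VL n) (VL n))).
  by rewrite -mulrA ler_wpM2l// -nE -[leRHS]mulr1 ler_wpM2l ?lpn_ge0.
have s2 : 0 < 2 - r by rewrite subr_gt0.
(* At the limit A Vi = M spow(Vi). Multiplying Vi by lam gives lam on the left and lam^(r-1) on the
   right, so lam^(2-r) has to be 1/M. *)
pose lam := M `^ (- (2 - r)^-1).
have lam0 : 0 < lam by exact: powR_gt0.
exists (fun x => lam * Vi x); split; first exact: Lfun_scal.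
  move=> h; apply: Vin0; apply: filterS h => x /eqP.
  by rewrite mulf_eq0 (gt_eqF lam0) /= => /eqP.
have E : (fun x => lam * Vi x) = (fun x => lam * Vi x + 0) by apply/funext => x; rewrite addr0.
apply: filterS3 (Alin lam ViL (Lfun0 _ r1e)) AVi A0 => x; rewrite -E => -> -> ->.
rewrite addr0 spow_scale ?(ltW lam0)// ViE /Y mulrA; congr (_ * _).
rewrite /lam -powRrM -[X in _ = _ * X](powR_inv1 (ltW M0)) -powRD; last by rewrite (gt_eqF M0) implybT.
congr (_ `^ _); field; rewrite gt_eqF//.
Qed.
End variational.

(** * Square sums and weights *)

Lemma sqr_sum_le (R : realType) (u v : R) : 0 <= u -> 0 <= v -> Num.sqrt (u ^+ 2 + v ^+ 2) <= u + v.
Proof.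
move=> u0 v0; rewrite -(ler_pXn2r (ltn0Sn 1)) ?nnegrE ?sqrtr_ge0 ?addr_ge0//.
rewrite sqr_sqrtr ?addr_ge0 ?sqr_ge0//; nra.
Qed.

Lemma le_powRW (R : realType) (c x y : R) : 0 < c -> 0 <= x -> 0 <= y ->
  x `^ c <= y `^ c -> x <= y.
Proof.
move=> c0 x0 y0; apply: contra_le => yx.
by apply: gt0_ltr_powR; rewrite ?nnegrE.
Qed.

Section square_sums.
Context d (X : measurableType d) (R : realType).
Variable mu : {measure set X -> \bar R}.

Lemma powR_Lfun (a t : R) (f : X -> R) : 0 < a -> 0 < t -> f \in Lfun mu (a * t)%:E ->
  (fun x => `|f x| `^ a) \in Lfun mu t%:E /\
  lpn mu t%:E (fun x => `|f x| `^ a) = lpn mu (a * t)%:E f `^ a.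
Proof.
move=> a0 t0 fL.
have mf : measurable_fun [set: X] (fun x => `|f x| `^ a).
  apply: (@measurableT_comp _ _ _ _ _ _ (@powR R ^~ a)) => //.
  by apply: measurableT_comp => //; exact: Lfun_meas fL.
have E x : `| `|f x| `^ a | `^ t = `|f x| `^ (a * t).
  by rewrite ger0_norm ?powR_ge0// powRrM.
have gL : (fun x => `|f x| `^ a) \in Lfun mu t%:E.
  apply/(Lfun_powRP _ t0) => //; under eq_integral do rewrite E.
  by rewrite lpn_powR ?mulr_gt0// ltry.
split => //.
rewrite -[LHS](@powRVK _ _ t) ?lpn_ge0// lpn_pow//.
under eq_Rintegral do rewrite E.
by rewrite -lpn_pow ?mulr_gt0// -powRrM -mulrA divff ?gt_eqF// mulr1.
Qed.

Lemma powR_Lfun_infty (a : R) (f : X -> R) : 0 < a -> f \in Lfun mu +oo%E ->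
  (fun x => `|f x| `^ a) \in Lfun mu +oo%E /\
  lpn mu +oo%E (fun x => `|f x| `^ a) <= lpn mu +oo%E f `^ a.
Proof.
move=> a0 fL.
have mf : measurable_fun [set: X] (fun x => `|f x| `^ a).
  apply: (@measurableT_comp _ _ _ _ _ _ (@powR R ^~ a)) => //.
  by apply: measurableT_comp => //; exact: Lfun_meas fL.
have N : ('N[mu]_+oo[EFin \o (fun x => (`|f x| `^ a)%R)] <= (lpn mu +oo%E f `^ a)%:E)%E.
  rewrite unlock; case: ifP => [mu0|_]; last by rewrite lee_fin powR_ge0.
  apply/ess_supP; apply: filterS (Lfun_infty fL) => x fx /=.
  rewrite lee_fin ger0_norm ?powR_ge0//; apply: ge0_ler_powR; rewrite ?nnegrE ?lpn_ge0//.
  exact: ltW.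
have gL : (fun x => `|f x| `^ a) \in Lfun mu +oo%E.
  by apply/LfunP'; split => //; exact: le_lt_trans N (ltry _).
by split => //; rewrite -lee_fin -lpnE.
Qed.

Lemma measurable_sqrt : measurable_fun [set: R] (@Num.sqrt R).
Proof. exact: continuous_measurable_fun (@sqrt_continuous R). Qed.

Lemma lpn_infty_le (f : X -> R) (K : R) : 0 <= K -> measurable_fun [set: X] f ->
  {ae mu, forall x, `|f x| <= K} -> f \in Lfun mu +oo%E /\ lpn mu +oo%E f <= K.
Proof.
move=> K0 mf fK.
have N : ('N[mu]_+oo[EFin \o f] <= K%:E)%E.
  rewrite unlock; case: ifP => [mu0|_]; last by rewrite lee_fin.
  by apply/ess_supP; apply: filterS fK => x fx /=; rewrite lee_fin.
have fL : f \in Lfun mu +oo%E.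
  by apply/LfunP'; split => //; exact: le_lt_trans N (ltry _).
by split => //; rewrite -lee_fin -lpnE.
Qed.

(** For a real exponent this is the triangle inequality in L^(q/2) for the squares, which is where q
    >= 2 enters; for [+oo] it is a pointwise bound. *)
Lemma lpn_sqrt2 q (f g : X -> R) : (2%:E <= q)%E -> f \in Lfun mu q -> g \in Lfun mu q ->
  (fun x => Num.sqrt (f x ^+ 2 + g x ^+ 2)) \in Lfun mu q /\
  lpn mu q (fun x => Num.sqrt (f x ^+ 2 + g x ^+ 2)) ^+ 2 <= lpn mu q f ^+ 2 + lpn mu q g ^+ 2.
Proof.
move=> q2 fL gL.
have q1 : (1 <= q)%E by apply: le_trans q2; rewrite lee_fin; lra.
have mf := Lfun_meas fL; have mg := Lfun_meas gL.
have ms : measurable_fun [set: X] (fun x => Num.sqrt (f x ^+ 2 + g x ^+ 2)).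
  apply: (measurableT_comp measurable_sqrt).
  by apply: measurable_funD; exact: measurable_funX.
have nL (h : X -> R) : h \in Lfun mu q -> (fun x => `|h x|) \in Lfun mu q.
  move=> hL; apply: (Lfun_le q1 _ hL); first by apply: measurableT_comp => //; exact: Lfun_meas hL.
  by apply: aeW => x; rewrite normr_id.
have sL : (fun x => Num.sqrt (f x ^+ 2 + g x ^+ 2)) \in Lfun mu q.
  apply: (Lfun_le q1 ms (Lfun_add q1 (nL _ fL) (nL _ gL))).
  apply: aeW => x; rewrite [leLHS]ger0_norm ?sqrtr_ge0// [leRHS]ger0_norm ?addr_ge0//.
  by rewrite -(real_normK (num_real (f x))) -(real_normK (num_real (g x))) sqr_sum_le.
split => //.
case: q q2 q1 fL gL nL sL => [q||] q2 q1 fL gL nL sL; last by rewrite leeNy_eq in q2.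
- rewrite lee_fin in q2; have q0 : 0 < q by lra.
  have t1 : 1 <= q / 2 by lra.
  have t0 : 0 < q / 2 by lra.
  have t1e : (1 <= (q / 2)%:E)%E by rewrite lee_fin.
  have qE : q = 2 * (q / 2) by field.
  have P (h : X -> R) : h \in Lfun mu q%:E -> (fun x => `|h x| `^ 2) \in Lfun mu (q / 2)%:E /\
      lpn mu (q / 2)%:E (fun x => `|h x| `^ 2) = lpn mu q%:E h ^+ 2.
    move=> hL; rewrite {1}qE in hL.
    have [h1 h2] := powR_Lfun (ltr0Sn _ 1) t0 hL; split => //.
    by rewrite h2 -qE powR_mulrn ?lpn_ge0.
  have [_ <-] := P _ sL; have [fL2 <-] := P _ fL; have [gL2 <-] := P _ gL.
  apply: le_trans (lpnD t1e fL2 gL2).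
  rewrite le_eqVlt; apply/orP; left; apply/eqP; congr (lpn _ _ _); apply/funext => x.
  rewrite ger0_norm ?sqrtr_ge0// !powR_mulrn ?sqrtr_ge0// sqr_sqrtr ?addr_ge0 ?sqr_ge0//.
  by rewrite !real_normK ?num_real.
- have h0 : 0 <= lpn mu +oo%E f ^+ 2 + lpn mu +oo%E g ^+ 2 by rewrite addr_ge0 ?sqr_ge0.
  have fgK : {ae mu, forall x, `|Num.sqrt (f x ^+ 2 + g x ^+ 2)| <=
      Num.sqrt (lpn mu +oo%E f ^+ 2 + lpn mu +oo%E g ^+ 2)}.
    apply: filterS2 (Lfun_infty fL) (Lfun_infty gL) => x fx gx.
    rewrite ger0_norm ?sqrtr_ge0// ler_wsqrtr// lerD//.
      by rewrite -(real_normK (num_real (f x))) lerXn2r ?nnegrE ?lpn_ge0.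
    by rewrite -(real_normK (num_real (g x))) lerXn2r ?nnegrE ?lpn_ge0.
  have [_ le] := lpn_infty_le (sqrtr_ge0 _) ms fgK.
  have := lerXn2r 2 (lpn_ge0 _ _ _ : _ \is Num.nneg) (sqrtr_ge0 _ : _ \is Num.nneg) le.
  by move=> /le_trans; apply; rewrite sqr_sqrtr.
Qed.

Lemma lpn_sqrt_sum q (u : nat -> X -> R) lo hi : (2%:E <= q)%E ->
  (forall j, (lo <= j < hi)%N -> u j \in Lfun mu q) ->
  (fun x => Num.sqrt (\sum_(lo <= j < hi) u j x ^+ 2)) \in Lfun mu q /\
  lpn mu q (fun x => Num.sqrt (\sum_(lo <= j < hi) u j x ^+ 2)) ^+ 2 <=
    \sum_(lo <= j < hi) lpn mu q (u j) ^+ 2.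
Proof.
move=> q2; have q1 : (1 <= q)%E by apply: le_trans q2; rewrite lee_fin; lra.
have base : (fun _ : X => Num.sqrt 0 : R) \in Lfun mu q /\ lpn mu q (fun=> Num.sqrt 0) ^+ 2 <= 0 :> R.
  rewrite sqrtr0; split; first exact: Lfun0.
  have -> : lpn mu q (fun=> 0) = lpn mu q (fun x => 0 * (fun=> 0 : R) x) by congr (lpn _ _ _); apply/funext => x; rewrite mul0r.
  by rewrite lpnZ ?Lfun0// normr0 mul0r expr0n.
have [hl|] := leqP hi lo.
  move=> _; rewrite big_geq//.
  have -> : (fun x => Num.sqrt (\sum_(lo <= j < hi) u j x ^+ 2)) = (fun=> Num.sqrt 0).
    by apply/funext => x; rewrite big_geq.
  exact: base.
elim: hi => [//|hi IH]; rewrite ltnS => lh uL.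
have uhi : u hi \in Lfun mu q by apply: uL; rewrite lh ltnSn.
have {IH} IH : (fun x => Num.sqrt (\sum_(lo <= j < hi) u j x ^+ 2)) \in Lfun mu q /\
  lpn mu q (fun x => Num.sqrt (\sum_(lo <= j < hi) u j x ^+ 2)) ^+ 2 <=
    \sum_(lo <= j < hi) lpn mu q (u j) ^+ 2.
  move: lh; rewrite leq_eqVlt => /predU1P[->|lh].
    rewrite big_geq//.
    have -> : (fun x => Num.sqrt (\sum_(hi <= j < hi) u j x ^+ 2)) = (fun=> Num.sqrt 0).
      by apply/funext => x; rewrite big_geq.
    exact: base.
  by apply: IH => // j /andP[lj jh]; apply: uL; rewrite lj (ltn_trans jh).
have [L1 L2] := lpn_sqrt2 q2 IH.1 uhi.
have E : (fun x => Num.sqrt (\sum_(lo <= j < hi.+1) u j x ^+ 2)) =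
    (fun x => Num.sqrt (Num.sqrt (\sum_(lo <= j < hi) u j x ^+ 2) ^+ 2 + u hi x ^+ 2)).
  apply/funext => x; rewrite big_nat_recr//= sqr_sqrtr//.
  by apply: sumr_ge0 => j _; exact: sqr_ge0.
rewrite E; split => //; apply: (le_trans L2).
by rewrite big_nat_recr//= lerD2r IH.2.
Qed.

End square_sums.

Section cauchy.
Context {R : realType}.

Lemma cauchy_sum (a b : nat -> R) lo hi :
  `|\sum_(lo <= j < hi) a j * b j| <=
  Num.sqrt (\sum_(lo <= j < hi) a j ^+ 2) * Num.sqrt (\sum_(lo <= j < hi) b j ^+ 2).
Proof.
set Sa := \sum_(lo <= j < hi) a j ^+ 2; set Sb := \sum_(lo <= j < hi) b j ^+ 2.
set Sc := \sum_(lo <= j < hi) a j * b j.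
have Sa0 : 0 <= Sa by apply: sumr_ge0 => j _; exact: sqr_ge0.
have Sb0 : 0 <= Sb by apply: sumr_ge0 => j _; exact: sqr_ge0.
have Q (t : R) : 0 <= t ^+ 2 * Sa + 2 * t * Sc + Sb.
  have -> : t ^+ 2 * Sa + 2 * t * Sc + Sb = \sum_(lo <= j < hi) (t * a j + b j) ^+ 2.
    rewrite /Sa /Sb /Sc !mulr_sumr -!big_split /=; apply: eq_bigr => j _; ring.
  by apply: sumr_ge0 => j _; exact: sqr_ge0.
have key : Sc ^+ 2 <= Sa * Sb.
  have [Sa00|Sa00] := eqVneq Sa 0.
    have [->|Sc0] := eqVneq Sc 0; first by rewrite expr0n mulr_ge0.
    (* With [Sa] = 0 the polynomial in t is affine, and at this t it takes the value -1. *)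
    have := Q (- (Sb + 1) / (2 * Sc)); rewrite Sa00 mulr0 add0r.
    have -> : 2 * (- (Sb + 1) / (2 * Sc)) * Sc = - (Sb + 1) by field.
    by rewrite opprD addrAC addNr add0r leNgt oppr_lt0 ltr01.
  have Sap : 0 < Sa by rewrite lt_neqAle eq_sym Sa00.
  have := Q (- Sc / Sa).
  have -> : (- Sc / Sa) ^+ 2 * Sa + 2 * (- Sc / Sa) * Sc + Sb = Sb - Sc ^+ 2 / Sa by field.
  by rewrite subr_ge0 ler_pdivrMr// mulrC.
rewrite -sqrtrM// -sqrtr_sqr ler_wsqrtr//.
Qed.
End cauchy.

(** * Multiplication by the weight Q^(1/p) *)

Section weights.
Context d (X : measurableType d) (R : realType).
Variable mu : {measure set X -> \bar R}.
Implicit Types f g v : X -> R.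

Lemma mul_Lfun_infty q g v : (1 <= q)%E -> g \in Lfun mu +oo%E -> v \in Lfun mu q ->
  (fun x => g x * v x) \in Lfun mu q /\
  lpn mu q (fun x => g x * v x) <= lpn mu +oo%E g * lpn mu q v.
Proof.
move=> q1 gL vL; have kL := Lfun_scal (lpn mu +oo%E g) q1 vL.
have mgv : measurable_fun [set: X] (fun x => g x * v x).
  by apply: measurable_funM; [exact: Lfun_meas gL|exact: Lfun_meas vL].
have ae : {ae mu, forall x, `|g x * v x| <= `|lpn mu +oo%E g * v x|}.
  apply: filterS (Lfun_infty gL) => x gx.
  by rewrite !normrM ler_wpM2r// (ger0_norm (lpn_ge0 _ _ _)).
split; first exact: Lfun_le kL ae.
by have := lpn_le q1 mgv kL ae; rewrite lpnZ// (ger0_norm (lpn_ge0 _ _ _)).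
Qed.

(** Hoelder's inequality for |g|^c and |v|^c with the conjugate exponents w/c and a/c. *)
Lemma mul_Lfun_real (c w a : R) g v : 1 <= c -> 0 < w -> 0 < a -> c / w + c / a = 1 ->
  g \in Lfun mu w%:E -> v \in Lfun mu a%:E ->
  (fun x => g x * v x) \in Lfun mu c%:E /\
  lpn mu c%:E (fun x => g x * v x) <= lpn mu w%:E g * lpn mu a%:E v.
Proof.
move=> c1 w0 a0 E gL vL; have c0 : 0 < c by lra.
have wc0 : 0 < w / c by rewrite divr_gt0.
have ac0 : 0 < a / c by rewrite divr_gt0.
have cw : c / w < 1 by rewrite -E ltrDl divr_gt0.
have wc1 : 1 < w / c by rewrite -invf_div invf_gt1// divr_gt0.
have wE : w = c * (w / c) by field; rewrite gt_eqF.
have aE : a = c * (a / c) by field; rewrite gt_eqF.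
have cE : @hoelder_conjugate R (w / c)%:E = (a / c)%:E.
  apply/esym/hoelder_conjugateP; [by rewrite ltNyr|by rewrite eqe gt_eqF|].
  by rewrite !inver !gt_eqF// -EFinD !invf_div E.
move: (gL) (vL); rewrite {1}wE {1}aE => /(powR_Lfun c0 wc0)[gL' gE] /(powR_Lfun c0 ac0)[vL' vE].
rewrite -wE in gE; rewrite -aE in vE; rewrite -cE in vL' vE.
have w1e : (1 <= (w / c)%:E)%E by rewrite lee_fin ltW.
have mgv : measurable_fun [set: X] (fun x => g x * v x).
  by apply: measurable_funM; [exact: Lfun_meas gL|exact: Lfun_meas vL].
have [_ le] := hoelder_Lfun w1e gL' vL'.
rewrite gE vE -powRM ?lpn_ge0// in le.
have {}le : (\int[mu]_x (`|g x * v x| `^ c)%:E <= ((lpn mu w%:E g * lpn mu a%:E v) `^ c)%:E)%E.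
  apply: le_trans le; rewrite le_eqVlt; apply/orP; left; apply/eqP.
  apply: eq_integral => x _; rewrite normrM powRM//.
  by rewrite normrM !(ger0_norm (powR_ge0 _ _)).
have L : (fun x => g x * v x) \in Lfun mu c%:E.
  by apply/(Lfun_powRP _ c0) => //; exact: le_lt_trans le (ltry _).
split => //; move: le; rewrite lpn_powR// lee_fin => le.
by apply: le_powRW le; rewrite ?mulr_ge0 ?lpn_ge0.
Qed.

Variables (p r : R) (q : \bar R) (Q : X -> R).
Hypotheses (p2 : 2 < p) (pr : p^-1 + r^-1 = 1) (pq : (p%:E <= q)%E).
Hypothesis QL : Q \in Lfun mu (weight_exponent p q).
Hypothesis Q0 : {ae mu, forall x, 0 <= Q x}.

Let Qt x := Q x `^ p^-1.
Let p0 : 0 < p. Proof. by move: p2; lra. Qed.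
Let r1 : 1 < r.
Proof.
have ri : r^-1 = 1 - p^-1 by rewrite -pr; ring.
have i1 : p^-1 < 1 by rewrite invf_lt1//; move: p2; lra.
have i0 : 0 < p^-1 by rewrite invr_gt0.
have r0 : 0 < r by rewrite -invr_gt0 ri subr_gt0.
by rewrite -invf_lt1// ri; lra.
Qed.
Let r0 : 0 < r. Proof. by move: r1; lra. Qed.
Let rE : r = p / (p - 1).
Proof.
have ri : r^-1 = 1 - p^-1 by rewrite -pr; ring.
rewrite -[LHS]invrK ri; field; rewrite !gt_eqF//=; move: p2; lra.
Qed.

Lemma measurable_weight : measurable_fun [set: X] Qt.
Proof.
apply: (@measurableT_comp _ _ _ _ _ _ (@powR R ^~ p^-1)) => //.
exact: Lfun_meas QL.
Qed.

Let QtE : {ae mu, forall x, Qt x = `|Q x| `^ p^-1}.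
Proof. by apply: filterS Q0 => x Qx; rewrite ger0_norm. Qed.

Let Qt_real (t : R) : 1 <= t -> Q \in Lfun mu (p^-1 * t)%:E -> Qt \in Lfun mu t%:E.
Proof.
move=> t1 QL'; have t0 : 0 < t by lra.
have ip0 : 0 < p^-1 by rewrite invr_gt0.
have [L _] := powR_Lfun ip0 t0 QL'.
by apply: Lfun_ae L QtE; [rewrite lee_fin|exact: measurable_weight].
Qed.

Let Qt_infty : Q \in Lfun mu +oo%E -> Qt \in Lfun mu +oo%E.
Proof.
move=> QL'; have ip0 : 0 < p^-1 by rewrite invr_gt0.
have [L _] := powR_Lfun_infty ip0 QL'.
by apply: Lfun_ae L QtE; [rewrite leey|exact: measurable_weight].
Qed.

(** Q^(1/p) lies in L^w with 1/w = 1/p - 1/q. As 1/q' = 1/p' + 1/w and 1/p = 1/q + 1/w, one weight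
    norm bounds both maps, from L^(p') to L^(q') and from L^q to L^p. The end points q = p and q =
    oo use the same relations with w = oo and w = p. *)
Lemma weight_bounded : exists2 c : R, 0 <= c &
  (forall v, v \in Lfun mu r%:E ->
     (fun x => Qt x * v x) \in Lfun mu (hoelder_conjugate q) /\
     lpn mu (hoelder_conjugate q) (fun x => Qt x * v x) <= c * lpn mu r%:E v) /\
  (forall u, u \in Lfun mu q -> (fun x => Qt x * u x) \in Lfun mu p%:E /\
     lpn mu p%:E (fun x => Qt x * u x) <= c * lpn mu q u).
Proof.
have p1 : 1 < p by move: p2; lra.
have p1e : (1 <= p%:E)%E by rewrite lee_fin ltW.
have r1e : (1 <= r%:E)%E by rewrite lee_fin ltW.
have cp : @hoelder_conjugate R p%:E = r%:E.
  apply/esym/hoelder_conjugateP; [by rewrite ltNyr|by rewrite eqe gt_eqF|].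
  by rewrite !inver !gt_eqF// -EFinD pr.
move: QL pq; case: q => [q'||] QL' pq'; last by rewrite leeNy_eq in pq'.
- rewrite lee_fin in pq'; move: QL'; rewrite /weight_exponent.
  case: eqVneq => [-> QL'|qp QL'].
    rewrite cp; have QtL := Qt_infty QL'.
    exists (lpn mu +oo%E Qt); first exact: lpn_ge0.
    by split=> [v vL|u uL]; exact: mul_Lfun_infty.
  have q0 : 0 < q' by exact: lt_le_trans pq'.
  have pq1 : p < q' by rewrite lt_neqAle eq_sym qp.
  have qp0 : 0 < q' - p by rewrite subr_gt0.
  have q1 : 0 < q' - 1 by rewrite subr_gt0; apply: lt_trans pq1.
  have w0 : 0 < p * q' / (q' - p) by rewrite divr_gt0// mulr_gt0.
  have QtL : Qt \in Lfun mu (p * q' / (q' - p))%:E.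
    apply: Qt_real.
      rewrite ler_pdivlMr// mul1r; move: p2 pq1 q0 => ? ? ?; nra.
    have -> : p^-1 * (p * q' / (q' - p)) = q' / (q' - p) by field; rewrite !gt_eqF.
    exact: QL'.
  have cq : @hoelder_conjugate R q'%:E = (q' / (q' - 1))%:E.
    rewrite /hoelder_conjugate /= eqe (gt_eqF q0) -EFinD inver (gt_eqF q1).
    by rewrite -EFinM.
  exists (lpn mu (p * q' / (q' - p))%:E Qt); first exact: lpn_ge0.
  rewrite cq; split=> [v vL|u uL]; apply: mul_Lfun_real => //.
  + by rewrite ler_pdivlMr// mul1r gerBl.
  + rewrite rE; have pp : 0 < p - 1 by lra.
    by field; rewrite !gt_eqF.
  + by field; rewrite !gt_eqF.
- rewrite hoelder_conjugatey /= in QL' *.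
  have QtL : Qt \in Lfun mu p%:E.
    by apply: Qt_real; [exact: ltW|rewrite mulVf// gt_eqF].
  exists (lpn mu p%:E Qt); first exact: lpn_ge0; split=> [v vL|u uL].
    by apply: mul_Lfun_real => //; rewrite !div1r pr.
  have [L le] := mul_Lfun_infty p1e uL QtL.
  have E : (fun x => Qt x * u x) = (fun x => u x * Qt x) by apply/funext => x; rewrite mulrC.
  by rewrite E; split => //; rewrite mulrC.
Qed.

End weights.

(** * Blocks of time frequencies *)

Section fubini.
Context d1 (T : measurableType d1) d2 (X : measurableType d2) (R : realType).
Variable m1 : {sigma_finite_measure set T -> \bar R}.
Variable m2 : {sigma_finite_measure set X -> \bar R}.

Lemma Rint_prod21 (f : T * X -> R) : (m1 \x m2)%E.-integrable [set: T * X] (EFin \o f) ->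
  \int[(m1 \x m2)%E]_z f z = \int[m2]_x \int[m1]_t f (t, x).
Proof.
move=> iF; rewrite /Rintegral -(integral21_prod_meas1 iF); congr fine.
apply: ae_eq_integral => //.
- exact: measurable_fubini_G iF.
- apply/measurable_EFinP; apply: measurableT_comp => //; exact: measurable_fubini_G iF.
- apply: filterS (ae_integrable2 iF) => x ix _; rewrite fineK//.
  exact: integrable_fin_num ix.
Qed.

Lemma Rint_prod12 (f : T * X -> R) : (m1 \x m2)%E.-integrable [set: T * X] (EFin \o f) ->
  \int[(m1 \x m2)%E]_z f z = \int[m1]_t \int[m2]_x f (t, x).
Proof.
move=> iF; rewrite /Rintegral -(integral12_prod_meas1 iF); congr fine.
apply: ae_eq_integral => //.
- exact: measurable_fubini_F iF.
- apply/measurable_EFinP; apply: measurableT_comp => //; exact: measurable_fubini_F iF.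
- apply: filterS (ae_integrable1 iF) => x ix _; rewrite fineK//.
  exact: integrable_fin_num ix.
Qed.

Lemma eq_Rint_ae d (Y : measurableType d) (mu : {measure set Y -> \bar R}) (f g : Y -> R) :
  measurable_fun [set: Y] f -> measurable_fun [set: Y] g ->
  {ae mu, forall y, f y = g y} -> \int[mu]_y f y = \int[mu]_y g y.
Proof.
move=> mf mg fg; rewrite /Rintegral; congr fine; apply: ae_eq_integral => //;
  [exact/measurable_EFinP|exact/measurable_EFinP|by apply: filterS fg => y -> _].
Qed.

End fubini.

(** * Finite sums of orthogonal time profiles *)

Section profiles.
Context d1 (T : measurableType d1) d2 (X : measurableType d2) (R : realType).
Variable m1 : {finite_measure set T -> \bar R}.
Variable m2 : {sigma_finite_measure set X -> \bar R}.
Variables (e : nat -> T -> R) (ka : R).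
Hypothesis me : forall j, measurable_fun [set: T] (e j).
Hypothesis e1 : forall j t, `|e j t| <= 1.
Hypothesis ka0 : 0 < ka.
Hypothesis eo : forall i j, \int[m1]_t (e i t * e j t) = if i == j then ka else 0.

Lemma bounded_integrable (f : T -> R) (K : R) : measurable_fun [set: T] f ->
  (forall t, `|f t| <= K) -> m1.-integrable [set: T] (EFin \o f).
Proof.
move=> mf fK; have iK := finite_measure_integrable_cst m1 K.
apply: (le_integrable measurableT _ _ (iK _ measurableT)) => //; first exact/measurable_EFinP.
by move=> t _; rewrite /= lee_fin (le_trans (fK t))// ler_norm.
Qed.

Let esum (a : nat -> R) lo hi t := \sum_(lo <= j < hi) a j * e j t.

Let mesum a lo hi : measurable_fun [set: T] (esum a lo hi).
Proof. by apply: measurable_sum => j; apply: measurable_funM. Qed.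

Let esum_bd a lo hi t : `|esum a lo hi t| <= \sum_(lo <= j < hi) `|a j|.
Proof.
apply: (le_trans (ler_norm_sum _ _ _)); apply: ler_sum => j _.
by rewrite normrM -[leRHS]mulr1 ler_wpM2l.
Qed.

Let esum_e a lo hi i : (hi <= i)%N -> \int[m1]_t (esum a lo hi t * e i t) = 0.
Proof.
have [hl|] := leqP hi lo.
  move=> _; under eq_Rintegral do rewrite /esum big_geq// mul0r.
  by rewrite Rintegral_cst// mul0r.
elim: hi => [//|h IH]; rewrite ltnS => lh hi.
have E t : esum a lo h.+1 t * e i t = esum a lo h t * e i t + a h * (e h t * e i t).
  by rewrite /esum big_nat_recr//= mulrDl mulrA.
under eq_Rintegral do rewrite E.
have I1 : m1.-integrable [set: T] (EFin \o (fun t => esum a lo h t * e i t)).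
  apply: (@bounded_integrable _ (\sum_(lo <= j < h) `|a j|)); first exact: measurable_funM.
  by move=> t; rewrite normrM -[leRHS]mulr1 ler_pM.
have I2 : m1.-integrable [set: T] (EFin \o (fun t => e h t * e i t)).
  apply: (@bounded_integrable _ 1); first exact: measurable_funM.
  by move=> t; rewrite normrM -[leRHS]mulr1 ler_pM.
have I3 : m1.-integrable [set: T] (EFin \o (fun t => a h * (e h t * e i t))).
  by have := integrableZl measurableT (a h) I2; apply: eq_integrable.
rewrite RintegralD// RintegralZl// eo (ltn_eqF hi) mulr0 addr0.
move: lh; rewrite leq_eqVlt => /predU1P[->|lh].
  under eq_Rintegral do rewrite /esum big_geq// mul0r.
  by rewrite Rintegral_cst// mul0r.
by apply: IH => //; exact: ltnW.
Qed.

Let esum_sq a lo hi : \int[m1]_t (esum a lo hi t ^+ 2) = ka * \sum_(lo <= j < hi) a j ^+ 2.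
Proof.
have [hl|] := leqP hi lo.
  under eq_Rintegral do rewrite /esum big_geq// expr0n.
  by rewrite Rintegral_cst// mul0r big_geq// mulr0.
elim: hi => [//|h IH]; rewrite ltnS => lh.
have E t : esum a lo h.+1 t ^+ 2 = (esum a lo h t ^+ 2 + (2 * a h) * (esum a lo h t * e h t)) + a h ^+ 2 * (e h t * e h t).
  by rewrite /esum big_nat_recr//=; ring.
under eq_Rintegral do rewrite E.
have I0 : m1.-integrable [set: T] (EFin \o (fun t => esum a lo h t ^+ 2)).
  apply: (@bounded_integrable _ ((\sum_(lo <= j < h) `|a j|) ^+ 2)); first exact: measurable_funX.
  by move=> t; rewrite normrX lerXn2r ?nnegrE ?sumr_ge0.
have I1 : m1.-integrable [set: T] (EFin \o (fun t => esum a lo h t * e h t)).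
  apply: (@bounded_integrable _ (\sum_(lo <= j < h) `|a j|)); first exact: measurable_funM.
  by move=> t; rewrite normrM -[leRHS]mulr1 ler_pM.
have I2 : m1.-integrable [set: T] (EFin \o (fun t => e h t * e h t)).
  apply: (@bounded_integrable _ 1); first exact: measurable_funM.
  by move=> t; rewrite normrM -[leRHS]mulr1 ler_pM.
have I3 : m1.-integrable [set: T] (EFin \o (fun t => a h ^+ 2 * (e h t * e h t))).
  by have := integrableZl measurableT (a h ^+ 2) I2; apply: eq_integrable.
have I4 : m1.-integrable [set: T] (EFin \o (fun t => (2 * a h) * (esum a lo h t * e h t))).
  by have := integrableZl measurableT (2 * a h) I1; apply: eq_integrable.
have I5 : m1.-integrable [set: T] (EFin \o (fun t => esum a lo h t ^+ 2 + (2 * a h) * (esum a lo h t * e h t))).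
  by have := integrableD measurableT I0 I4; apply: eq_integrable.
rewrite RintegralD// RintegralD// !RintegralZl// eo eqxx (esum_e _ _ (leqnn h)) mulr0 addr0.
rewrite big_nat_recr//= mulrDr [ka * a h ^+ 2]mulrC; congr (_ + _).
move: lh; rewrite leq_eqVlt => /predU1P[->|lh]; last exact: IH.
under eq_Rintegral do rewrite /esum big_geq// expr0n.
by rewrite Rintegral_cst// mul0r big_geq// mulr0.
Qed.

(** Let S be the sum with the unnormalised coefficients and B the sum of their squares. Expanding
    the integral of (ka f - S)^2 >= 0 gives ka^2 |f|^2 - 2 ka B + ka B >= 0. *)
Lemma bessel (f : T -> R) (K : R) n : measurable_fun [set: T] f -> (forall t, `|f t| <= K) ->
  \sum_(0 <= j < n) (\int[m1]_t (f t * e j t)) ^+ 2 <= ka * \int[m1]_t (f t ^+ 2).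
Proof.
move=> mf fK; pose b j := \int[m1]_t (f t * e j t); pose S := esum b 0 n.
pose B := \sum_(0 <= j < n) b j ^+ 2; rewrite -/B.
have K0 : 0 <= K by apply: le_trans (fK point).
have If : m1.-integrable [set: T] (EFin \o (fun t => f t ^+ 2)).
  apply: (@bounded_integrable _ (K ^+ 2)); first exact: measurable_funX.
  by move=> t; rewrite normrX lerXn2r ?nnegrE.
have IS : m1.-integrable [set: T] (EFin \o (fun t => S t ^+ 2)).
  apply: (@bounded_integrable _ ((\sum_(0 <= j < n) `|b j|) ^+ 2)); first by apply: measurable_funX; exact: mesum.
  by move=> t; rewrite normrX lerXn2r ?nnegrE ?sumr_ge0//; exact: esum_bd.
have Ifs : m1.-integrable [set: T] (EFin \o (fun t => f t * S t)).
  apply: (@bounded_integrable _ (K * \sum_(0 <= j < n) `|b j|)); first by apply: measurable_funM => //; exact: mesum.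
  by move=> t; rewrite normrM ler_pM//; exact: esum_bd.
have fS : \int[m1]_t (f t * S t) = B.
  rewrite /S /B; elim: n {S B IS Ifs} => [|n IH].
    by under eq_Rintegral do rewrite /esum big_geq// mulr0; rewrite Rintegral_cst// mul0r big_geq.
  have I1 : m1.-integrable [set: T] (EFin \o (fun t => f t * esum b 0 n t)).
    apply: (@bounded_integrable _ (K * \sum_(0 <= j < n) `|b j|)); first by apply: measurable_funM => //; exact: mesum.
    by move=> t; rewrite normrM ler_pM//; exact: esum_bd.
  have I2 : m1.-integrable [set: T] (EFin \o (fun t => f t * e n t)).
    apply: (@bounded_integrable _ (K * 1)); first exact: measurable_funM.
    by move=> t; rewrite normrM ler_pM.
  have I3 : m1.-integrable [set: T] (EFin \o (fun t => b n * (f t * e n t))).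
    by have := integrableZl measurableT (b n) I2; apply: eq_integrable.
  rewrite big_nat_recr//= -IH expr2 -[in X in _ + X]RintegralZl// -RintegralD//.
  by apply: eq_Rintegral => t _; rewrite /esum big_nat_recr//=; ring.
have SS : \int[m1]_t (S t ^+ 2) = ka * B by exact: esum_sq.
have I4 : m1.-integrable [set: T] (EFin \o (fun t => ka ^+ 2 * f t ^+ 2)).
  by have := integrableZl measurableT (ka ^+ 2) If; apply: eq_integrable.
have I5 : m1.-integrable [set: T] (EFin \o (fun t => (- 2 * ka) * (f t * S t))).
  by have := integrableZl measurableT (- 2 * ka) Ifs; apply: eq_integrable.
have I6 : m1.-integrable [set: T] (EFin \o (fun t => ka ^+ 2 * f t ^+ 2 + (- 2 * ka) * (f t * S t))).
  by have := integrableD measurableT I4 I5; apply: eq_integrable.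
have h : 0 <= \int[m1]_t (ka ^+ 2 * f t ^+ 2 + (- 2 * ka) * (f t * S t) + S t ^+ 2).
  apply: Rintegral_ge0 => t _.
  have -> : ka ^+ 2 * f t ^+ 2 + (- 2 * ka) * (f t * S t) + S t ^+ 2 = (ka * f t - S t) ^+ 2 by ring.
  exact: sqr_ge0.
rewrite RintegralD// RintegralD// !RintegralZl// fS SS in h.
rewrite -(ler_pM2l ka0); move: h; set x := \int[m1]_t _ => h; lra.
Qed.

Lemma bessel_cvg (f : T -> R) (K : R) : measurable_fun [set: T] f -> (forall t, `|f t| <= K) ->
  \int[m1]_t (f t * e j t) @[j --> \oo] --> 0.
Proof.
move=> mf fK; pose u j := (\int[m1]_t (f t * e j t)) ^+ 2.
have uc : u j @[j --> \oo] --> 0.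
  apply: cvg_series_cvg_0; apply: nondecreasing_is_cvgn.
    apply/nondecreasing_seqP => n; rewrite /series/= big_nat_recr//= lerDl; exact: sqr_ge0.
  exists (ka * \int[m1]_t (f t ^+ 2)) => _ [n _ <-]; exact: bessel mf fK.
apply/cvgrPdist_lt => eps eps0; have e2 : 0 < eps ^+ 2 by rewrite exprn_gt0.
move/cvgrPdist_lt: uc => /(_ _ e2); apply: filterS => j.
rewrite !sub0r !normrN normrX => h.
by rewrite -(ltr_pXn2r (ltn0Sn 1)) ?nnegrE ?(ltW eps0).
Qed.

Variables (p r : R).
Hypotheses (p2 : 2 < p) (pr : p^-1 + r^-1 = 1).
Let p0 : 0 < p. Proof. by move: p2; lra. Qed.
Let p1e : (1 <= p%:E)%E. Proof. by rewrite lee_fin; move: p2; lra. Qed.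

(** Norm of the passage from square-summable coefficients to L^p in time for n modes. It is paid
    twice per block, once in summing U and once, by duality, in bounding the coefficients of V;
    hence the total cost n^(1 - 2/p). *)
Definition block_const (n : nat) : R := ka `^ p^-1 * n%:R `^ (2^-1 - p^-1).

Lemma block_const_ge0 n : 0 <= block_const n.
Proof. by rewrite mulr_ge0 ?powR_ge0. Qed.

(* Interpolation between the bounds |S|_oo <= sqrt n |a| and |S|_2 = sqrt ka |a|. *)
Lemma block_norm_time (a : nat -> R) lo hi :
  ('N[m1]_p%:E[EFin \o (fun t => \sum_(lo <= j < hi) a j * e j t)%R] <=
   (block_const (hi - lo) * Num.sqrt (\sum_(lo <= j < hi) a j ^+ 2))%:E)%E.
Proof.
rewrite -/(esum a lo hi); set A := Num.sqrt _; set n := (hi - lo)%N.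
have A0 : 0 <= A by exact: sqrtr_ge0.
have AE : A ^+ 2 = \sum_(lo <= j < hi) a j ^+ 2.
  by rewrite sqr_sqrtr//; apply: sumr_ge0 => j _; exact: sqr_ge0.
pose B := A * Num.sqrt n%:R.
have B0 : 0 <= B by rewrite mulr_ge0.
have SB t : `|esum a lo hi t| <= B.
  apply: (le_trans (cauchy_sum _ _ _ _)); rewrite ler_wpM2l// ler_wsqrtr//.
  apply: (@le_trans _ _ (\sum_(lo <= j < hi) 1)).
    by apply: ler_sum => j _; rewrite -(real_normK (num_real (e j t))) expr_le1.
  by rewrite sumr_const_nat.
have le1 : (\int[m1]_t `|(EFin \o esum a lo hi) t| `^ p <= (B `^ (p - 2) * (ka * A ^+ 2))%:E)%E.
  have I0 : m1.-integrable [set: T] (EFin \o (fun t => esum a lo hi t ^+ 2)).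
    apply: (@bounded_integrable _ ((\sum_(lo <= j < hi) `|a j|) ^+ 2)); first exact: measurable_funX.
    by move=> t; rewrite normrX lerXn2r ?nnegrE ?sumr_ge0.
  have -> : (B `^ (p - 2) * (ka * A ^+ 2))%:E = (\int[m1]_t ((B `^ (p - 2))%:E * (esum a lo hi t ^+ 2)%:E))%E.
    rewrite AE -esum_sq EFinM ge0_integralZl_EFin//; last 3 first.
    - by move=> t _; rewrite lee_fin sqr_ge0.
    - by apply/measurable_EFinP; exact: measurable_funX.
    - exact: powR_ge0.
    rewrite /Rintegral fineK//; exact: integrable_fin_num.
  apply: ge0_le_integral => //.
  - by move=> t _; exact: poweR_ge0.
  - by apply: measurable_fun_poweR; apply: measurableT_comp => //; exact/measurable_EFinP.
  - by apply: measurable_funeM; apply/measurable_EFinP; exact: measurable_funX.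
  move=> t _; have -> : (`|(EFin \o esum a lo hi) t| = `|esum a lo hi t|%:E)%E by [].
  rewrite poweR_EFin -EFinM lee_fin.
  have -> : `|esum a lo hi t| `^ p = `|esum a lo hi t| `^ (p - 2) * esum a lo hi t ^+ 2.
    rewrite -(real_normK (num_real (esum a lo hi t))).
    have [->|n0] := eqVneq `|esum a lo hi t| 0.
      by rewrite powR0 ?gt_eqF// expr0n mulr0.
    by rewrite -powR_mulrn// -powRD ?n0 ?implybT//; congr (_ `^ _); ring.
  rewrite ler_wpM2r ?sqr_ge0//; apply: ge0_ler_powR; rewrite ?nnegrE//; move: p2; lra.
rewrite LnormE; apply: (@le_trans _ _ ((B `^ (p - 2) * (ka * A ^+ 2))%:E `^ p^-1)%E).
  apply: ge0_le_poweR => //; first by rewrite invr_ge0 ltW.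
  by apply: integral_ge0 => t _; exact: poweR_ge0.
rewrite poweR_EFin lee_fin /block_const.
have [->|An0] := eqVneq A 0.
  by rewrite expr0n !mulr0 powR0// invr_eq0 gt_eqF.
have Ap : 0 < A by rewrite lt_neqAle eq_sym An0.
have BE : B `^ (p - 2) = A `^ (p - 2) * n%:R `^ ((p - 2) / 2).
  rewrite /B powRM ?sqrtr_ge0// -powR12_sqrt// -powRrM; congr (_ * _ `^ _); by field.
have A2 : A ^+ 2 = A `^ 2 by rewrite powR_mulrn.
rewrite A2 BE !powRM ?mulr_ge0 ?powR_ge0 ?(ltW ka0)// -!powRrM.
have -> : (p - 2) / 2 / p = 2^-1 - p^-1 by field; rewrite gt_eqF.
rewrite le_eqVlt; apply/orP; left; apply/eqP.
have -> : A `^ ((p - 2) / p) * n%:R `^ (2^-1 - p^-1) * (ka `^ p^-1 * A `^ (2 / p)) =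
  ka `^ p^-1 * n%:R `^ (2^-1 - p^-1) * (A `^ ((p - 2) / p) * A `^ (2 / p)) by ring.
rewrite -powRD ?An0 ?implybT//; have -> : (p - 2) / p + 2 / p = 1 by field; rewrite gt_eqF.
by rewrite powRr1.
Qed.

Definition mode_sum (u : nat -> X -> R) lo hi (z : T * X) : R :=
  \sum_(lo <= j < hi) u j z.2 * e j z.1.

Lemma measurable_mode_sum u lo hi : (forall j, (lo <= j < hi)%N -> measurable_fun [set: X] (u j)) ->
  measurable_fun [set: T * X] (mode_sum u lo hi).
Proof.
move=> mu.
have -> : mode_sum u lo hi = fun z => \sum_(lo <= j < hi) (if (lo <= j < hi)%N then u j z.2 else 0) * e j z.1.
  by apply/funext => z; apply: eq_big_nat => j ->.
apply: measurable_sum => j; apply: measurable_funM; last first.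
  by apply: measurableT_comp => //; exact: measurable_fst.
have [h|h] := boolP (lo <= j < hi)%N => //.
by apply: (measurableT_comp (mu j h)); exact: measurable_snd.
Qed.

(** The bound in time holds at each x with the square root of the sum of squares, whose L^q norm is
    then estimated by [lpn_sqrt_sum]. *)
Lemma block_mixed q (u : nat -> X -> R) lo hi : (2%:E <= q)%E ->
  (forall j, (lo <= j < hi)%N -> u j \in Lfun m2 q) ->
  (mixN m1 m2 p q (EFin \o mode_sum u lo hi) <=
   (block_const (hi - lo) * Num.sqrt (\sum_(lo <= j < hi) lpn m2 q (u j) ^+ 2))%:E)%E.
Proof.
move=> q2 uL; have q1 : (1 <= q)%E by apply: le_trans q2; rewrite lee_fin; lra.
have [sL sE] := lpn_sqrt_sum q2 uL.
have kL := Lfun_scal (block_const (hi - lo)) q1 sL.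
have mu j : (lo <= j < hi)%N -> measurable_fun [set: X] (u j).
  by move=> /uL /Lfun_meas.
have k0 := block_const_ge0 (hi - lo).
apply: (@le_trans _ _ ('N[m2]_q[EFin \o (fun x => block_const (hi - lo) * Num.sqrt (\sum_(lo <= j < hi) u j x ^+ 2))%R])%E).
  apply: Lnorm_le_ae => //.
  - by apply: measurable_inner; apply/measurable_EFinP; exact: measurable_mode_sum.
  - exact: Lfun_emeas kL.
  apply: aeW => x; rewrite gee0_abs ?Lnorm_ge0// gee0_abs; last first.
    by rewrite lee_fin mulr_ge0.
  exact: block_norm_time (fun j => u j x) lo hi.
rewrite (lpnE kL) lee_fin lpnZ// ger0_norm// ler_wpM2l//.
rewrite -(ler_pXn2r (ltn0Sn 1)) ?nnegrE ?lpn_ge0//.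
by rewrite sqr_sqrtr//; apply: sumr_ge0 => j _; exact: sqr_ge0.
Qed.

Lemma mixN_lty_Lfun (s : R) (W : T * X -> R) : 1 <= s -> measurable_fun [set: T * X] W ->
  (W \in Lfun (m1 \x m2)%E s%:E) <-> (mixN m1 m2 s s%:E (EFin \o W) < +oo)%E.
Proof.
move=> s1 mW; rewrite mixN_diag//; last exact/measurable_EFinP.
by split=> [/LfunP'[]//|h]; apply/LfunP'.
Qed.

Lemma mode_sum_Lfun (w : nat -> X -> R) lo hi :
  (forall j, (lo <= j < hi)%N -> w j \in Lfun m2 p%:E) ->
  mode_sum w lo hi \in Lfun (m1 \x m2)%E p%:E /\
  lpn (m1 \x m2)%E p%:E (mode_sum w lo hi) <=
   block_const (hi - lo) * Num.sqrt (\sum_(lo <= j < hi) lpn m2 p%:E (w j) ^+ 2).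
Proof.
move=> wL; have pp : (2%:E <= p%:E)%E by rewrite lee_fin ltW.
have := block_mixed pp wL => le.
have mW : measurable_fun [set: T * X] (mode_sum w lo hi).
  by apply: measurable_mode_sum => j /wL /Lfun_meas.
have L : mode_sum w lo hi \in Lfun (m1 \x m2)%E p%:E.
  by apply/mixN_lty_Lfun => //; exact: le_lt_trans le (ltry _).
split => //; rewrite -lee_fin -lpnE// -mixN_diag//; exact/measurable_EFinP.
Qed.

Definition coef j (V : T * X -> R) (x : X) : R := ka^-1 * \int[m1]_t (V (t, x) * e j t).

Lemma measurable_coef j V : measurable_fun [set: T * X] V -> measurable_fun [set: X] (coef j V).
Proof.
move=> mV; apply: measurable_funM => //.
have mVe : measurable_fun [set: T * X] (EFin \o (fun z : T * X => V z * e j z.1)).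
  apply/measurable_EFinP; apply: measurable_funM => //.
  by apply: measurableT_comp => //; exact: measurable_fst.
apply: measurableT_comp => //.
under eq_fun do rewrite integralE.
apply: emeasurable_funB.
- have := measurable_fun_fubini_tonelli_G (m1 := m1) _ (measurable_funepos mVe) (funepos_ge0 _).
  by apply: eq_measurable_fun => x _; apply: eq_integral => t _; rewrite !funeposE.
- have := measurable_fun_fubini_tonelli_G (m1 := m1) _ (measurable_funeneg mVe) (funeneg_ge0 _).
  by apply: eq_measurable_fun => x _; apply: eq_integral => t _; rewrite !funenegE.
Qed.

Let r1 : 1 < r.
Proof.
have ri : r^-1 = 1 - p^-1 by rewrite -pr; ring.
have i1 : p^-1 < 1 by rewrite invf_lt1//; move: p2; lra.
have i0 : 0 < p^-1 by rewrite invr_gt0.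
have r0 : 0 < r by rewrite -invr_gt0 ri subr_gt0.
by rewrite -invf_lt1// ri; lra.
Qed.
Let r1e : (1 <= r%:E)%E. Proof. by rewrite lee_fin ltW. Qed.
Let r0 : 0 < r. Proof. by move: r1; lra. Qed.
Let conjr : @hoelder_conjugate R r%:E = p%:E.
Proof.
by apply/esym/hoelder_conjugateP; [rewrite ltNyr|rewrite eqe gt_eqF|];
  rewrite ?inver ?gt_eqF// -EFinD addrC pr.
Qed.
Let conjp : @hoelder_conjugate R p%:E = r%:E.
Proof. by rewrite -conjr hoelder_conjugateK. Qed.

Lemma slice_Lfun (s : R) (V : T * X -> R) : 1 <= s -> V \in Lfun (m1 \x m2)%E s%:E ->
  {ae m2, forall x, (fun t => V (t, x)) \in Lfun m1 s%:E}.
Proof.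
move=> s1 VL; have mV := Lfun_meas VL.
have s1e : (1 <= s%:E)%E by rewrite lee_fin.
have := (mixN_lty_Lfun s1 mV).1 VL.
move=> /(Lnorm_lty_ae s1e (measurable_inner m1 s (Lfun_emeas VL))); apply: filterS => x.
rewrite fin_numElt => /andP[_ fx]; apply/LfunP'; split => //.
by apply: measurableT_comp => //; exact: measurable_pair2.
Qed.

Lemma Lfun_fin_integrable (s : R) (f : T -> R) : 1 <= s -> f \in Lfun m1 s%:E ->
  m1.-integrable [set: T] (EFin \o f).
Proof.
move=> s1 fL; apply/Lfun1P; apply: Lfun_subset fL => //; rewrite ?lee_fin//.
exact: fin_num_measure.
Qed.

Lemma integrable_mul_e j (f : T -> R) : m1.-integrable [set: T] (EFin \o f) ->
  m1.-integrable [set: T] (EFin \o (fun t => f t * e j t)).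
Proof.
move=> iF; apply: (le_integrable measurableT _ _ iF).
  apply/measurable_EFinP; apply: measurable_funM => //.
  by apply/measurable_EFinP; exact: measurable_int iF.
by move=> t _; rewrite /= lee_fin normrM -[leRHS]mulr1 ler_wpM2l.
Qed.

Lemma e_Lfun j : e j \in Lfun m1 p%:E /\ lpn m1 p%:E (e j) <= lpn m1 p%:E (cst 1).
Proof.
have c1 : cst 1 \in Lfun m1 p%:E by exact: Lfun_cst.
have ae : {ae m1, forall t, `|e j t| <= `|cst 1 t : R|}.
  by apply: aeW => t; rewrite /= normr1.
by split; [exact: Lfun_le c1 ae|exact: lpn_le c1 ae].
Qed.

Lemma coef_Lfun j V : V \in Lfun (m1 \x m2)%E r%:E -> coef j V \in Lfun m2 r%:E.
Proof.
move=> VL; have mV := Lfun_meas VL; have mV' := Lfun_emeas VL.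
pose K := ka^-1 * lpn m1 p%:E (cst 1).
pose g x := fine ('N[m1]_r%:E[(fun t => (EFin \o V) (t, x))])%E.
have fin := (mixN_lty_Lfun (ltW r1) mV).1 VL.
have mg : measurable_fun [set: X] g by apply: measurableT_comp => //; exact: measurable_inner.
have gL : g \in Lfun m2 r%:E.
  apply/LfunP'; split => //; apply: le_lt_trans (fin); apply: Lnorm_le_ae => //.
  - exact/measurable_EFinP.
  - exact: measurable_inner.
  apply: filterS (Lnorm_lty_ae r1e (measurable_inner m1 r mV') fin) => x xf.
  by rewrite /= /g -[in leRHS](fineK xf).
apply: (Lfun_le r1e (measurable_coef j mV) (Lfun_scal K r1e gL)).
apply: filterS (slice_Lfun (ltW r1) VL) => x xL.
have [eL eK] := e_Lfun j.
have K0 : 0 <= K by rewrite mulr_ge0 ?lpn_ge0// invr_ge0 ltW.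
have g0 : 0 <= g x by rewrite fine_ge0 ?Lnorm_ge0.
rewrite [leRHS](ger0_norm (mulr_ge0 K0 g0)).
have ik0 : 0 <= ka^-1 by rewrite invr_ge0 ltW.
rewrite /coef normrM (ger0_norm ik0).
rewrite /K -mulrA ler_wpM2l//.
have eL' : e j \in Lfun m1 (hoelder_conjugate r%:E) by rewrite conjr.
apply: (le_trans (hoelder_Rint r1e xL eL')); rewrite conjr mulrC.
by rewrite ler_wpM2r// lpn_ge0.
Qed.

Lemma mode1_Lfun j (w : X -> R) : w \in Lfun m2 p%:E ->
  (fun z : T * X => w z.2 * e j z.1) \in Lfun (m1 \x m2)%E p%:E.
Proof.
move=> wL; have [L _] := @mode_sum_Lfun (fun=> w) j j.+1 (fun _ _ => wL).
by have -> : (fun z : T * X => w z.2 * e j z.1) = mode_sum (fun=> w) j j.+1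
  by apply/funext => z; rewrite /mode_sum big_nat1.
Qed.

Lemma coef_pairing j V (w : X -> R) : V \in Lfun (m1 \x m2)%E r%:E -> w \in Lfun m2 p%:E ->
  \int[(m1 \x m2)%E]_z ((w z.2 * e j z.1) * V z) = ka * \int[m2]_x (coef j V x * w x).
Proof.
move=> VL wL; have wL' := mode1_Lfun j wL.
have VL' : V \in Lfun (m1 \x m2)%E (hoelder_conjugate p%:E) by rewrite conjp.
have [iF _] := hoelder_Lfun p1e wL' VL'.
have cL := coef_Lfun j VL.
have cL' : coef j V \in Lfun m2 (hoelder_conjugate p%:E) by rewrite conjp.
have [iG _] := hoelder_Lfun p1e wL cL'.
rewrite (Rint_prod21 iF) -RintegralZl//; last by apply: eq_integrable iG => // x _; rewrite /= mulrC.
apply: eq_Rint_ae.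
- by apply: measurableT_comp => //; exact: measurable_fubini_G iF.
- apply: measurable_funM => //; apply: measurable_funM; [exact: Lfun_meas cL|exact: Lfun_meas wL].
apply: filterS (slice_Lfun (ltW r1) VL) => x xL.
have i1 := integrable_mul_e j (Lfun_fin_integrable (ltW r1) xL).
rewrite /coef mulrA mulrA divff ?gt_eqF// mul1r mulrC -RintegralZl//.
by apply: eq_Rintegral => t _ /=; ring.
Qed.

Lemma coef_lin j (a : R) V W : V \in Lfun (m1 \x m2)%E r%:E -> W \in Lfun (m1 \x m2)%E r%:E ->
  {ae m2, forall x, coef j (fun z => a * V z + W z) x = a * coef j V x + coef j W x}.
Proof.
move=> VL WL; apply: filterS2 (slice_Lfun (ltW r1) VL) (slice_Lfun (ltW r1) WL) => x xV xW.
have i1 := integrable_mul_e j (Lfun_fin_integrable (ltW r1) xV).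
have i2 := integrable_mul_e j (Lfun_fin_integrable (ltW r1) xW).
have i3 : m1.-integrable [set: T] (EFin \o (fun t => a * (V (t, x) * e j t))).
  by have := integrableZl measurableT a i1; apply: eq_integrable.
have E : \int[m1]_t ((a * V (t, x) + W (t, x)) * e j t) =
    a * \int[m1]_t (V (t, x) * e j t) + \int[m1]_t (W (t, x) * e j t).
  rewrite -RintegralZl// -RintegralD//.
  by apply: eq_Rintegral => t _; ring.
by rewrite /coef E; ring.
Qed.

Lemma Rintegral_sum_nat d (Y : measurableType d) (mu : {measure set Y -> \bar R})
    (f : nat -> Y -> R) lo hi :
  (forall j, (lo <= j < hi)%N -> mu.-integrable [set: Y] (EFin \o f j)) ->
  mu.-integrable [set: Y] (EFin \o (fun y => \sum_(lo <= j < hi) f j y)) /\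
  \int[mu]_y \sum_(lo <= j < hi) f j y = \sum_(lo <= j < hi) \int[mu]_y f j y.
Proof.
have base : mu.-integrable [set: Y] (EFin \o (fun=> 0 : R)) /\ \int[mu]_y (0 : R) = 0.
  by split; [exact: integrable0|rewrite /Rintegral integral0].
have [hl|] := leqP hi lo.
  move=> _; rewrite big_geq//.
  have -> : (fun y => \sum_(lo <= j < hi) f j y) = fun=> 0.
    by apply/funext => y; rewrite big_geq.
  exact: base.
elim: hi => [//|h IH]; rewrite ltnS => lh iF.
have ih : mu.-integrable [set: Y] (EFin \o f h) by apply: iF; rewrite lh ltnSn.
have {IH} [I1 I2] : mu.-integrable [set: Y] (EFin \o (fun y => \sum_(lo <= j < h) f j y)) /\
    \int[mu]_y \sum_(lo <= j < h) f j y = \sum_(lo <= j < h) \int[mu]_y f j y.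
  move: lh; rewrite leq_eqVlt => /predU1P[->|lh].
    rewrite big_geq//.
    have -> : (fun y => \sum_(h <= j < h) f j y) = fun=> 0.
      by apply/funext => y; rewrite big_geq.
    exact: base.
  by apply: IH => // j /andP[lj jh]; apply: iF; rewrite lj (ltn_trans jh).
have -> : (fun y => \sum_(lo <= j < h.+1) f j y) = (fun y => \sum_(lo <= j < h) f j y + f h y).
  by apply/funext => y; rewrite big_nat_recr.
split; first by have := integrableD measurableT I1 ih; apply: eq_integrable.
by rewrite RintegralD// I2 big_nat_recr.
Qed.

(* Duality with [block_mixed]: test V against the sum of w_j e_j, where w_j is
   the duality map of the j-th coefficient. *)
Lemma coef_block V lo hi : V \in Lfun (m1 \x m2)%E r%:E ->
  Num.sqrt (\sum_(lo <= j < hi) lpn m2 r%:E (coef j V) ^+ 2) <=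
  ka^-1 * block_const (hi - lo) * lpn (m1 \x m2)%E r%:E V.
Proof.
move=> VL; set S := \sum_(lo <= j < hi) _; set N := lpn (m1 \x m2)%E _ _.
have S0 : 0 <= S by apply: sumr_ge0 => j _; exact: sqr_ge0.
have rpE : r * (p - 1) = p.
  have ri : r^-1 = 1 - p^-1 by rewrite -pr; ring.
  rewrite -[r]invrK ri; field; rewrite !gt_eqF//=; move: p2; lra.
have prE : p * (r - 1) = r by move: rpE; lra.
have p1 : 1 < p by move: p2; lra.
(* The normalisation by |c_j|^(2-r) makes the norm of w_j in L^p equal to that of c_j in L^r, and
   the pairing of the two equal to its square. *)
pose c j := coef j V; pose w j x := lpn m2 r%:E (c j) `^ (2 - r) * spow r (c j x).
have cL j : c j \in Lfun m2 r%:E by exact: coef_Lfun.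
have r2 : r < 2 by move: rpE r0 p2 => h1 h2 h3; nra.
have wL j : w j \in Lfun m2 p%:E /\ lpn m2 p%:E (w j) = lpn m2 r%:E (c j).
  have [L E] := spow_Lfun r1 p1 prE (cL j); split; first exact: Lfun_scal.
  rewrite /w lpnZ// ger0_norm ?powR_ge0//.
  have -> : lpn m2 p%:E (fun x => spow r (c j x)) = lpn m2 r%:E (c j) `^ (r - 1).
    rewrite -[LHS](@powRVK _ _ p) ?lpn_ge0// E -powRrM; congr (_ `^ _).
    by rewrite -{1}prE mulrAC divff ?gt_eqF// mul1r.
  have [->|n0] := eqVneq (lpn m2 r%:E (c j)) 0.
    by rewrite !powR0 ?mul0r// gt_eqF// subr_gt0.
  rewrite -powRD ?n0 ?implybT//; have -> : 2 - r + (r - 1) = 1 by ring.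
  by rewrite powRr1// lpn_ge0.
have cw j : \int[m2]_x (c j x * w j x) = lpn m2 r%:E (c j) ^+ 2.
  have -> : \int[m2]_x (c j x * w j x) = \int[m2]_x (lpn m2 r%:E (c j) `^ (2 - r) * `|c j x| `^ r).
    by apply: eq_Rintegral => x _; rewrite /w -(spow_mul _ r1); ring.
  rewrite RintegralZl//; last exact: integrable_pow (ltW r1) (cL j).
  rewrite -lpn_pow//; have [->|n0] := eqVneq (lpn m2 r%:E (c j)) 0.
    by rewrite !powR0 ?mul0r ?expr0n// gt_eqF// subr_gt0.
  rewrite -powRD ?n0 ?implybT//; have -> : 2 - r + r = 2 by ring.
  by rewrite powR_mulrn// lpn_ge0.
have [WL WE] := @mode_sum_Lfun w lo hi (fun j _ => (wL j).1).
have VL' : V \in Lfun (m1 \x m2)%E (hoelder_conjugate p%:E) by rewrite conjp.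
have := hoelder_Rint p1e WL VL'; rewrite conjp -/N.
have -> : \int[(m1 \x m2)%E]_z (mode_sum w lo hi z * V z) = ka * S.
  under eq_Rintegral do rewrite /mode_sum mulr_suml.
  have iF j : (m1 \x m2)%E.-integrable [set: T * X] (EFin \o (fun z => w j z.2 * e j z.1 * V z)).
    by have [] := hoelder_Lfun p1e (mode1_Lfun j (wL j).1) VL'.
  have [_ ->] := @Rintegral_sum_nat _ _ (m1 \x m2)%E (fun j z => w j z.2 * e j z.1 * V z) lo hi (fun j _ => iF j).
  rewrite mulr_sumr; apply: eq_bigr => j _.
  by rewrite coef_pairing ?(wL j).1// cw.
rewrite ger0_norm ?mulr_ge0 ?(ltW ka0)// => le.
have {}WE : lpn (m1 \x m2)%E p%:E (mode_sum w lo hi) <= block_const (hi - lo) * Num.sqrt S.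
  apply: le_trans WE _; rewrite le_eqVlt; apply/orP; left; apply/eqP; congr (_ * Num.sqrt _).
  by apply: eq_bigr => j _; rewrite (wL j).2.
have [->|Sn0] := eqVneq S 0.
  by rewrite sqrtr0 mulr_ge0 ?lpn_ge0// mulr_ge0 ?block_const_ge0// invr_ge0 ltW.
have sS : 0 < Num.sqrt S by rewrite sqrtr_gt0 lt_neqAle eq_sym Sn0.
have {}le := le_trans le (ler_wpM2r (lpn_ge0 _ _ _) WE).
rewrite -{1}(sqr_sqrtr S0) in le.
rewrite -mulrA mulrC ler_pdivlMr// -(ler_pM2r sS) [leRHS](_ : _ = block_const (hi - lo) * Num.sqrt S * N); last by ring.
by apply: le_trans le; rewrite le_eqVlt; apply/orP; left; apply/eqP; ring.
Qed.
End profiles.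

(** * Compactness and ground states *)

Lemma sum_sqr_le (R : realType) (a : nat -> R) lo hi : (forall j, 0 <= a j) ->
  \sum_(lo <= j < hi) a j ^+ 2 <= (\sum_(lo <= j < hi) a j) ^+ 2.
Proof.
move=> a0; have [hl|] := leqP hi lo; first by rewrite !big_geq// expr0n.
elim: hi => [//|h IH]; rewrite ltnS => lh; rewrite !big_nat_recr//=.
have s0 : 0 <= \sum_(lo <= j < h) a j by apply: sumr_ge0.
have {}IH : \sum_(lo <= j < h) a j ^+ 2 <= (\sum_(lo <= j < h) a j) ^+ 2.
  by move: lh; rewrite leq_eqVlt => /predU1P[<-|//]; rewrite !big_geq// expr0n.
rewrite sqrrD; move: IH; rewrite -addrA => IH; apply: lerD => //.
by rewrite lerDr mulrn_wge0// mulr_ge0.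
Qed.

Section subsequences.
Context {R : realType}.

Lemma homo_ltn_ge (u : nat -> nat) : {homo u : i j / (i < j)%N} -> forall n, (n <= u n)%N.
Proof. by move=> hu; elim=> [//|n IH]; exact: leq_ltn_trans IH (hu _ _ (ltnSn n)). Qed.

Lemma homo_ltnS (u : nat -> nat) : (forall n, (u n < u n.+1)%N) -> {homo u : i j / (i < j)%N}.
Proof.
move=> h i j; elim: j => [//|j IH]; rewrite ltnS leq_eqVlt => /predU1P[->|/IH ij]; first exact: h.
exact: ltn_trans ij (h j).
Qed.

(* Cantor's diagonal argument: [Lim j u] says that the j-th quantity converges
   along the subsequence u. *)
Lemma diagonal_subsequence (Lim : nat -> (nat -> nat) -> Prop) :
  (forall j u, {homo u : i k / (i < k)%N} ->
     exists tau, {homo tau : i k / (i < k)%N} /\ Lim j (u \o tau)) ->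
  (forall j u v n0, (forall i, (n0 <= i)%N -> exists2 k, (i <= k)%N & v i = u k) ->
     Lim j u -> Lim j v) ->
  exists2 v, {homo v : i k / (i < k)%N} & forall j, Lim j v.
Proof.
move=> hex hsub.
pose H := {u : nat -> nat | {homo u : i k / (i < k)%N}}.
have step j (u : H) : {tau : nat -> nat | {homo tau : i k / (i < k)%N} /\ Lim j (sval u \o tau)}.
  by apply: cid; exact: hex (svalP u).
have homc (u : H) j : {homo (sval u \o sval (step j u)) : i k / (i < k)%N}.
  by move=> i k ik; apply: (svalP u); apply: (svalP (step j u)).1.
have hid : {homo (fun i : nat => i) : i k / (i < k)%N} by [].
pose W := fix W n : H := if n is m.+1 then exist (fun u : nat -> nat => {homo u : i k / (i < k)%N}) _ (homc (W m) m)
  else exist (fun u : nat -> nat => {homo u : i k / (i < k)%N}) (fun i => i) hid.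
have WL j : Lim j (sval (W j.+1)) by exact: (svalP (step j (W j))).2.
(* A later subsequence runs through terms of an earlier one at indices that are not smaller. From
   the index [j.+1] on, this is also true of the diagonal, in the form that lets it inherit
   [Lim j]. *)
have Wsub j n : (j <= n)%N -> forall i, exists2 k, (i <= k)%N & sval (W n) i = sval (W j) k.
  elim: n => [|n IH]; first by rewrite leqn0 => /eqP -> i; exists i.
  rewrite leq_eqVlt => /predU1P[-> i|]; first by exists i.
  rewrite ltnS => jn i.
  have [k ik E] := IH jn (sval (step n (W n)) i).
  exists k; last by rewrite /= E.
  exact: leq_trans (homo_ltn_ge (svalP (step n (W n))).1 i) ik.
exists (fun i => sval (W i) i).
  apply: homo_ltnS => n /=; apply: (svalP (W n)).
  exact: homo_ltn_ge (svalP (step n (W n))).1 n.+1.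
move=> j; apply: (hsub j (sval (W j.+1)) _ j.+1) (WL j) => i ji.
exact: Wsub.
Qed.
End subsequences.

Section Lp_complete.
Context d (S : measurableType d) (R : realType).
Variable mu : {measure set S -> \bar R}.

(** The indices are spread out until consecutive terms differ by less than 2^-n in norm; the
    subsequence is then geometrically Cauchy. *)
Lemma Lp_cauchy_subseq q (F : nat -> S -> R) : (1 <= q)%E ->
  (forall n, F n \in Lfun mu q) ->
  (forall e : R, 0 < e -> exists I, forall a b, (I <= a)%N -> (I <= b)%N ->
     lpn mu q (fun x => F a x - F b x) < e) ->
  exists tau, {homo tau : i k / (i < k)%N} /\
  exists2 Z, Z \in Lfun mu q & lpn mu q (fun x => F (tau n) x - Z x) @[n --> \oo] --> 0.
Proof.
move=> q1 FL Fc.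
have h0 n : 0 < 2^-1 ^+ n :> R by rewrite exprn_gt0.
have c n : {I | forall a b, (I <= a)%N -> (I <= b)%N -> lpn mu q (fun x => F a x - F b x) < 2^-1 ^+ n}.
  by apply: cid; exact: Fc.
pose tau := fix tau n := if n is m.+1 then maxn (tau m).+1 (sval (c m.+1)) else sval (c 0%N).
have tc n : (sval (c n) <= tau n)%N by case: n => [//|n] /=; rewrite leq_maxr.
have tS n : (tau n < tau n.+1)%N by rewrite /= leq_maxl.
exists tau; split; first exact: homo_ltnS.
pose G n := F (tau n).
have GL n : G n \in Lfun mu q by exact: FL.
have mG n : measurable_fun [set: S] (G n) by exact: Lfun_meas (GL n).
have GN n : ('N[mu]_q[(fun z => `|(G n.+1 z - G n z)%:E|)] <= (1 * 2^-1 ^+ n)%:E)%E.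
  have dL := Lfun_sub q1 (GL n.+1) (GL n).
  have -> : (fun z => `|(G n.+1 z - G n z)%:E|%E) = abse \o (EFin \o (fun z => G n.+1 z - G n z)) by [].
  rewrite Lnorm_abse lpnE// lee_fin mul1r ltW//.
  apply: (svalP (c n)); first exact: leq_trans (tc n) (ltnW (tS n)).
  exact: tc.
have rho : 0 <= (2^-1 : R) < 1 by rewrite invr_ge0 invf_lt1 //= ler0n ltr1n.
have NmP := banach_norm_Lnorm mu q1.
pose Z x := flim (G ^~ x).
have mZ : measurable_fun [set: S] Z by exact: measurable_flim.
have ZL : Z \in Lfun mu q.
  apply/LfunP'; split => //.
  have := riesz_fischer_lty NmP mG ler01 rho GN; rewrite -/(abse \o (EFin \o Z)) Lnorm_abse; apply.
  have -> : (fun z => `|(G 0%N z)%:E|%E) = abse \o (EFin \o G 0%N) by [].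
  by rewrite Lnorm_abse lpnE// ltry.
exists Z => //.
apply: (@squeeze0 _ _ (fun n => 2 * 2^-1 ^+ n)).
  move=> n; rewrite lpn_ge0 /=.
  have := riesz_fischer_le NmP mG ler01 rho GN n.
  have dL := Lfun_sub q1 ZL (GL n).
  have -> : (fun z => `|(flim (G^~ z) - G n z)%:E|%E) = abse \o (EFin \o (fun z => Z z - G n z)) by [].
  rewrite Lnorm_abse lpnE// lee_fin => le.
  have -> : lpn mu q (fun x => F (tau n) x - Z x) = lpn mu q (fun x => Z x - G n x).
    have -> : (fun x => F (tau n) x - Z x) = (fun x => -1 * (Z x - G n x)) by apply/funext => x; rewrite /G; ring.
    by rewrite lpnZ// normrN1 mul1r.
  apply: (le_trans le); rewrite le_eqVlt; apply/orP; left; apply/eqP; by field.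
rewrite -[X in _ --> X](mulr0 2); apply: cvgMr; apply: cvg_expr.
by rewrite ger0_norm ?invr_ge0// invf_lt1// ltr1n.
Qed.
End Lp_complete.

(** * The operator assembled from its modes, and its ground state *)

Section operator.
Context d1 (T : measurableType d1) d2 (X : measurableType d2) (R : realType).
Variable m1 : {finite_measure set T -> \bar R}.
Variable m2 : {sigma_finite_measure set X -> \bar R}.
Variables (e : nat -> T -> R) (ka : R).
Hypothesis me : forall j, measurable_fun [set: T] (e j).
Hypothesis e1 : forall j t, `|e j t| <= 1.
Hypothesis ka0 : 0 < ka.
Hypothesis eo : forall i j, \int[m1]_t (e i t * e j t) = if i == j then ka else 0.
Variables (p r : R) (q : \bar R).
Hypotheses (p2 : 2 < p) (pr : p^-1 + r^-1 = 1) (pq : (p%:E <= q)%E).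
Let m := (m1 \x m2)%E.

Let p0 : 0 < p. Proof. by move: p2; lra. Qed.
Let p1 : 1 < p. Proof. by move: p2; lra. Qed.
Let p1e : (1 <= p%:E)%E. Proof. by rewrite lee_fin ltW. Qed.
Let q1 : (1 <= q)%E. Proof. exact: le_trans p1e pq. Qed.
Let q2 : (2%:E <= q)%E. Proof. by apply: le_trans pq; rewrite lee_fin ltW. Qed.
Let ri : r^-1 = 1 - p^-1. Proof. by rewrite -pr; ring. Qed.
Let r1 : 1 < r.
Proof.
have i1 : p^-1 < 1 by rewrite invf_lt1//; move: p2; lra.
have i0 : 0 < p^-1 by rewrite invr_gt0.
have r0 : 0 < r by rewrite -invr_gt0 ri subr_gt0.
by rewrite -invf_lt1// ri; lra.
Qed.
Let r1e : (1 <= r%:E)%E. Proof. by rewrite lee_fin ltW. Qed.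
Let r0 : 0 < r. Proof. by move: r1; lra. Qed.
Let rpE : r * (p - 1) = p.
Proof. by rewrite -[r]invrK ri; field; rewrite !gt_eqF//=; move: p2; lra. Qed.
Let prE : p * (r - 1) = r. Proof. by move: rpE; lra. Qed.
Let conjr : @hoelder_conjugate R r%:E = p%:E.
Proof.
by apply/esym/hoelder_conjugateP; [rewrite ltNyr|rewrite eqe gt_eqF|];
  rewrite ?inver ?gt_eqF// -EFinD addrC pr.
Qed.
Let conjp : @hoelder_conjugate R p%:E = r%:E.
Proof. by rewrite -conjr hoelder_conjugateK. Qed.

Lemma ae_snd (P : X -> Prop) : {ae m2, forall x, P x} -> {ae m, forall z : T * X, P z.2}.
Proof.
move=> [B [mB B0 Bs]]; exists ([set: T] `*` B); split.
- exact: measurableX.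
- rewrite [LHS](product_measure1E m1 m2 measurableT mB).
  by rewrite [X in (_ * X)%E](_ : _ = 0%E) ?mule0.
- by move=> z /= nP; split => //; exact: Bs.
Qed.

Lemma snd_Lfun (s : R) (w : X -> R) : 1 <= s -> w \in Lfun m2 s%:E ->
  (fun z : T * X => w z.2) \in Lfun m s%:E.
Proof.
move=> s1 wL; have s0 : 0 < s by lra.
have mw : measurable_fun [set: T * X] (fun z : T * X => w z.2).
  by apply: (measurableT_comp (Lfun_meas wL)); exact: measurable_snd.
apply/(Lfun_powRP _ s0) => //.
rewrite (@fubini_tonelli2 _ _ _ _ _ m1 m2 (fun z : T * X => (`|w z.2| `^ s)%:E)); last 2 first.
- apply/measurable_EFinP; apply: (@measurableT_comp _ _ _ _ _ _ (@powR R ^~ s)) => //.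
  exact: measurableT_comp.
- by move=> z; rewrite lee_fin powR_ge0.
rewrite /fubini_G /=.
under eq_integral do rewrite integral_cst//.
rewrite ge0_integralZr//.
- rewrite lpn_powR// lte_mul_pinfty ?ltry//; first by rewrite lee_fin powR_ge0.
  by apply: fin_num_fun_lty => //; exact: fin_num_measure.
- apply/measurable_EFinP; apply: (@measurableT_comp _ _ _ _ _ _ (@powR R ^~ s)) => //.
  by apply: measurableT_comp => //; exact: Lfun_meas wL.
Qed.

Variables (Qt : X -> R) (cQ : R).
Hypothesis mQt : measurable_fun [set: X] Qt.
Hypothesis cQ0 : 0 <= cQ.
Hypothesis QtP : forall u, u \in Lfun m2 q -> (fun x => Qt x * u x) \in Lfun m2 p%:E /\
  lpn m2 p%:E (fun x => Qt x * u x) <= cQ * lpn m2 q u.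

(** The weight does not depend on time and leaves the inner norm; what remains is [QtP] for the
    function x |-> |W(., x)|. *)
Lemma weight_mixed (W : T * X -> R) : measurable_fun [set: T * X] W ->
  (mixN m1 m2 p q (EFin \o W) < +oo)%E ->
  (fun z => Qt z.2 * W z) \in Lfun m p%:E /\
  ((lpn m p%:E (fun z => Qt z.2 * W z)%R)%:E <= cQ%:E * mixN m1 m2 p q (EFin \o W))%E.
Proof.
move=> mW NW; have mW' : measurable_fun [set: T * X] (EFin \o W) by exact/measurable_EFinP.
have ae := Lnorm_lty_ae q1 (measurable_inner m1 p mW') NW.
pose w x := fine ('N[m1]_p%:E[(fun t => (EFin \o W) (t, x))])%E.
have mw : measurable_fun [set: X] w by apply: measurableT_comp => //; exact: measurable_inner.
have wE : (mixN m1 m2 p q (EFin \o W) = 'N[m2]_q[EFin \o w])%E.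
  apply: eq_Lnorm_ae => //; first exact: measurable_inner.
    exact/measurable_EFinP.
  by apply: filterS ae => x xf /=; rewrite fineK.
have wL : w \in Lfun m2 q by apply/LfunP'; rewrite -wE.
have [QL Qle] := QtP wL.
have mQW : measurable_fun [set: T * X] (fun z => Qt z.2 * W z).
  by apply: measurable_funM => //; apply: (measurableT_comp mQt); exact: measurable_snd.
have le : (mixN m1 m2 p p%:E (EFin \o (fun z => Qt z.2 * W z)%R) <= 'N[m2]_p%:E[EFin \o (fun x => Qt x * w x)%R])%E.
  apply: Lnorm_le_ae => //.
  - by apply: measurable_inner; exact/measurable_EFinP.
  - exact: Lfun_emeas QL.
  apply: filterS ae => x xf; rewrite gee0_abs ?Lnorm_ge0//.
  have WxL : (fun t => W (t, x)) \in Lfun m1 p%:E.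
    apply/LfunP'; split; first by apply: measurableT_comp => //; exact: measurable_pair2.
    by move: xf; rewrite fin_numElt => /andP[].
  have ZL := Lfun_scal (Qt x) p1e WxL.
  have -> : 'N[m1]_p%:E[(fun t => (EFin \o (fun z => Qt z.2 * W z)%R) (t, x))]%E = (lpn m1 p%:E (fun t => Qt x * W (t, x)))%:E.
    by rewrite -(lpnE ZL).
  by rewrite lpnZ//= lee_fin normrM (ger0_norm (_ : 0 <= w x))// fine_ge0 ?Lnorm_ge0.
have L : (fun z => Qt z.2 * W z) \in Lfun m p%:E.
  apply/(mixN_lty_Lfun _ _ (ltW p1)) => //; apply: (le_lt_trans le).
  by rewrite lpnE// ltry.
split => //; rewrite -lpnE// -mixN_diag//; last exact/measurable_EFinP.
apply: (le_trans le); rewrite lpnE// wE (lpnE wL) -EFinM lee_fin.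
exact: Qle.
Qed.

(** [G j] stands for v |-> R_(k_j)[Q^(1/p) v] and [kappa j] for a bound of its norm. In [kapP] the
    decay of this bound beats the double cost of a block of 2^n modes. *)
Variables (G : nat -> (X -> R) -> X -> R) (kappa : nat -> R) (Lam rho : R).
Hypothesis GL : forall j v, v \in Lfun m2 r%:E -> G j v \in Lfun m2 q.
Hypothesis Glin : forall j (a : R) v w, v \in Lfun m2 r%:E -> w \in Lfun m2 r%:E ->
  {ae m2, forall x, G j (fun x => a * v x + w x) x = a * G j v x + G j w x}.
Hypothesis Gbd : forall j v, v \in Lfun m2 r%:E -> lpn m2 q (G j v) <= kappa j * lpn m2 r%:E v.
Hypothesis Lam0 : 0 <= Lam.
Hypothesis rho01 : 0 <= rho < 1.
Hypothesis kapP : forall n j, (2 ^ n - 1 <= j < 2 ^ n.+1 - 1)%N ->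
  kappa j * (ka^-1 * block_const ka p (2 ^ n) ^+ 2) <= Lam * rho ^+ n.
Hypothesis Gsym : forall j v w, v \in Lfun m2 r%:E -> w \in Lfun m2 r%:E ->
  \int[m2]_x (Qt x * G j v x * w x) = \int[m2]_x (v x * (Qt x * G j w x)).
Hypothesis Gcpt : forall j (v : nat -> X -> R) (M : R), (forall n, v n \in Lfun m2 r%:E) ->
  (forall n, lpn m2 r%:E (v n) <= M) ->
  exists sigma, {homo sigma : i k / (i < k)%N} /\ exists2 g, g \in Lfun m2 p%:E &
  lpn m2 p%:E (fun x => Qt x * G j (v (sigma n)) x - g x) @[n --> \oo] --> 0.

Local Notation cof := (coef m1 e ka).
Local Notation Lr := (Lfun m r%:E).
Local Notation Lp := (Lfun m p%:E).

Let cL j V : V \in Lr -> cof j V \in Lfun m2 r%:E.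
Proof. exact: (coef_Lfun me e1 ka0 p2 pr). Qed.

(** The maps act on representatives; by linearity and boundedness a difference that vanishes almost
    everywhere is sent to one that does. *)
Lemma G_ae j v w : v \in Lfun m2 r%:E -> w \in Lfun m2 r%:E ->
  {ae m2, forall x, v x = w x} -> {ae m2, forall x, G j v x = G j w x}.
Proof.
move=> vL wL vw; have dL := Lfun_add r1e (Lfun_scal (-1) r1e vL) wL.
have n0 : lpn m2 r%:E (fun x => -1 * v x + w x) = 0.
  have -> : 0 = lpn m2 r%:E (fun x => 0 * v x) by rewrite lpnZ// normr0 mul0r.
  apply: lpn_ae => //; [exact: Lfun_meas dL|exact: Lfun_scal|].
  by apply: filterS vw => x ->; ring.
have G0 : lpn m2 q (G j (fun x => -1 * v x + w x)) = 0.
  by apply/eqP; rewrite eq_le lpn_ge0 andbT (le_trans (Gbd j dL))// n0 mulr0.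
apply: filterS2 (lpn_eq0 q1 (GL j dL) G0) (Glin j (-1) vL wL) => x -> /eqP.
by rewrite mulN1r eq_sym addrC subr_eq0 => /eqP.
Qed.

(** Cutting at 2^n - 1 gives the n-th block exactly 2^n modes although counting starts at 0: the
    block 0 is the single mode 0, and the partial sum 0 is empty. *)
Definition partial_mode n V : T * X -> R := mode_sum e (fun j => G j (cof j V)) 0 (2 ^ n - 1).
Definition mode_op V z : R := flim (fun n => partial_mode n V z).
Definition weighted_op V z : R := Qt z.2 * mode_op V z.

Let measP n V : V \in Lr -> measurable_fun [set: T * X] (partial_mode n V).
Proof.
by move=> VL; apply: (measurable_mode_sum me) => j _; exact: Lfun_meas (GL j (cL j VL)).
Qed.

Lemma mixN_abse (W : T * X -> R) : mixN m1 m2 p q (fun z => `|(W z)%:E|)%E = mixN m1 m2 p q (EFin \o W).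
Proof.
rewrite /mixN; congr (Lnorm _ _ _); apply/funext => x.
exact: (Lnorm_abse m1 (fun t => (W (t, x))%:E)).
Qed.

(** [block_mixed] costs one factor of [block_const] and [coef_block] another one; [kapP], solved for
    [kappa j], turns their product into Lam rho^n. *)
Let block_le V n : V \in Lr ->
  (mixN m1 m2 p q (fun z => `|(partial_mode n.+1 V z - partial_mode n V z)%:E|) <=
   (Lam * lpn m r%:E V * rho ^+ n)%:E)%E.
Proof.
move=> VL; rewrite mixN_abse.
have e1n : (2 ^ n - 1 <= 2 ^ n.+1 - 1)%N by rewrite leq_sub2r// leq_exp2l.
have -> : (fun z => partial_mode n.+1 V z - partial_mode n V z) =
    mode_sum e (fun j => G j (cof j V)) (2 ^ n - 1) (2 ^ n.+1 - 1).
  apply/funext => z; rewrite /partial_mode /mode_sum (big_cat_nat (n := 2 ^ n - 1))//=.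
  by rewrite addrAC subrr add0r.
have := block_mixed me e1 ka0 eo p2 q2 (fun j _ => GL j (cL j VL)) (lo := 2 ^ n - 1) (hi := 2 ^ n.+1 - 1).
move=> /le_trans; apply; rewrite lee_fin.
have -> : (2 ^ n.+1 - 1 - (2 ^ n - 1) = 2 ^ n)%N.
  by rewrite subnBA ?expn_gt0// subnK ?expn_gt0// expnS mul2n -addnn addnK.
set bc := block_const ka p (2 ^ n).
have bc0 : 0 < bc.
  by rewrite mulr_gt0// powR_gt0// ltr0n expn_gt0.
have bk0 : 0 < ka^-1 * bc ^+ 2 by rewrite mulr_gt0// ?invr_gt0// exprn_gt0.
pose K := Lam * rho ^+ n / (ka^-1 * bc ^+ 2).
have K0 : 0 <= K by rewrite divr_ge0// ?(ltW bk0)// mulr_ge0// exprn_ge0//; case/andP: rho01.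
have le1 : Num.sqrt (\sum_(2 ^ n - 1 <= j < 2 ^ n.+1 - 1) lpn m2 q (G j (cof j V)) ^+ 2) <=
    K * (ka^-1 * bc * lpn m r%:E V).
  have := coef_block me e1 ka0 eo p2 pr (2 ^ n - 1) (2 ^ n.+1 - 1) VL.
  have -> : (2 ^ n.+1 - 1 - (2 ^ n - 1) = 2 ^ n)%N.
    by rewrite subnBA ?expn_gt0// subnK ?expn_gt0// expnS mul2n -addnn addnK.
  rewrite -/bc => cb; apply: le_trans (ler_wpM2l K0 cb).
  rewrite -{1}(ger0_norm K0) -sqrtr_sqr -sqrtrM ?sqr_ge0// ler_wsqrtr//.
  rewrite mulr_sumr; apply: ler_sum_nat => j jn.
  rewrite -exprMn; apply: lerXn2r; rewrite ?nnegrE ?lpn_ge0 ?(mulr_ge0 K0 (lpn_ge0 _ _ _))//.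
  apply: (le_trans (Gbd j (cL j VL))); rewrite ler_wpM2r ?lpn_ge0//.
  by rewrite ler_pdivlMr//; exact: kapP.
apply: (le_trans (ler_wpM2l (ltW bc0) le1)).
rewrite le_eqVlt; apply/orP; left; apply/eqP; rewrite /K; field.
by rewrite !gt_eqF.
Qed.

Let NmP : banach_norm m (mixN m1 m2 p q).
Proof. by apply: banach_norm_mixN => //; exact: ltW. Qed.

Let LN0 V : 0 <= Lam * lpn m r%:E V. Proof. by rewrite mulr_ge0// lpn_ge0. Qed.

Lemma measurable_mode_op V : V \in Lr -> measurable_fun [set: T * X] (mode_op V).
Proof. by move=> VL; apply: measurable_flim => n; exact: measP. Qed.

Lemma partial_mode_cvg V : V \in Lr ->
  {ae m, forall z, partial_mode n V z @[n --> \oo] --> mode_op V z}.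
Proof.
move=> VL; exact: (riesz_fischer_cvg NmP (fun n => measP n VL) (LN0 V) rho01 (fun n => block_le n VL)).
Qed.

Lemma partial_mode_le V n : V \in Lr ->
  (mixN m1 m2 p q (EFin \o (fun z => mode_op V z - partial_mode n V z)%R) <=
   (Lam * lpn m r%:E V * rho ^+ n / (1 - rho))%:E)%E.
Proof.
move=> VL; rewrite -mixN_abse.
exact: (riesz_fischer_le NmP (fun n => measP n VL) (LN0 V) rho01 (fun n => block_le n VL) n).
Qed.

Let partial0 V : partial_mode 0 V = fun=> 0.
Proof. by apply/funext => z; rewrite /partial_mode /mode_sum big_geq. Qed.

Lemma mode_op_le V : V \in Lr ->
  (mixN m1 m2 p q (EFin \o mode_op V) <= (Lam * lpn m r%:E V / (1 - rho))%:E)%E.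
Proof.
move=> VL; have := partial_mode_le 0 VL; rewrite partial0 expr0 mulr1.
by under [X in (EFin \o X)%FUN]eq_fun do rewrite subr0.
Qed.

Let D := cQ * Lam / (1 - rho).

Let omr : 0 < 1 - rho. Proof. by rewrite subr_gt0; case/andP: rho01. Qed.
Let D0 : 0 <= D. Proof. by rewrite divr_ge0 ?(ltW omr)// mulr_ge0. Qed.

Lemma weighted_op_mixed V : V \in Lr -> weighted_op V \in Lp /\
  ((lpn m p%:E (weighted_op V))%:E <= cQ%:E * mixN m1 m2 p q (EFin \o mode_op V))%E.
Proof.
move=> VL; exact: (weight_mixed (measurable_mode_op VL) (le_lt_trans (mode_op_le VL) (ltry _))).
Qed.

Lemma weighted_op_le V : V \in Lr -> lpn m p%:E (weighted_op V) <= D * lpn m r%:E V.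
Proof.
move=> VL; have [_ le] := weighted_op_mixed VL.
rewrite -lee_fin; apply: (le_trans le).
apply: (@le_trans _ _ (cQ%:E * (Lam * lpn m r%:E V / (1 - rho))%:E)%E).
  by apply: lee_wpmul2l; [rewrite lee_fin|exact: mode_op_le].
by rewrite -EFinM lee_fin le_eqVlt; apply/orP; left; apply/eqP; rewrite /D; ring.
Qed.

Let wmode n V := mode_sum e (fun j x => Qt x * G j (cof j V) x) 0 (2 ^ n - 1).

Let wmodeE n V z : wmode n V z = Qt z.2 * partial_mode n V z.
Proof.
rewrite /wmode /partial_mode /mode_sum mulr_sumr; apply: eq_bigr => j _; ring.
Qed.

Let QGL V j : V \in Lr -> (fun x => Qt x * G j (cof j V) x) \in Lfun m2 p%:E.
Proof. by move=> VL; have [] := QtP (GL j (cL j VL)). Qed.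

Let wmodeL n V : V \in Lr -> wmode n V \in Lp.
Proof.
by move=> VL; have [] := mode_sum_Lfun me e1 ka0 eo p2 (fun j (_ : (0 <= j < 2 ^ n - 1)%N) => QGL j VL).
Qed.

Let tail n V : V \in Lr ->
  lpn m p%:E (fun z => weighted_op V z - wmode n V z) <= D * lpn m r%:E V * rho ^+ n.
Proof.
move=> VL; have le := partial_mode_le n VL.
have mW : measurable_fun [set: T * X] (fun z => mode_op V z - partial_mode n V z).
  by apply: measurable_funB; [exact: measurable_mode_op|exact: measP].
have [_] := weight_mixed mW (le_lt_trans le (ltry _)).
have -> : (fun z => Qt z.2 * (mode_op V z - partial_mode n V z)) =
    (fun z => weighted_op V z - wmode n V z).
  by apply/funext => z; rewrite wmodeE mulrBr.
rewrite -[_ <= _ :> R]lee_fin => /le_trans; apply.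
apply: (@le_trans _ _ (cQ%:E * (Lam * lpn m r%:E V * rho ^+ n / (1 - rho))%:E)%E).
  by apply: lee_wpmul2l; [rewrite lee_fin|exact: le].
by rewrite -EFinM lee_fin le_eqVlt; apply/orP; left; apply/eqP; rewrite /D; ring.
Qed.

Let rho_cvg (K : R) : K * rho ^+ n @[n --> \oo] --> 0.
Proof.
rewrite -[X in _ --> X](mulr0 K); apply: cvgMr; apply: cvg_expr.
by case/andP: rho01 => h0 h1; rewrite ger0_norm.
Qed.

(** Linearity of all coefficients holds off one null set of x, and off a further null set both
    series converge; there the limit of the combined partial sums is the combination of the
    limits. *)
Lemma mode_op_linear (a : R) V W : V \in Lr -> W \in Lr ->
  {ae m, forall z, mode_op (fun z => a * V z + W z) z = a * mode_op V z + mode_op W z}.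
Proof.
move=> VL WL; have aVL := Lfun_scal a r1e VL; have UL := Lfun_add r1e aVL WL.
have ae : {ae m2, forall x, forall j, G j (cof j (fun z => a * V z + W z)) x = a * G j (cof j V) x + G j (cof j W) x}.
  apply: ae_foralln => j.
  have cvL := Lfun_add r1e (Lfun_scal a r1e (cL j VL)) (cL j WL).
  have h1 := G_ae j (cL j UL) cvL (coef_lin ka me e1 p2 pr j a VL WL).
  by apply: filterS2 h1 (Glin j a (cL j VL) (cL j WL)) => x -> ->.
apply: filterS2 (ae_snd ae) (filterI (partial_mode_cvg VL) (partial_mode_cvg WL)) => z zE [zV zW].
apply: cvg_flim.
have -> : (fun n => partial_mode n (fun z => a * V z + W z) z) =
    (fun n => a * partial_mode n V z + partial_mode n W z).
  apply/funext => n; rewrite /partial_mode /mode_sum mulr_sumr -big_split /=.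
  by apply: eq_bigr => j _; rewrite zE; ring.
have hV : a * partial_mode n V z @[n --> \oo] --> a * mode_op V z by apply: cvgMr; exact: zV.
exact: (cvgD hV zW).
Qed.

Let weighted_op_linear (a : R) V W : V \in Lr -> W \in Lr ->
  {ae m, forall z, weighted_op (fun z => a * V z + W z) z = a * weighted_op V z + weighted_op W z}.
Proof.
move=> VL WL; apply: filterS (mode_op_linear a VL WL) => z zE.
have -> : weighted_op (fun z => a * V z + W z) z = Qt z.2 * (a * mode_op V z + mode_op W z) by congr (_ * _).
by rewrite mulrDr mulrCA.
Qed.

Let pairing n V W := ka * (\sum_(0 <= j < 2 ^ n - 1) \int[m2]_x (cof j W x * (Qt x * G j (cof j V) x))).

Let pairing_cvg V W : V \in Lr -> W \in Lr ->
  pairing n V W @[n --> \oo] -->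
  \int[m]_z (weighted_op V z * W z).
Proof.
move=> VL WL.
have AL := (weighted_op_mixed VL).1.
have WL' : W \in Lfun m (hoelder_conjugate p%:E) by rewrite conjp.
have E n : pairing n V W =
    \int[m]_z (wmode n V z * W z).
  rewrite /pairing mulr_sumr.
  have iF j : m.-integrable [set: T * X] (EFin \o (fun z => (Qt z.2 * G j (cof j V) z.2) * e j z.1 * W z)).
    by have [] := hoelder_Lfun p1e (mode1_Lfun me e1 ka0 eo p2 j (QGL j VL)) WL'.
  under [in RHS]eq_Rintegral do rewrite /wmode /mode_sum mulr_suml.
  have [_ ->] := @Rintegral_sum_nat _ _ _ m (fun j z => (Qt z.2 * G j (cof j V) z.2) * e j z.1 * W z) 0%N (2 ^ n - 1) (fun j _ => iF j).
  by apply: eq_bigr => j _; rewrite -(coef_pairing me e1 ka0 eo p2 pr j WL (QGL j VL)).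
apply/subr_cvg0; under eq_fun do rewrite E; apply: norm_cvg0; under eq_fun do rewrite distrC.
apply: (@squeeze0 _ _ (fun n => D * lpn m r%:E V * rho ^+ n * lpn m r%:E W)); last first.
  rewrite -[X in _ --> X](mul0r (lpn m r%:E W)); apply: cvgMl; exact: rho_cvg.
move=> n; rewrite normr_ge0 /=.
have [i1 _] := hoelder_Lfun p1e AL WL'.
have [i2 _] := hoelder_Lfun p1e (wmodeL n VL) WL'.
rewrite -RintegralB//.
have -> : \int[m]_z ((weighted_op V \* W) z - (wmode n V \* W) z) =
    \int[m]_z ((weighted_op V z - wmode n V z) * W z).
  by apply: eq_Rintegral => z _ /=; ring.
have dL := Lfun_sub p1e AL (wmodeL n VL).
apply: (le_trans (hoelder_Rint p1e dL WL')); rewrite conjp ler_wpM2r ?lpn_ge0//.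
exact: tail.
Qed.

(** The truncated forms are symmetric mode by mode through [Gsym], and both orders converge to the
    full form. *)
Let weighted_op_sym V W : V \in Lr -> W \in Lr ->
  \int[m]_z (weighted_op V z * W z) = \int[m]_z (V z * weighted_op W z).
Proof.
move=> VL WL; have h1 := pairing_cvg VL WL; have h2 := pairing_cvg WL VL.
under [RHS]eq_Rintegral do rewrite mulrC.
have E n : pairing n V W = pairing n W V.
  rewrite /pairing; apply: (congr1 ( *%R ka)); apply: eq_bigr => j _.
  by rewrite -Gsym ?cL//; apply: eq_Rintegral => x _; rewrite mulrC.
have {}h2 : pairing n V W @[n --> \oo] --> \int[m]_z (weighted_op W z * V z).
  by under eq_fun do rewrite E.
exact: (cvg_unique (@Rhausdorff R) h1 h2).
Qed.

(** A diagonal subsequence makes every single mode converge; the tails are small uniformly on the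
    unit ball, so the images form a Cauchy sequence. *)
Let weighted_op_cpt (v : nat -> T * X -> R) : (forall n, v n \in Lr) ->
  (forall n, lpn m r%:E (v n) <= 1) ->
  exists sigma : nat -> nat, {homo sigma : i j / (i < j)%N >-> (i < j)%N} /\
  exists2 g, g \in Lp & lpn m p%:E (fun x => weighted_op (v (sigma n)) x - g x) @[n --> \oo] --> 0.
Proof.
move=> vL v1.
pose w j i x := Qt x * G j (cof j (v i)) x.
have wL j i : w j i \in Lfun m2 p%:E by exact: QGL.
pose Lim j (u : nat -> nat) := exists2 g, g \in Lfun m2 p%:E &
  lpn m2 p%:E (fun x => w j (u n) x - g x) @[n --> \oo] --> 0.
have [u hu uL] : exists2 u, {homo u : i k / (i < k)%N} & forall j, Lim j u.
  apply: diagonal_subsequence.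
    move=> j u hu.
    have cb n : lpn m2 r%:E (cof j (v (u n))) <= ka^-1 * block_const ka p 1.
      have := coef_block me e1 ka0 eo p2 pr j j.+1 (vL (u n)).
      rewrite big_nat1 sqrtr_sqr ger0_norm ?lpn_ge0// subSnn => /le_trans; apply.
      rewrite -[leRHS]mulr1 ler_wpM2l// mulr_ge0 ?block_const_ge0// invr_ge0 ltW//.
    have [tau [htau [g gL gc]]] := @Gcpt j (fun n => cof j (v (u n))) _ (fun n => cL j (vL (u n))) cb.
    by exists tau; split => //; exists g.
  move=> j u u' n0 h [g gL gc]; exists g => //.
  apply/cvgrPdist_lt => eps eps0; move/cvgrPdist_lt: gc => /(_ _ eps0) [I _ hI].
  exists (maxn n0 I) => // i /=; rewrite geq_max => /andP[n0i Ii].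
  have [k ik ->] := h i n0i; apply: hI; exact: leq_trans Ii ik.
have FL i : weighted_op (v (u i)) \in Lp by exact: (weighted_op_mixed (vL _)).1.
have [tau [htau [Z ZL Zc]]] : exists tau, {homo tau : i k / (i < k)%N} /\
    exists2 Z, Z \in Lp & lpn m p%:E (fun x => weighted_op (v (u (tau n))) x - Z x) @[n --> \oo] --> 0.
  apply: (Lp_cauchy_subseq p1e FL) => eps eps0.
  have e4 : 0 < eps / 4 by rewrite divr_gt0.
  (* Four quarters of eps: the tails of the two terms compared, and the distances of their
     truncations from the common limit [Zn]. *)
  have [n tn] : exists n, D * rho ^+ n < eps / 4.
    move/cvgrPdist_lt: (rho_cvg D) => /(_ _ e4) [n _ hn].
    by exists n; have := hn n (leqnn n); rewrite sub0r normrN; apply: le_lt_trans; exact: ler_norm.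
  have tl i : lpn m p%:E (fun z => weighted_op (v i) z - wmode n (v i) z) <= eps / 4.
    apply: (le_trans (tail n (vL i))); apply: le_trans (ltW tn).
    rewrite mulrAC -[leRHS]mulr1 ler_wpM2l// mulr_ge0// exprn_ge0//; by case/andP: rho01.
  have gj j := cid2 (uL j).
  pose g j := sval (gj j).
  have gL j : g j \in Lfun m2 p%:E by exact: (s2valP (gj j)).
  have gc j : lpn m2 p%:E (fun x => w j (u i) x - g j x) @[i --> \oo] --> 0 by exact: (s2valP' (gj j)).
  pose Zn := mode_sum e g 0 (2 ^ n - 1) : T * X -> R.
  have [ZnL _] := mode_sum_Lfun me e1 ka0 eo p2 (fun j (_ : (0 <= j < 2 ^ n - 1)%N) => gL j).
  have dL j i : (fun x => w j i x - g j x) \in Lfun m2 p%:E by exact: Lfun_sub.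
  have c1 : lpn m p%:E (fun z => wmode n (v (u i)) z - Zn z) @[i --> \oo] --> 0.
    apply: (@squeeze0 _ _ (fun i => block_const ka p (2 ^ n - 1 - 0) *
      (\sum_(0 <= j < 2 ^ n - 1) lpn m2 p%:E (fun x => w j (u i) x - g j x)))).
      move=> i; rewrite lpn_ge0 /=.
      have [_ le] := mode_sum_Lfun me e1 ka0 eo p2 (fun j (_ : (0 <= j < 2 ^ n - 1)%N) => dL j (u i)).
      have -> : (fun z => wmode n (v (u i)) z - Zn z) = mode_sum e (fun j x => w j (u i) x - g j x) 0 (2 ^ n - 1).
        apply/funext => z; rewrite /wmode /Zn /mode_sum -sumrB.
        by apply: eq_bigr => j _; rewrite -mulrBl.
      apply: (le_trans le); rewrite ler_wpM2l ?block_const_ge0//.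
      set Sm := \sum_(_ <= _ < _) lpn _ _ _.
      have Sm0 : 0 <= Sm by apply: sumr_ge0 => j _; exact: lpn_ge0.
      rewrite -[leRHS](ger0_norm Sm0) -sqrtr_sqr ler_wsqrtr//.
      by apply: sum_sqr_le => j; exact: lpn_ge0.
    rewrite -[X in _ --> X](mulr0 (block_const ka p (2 ^ n - 1 - 0))); apply: cvgMr.
    elim: (2 ^ n - 1)%N => [|k IH].
      by under eq_fun do rewrite big_geq//; exact: cvg_cst.
    under eq_fun do rewrite big_nat_recr//=.
    have h := cvgD IH (gc k); rewrite addr0 in h; exact: h.
  move/cvgrPdist_lt: c1 => /(_ _ e4) [I _ hI].
  exists I => a b aI bI.
  have tele (x y z s t : R) : x - y = ((x - s) + (s - z)) - ((y - t) + (t - z)) by ring.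
  have ha := hI _ aI; have hb := hI _ bI.
  rewrite sub0r normrN ger0_norm ?lpn_ge0// in ha.
  rewrite sub0r normrN ger0_norm ?lpn_ge0// in hb.
  have L1 i := Lfun_sub p1e (FL i) (wmodeL n (vL (u i))).
  have L2 i := Lfun_sub p1e (wmodeL n (vL (u i))) ZnL.
  have L3 i := Lfun_add p1e (L1 i) (L2 i).
  have -> : (fun x => weighted_op (v (u a)) x - weighted_op (v (u b)) x) =
     (fun z => ((weighted_op (v (u a)) z - wmode n (v (u a)) z) + (wmode n (v (u a)) z - Zn z)) -
       ((weighted_op (v (u b)) z - wmode n (v (u b)) z) + (wmode n (v (u b)) z - Zn z))).
    apply/funext => z; exact: tele.
  have k1 := lpnB p1e (L3 a) (L3 b).
  have k2 := lpnD p1e (L1 a) (L2 a); have k3 := lpnD p1e (L1 b) (L2 b).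
  have k4 := tl (u a); have k5 := tl (u b).
  apply: (le_lt_trans k1).
  move: ha hb k2 k3 k4 k5.
  set y1 := lpn _ _ _; set y2 := lpn _ _ _; set y3 := lpn _ _ _; set y4 := lpn _ _ _; set y5 := lpn _ _ _; set y6 := lpn _ _ _.
  lra.
exists (u \o tau); split; first by move=> i k ik; apply: hu; exact: htau.
by exists Z.
Qed.

Variable om : X -> R.
Hypothesis omL : om \in Lfun m2 r%:E.
Hypothesis ompos : 0 < \int[m2]_x (om x * (Qt x * G 0 om x)).

Let W0 (z : T * X) := om z.2 * e 0 z.1.

Let W0L : W0 \in Lr.
Proof.
have L := snd_Lfun (ltW r1) omL.
apply: (Lfun_le r1e _ L).
  apply: measurable_funM; first exact: Lfun_meas L.
  by apply: measurableT_comp => //; exact: measurable_fst.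
by apply: aeW => z; rewrite /W0 normrM -[leRHS]mulr1 ler_wpM2l.
Qed.

Let coefW0 j : cof j W0 = if j == 0%N then om else fun=> 0.
Proof.
apply/funext => x; rewrite /coef /W0 /=.
have i2 : m1.-integrable [set: T] (EFin \o (fun t => e 0 t * e j t)).
  apply: (@bounded_integrable _ _ _ _ _ 1); first exact: measurable_funM.
  by move=> t; rewrite normrM -[leRHS]mulr1 ler_pM.
have -> : \int[m1]_t (om x * e 0 t * e j t) = om x * \int[m1]_t (e 0 t * e j t).
  by rewrite -RintegralZl//; apply: eq_Rintegral => t _; ring.
rewrite eo eq_sym; case: eqP => _; last by rewrite !mulr0.
by rewrite mulrCA mulVf ?mulr1// gt_eqF.
Qed.

(** [W0] is the tensor product of [om] with the profile 0, so the form sees the mode 0 alone and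
    reduces to [ompos]. *)
Let W0pos : 0 < \int[m]_z (weighted_op W0 z * W0 z).
Proof.
have h := pairing_cvg W0L W0L.
have -> : \int[m]_z (weighted_op W0 z * W0 z) = ka * \int[m2]_x (om x * (Qt x * G 0 om x)).
  apply/esym/(cvg_unique _ _ h) => //; apply: cvg_near_cst.
  (* From n = 1 on the truncation contains the mode 0, and the sequence is constant. *)
  exists 1%N => // n /= n1.
  rewrite /pairing; have : (0 < 2 ^ n - 1)%N by rewrite subn_gt0 -{1}(expn0 2) ltn_exp2l.
  case: (2 ^ n - 1)%N => [//|k] _; rewrite big_nat_recl// big1 ?addr0 => [|j _].
    by rewrite coefW0.
  rewrite coefW0 /=; under eq_Rintegral do rewrite mul0r.
  by rewrite /Rintegral integral0.
by rewrite mulr_gt0.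
Qed.

(** Taking norms in A V = spow r V gives |A V| = |V|^(r-1). Bounding |A V| by D |V| and dividing by
    |V|^(r-1) gives the third clause; bounding it through the weight by the norm of [mode_op V]
    gives the last. *)
Lemma weighted_ground_state : exists V : T * X -> R,
  [/\ V \in Lr, {ae m, forall z, weighted_op V z = spow r (V z)},
    1 <= D * lpn m r%:E V `^ (2 - r) &
    ((lpn m r%:E V `^ (r - 1))%:E <= cQ%:E * mixN m1 m2 p q (EFin \o mode_op V))%E].
Proof.
have [V [VL V0 VE]] := @dual_ground_state _ _ _ m r p D weighted_op r1 p2 pr
  (fun V VL => (weighted_op_mixed VL).1)
  weighted_op_linear D0 weighted_op_le weighted_op_sym weighted_op_cpt W0 W0L W0pos.
exists V.
have [AL le] := weighted_op_mixed VL.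
have N0 : 0 < lpn m r%:E V.
  rewrite lt_neqAle lpn_ge0 andbT; apply/eqP => n0; apply: V0.
  by apply: (lpn_eq0 r1e VL).
have NE : lpn m p%:E (weighted_op V) = lpn m r%:E V `^ (r - 1).
  have [JL JE] := spow_Lfun r1 p1 prE VL.
  have -> : lpn m p%:E (weighted_op V) = lpn m p%:E (fun z => spow r (V z)).
    by apply: lpn_ae => //; exact: Lfun_meas AL.
  rewrite -[LHS](@powRVK _ _ p) ?lpn_ge0// JE -powRrM; congr (_ `^ _).
  by rewrite -{1}prE mulrAC divff ?gt_eqF// mul1r.
split => //; last by rewrite -NE.
have := weighted_op_le VL; rewrite NE => h.
have := ler_wpM2r (powR_ge0 (lpn m r%:E V) (1 - r)) h.
rewrite -mulrA -powRD ?(gt_eqF N0) ?implybT//.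
rewrite -[X in D * (X * _)](powRr1 (ltW N0)) -powRD ?(gt_eqF N0) ?implybT//.
have -> : r - 1 + (1 - r) = 0 by ring.
have -> : 1 + (1 - r) = 2 - r by ring.
by rewrite powRr0.
Qed.

End operator.

(** * Fourier series on a period *)

Lemma Rint_dominated d (T : measurableType d) (R : realType) (mu : {measure set T -> \bar R})
    (f_ : nat -> T -> R) (f g : T -> R) :
  (forall n, measurable_fun [set: T] (f_ n)) -> measurable_fun [set: T] f ->
  {ae mu, forall x, f_ n x @[n --> \oo] --> f x} ->
  mu.-integrable [set: T] (EFin \o g) -> (forall n, {ae mu, forall x, `|f_ n x| <= g x}) ->
  \int[mu]_x f_ n x @[n --> \oo] --> \int[mu]_x f x.
Proof.
move=> mf_ mf fc ig fg.
have [|||||i1 _ h] := @dominated_convergence _ _ _ mu _ measurableT (fun n => EFin \o f_ n) (EFin \o f) (EFin \o g).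
- by move=> n; apply/measurable_EFinP; exact: mf_.
- exact/measurable_EFinP.
- by apply: filterS fc => x hx _; apply/fine_cvgP; split; [exact: nearW|exact: hx].
- exact: ig.
- have fg' : {ae mu, forall x, forall n, `|f_ n x| <= g x} by exact: ae_foralln.
  by apply: filterS fg' => x hx n _; rewrite lee_fin; exact: hx.
by apply: fine_cvg; rewrite fineK ?integrable_fin_num.
Qed.

Section lebesgue_affine.
Context {R : realType}.
Local Notation mu := (@lebesgue_measure R).
Local Notation TR := (measurableTypeR R).

Definition shiftR (a : R) (t : TR) : TR := t + a.

Lemma measurable_shiftR (a : R) : measurable_fun [set: TR] (shiftR a).
Proof. by apply: measurable_funD. Qed.

HB.instance Definition _ a := isMeasurableFun.Build _ _ _ _ (shiftR a) (measurable_shiftR a).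

Lemma lebesgue_measure_shift (a : R) (A : set TR) : measurable A ->
  pushforward mu (shiftR a) A = mu A.
Proof.
move=> mA; apply/esym/lebesgue_measure_unique => //= _ [[x y]] _ <-.
rewrite /pushforward.
have -> : shiftR a @^-1` `]x, y]%classic = `](x - a), (y - a)]%classic.
  by apply/seteqP; split=> t /=; rewrite /shiftR !in_itv/= => /andP[h1 h2]; apply/andP; split; lra.
rewrite !lebesgue_measure_itv/= !lte_fin ltrD2r -!EFinD.
by case: ifP => // _; congr (_%:E); ring.
Qed.

Lemma ge0_integral_shift (a : R) (D : set TR) (f : TR -> \bar R) : measurable D ->
  measurable_fun [set: TR] f -> (forall t, 0 <= f t)%E ->
  (\int[mu]_(t in shiftR a @^-1` D) f (shiftR a t) = \int[mu]_(t in D) f t)%E.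
Proof.
move=> mD mf f0.
rewrite -(ge0_integral_pushforward (measurable_shiftR a) mu mD (measurable_funTS mf))//.
by apply: eq_measure_integral => A mA _; exact: lebesgue_measure_shift.
Qed.

Lemma ge0_integral_opp (D : set TR) (f : TR -> \bar R) : measurable D ->
  measurable_fun [set: TR] f -> (forall t, 0 <= f t)%E ->
  (\int[mu]_(t in (-%R : TR -> TR) @^-1` D) f ((-%R : TR -> TR) t) = \int[mu]_(t in D) f t)%E.
Proof.
move=> mD mf f0.
have mN : measurable_fun [set: TR] (-%R : TR -> TR) by exact: oppr_measurable.
rewrite -(ge0_integral_pushforward mN mu mD (measurable_funTS mf))//.
by apply: eq_measure_integral => A mA _; exact: lebesgue_measureN.
Qed.

End lebesgue_affine.

Section period.
Context {R : realType}.
Local Notation mu := (@lebesgue_measure R).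
Local Notation TR := (measurableTypeR R).
Local Notation P := (@period_measure R).
Local Notation pi2 := (2 * pi : R).
Local Notation I := (`[0, pi2[%classic : set TR).

Lemma pi2_gt0 : 0 < pi2. Proof. by rewrite mulr_gt0// pi_gt0. Qed.

Let mI : measurable I. Proof. exact: measurable_itv. Qed.

Let muI2 (A : set TR) : measurable A -> mu (A `&` `[0, pi2]%classic) = mu (A `&` I).
Proof.
move=> mA; apply/eqP; rewrite eq_le; apply/andP; split; last first.
  apply: le_measure; rewrite ?inE; [exact: measurableI|exact: measurableI|].
  by apply: setIS => t /=; rewrite !in_itv/= => /andP[-> /ltW ->].
apply: (@le_trans _ _ (mu ((A `&` I) `|` [set pi2]))).
  apply: le_measure; rewrite ?inE; [exact: measurableI|by apply: measurableU => //; exact: measurableI|].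
  move=> t [At] /=; rewrite !in_itv/= => /andP[t0]; rewrite le_eqVlt => /predU1P[->|tp]; first by right.
  by left; split => //; rewrite /= t0.
apply: (le_trans (measureU2 _ _ _)) => //; first exact: measurableI.
by rewrite [X in (_ + X)%E](lebesgue_measure_set1 pi2) adde0.
Qed.

(** The closed period of the definition is traded for the half-open one, whose translates tile the
    line; the end point is null. *)
Lemma period_measureE (A : set TR) : measurable A -> P A = mu (A `&` I).
Proof. by move=> mA; rewrite -muI2. Qed.

Lemma period_integral (f : TR -> \bar R) : measurable_fun [set: TR] f ->
  (\int[P]_t f t = \int[mu]_(t in I) f t)%E.
Proof.
move=> mf; have mfI : measurable_fun [set: TR] (f \_ I).
  by apply/(measurable_restrictT f mI); exact: measurable_funTS.
rewrite (@ae_eq_integral _ _ _ P setT (f \_ I) f)//; last first.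
  exists (~` I); split; first exact: measurableC.
    by rewrite [LHS]period_measureE ?setICl ?measure0//; exact: measurableC.
  move=> t /= /not_implyP[_ h] It; apply: h; rewrite patchE ifT//; exact/mem_set.
rewrite -integral_mkcond; apply: eq_measure_integral => A mA AI.
by rewrite [LHS]period_measureE// (setIidPl _ _).2.
Qed.

(** One copy of the period is cut at 2 pi - a, the other at a. Translation by a matches the first
    piece with the second piece of the other cut; the last piece wraps around by a - 2 pi, as
    periodicity allows. *)
Lemma ge0_period_shift (a : R) (f : TR -> \bar R) : 0 <= a <= pi2 ->
  measurable_fun [set: TR] f -> (forall t, 0 <= f t)%E -> (forall t, f (t + pi2) = f t) ->
  (\int[P]_t f (shiftR a t) = \int[P]_t f t)%E.
Proof.
move=> /andP[a0 a2] mf f0 fp.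
have mfa : measurable_fun [set: TR] (fun t : R => f (shiftR a t)) by apply: (measurableT_comp mf); exact: measurable_shiftR.
rewrite !period_integral//.
have U b : 0 <= b <= pi2 -> I = `[0, b[%classic `|` `[b, pi2[%classic.
  move=> /andP[b0 b2]; apply/seteqP; split => t /=; rewrite !in_itv/=.
    by move=> /andP[t0 t2]; case: (ltP t b) => tb; [left|right]; rewrite ?t0.
  by case=> /andP[h1 h2]; apply/andP; split; lra.
have Dj b : [disjoint (`[0, b[%classic : set TR) & `[b, pi2[%classic].
  apply/disj_setPS => t /= []; rewrite !in_itv/= => /andP[_ tb] /andP[bt _]; lra.
rewrite {1}(U (pi2 - a)); last by apply/andP; split; lra.
rewrite (U a) ?a0// !ge0_integral_setU//; try exact: measurable_funTS.
rewrite addeC; congr (_ + _)%E.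
- rewrite -(@ge0_integral_shift _ (a - pi2) `[0, a[%classic)//.
  have -> : shiftR (a - pi2) @^-1` `[0, a[%classic = `[(pi2 - a), pi2[%classic.
    by apply/seteqP; split=> t /=; rewrite /shiftR !in_itv/= => /andP[h1 h2]; apply/andP; split; lra.
  by apply: eq_integral => t _; rewrite -[in RHS]fp /shiftR; congr f; ring.
- rewrite -(@ge0_integral_shift _ a `[a, pi2[%classic)//.
  congr (integral _ _ _).
  by apply/seteqP; split=> t /=; rewrite /shiftR !in_itv/= => /andP[h1 h2]; apply/andP; split; lra.
Qed.

(** Reflection turns the period into ]-2 pi, 0], which a translation by 2 pi brings back; exchanging
    the end points changes nothing. *)
Lemma ge0_period_opp (f : TR -> \bar R) :
  measurable_fun [set: TR] f -> (forall t, 0 <= f t)%E -> (forall t, f (t + pi2) = f t) ->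
  (\int[P]_t f ((-%R : TR -> TR) t) = \int[P]_t f t)%E.
Proof.
move=> mf f0 fp.
have mN : measurable_fun [set: TR] (-%R : TR -> TR) by exact: oppr_measurable.
have mfN : measurable_fun [set: TR] (fun t : R => f ((-%R : TR -> TR) t)) by exact: (measurableT_comp mf mN).
rewrite !period_integral//.
have -> : I = (-%R : TR -> TR) @^-1` `](- pi2), 0]%classic.
  by apply/seteqP; split=> t /=; rewrite !in_itv/= => /andP[h1 h2]; apply/andP; split; lra.
rewrite ge0_integral_opp//.
have -> : (-%R : TR -> TR) @^-1` `](- pi2), 0]%classic = I.
  by apply/seteqP; split=> t /=; rewrite !in_itv/= => /andP[h1 h2]; apply/andP; split; lra.
transitivity (\int[mu]_(t in `]0%R, pi2]) f t)%E.
  rewrite -(@ge0_integral_shift _ pi2 `]0, pi2]%classic)//.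
  have -> : shiftR pi2 @^-1` `]0, pi2]%classic = `](- pi2), 0]%classic.
    by apply/seteqP; split=> t /=; rewrite /shiftR !in_itv/= => /andP[h1 h2]; apply/andP; split; lra.
  by apply: eq_integral => t _; rewrite -[in LHS]fp.
rewrite -integral_itv_bndo_bndc; last exact: measurable_funTS.
by rewrite integral_itv_obnd_cbnd//; exact: measurable_funTS.
Qed.

(* Both identities hold without integrability, as the integral is the
   difference of the integrals of the positive and negative parts. *)
Lemma period_Rint_shift (a : R) (f : R -> R) : 0 <= a <= pi2 ->
  measurable_fun [set: TR] f -> (forall t, f (t + pi2) = f t) ->
  \int[P]_t f (t + a) = \int[P]_t f t.
Proof.
move=> a2 mf fp; rewrite /Rintegral; congr fine.
have mE : measurable_fun [set: TR] (EFin \o f) by exact/measurable_EFinP.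
rewrite (integralE _ _ (fun t : TR => (f (t + a))%:E)) (integralE _ _ (fun t : TR => (f t)%:E)).
congr (_ - _)%E.
- rewrite -[RHS](ge0_period_shift a2 (measurable_funepos mE) (funepos_ge0 _)) => [|t].
    by apply: eq_integral => t _; rewrite !funeposE.
  by rewrite !funeposE /= fp.
- rewrite -[RHS](ge0_period_shift a2 (measurable_funeneg mE) (funeneg_ge0 _)) => [|t].
    by apply: eq_integral => t _; rewrite !funenegE.
  by rewrite !funenegE /= fp.
Qed.

Lemma period_Rint_opp (f : R -> R) :
  measurable_fun [set: TR] f -> (forall t, f (t + pi2) = f t) ->
  \int[P]_t f (- t) = \int[P]_t f t.
Proof.
move=> mf fp; rewrite /Rintegral; congr fine.
have mE : measurable_fun [set: TR] (EFin \o f) by exact/measurable_EFinP.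
rewrite (integralE _ _ (fun t : TR => (f (- t))%:E)) (integralE _ _ (fun t : TR => (f t)%:E)).
congr (_ - _)%E.
- rewrite -[RHS](ge0_period_opp (measurable_funepos mE) (funepos_ge0 _)) => [|t].
    by apply: eq_integral => t _; rewrite !funeposE.
  by rewrite !funeposE /= fp.
- rewrite -[RHS](ge0_period_opp (measurable_funeneg mE) (funeneg_ge0 _)) => [|t].
    by apply: eq_integral => t _; rewrite !funenegE.
  by rewrite !funenegE /= fp.
Qed.

Lemma continuous_Rmeas (f : R -> R) : continuous f -> measurable_fun [set: TR] f.
Proof. by move=> cf; exact: continuous_measurable_fun. Qed.

Lemma period_FTC (F f : R -> R) : (forall t : R, is_derive t 1 F (f t)) -> continuous f ->
  \int[P]_t f t = F pi2 - F 0.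
Proof.
move=> dF cf.
have cF t : {for t, continuous F}.
  by apply: differentiable_continuous; apply/derivable1_diffP; exact: ex_derive.
rewrite /Rintegral period_integral; last by apply/measurable_EFinP; exact: continuous_Rmeas.
rewrite integral_itv_bndo_bndc; last by apply: measurable_funTS; apply/measurable_EFinP; exact: continuous_Rmeas.
rewrite (@continuous_FTC2 _ f F 0 pi2 pi2_gt0)//.
- by apply: continuous_subspaceT => t; exact: cf.
- split.
  + by move=> t _; exact: ex_derive.
  + by apply: cvg_at_right_filter; exact: cF.
  + by apply: cvg_at_left_filter; exact: cF.
- by move=> t _; rewrite derive1E; exact: derive_val.
Qed.

Lemma period_cst : \int[P]_t (1 : R) = pi2.
Proof.
by rewrite (@period_FTC id (fun=> 1)) ?subr0// => t; exact: cvg_cst.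
Qed.

Lemma cos2piD (k : nat) (x : R) : cos (x + k%:R * pi2) = cos x.
Proof.
have -> : x + k%:R * pi2 = x + (pi *+ 2) *+ k by rewrite !mulr_natl.
exact: (periodicn (@cosD2pi R)).
Qed.

Lemma sin2piD (k : nat) (x : R) : sin (x + k%:R * pi2) = sin x.
Proof.
have -> : x + k%:R * pi2 = x + (pi *+ 2) *+ k by rewrite !mulr_natl.
exact: (periodicn (@sinD2pi R)).
Qed.

Lemma is_derive_lin (k c t : R) : is_derive t 1 (fun t : R => k * t + c) k.
Proof.
have -> : (fun t : R => k * t + c) = (k *: id + cst c) by [].
by apply: is_derive_eq; rewrite addr0 /GRing.scale/= mulr1.
Qed.

Lemma is_derive_sin_lin (k c t : R) : is_derive t 1 (fun t : R => sin (k * t + c)) (k * cos (k * t + c)).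
Proof.
have h := is_derive_lin k c t.
have := @is_derive1_comp _ (@sin R) (fun t : R => k * t + c) t (cos (k * t + c)) k _ h.
by rewrite [k * cos _]mulrC; apply.
Qed.

Lemma is_derive_cos_lin (k c t : R) : is_derive t 1 (fun t : R => cos (k * t + c)) (- (k * sin (k * t + c))).
Proof.
have h := is_derive_lin k c t.
have := @is_derive1_comp _ (@cos R) (fun t : R => k * t + c) t (- sin (k * t + c)) k _ h.
by rewrite -mulrN [k * - sin _]mulrC; apply.
Qed.

Lemma continuous_cos_lin (k c : R) : continuous (fun t : R => cos (k * t + c)).
Proof.
move=> t; apply: differentiable_continuous; apply/derivable1_diffP.
by have := is_derive_cos_lin k c t => h; exact: ex_derive.
Qed.

Lemma continuous_sin_lin (k c : R) : continuous (fun t : R => sin (k * t + c)).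
Proof.
move=> t; apply: differentiable_continuous; apply/derivable1_diffP.
by have := is_derive_sin_lin k c t => h; exact: ex_derive.
Qed.

Lemma period_cos (k : nat) (c : R) : (0 < k)%N -> \int[P]_t cos (k%:R * t + c) = 0.
Proof.
move=> k0; have k0' : k%:R != 0 :> R by rewrite pnatr_eq0 -lt0n.
have dF (t : R) : is_derive t 1 (fun t : R => k%:R^-1 * sin (k%:R * t + c)) (cos (k%:R * t + c)).
  have h := is_derive_sin_lin k%:R c t.
  have := @is_deriveZ _ _ _ (fun t : R => sin (k%:R * t + c)) k%:R^-1 t 1 _ h.
  by rewrite /GRing.scale/= mulrA mulVf// mul1r.
rewrite (period_FTC dF); last exact: continuous_cos_lin.
by rewrite (addrC (_ * pi2)) sin2piD mulr0 add0r subrr.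
Qed.

(** One boolean selects sine or cosine, so that the parity is the sign (-1)^b and both families
    share their proofs. *)
Definition trig (b : bool) (k : nat) (t : R) : R := if b then sin (k%:R * t) else cos (k%:R * t).

Lemma trig_norm b k t : `|trig b k t| <= 1.
Proof. by case: b; rewrite /trig ?sin_max ?cos_max. Qed.

Lemma continuous_trig b k : continuous (trig b k).
Proof.
case: b => t.
- by have := @continuous_sin_lin k%:R 0 t; under eq_fun do rewrite addr0.
- by have := @continuous_cos_lin k%:R 0 t; under eq_fun do rewrite addr0.
Qed.

Lemma measurable_trig b k : measurable_fun [set: TR] (trig b k).
Proof. exact: (continuous_Rmeas (@continuous_trig b k)). Qed.

Lemma measurable_trigB b k a : measurable_fun [set: TR] (fun t => trig b k (t - a)).
Proof. by apply: (measurableT_comp (measurable_trig b k)); exact: (measurable_shiftR (- a)). Qed.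

Lemma trig2pi b k t : trig b k (t + pi2) = trig b k t.
Proof. by case: b; rewrite /trig mulrDr ?sin2piD ?cos2piD. Qed.

Lemma trigN b k t : trig b k (- t) = (-1) ^+ b * trig b k t.
Proof. by case: b; rewrite /trig mulrN ?sinN ?cosN ?expr0 ?expr1 ?mul1r ?mulN1r. Qed.

Lemma trigD b k t a : trig b k (t + a) =
  cos (k%:R * a) * trig b k t - (-1) ^+ b * sin (k%:R * a) * trig (~~ b) k t.
Proof. by case: b; rewrite /trig mulrDr ?sinD ?cosD ?expr0 ?expr1 /=; ring. Qed.

Let trig_mul b k l t : trig b k t * trig b l t =
  (cos ((k%:R - l%:R) * t) + (-1) ^+ b * cos ((k%:R + l%:R) * t)) / 2.
Proof.
have -> : (k%:R - l%:R) * t = k%:R * t - l%:R * t by ring.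
have -> : (k%:R + l%:R) * t = k%:R * t + l%:R * t by ring.
by case: b; rewrite /trig cosB cosD ?expr0 ?expr1; field.
Qed.

Let icos (k c : R) : P.-integrable [set: TR] (EFin \o (fun t => cos (k * t + c))).
Proof.
apply: (@bounded_integrable _ _ _ _ _ 1); first exact: (continuous_Rmeas (@continuous_cos_lin k c)).
by move=> t; exact: cos_max.
Qed.

(** The phase a is carried along because pointwise convergence at a uses Bessel's inequality for the
    profiles centred at a; the solution itself uses a = 0. *)
Lemma trig_orth b k l a : (0 < k)%N -> (0 < l)%N ->
  \int[P]_t (trig b k (t - a) * trig b l (t - a)) = if k == l then pi else 0.
Proof.
move=> k0 l0.
have E t : trig b k (t - a) * trig b l (t - a) =
  2^-1 * cos ((k%:R - l%:R) * t + - ((k%:R - l%:R) * a)) +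
  (2^-1 * (-1) ^+ b) * cos ((k + l)%:R * t + - ((k + l)%:R * a)).
  rewrite trig_mul natrD.
  have -> : (k%:R - l%:R) * (t - a) = (k%:R - l%:R) * t + - ((k%:R - l%:R) * a) by ring.
  have -> : (k%:R + l%:R) * (t - a) = (k%:R + l%:R) * t + - ((k%:R + l%:R) * a) by ring.
  by field.
under eq_Rintegral do rewrite E.
have i1 := icos (k%:R - l%:R) (- ((k%:R - l%:R) * a)).
have i2 := icos (k + l)%:R (- ((k + l)%:R * a)).
have i3 : P.-integrable [set: TR] (EFin \o (fun t => 2^-1 * cos ((k%:R - l%:R) * t + - ((k%:R - l%:R) * a)))).
  by have := integrableZl measurableT 2^-1 i1; apply: eq_integrable.
have i4 : P.-integrable [set: TR] (EFin \o (fun t => (2^-1 * (-1) ^+ b) * cos ((k + l)%:R * t + - ((k + l)%:R * a)))).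
  by have := integrableZl measurableT (2^-1 * (-1) ^+ b) i2; apply: eq_integrable.
rewrite RintegralD// !RintegralZl// period_cos ?addn_gt0 ?k0// mulr0 addr0.
case: ltngtP => [kl|kl|->].
- have -> : \int[P]_t cos ((k%:R - l%:R) * t + - ((k%:R - l%:R) * a)) =
      \int[P]_t cos ((l - k)%:R * t + - ((l - k)%:R * a)).
    by apply: eq_Rintegral => t _; rewrite -cosN natrB 1?ltnW//; congr cos; ring.
  by rewrite period_cos ?subn_gt0// mulr0.
- have -> : \int[P]_t cos ((k%:R - l%:R) * t + - ((k%:R - l%:R) * a)) =
      \int[P]_t cos ((k - l)%:R * t + - ((k - l)%:R * a)).
    by apply: eq_Rintegral => t _; rewrite natrB 1?ltnW.
  by rewrite period_cos ?subn_gt0// mulr0.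
- under eq_Rintegral do rewrite subrr !mul0r oppr0 addr0 cos0.
  by rewrite period_cst mulrA mulVf// mul1r.
Qed.

Lemma periodicz (f : R -> R) : (forall t, f (t + pi2) = f t) ->
  forall (n : int) t, f (t + n%:~R * pi2) = f t.
Proof.
move=> fp; have fn (n : nat) t : f (t + n%:R * pi2) = f t.
  by rewrite mulr_natl; exact: (periodicn fp).
case=> n t; first exact: fn.
by rewrite NegzE mulrNz -pmulrn mulNr -(fn n.+1) subrK.
Qed.

(* Jordan's inequality with a non-optimal constant, from the mean value
   theorem on [0, 1] and monotonicity beyond. *)
Lemma sin_half_lb : exists2 c : R, 0 < c & forall u, `|u| <= pi -> c * `|u| <= `|sin (u / 2)|.
Proof.
have p2 := @pi_ge2 R; have ph2 := @pihalf_lt2 R; have ph1 := @pihalf_ge1 R.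
have c1 := @cos1_gt0 R.
have s1 : 0 < sin (1 : R) by apply: sin_gt0_pi; move: p2; lra.
pose c : R := Num.min (cos 1 / 2) (sin 1 / 4).
have c0 : 0 < c by rewrite lt_min !divr_gt0.
have cl1 : c <= cos 1 / 2 by rewrite ge_min lexx.
have cl2 : c <= sin 1 / 4 by rewrite ge_min lexx orbT.
exists c => //.
have pos u : 0 <= u <= pi -> c * u <= sin (u / 2).
  move=> /andP[u0 up]; set v := u / 2; have uE : u = 2 * v by rewrite /v; field.
  have v0 : 0 <= v by rewrite divr_ge0.
  have vp : v <= pi / 2 by rewrite /v ler_pM2r.
  rewrite uE; have [v1|v1] := leP v 1.
    move: v0; rewrite le_eqVlt => /predU1P[<-|v0]; first by rewrite sin0 !mulr0.
    have [x xi] := @MVT _ (@sin R) (@cos R) 0 v v0 (fun x _ => is_derive_sin x)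
      (continuous_subspaceT (@continuous_sin R)).
    rewrite sin0 !subr0 => ->; rewrite mulrA ler_wpM2r ?(ltW v0)//.
    move: xi; rewrite in_itv/= => /andP[x0 xv].
    have : cos 1 <= cos x.
      by rewrite ltW// ltr_cos ?in_itv/=; [lra| |]; apply/andP; split; lra.
    lra.
  have : sin 1 <= sin v.
    by rewrite ltW// ltr_sin ?in_itv/=; [lra| |]; apply/andP; split; lra.
  have : c * (2 * v) <= sin 1 / 4 * (2 * v) by rewrite ler_wpM2r// mulr_ge0.
  nra.
move=> u; have [u0|u0] := leP 0 u => up.
  by rewrite (ger0_norm u0) in up *; apply: le_trans (ler_norm _); apply: pos; rewrite u0.
rewrite (ltr0_norm u0) in up *; rewrite -normrN -sinN -mulNr.
by apply: le_trans (ler_norm _); apply: pos; rewrite up oppr_ge0 ltW.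
Qed.

(** By periodicity t - a may be reduced modulo 2 pi to [-pi, pi], where [sin_half_lb] compares its
    modulus with the half-angle sine. *)
Lemma lip_sin_half : exists2 c : R, 0 < c & forall (phi : R -> R) (K : R), 0 <= K ->
  (forall t, phi (t + pi2) = phi t) -> (forall t s, `|phi t - phi s| <= K * `|t - s|) ->
  forall t a, `|phi t - phi a| <= c * K * `|sin ((t - a) / 2)|.
Proof.
have [c c0 cs] := sin_half_lb; exists c^-1; first by rewrite invr_gt0.
move=> phi K K0 pp lip t a; pose u := t - a.
(* The added one half rounds to the nearest integer, so that the reduced [v] lies in [-pi, pi]. *)
pose n := Num.floor (u / pi2 + 2^-1); pose v := u + (- n)%:~R * pi2.
have vp : `|v| <= pi.
  have := floor_itv (u / pi2 + 2^-1); rewrite -/n intrD => /andP[h1 h2].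
  have p0 := pi2_gt0; have pn0 : pi != 0 :> R by rewrite gt_eqF// pi_gt0.
  have fE (w : R) : w != 0 -> u + w = (u / (2 * w) + 2^-1) * (2 * w) by move=> w0; field.
  have {}h1 : n%:~R * pi2 <= u + pi by rewrite (fE _ pn0) ler_pM2r.
  have {}h2 : u + pi < (n%:~R + 1) * pi2 by rewrite (fE _ pn0) ltr_pM2r.
  by rewrite ler_norml /v mulrNz; move: h1 h2; set z := n%:~R; lra.
have -> : phi t = phi (a + v).
  by rewrite -(periodicz pp (- n) t) /v /u; congr phi; ring.
have -> : `|sin ((t - a) / 2)| = `|sin (v / 2)|.
  rewrite /v; apply/esym/(@periodicz (fun u => `|sin (u / 2)|)) => x.
  have -> : (x + pi2) / 2 = x / 2 + pi by field.
  by rewrite (sinDpi (x / 2)) normrN.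
apply: (le_trans (lip _ _)); have -> : a + v - a = v by ring.
have -> : c^-1 * K * `|sin (v / 2)| = K * (c^-1 * `|sin (v / 2)|) by ring.
by apply: ler_wpM2l => //; rewrite ler_pdivlMl//; exact: cs.
Qed.

(** Induction: 2 sin(u/2) cos((n+1) u) is the difference of two consecutive right-hand sides. *)
Lemma dirichlet_kernel (u : R) n :
  sin (u / 2) * (1 + \sum_(1 <= k < n.+1) 2 * cos (k%:R * u)) = sin (n%:R * u + u / 2).
Proof.
elim: n => [|n IH]; first by rewrite big_geq// addr0 mulr1 mul0r add0r.
rewrite big_nat_recr//= addrA mulrDr IH.
have -> : n%:R * u + u / 2 = n.+1%:R * u - u / 2 by rewrite -natr1; field.
rewrite sinB sinD; ring.
Qed.

(** * Fourier partial sums of a Lipschitz function *)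

Section dirichlet.
Variables (phi : R -> R) (K M c : R).
Hypothesis K0 : 0 <= K.
Hypothesis pp : forall t, phi (t + pi2) = phi t.
Hypothesis lip : forall t s, `|phi t - phi s| <= K * `|t - s|.
Hypothesis bd : forall t, `|phi t| <= M.
Hypothesis c0 : 0 < c.
Hypothesis cP : forall t a, `|phi t - phi a| <= c * K * `|sin ((t - a) / 2)|.

Lemma lip_continuous : continuous phi.
Proof.
move=> t; apply/cvgrPdist_lt => eps eps0.
have e0 : 0 < eps / (K + 1) by rewrite divr_gt0// ltr_wpDl.
near=> s.
apply: (le_lt_trans (lip t s)).
have h : `|t - s| < eps / (K + 1).
  by near: s; apply: (@cvgr_dist_lt _ _ _ _ _ id t) => //; exact: cvg_id.
apply: (@le_lt_trans _ _ ((K + 1) * `|t - s|)); first by rewrite ler_wpM2r// lerDl.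
by rewrite mulrC -ltr_pdivlMr// ltr_wpDl.
Unshelve. all: by end_near. Qed.

Let mphi : measurable_fun [set: TR] phi. Proof. exact: continuous_Rmeas lip_continuous. Qed.

Definition fcoef b k := \int[P]_t (phi t * trig b k t).

Definition fsum n a := (2 * pi)^-1 * fcoef false 0 +
  pi^-1 * \sum_(1 <= k < n) (cos (k%:R * a) * fcoef false k + sin (k%:R * a) * fcoef true k).

Let iphi b k : P.-integrable [set: TR] (EFin \o (fun t => phi t * trig b k t)).
Proof.
apply: (@bounded_integrable _ _ _ _ _ M).
  by apply: measurable_funM => //; exact: measurable_trig.
by move=> t; rewrite normrM -[leRHS]mulr1 ler_pM// trig_norm.
Qed.

Let term k a : (0 < k)%N -> P.-integrable [set: TR] (EFin \o (fun t => 2 * ((phi t - phi a) * cos (k%:R * (t - a))))) /\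
  \int[P]_t (2 * ((phi t - phi a) * cos (k%:R * (t - a)))) =
  2 * (cos (k%:R * a) * fcoef false k + sin (k%:R * a) * fcoef true k).
Proof.
move=> k0.
have -> : (fun t => 2 * ((phi t - phi a) * cos (k%:R * (t - a)))) =
    (fun t => (2 * cos (k%:R * a)) * (phi t * trig false k t) + (2 * sin (k%:R * a)) * (phi t * trig true k t)
    + (- 2 * phi a) * cos (k%:R * t + - (k%:R * a))).
  apply/funext => t; have -> : k%:R * (t - a) = k%:R * t - k%:R * a by ring.
  by rewrite /trig cosB; ring.
have i1 : P.-integrable [set: TR] (EFin \o (fun t => (2 * cos (k%:R * a)) * (phi t * trig false k t))).
  by have := integrableZl measurableT (2 * cos (k%:R * a)) (iphi false k); apply: eq_integrable.
have i2 : P.-integrable [set: TR] (EFin \o (fun t => (2 * sin (k%:R * a)) * (phi t * trig true k t))).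
  by have := integrableZl measurableT (2 * sin (k%:R * a)) (iphi true k); apply: eq_integrable.
have i3' := icos k%:R (- (k%:R * a)).
have i3 : P.-integrable [set: TR] (EFin \o (fun t => (- 2 * phi a) * cos (k%:R * t + - (k%:R * a)))).
  by have := integrableZl measurableT (- 2 * phi a) i3'; apply: eq_integrable.
have i4 : P.-integrable [set: TR] (EFin \o (fun t => (2 * cos (k%:R * a)) * (phi t * trig false k t) + (2 * sin (k%:R * a)) * (phi t * trig true k t))).
  by have := integrableD measurableT i1 i2; apply: eq_integrable.
split; first by have := integrableD measurableT i4 i3; apply: eq_integrable.
rewrite RintegralD// RintegralD// !RintegralZl// period_cos// /fcoef; ring.
Qed.

Lemma fsum_kernel n a : fsum n.+1 a - phi a =
  (2 * pi)^-1 * \int[P]_t ((phi t - phi a) * (1 + \sum_(1 <= k < n.+1) 2 * cos (k%:R * (t - a)))).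
Proof.
have E t : (phi t - phi a) * (1 + \sum_(1 <= k < n.+1) 2 * cos (k%:R * (t - a))) =
   (phi t - phi a) + \sum_(1 <= k < n.+1) 2 * ((phi t - phi a) * cos (k%:R * (t - a))).
  rewrite mulrDr mulr1 mulr_sumr; congr (_ + _); apply: eq_bigr => k _; ring.
under eq_Rintegral do rewrite E.
have [I1 E1] := @Rintegral_sum_nat _ _ _ P (fun k t => 2 * ((phi t - phi a) * cos (k%:R * (t - a)))) 1 n.+1
  (fun k kn => (term a (proj1 (andP kn))).1).
have i0 : P.-integrable [set: TR] (EFin \o phi) by exact: (bounded_integrable _ mphi bd).
have i00 : P.-integrable [set: TR] (EFin \o (fun=> phi a)).
  exact: (@bounded_integrable _ _ _ _ _ `|phi a|).
have i1 : P.-integrable [set: TR] (EFin \o (fun t => phi t - phi a)).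
  by have := integrableB measurableT i0 i00; apply: eq_integrable.
rewrite RintegralD// RintegralB// E1.
have -> : \int[P]_t phi a = phi a * pi2.
  have -> : \int[P]_t phi a = \int[P]_t (phi a * 1) by apply: eq_Rintegral => t _; rewrite mulr1.
  rewrite RintegralZl ?period_cst//; exact: (@bounded_integrable _ _ _ _ _ `|1|).
have -> : \int[P]_t phi t = fcoef false 0.
  by apply: eq_Rintegral => t _; rewrite /trig mul0r cos0 mulr1.
have -> : \sum_(1 <= k < n.+1) \int[P]_t (2 * ((phi t - phi a) * cos (k%:R * (t - a)))) =
    2 * \sum_(1 <= k < n.+1) (cos (k%:R * a) * fcoef false k + sin (k%:R * a) * fcoef true k).
  rewrite mulr_sumr; apply: eq_big_nat => k /andP[k0 _]; exact: (term a k0).2.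
have pn0 : pi != 0 :> R by rewrite gt_eqF// pi_gt0.
have fE (w F S f : R) : w != 0 ->
  (2 * w)^-1 * F + w^-1 * S - f = (2 * w)^-1 * (F - f * (2 * w) + 2 * S) by move=> w0; field.
exact: fE.
Qed.

(** The difference quotient of phi by the half-angle sine. The inverse sine is written as the sine
    times a power of its square, which keeps measurability within reach and gives 0 where the sine
    vanishes. *)
Let h a t := (phi t - phi a) * sin ((t - a) / 2) * (sin ((t - a) / 2) ^+ 2) `^ (- 1).

Let hE a t : h a t * sin ((t - a) / 2) = phi t - phi a.
Proof.
rewrite /h; have [s0|s0] := eqVneq (sin ((t - a) / 2)) 0.
  by have := cP t a; rewrite s0 normr0 mulr0 normr_le0 => /eqP ->; rewrite !mul0r.
by rewrite powR_inv1 ?sqr_ge0//; field.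
Qed.

Let hbd a t : `|h a t| <= c * K.
Proof.
have cK : 0 <= c * K by rewrite mulr_ge0// ltW.
have [s0|s0] := eqVneq (sin ((t - a) / 2)) 0.
  by rewrite /h s0 mulr0 mul0r normr0.
by have := cP t a; rewrite -hE normrM ler_pM2r// normr_gt0.
Qed.

Let msin a : measurable_fun [set: TR] (fun t => sin ((t - a) / 2)).
Proof.
have -> : (fun t => sin ((t - a) / 2)) = (fun t => sin (2^-1 * t + - (2^-1 * a))).
  by apply/funext => t; congr sin; ring.
exact: (continuous_Rmeas (@continuous_sin_lin 2^-1 (- (2^-1 * a)))).
Qed.

Let mcos a : measurable_fun [set: TR] (fun t => cos ((t - a) / 2)).
Proof.
have -> : (fun t => cos ((t - a) / 2)) = (fun t => cos (2^-1 * t + - (2^-1 * a))).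
  by apply/funext => t; congr cos; ring.
exact: (continuous_Rmeas (@continuous_cos_lin 2^-1 (- (2^-1 * a)))).
Qed.

Let mh a : measurable_fun [set: TR] (h a).
Proof.
apply: measurable_funM; first by apply: measurable_funM => //; exact: measurable_funB.
apply: (@measurableT_comp _ _ _ _ _ _ (@powR R ^~ (-1))) => //.
exact: measurable_funX.
Qed.

Let fsum_h n a : fsum n.+1 a - phi a = (2 * pi)^-1 * \int[P]_t (h a t * sin (n%:R * (t - a) + (t - a) / 2)).
Proof.
rewrite fsum_kernel; congr (_ * _); apply: eq_Rintegral => t _.
by rewrite -{1}hE -mulrA dirichlet_kernel.
Qed.

(** The denominator of the Dirichlet kernel is absorbed by the bounded quotient [h], so the error is
    bounded uniformly in n; dominated convergence relies on this. *)
Lemma fsum_err n a : `|fsum n.+1 a - phi a| <= c * K.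
Proof.
have ip : 0 <= (2 * pi)^-1 :> R by rewrite invr_ge0 ltW// pi2_gt0.
have cK : 0 <= c * K by rewrite mulr_ge0// ltW.
have msn : measurable_fun [set: TR] (fun t => sin (n%:R * (t - a) + (t - a) / 2)).
  have -> : (fun t => sin (n%:R * (t - a) + (t - a) / 2)) = (fun t => sin ((n%:R + 2^-1) * t + - ((n%:R + 2^-1) * a))).
    by apply/funext => t; congr sin; ring.
  exact: (continuous_Rmeas (@continuous_sin_lin (n%:R + 2^-1) (- ((n%:R + 2^-1) * a)))).
have b1 t : `|h a t * sin (n%:R * (t - a) + (t - a) / 2)| <= c * K.
  by rewrite normrM -[leRHS]mulr1 ler_pM// sin_max.
have i1 : P.-integrable [set: TR] (EFin \o (fun t => h a t * sin (n%:R * (t - a) + (t - a) / 2))).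
  by apply: (@bounded_integrable _ _ _ _ _ (c * K)) => //; exact: measurable_funM.
rewrite fsum_h normrM (ger0_norm ip).
have -> : c * K = (2 * pi)^-1 * (c * K * pi2).
  by rewrite mulrCA mulVf ?mulr1// gt_eqF// pi2_gt0.
apply: ler_wpM2l => //; apply: (le_trans (le_normr_Rintegral measurableT i1)).
have ic : P.-integrable [set: TR] (EFin \o (fun=> c * K)) by exact: (@bounded_integrable _ _ _ _ _ `|c * K|).
apply: (@le_trans _ _ (\int[P]_t (c * K))); last first.
  have -> : \int[P]_t (c * K) = \int[P]_t (c * K * 1) by apply: eq_Rintegral => t _; rewrite mulr1.
  by rewrite RintegralZl ?period_cst//; exact: (@bounded_integrable _ _ _ _ _ `|1|).
apply: le_Rintegral => //.
by apply: (@bounded_integrable _ _ _ _ _ (c * K)) => [|t]; rewrite ?normr_id//; apply: measurableT_comp => //; exact: measurable_funM.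
Qed.

(** The addition formula splits the kernel into a sine and a cosine of frequency n times bounded
    functions; by Bessel's inequality these integrals tend to 0. *)
Lemma fsum_cvg a : fsum n a @[n --> \oo] --> phi a.
Proof.
(* Two index shifts: [fsum_h] speaks of [fsum n.+1], and orthogonality needs positive
   frequencies. *)
apply/subr_cvg0; rewrite -(cvg_shiftS (fun n => fsum n a - phi a)) -(cvg_shiftS (fun n => fsum n.+1 a - phi a)).
have E n : fsum n.+2 a - phi a = (2 * pi)^-1 *
   (\int[P]_t (h a t * cos ((t - a) / 2) * trig true n.+1 (t - a)) +
    \int[P]_t (h a t * sin ((t - a) / 2) * trig false n.+1 (t - a))).
  rewrite fsum_h; congr (_ * _).
  have i (b : bool) (f : R -> R) : measurable_fun [set: TR] f -> (forall t, `|f t| <= 1) ->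
      P.-integrable [set: TR] (EFin \o (fun t => h a t * f t * trig b n.+1 (t - a))).
    move=> mf f1; apply: (@bounded_integrable _ _ _ _ _ (c * K)).
      apply: measurable_funM; [exact: measurable_funM|exact: measurable_trigB].
    move=> t; rewrite normrM -[leRHS]mulr1 ler_pM ?trig_norm//.
    by rewrite normrM -[leRHS]mulr1 ler_pM.
  rewrite -RintegralD//; last 2 first.
  - by apply: i => // t; exact: cos_max.
  - by apply: i => // t; exact: sin_max.
  by apply: eq_Rintegral => t _; rewrite /trig sinD; ring.
under eq_fun do rewrite E.
have bcv (b : bool) (f : R -> R) : measurable_fun [set: TR] f -> (forall t, `|f t| <= 1) ->
    \int[P]_t (h a t * f t * trig b n.+1 (t - a)) @[n --> \oo] --> 0.
  move=> mf f1.
  apply: (@bessel_cvg _ _ _ P (fun n t => trig b n.+1 (t - a)) pi _ _ (pi_gt0 R) _ (fun t => h a t * f t) (c * K)).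
  - by move=> j; exact: measurable_trigB.
  - by move=> j t; exact: trig_norm.
  - by move=> i j; rewrite trig_orth.
  - exact: measurable_funM.
  - by move=> t; rewrite normrM -[leRHS]mulr1 ler_pM.
have h1 := bcv true _ (mcos a) (fun t => cos_max _).
have h2 := bcv false _ (msin a) (fun t => sin_max _).
have := cvgMr (a := (2 * pi)^-1) (cvgD h1 h2); rewrite addr0 mulr0; exact.
Qed.

End dirichlet.

Lemma continuous_period_integrable (f : R -> R) : continuous f -> P.-integrable [set: TR] (EFin \o f).
Proof.
move=> cf; have mf := continuous_Rmeas cf.
apply/integrableP; split; first exact/measurable_EFinP.
rewrite period_integral; last by do 2 apply: measurableT_comp => //.
have : mu.-integrable `[0, pi2]%classic (EFin \o f).
  by apply: continuous_compact_integrable; [exact: segment_compact|exact: continuous_subspaceT].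
move=> /integrableP[_]; apply: le_lt_trans; rewrite integral_itv_bndo_bndc//.
by apply: measurable_funTS; do 2 apply: measurableT_comp => //.
Qed.

(** Both integrations by parts at once: f' e - f e' has the derivative f'' e + k^2 f e and takes the
    same value at the two ends of the period. *)
Lemma period_ibp b k (f f1 f2 : R -> R) : (forall t : R, is_derive t 1 f (f1 t)) ->
  (forall t : R, is_derive t 1 f1 (f2 t)) -> continuous f2 ->
  (forall t, f (t + pi2) = f t) -> (forall t, f1 (t + pi2) = f1 t) ->
  \int[P]_t (f2 t * trig b k t) = - k%:R ^+ 2 * \int[P]_t (f t * trig b k t).
Proof.
move=> df df1 cf2 fp f1p.
have cf : continuous f by move=> t; apply: differentiable_continuous; apply/derivable1_diffP; exact: ex_derive.
pose dt (t : R) := if b then k%:R * cos (k%:R * t) else - (k%:R * sin (k%:R * t)).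
have d1 (t : R) : is_derive t 1 (trig b k) (dt t).
  rewrite /dt; case: (b) => /=.
  - have := is_derive_sin_lin k%:R 0 t; rewrite addr0.
    by have -> : (fun t : R => sin (k%:R * t + 0)) = trig true k by apply/funext => x; rewrite addr0.
  - have := is_derive_cos_lin k%:R 0 t; rewrite addr0.
    by have -> : (fun t : R => cos (k%:R * t + 0)) = trig false k by apply/funext => x; rewrite addr0.
have d2 (t : R) : is_derive t 1 dt (- k%:R ^+ 2 * trig b k t).
  rewrite /dt; case: (b) => /=.
  - have := is_derive_cos_lin k%:R 0 t; rewrite addr0 => h.
    have := @is_deriveZ _ _ _ (fun t : R => cos (k%:R * t + 0)) k%:R t 1 _ h.
    have -> : k%:R \*: (fun t : R => cos (k%:R * t + 0)) = (fun t : R => k%:R * cos (k%:R * t)).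
      by apply/funext => x; rewrite /= addr0.
    by rewrite /GRing.scale/= => {}h; apply: is_derive_eq; rewrite /trig; ring.
  - have := is_derive_sin_lin k%:R 0 t; rewrite addr0 => h.
    have := @is_deriveZ _ _ _ (fun t : R => sin (k%:R * t + 0)) (- k%:R) t 1 _ h.
    have -> : - k%:R \*: (fun t : R => sin (k%:R * t + 0)) = (fun t : R => - (k%:R * sin (k%:R * t))).
      by apply/funext => x; rewrite /= addr0 -mulNr.
    by rewrite /GRing.scale/= => {}h; apply: is_derive_eq; rewrite /trig; ring.
pose W := f1 * trig b k - f * dt.
have dW (t : R) : is_derive t 1 W (f2 t * trig b k t + k%:R ^+ 2 * (f t * trig b k t)).
  have h1 := is_deriveM (df1 t) (d1 t); have h2 := is_deriveM (df t) (d2 t).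
  have h3 := is_deriveB h1 h2; apply: is_derive_eq; rewrite /GRing.scale/=; ring.
have ct := @continuous_trig b k.
have cE1 : continuous (fun t => f2 t * trig b k t) by move=> t; apply: cvgM; [exact: cf2|exact: ct].
have cE2 : continuous (fun t => f t * trig b k t) by move=> t; apply: cvgM; [exact: cf|exact: ct].
have cE : continuous (fun t => f2 t * trig b k t + k%:R ^+ 2 * (f t * trig b k t)).
  by move=> t; apply: cvgD; [exact: cE1|apply: cvgMr; exact: cE2].
have := period_FTC dW cE.
have -> : W pi2 = W 0.
  have h0 : trig b k pi2 = trig b k 0 by rewrite -[pi2]add0r trig2pi.
  have h1 : dt pi2 = dt 0.
    by rewrite /dt; case: (b); rewrite -[k%:R * pi2]add0r ?cos2piD ?sin2piD mulr0.
  have e1 : W pi2 = f1 pi2 * trig b k pi2 - f pi2 * dt pi2 by [].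
  have e2 : W 0 = f1 0 * trig b k 0 - f 0 * dt 0 by [].
  by rewrite e1 e2 h0 h1 -[pi2]add0r f1p fp.
rewrite subrr.
have i1 := continuous_period_integrable cE1; have i2 := continuous_period_integrable cE2.
have i3 : P.-integrable [set: TR] (EFin \o (fun t => k%:R ^+ 2 * (f t * trig b k t))).
  by have := integrableZl measurableT (k%:R ^+ 2) i2; apply: eq_integrable.
by rewrite RintegralD// RintegralZl// mulNr => /eqP; rewrite addr_eq0 => /eqP.
Qed.

(** * Fourier coefficients under the time symmetries *)

Section pairing.
Variables (b : bool) (m : nat) (g : R -> R).
Hypothesis m0 : (0 < m)%N.
Hypothesis ig : P.-integrable [set: TR] (EFin \o g).
Hypothesis gp : forall t, g (t + pi2) = g t.
Hypothesis gs : forall t, g (t + pi / m%:R) = - g t.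
Hypothesis gr : forall t, g (- t) = (-1) ^+ b * g t.

Let mg : measurable_fun [set: TR] g. Proof. by apply/measurable_EFinP; exact: measurable_int ig. Qed.
Let T b k := \int[P]_t (g t * trig b k t).
Let iT b' k : P.-integrable [set: TR] (EFin \o (fun t => g t * trig b' k t)).
Proof.
exact: (@integrable_mul_e _ _ _ P (fun k => trig b' k) (fun k => measurable_trig b' k) (fun k t => trig_norm b' k t) k g ig).
Qed.

Let T_other k : T (~~ b) k = 0.
Proof.
have mG : measurable_fun [set: TR] (fun t => g t * trig (~~ b) k t).
  by apply: measurable_funM => //; exact: measurable_trig.
have := period_Rint_opp mG (fun t => _); rewrite -/(T (~~ b) k) => /(_ _)/wrap[t|].
  by rewrite gp trig2pi.
have -> : \int[P]_t (g (- t) * trig (~~ b) k (- t)) = - 1 * T (~~ b) k.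
  transitivity (\int[P]_t (- 1 * (g t * trig (~~ b) k t))); last by rewrite RintegralZl.
  apply: eq_Rintegral => t _.
  by rewrite gr trigN; case: (b); rewrite ?expr0 ?expr1 /=; ring.
move=> h; lra.
Qed.

Let T_shift k : (1 + cos (k%:R * (pi / m%:R))) * T b k = 0.
Proof.
have mG : measurable_fun [set: TR] (fun t => g t * trig b k t).
  by apply: measurable_funM => //; exact: measurable_trig.
have am : 0 <= (pi : R) / m%:R <= pi2.
  have m1 : (1 : R) <= m%:R by rewrite ler1n.
  have pp := @pi_gt0 R.
  apply/andP; split; first by rewrite divr_ge0// ltW.
  rewrite ler_pdivrMr ?(lt_le_trans ltr01)//; apply: (@le_trans _ _ (pi2 * 1)); first by lra.
  by apply: ler_wpM2l => //; exact: ltW pi2_gt0.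
have := period_Rint_shift am mG (fun t => _); rewrite -/(T b k) => /(_ _)/wrap[t|].
  by rewrite gp trig2pi.
set a : R := pi / m%:R.
have i1 : P.-integrable [set: TR] (EFin \o (fun t => (- cos (k%:R * a)) * (g t * trig b k t))).
  by have := integrableZl measurableT (- cos (k%:R * a)) (iT b k); apply: eq_integrable.
have i2 : P.-integrable [set: TR] (EFin \o (fun t => ((-1) ^+ b * sin (k%:R * a)) * (g t * trig (~~ b) k t))).
  by have := integrableZl measurableT ((-1) ^+ b * sin (k%:R * a)) (iT (~~ b) k); apply: eq_integrable.
have -> : \int[P]_t (g (t + a) * trig b k (t + a)) = - cos (k%:R * a) * T b k + ((-1) ^+ b * sin (k%:R * a)) * T (~~ b) k.
  transitivity (\int[P]_t (- cos (k%:R * a) * (g t * trig b k t) + ((-1) ^+ b * sin (k%:R * a)) * (g t * trig (~~ b) k t))).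
    by apply: eq_Rintegral => t _; rewrite gs trigD; ring.
  by rewrite RintegralD// !RintegralZl.
rewrite T_other => h; lra.
Qed.

(** By [T_shift] a nonzero coefficient forces cos(k pi / m) = -1, which singles out the odd
    multiples of m. *)
Let T_zero k : (forall j, k != m * j.*2.+1)%N -> T b k = 0.
Proof.
move=> kj; have := T_shift k => /eqP; rewrite mulf_eq0 => /orP[/eqP h|/eqP//].
exfalso.
have mR : (0 : R) < m%:R by rewrite ltr0n.
pose q := (k %/ m)%N; pose r := (k %% m)%N; pose x : R := r%:R * (pi / m%:R).
have rm : (r < m)%N by rewrite ltn_mod.
have pp := @pi_gt0 R.
have x0 : 0 <= x by rewrite mulr_ge0// divr_ge0// ltW.
have xp : x < pi.
  by rewrite /x mulrA ltr_pdivrMr// mulrC ltr_pM2l// ltr_nat.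
(* With k = q m + r the angle is x in [0, pi), up to pi times the parity of q and whole periods. For
   even q it would need cos x = -1, which is impossible; for odd q it needs cos x = 1, so r = 0 and
   k is an excluded odd multiple of m. *)
have kE : k%:R * (pi / m%:R) = (x + (odd q)%:R * pi) + (q./2)%:R * pi2.
  have -> : k%:R = q%:R * m%:R + r%:R :> R by rewrite -natrM -natrD -divn_eq.
  have -> : q%:R = (odd q)%:R + (q./2)%:R * 2 :> R by rewrite -natrM muln2 -natrD odd_double_half.
  rewrite /x; field; exact: lt0r_neq0.
rewrite kE cos2piD in h; move: h.
case E : (odd q); last first.
  rewrite mul0r addr0 => h.
  have : cos pi < cos x by rewrite ltr_cos ?in_itv/= ?x0 ?(ltW xp) ?(ltW pp) ?lexx.
  by rewrite cospi; lra.
rewrite mul1r (cosDpi x) => h.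
move: x0; rewrite le_eqVlt => /predU1P[x0|x0].
  have r0 : r = 0%N.
    by apply/eqP; rewrite -(@pnatr_eq0 R); move/esym/eqP: x0; rewrite mulf_eq0 mulf_eq0 invr_eq0 (gt_eqF mR) (gt_eqF pp) !orbF.
  move/eqP: (kj q./2); apply.
  by rewrite {1}(divn_eq k m) -/q -/r r0 addn0 mulnC -{1}(odd_double_half q) E.
have : cos x < cos 0 by rewrite ltr_cos ?in_itv/= ?(ltW x0) ?(ltW xp) ?(ltW pp) ?lexx.
by rewrite cos0; lra.
Qed.

Variables (phi : R -> R) (K M c : R).
Hypothesis K0 : 0 <= K.
Hypothesis pp : forall t, phi (t + pi2) = phi t.
Hypothesis lip : forall t s, `|phi t - phi s| <= K * `|t - s|.
Hypothesis bd : forall t, `|phi t| <= M.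
Hypothesis c0 : 0 < c.
Hypothesis cP : forall t a, `|phi t - phi a| <= c * K * `|sin ((t - a) / 2)|.

Definition fpair n := pi^-1 * \sum_(0 <= j < n) T b (m * j.*2.+1) * fcoef phi b (m * j.*2.+1).

Let mphi : measurable_fun [set: TR] phi.
Proof. exact: (continuous_Rmeas (@lip_continuous phi K K0 lip)). Qed.

(** All frequencies except odd multiples of m, and the other parity, drop out against g. With the
    truncation 2 m n, a step from n to n + 1 adds exactly one surviving frequency, m (2 n + 1). *)
Let fpairE n : fpair n = \int[P]_t (g t * fsum phi (2 * m * n) t).
Proof.
pose F := fcoef phi.
have T0 : T false 0 = 0.
  case E : b; first by have := T_other 0; rewrite E.
  have := T_zero; rewrite E; apply => j; by rewrite eq_sym -lt0n muln_gt0 m0.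
pose fk k t := cos (k%:R * t) * F false k + sin (k%:R * t) * F true k.
have iF k : P.-integrable [set: TR] (EFin \o (fun t => g t * fk k t)) /\
    \int[P]_t (g t * fk k t) = T b k * F b k.
  have j1 : P.-integrable [set: TR] (EFin \o (fun t => F false k * (g t * trig false k t))).
    by have := integrableZl measurableT (F false k) (iT false k); apply: eq_integrable.
  have j2 : P.-integrable [set: TR] (EFin \o (fun t => F true k * (g t * trig true k t))).
    by have := integrableZl measurableT (F true k) (iT true k); apply: eq_integrable.
  have -> : (fun t => g t * fk k t) = (fun t => F false k * (g t * trig false k t) + F true k * (g t * trig true k t)).
    by apply/funext => t; rewrite /fk /trig; ring.
  split; first by have := integrableD measurableT j1 j2; apply: eq_integrable.
  rewrite RintegralD// !RintegralZl// -/(T false k) -/(T true k).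
  by have := T_other k; case: (b) => /= ->; ring.
have [I1 E1] := @Rintegral_sum_nat _ _ _ P (fun k t => g t * fk k t) 1 (2 * m * n) (fun k _ => (iF k).1).
have E t : g t * fsum phi (2 * m * n) t = ((2 * pi)^-1 * F false 0) * (g t * trig false 0 t) +
    pi^-1 * \sum_(1 <= k < 2 * m * n) g t * fk k t.
  by rewrite /fsum -mulr_sumr /trig mul0r cos0 /F; ring.
under eq_Rintegral do rewrite E.
have j1 : P.-integrable [set: TR] (EFin \o (fun t => ((2 * pi)^-1 * F false 0) * (g t * trig false 0 t))).
  by have := integrableZl measurableT ((2 * pi)^-1 * F false 0) (iT false 0); apply: eq_integrable.
have j2 : P.-integrable [set: TR] (EFin \o (fun t => pi^-1 * \sum_(1 <= k < 2 * m * n) g t * fk k t)).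
  by have := integrableZl measurableT pi^-1 I1; apply: eq_integrable.
rewrite RintegralD// !RintegralZl// -/(T false 0) T0 mulr0 add0r E1 /fpair; congr (_ * _).
under [RHS]eq_bigr do rewrite (iF _).2.
have Tb0 : T b 0 = 0.
  case E' : b; last exact: T0.
  transitivity (\int[P]_t (0 : R)); last by rewrite /Rintegral integral0.
  by apply: eq_Rintegral => t _; rewrite /trig mul0r sin0 mulr0.
transitivity (\sum_(0 <= k < 2 * m * n) T b k * F b k); last first.
  have [|n0] := posnP n; first by move=> ->; rewrite !muln0 !big_geq.
  by rewrite [LHS]big_ltn ?Tb0 ?mul0r ?add0r// !muln_gt0 m0.
elim: n {I1 E1 E j1 j2} => [|n IH]; first by rewrite !muln0 !big_geq.
rewrite big_nat_recr//= IH.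
pose k0 := (m * n.*2.+1)%N.
have e2 a : (2 * m * a = m * a.*2)%N by rewrite -mul2n mulnCA mulnA.
have k1 : (2 * m * n <= k0)%N by rewrite e2 leq_pmul2l.
have k2 : (k0 < 2 * m * n.+1)%N by rewrite e2 doubleS ltn_pmul2l.
rewrite [RHS](big_cat_nat (n := 2 * m * n))//=; last by rewrite leq_pmul2l// muln_gt0 m0.
congr (_ + _); rewrite [RHS](big_cat_nat (n := k0))//= ?(ltnW k2)//.
have Tz k : (2 * m * n <= k < 2 * m * n.+1)%N -> k != k0 -> T b k = 0.
  move=> /andP[h1 h2] kk0; apply: T_zero => j; apply: contraNneq kk0 => kE.
  rewrite kE e2 in h1; rewrite kE e2 in h2.
  rewrite leq_pmul2l// in h1; rewrite ltn_pmul2l// in h2.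
  rewrite kE /k0; suff -> : j = n by [].
  lia.
rewrite big_nat big1 ?add0r => [|k /andP[h1 h2]]; last first.
  by rewrite Tz ?mul0r ?h1 ?(ltn_trans h2)// ltn_eqF.
rewrite big_ltn// -/k0 big_nat big1 ?addr0// => k /andP[h1 h2].
by rewrite Tz ?mul0r ?h2 ?andbT ?(leq_trans k1 (ltnW h1))// gtn_eqF.
Qed.

Let fsum_bd n t : `|fsum phi n t| <= M + c * K.
Proof.
have -> : fsum phi n t = fsum phi n.-1.+1 t by case: n => //; rewrite /fsum !big_geq.
rewrite -[fsum _ _ _](subrK (phi t)) addrC; apply: (le_trans (ler_normD _ _)); apply: lerD => //.
exact: (fsum_err K0 lip bd c0 cP).
Qed.

Let mfsum n : measurable_fun [set: TR] (fsum phi n).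
Proof.
apply: measurable_funD => //; apply: measurable_funM => //.
apply: measurable_sum => k; apply: measurable_funD; apply: measurable_funM => //.
- exact: (measurable_trig false k).
- exact: (measurable_trig true k).
Qed.

Let MK : 0 <= M + c * K.
Proof. by apply: le_trans (fsum_bd 0 0). Qed.

Let inorm : P.-integrable [set: TR] (EFin \o (fun t => (M + c * K) * `|g t|)).
Proof.
by have := integrableZl measurableT (M + c * K) (integrable_norm ig); apply: eq_integrable.
Qed.

Let gfs_bd n t : `|g t * fsum phi n t| <= (M + c * K) * `|g t|.
Proof. by rewrite normrM mulrC ler_wpM2r// fsum_bd. Qed.

Lemma fpair_bound n : `|fpair n| <= (M + c * K) * \int[P]_t `|g t|.
Proof.
have mf : measurable_fun [set: TR] (fun t => g t * fsum phi (2 * m * n) t) by exact: measurable_funM.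
have i1 : P.-integrable [set: TR] (EFin \o (fun t => g t * fsum phi (2 * m * n) t)).
  apply: (le_integrable measurableT _ _ inorm); first exact/measurable_EFinP.
  by move=> t _ /=; rewrite lee_fin (le_trans (gfs_bd _ _))// ler_norm.
rewrite fpairE -RintegralZl//; last exact: integrable_norm.
apply: (le_trans (le_normr_Rintegral measurableT i1)); apply: le_Rintegral => //.
exact: (integrable_norm i1).
Qed.

(** As g is only integrable, convergence is asked of the partial sums of phi instead: they converge
    pointwise and are uniformly bounded, so the integrals against g converge by domination. *)
Lemma fpair_cvg : fpair n @[n --> \oo] --> \int[P]_t (g t * phi t).
Proof.
under eq_fun do rewrite fpairE.
apply: (Rint_dominated _ _ _ inorm).
- by move=> n; exact: measurable_funM.
- exact: measurable_funM.
- apply: aeW => t; apply: cvgMr.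
  have h := @fsum_cvg phi K M c K0 lip bd c0 cP t.
  apply: (cvg_comp (fun n => (2 * m * n)%N) (fsum phi ^~ t) _ h) => A [N _ NA].
  exists N => // n /= Nn; apply: NA; rewrite /= (leq_trans Nn)// leq_pmull// muln_gt0 m0//.
- by move=> n; apply: aeW => t; exact: gfs_bd.
Qed.

End pairing.
End period.

(** * Smooth functions of row vectors *)

Section measurability.
Context {R : realType}.
Local Notation TR := (measurableTypeR R).

Lemma measurable_glue d (X : measurableType d) (K : countType) (h : X -> K)
    d' (Y : measurableType d') (F : K -> X -> Y) :
  (forall k, measurable (h @^-1` [set k])) -> (forall k, measurable_fun [set: X] (F k)) ->
  measurable_fun [set: X] (fun x => F (h x) x).
Proof.
move=> mh mF _ B mB; rewrite setTI.
have -> : (fun x => F (h x) x) @^-1` B = \bigcup_k (h @^-1` [set k] `&` (F k @^-1` B)).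
  apply/seteqP; split => [x /= Bx|x [k _ [/= <-]]] //.
  by exists (h x).
apply: countable_bigcupT_measurable; first exact: countableP.
by move=> k; apply: measurableI => //; rewrite -[X in measurable X]setTI; exact: mF.
Qed.

Definition dyad (n : nat) (k : int) : R := k%:~R / 2 ^+ n.
Definition dfloor (n : nat) (t : R) : int := Num.floor (2 ^+ n * t).

Lemma dyad_floor n t : dyad n (dfloor n t) <= t < dyad n (dfloor n t) + 2^-1 ^+ n.
Proof.
have p : 0 < 2 ^+ n :> R by rewrite exprn_gt0.
have := floor_itv (2 ^+ n * t); rewrite -/(dfloor n t) intrD => /andP[h1 h2].
rewrite /dyad ler_pdivrMr// mulrC h1 /= -(ltr_pM2l p) mulrDr mulrCA divff ?gt_eqF// mulr1.
by rewrite exprVn divff ?gt_eqF.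
Qed.

Lemma dyad_dist n t : `|t - dyad n (dfloor n t)| <= 2^-1 ^+ n.
Proof.
have /andP[h1 h2] := dyad_floor n t; rewrite ger0_norm ?subr_ge0//.
by rewrite lerBlDl ltW.
Qed.

Lemma measurable_dfloor n k : measurable (dfloor n @^-1` [set k] : set TR).
Proof.
have p : 0 < 2 ^+ n :> R by rewrite exprn_gt0.
have -> : (dfloor n @^-1` [set k] : set TR) = `[dyad n k, (dyad n (k + 1))[%classic.
  apply/seteqP; split => t /=; rewrite in_itv/= /dyad ler_pdivrMr// ltr_pdivlMr// mulrC.
    by move=> <-; exact: floor_itv.
  by move=> h; exact: floor_def.
exact: measurable_itv.
Qed.

Context {N : nat}.
Local Notation E := 'rV[R]_N.

Definition dyadv n (k : 'rV[int]_N) : E := \row_i dyad n (k ord0 i).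
Definition dfloorv n (x : E) : 'rV[int]_N := \row_i dfloor n (x ord0 i).

Lemma mx_norm_le (x : E) (c : R) : 0 <= c -> (forall i, `|x ord0 i| <= c) -> `|x| <= c.
Proof.
move=> c0 xc; rewrite [`|x|]mx_normrE; apply: bigmax_le => // -[i j] _ /=.
by rewrite ord1.
Qed.

Lemma mx_norm_ge (x : E) i : `|x ord0 i| <= `|x|.
Proof.
rewrite [in leRHS]/Num.norm/= [leRHS]mx_normrE.
exact: (le_bigmax (0 : R) (fun ij : 'I_1 * 'I_N => `|x ij.1 ij.2|) (ord0, i)).
Qed.

Lemma dyadv_dist n x : `|x - dyadv n (dfloorv n x)| <= 2^-1 ^+ n.
Proof.
apply: mx_norm_le => [|i]; first by rewrite exprn_ge0// invr_ge0.
by rewrite !mxE; exact: dyad_dist.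
Qed.

Lemma measurable_dfloorv n k : measurable (dfloorv n @^-1` [set k] : set E).
Proof.
have -> : (dfloorv n @^-1` [set k] : set E) = \bigcap_(i in [set: 'I_N])
    ((fun v : E => v ord0 i) @^-1` (dfloor n @^-1` [set k ord0 i])).
  apply/seteqP; split => [x /= <- i _|x /= h]; first by rewrite /= mxE.
  by apply/rowP => i; rewrite mxE; exact: (h i I).
apply: fin_bigcap_measurable => // i _.
by rewrite -[X in measurable X]setTI; apply: measurable_rV_coord => //; exact: measurable_dfloor.
Qed.

Lemma half_cvg0 : (2^-1 : R) ^+ n @[n --> \oo] --> 0.
Proof. by apply: cvg_expr; rewrite ger0_norm ?invr_ge0// invf_lt1// ltr1n. Qed.

Lemma geom_cvg (V : normedModType R) (u : nat -> V) (x : V) :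
  (forall n, `|x - u n| <= 2^-1 ^+ n) -> u n @[n --> \oo] --> x.
Proof.
move=> ux; apply/cvgrPdist_lt => eps eps0.
have /cvgrPdist_lt /(_ _ eps0) := half_cvg0; apply: filterS => n.
by rewrite sub0r normrN ger0_norm ?exprn_ge0 ?invr_ge0// => h; exact: le_lt_trans (ux n) h.
Qed.

Lemma measurable_pointwise_cvg d (X : measurableType d) (f_ : nat -> X -> R) (f : X -> R) :
  (forall n, measurable_fun [set: X] (f_ n)) -> (forall x, f_ n x @[n --> \oo] --> f x) ->
  measurable_fun [set: X] f.
Proof.
move=> mf fc; have -> : f = (fun x => flim (f_ ^~ x)).
  by apply/funext => x; rewrite (cvg_flim (fc x)).
exact: measurable_flim.
Qed.

(** The sigma-algebra is generated by the coordinates, so f is exhibited as the limit of its values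
    at the dyadic grid points, each approximation being constant on countably many measurable
    cells. *)
Lemma continuous_measurable_rV (f : E -> R) : continuous f -> measurable_fun [set: E] f.
Proof.
move=> cf; apply: (@measurable_pointwise_cvg _ _ (fun n x => f (dyadv n (dfloorv n x)))).
  move=> n; apply: (@measurable_glue _ _ _ (dfloorv n) _ _ (fun k _ => f (dyadv n k))) => // k.
  exact: measurable_dfloorv.
by move=> x; apply: (cvg_comp _ f); [exact: geom_cvg (dyadv_dist ^~ x)|exact: cf].
Qed.

Lemma continuous_measurable_spacetime (f : R * E -> R) : continuous f ->
  measurable_fun [set: TR * E] f.
Proof.
move=> cf.
apply: (@measurable_pointwise_cvg _ _ (fun n z => f (dyad n (dfloor n z.1), dyadv n (dfloorv n z.2)))).
  move=> n; apply: (@measurable_glue _ _ _ (fun z => (dfloor n z.1, dfloorv n z.2)) _ _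
    (fun k _ => f (dyad n k.1, dyadv n k.2))) => // -[k k'].
  have -> : (fun z : TR * E => (dfloor n z.1, dfloorv n z.2)) @^-1` [set (k, k')] =
     (dfloor n @^-1` [set k]) `*` (dfloorv n @^-1` [set k']).
    by apply/seteqP; split => [[t x] /= [<- <-]|[t x] /= [<- <-]].
  by apply: measurableX; [exact: measurable_dfloor|exact: measurable_dfloorv].
move=> [t x] /=; apply: (cvg_comp (fun n => (dyad n (dfloor n t), dyadv n (dfloorv n x))) f); last exact: cf.
have h1 := @geom_cvg R (fun n => dyad n (dfloor n t)) t (dyad_dist ^~ t).
have h2 := geom_cvg (dyadv_dist ^~ x).
exact: (cvg_pair h1 h2).
Qed.

End measurability.

Section derivatives.
Context {R : realType}.

(** Along an affine map the two difference quotients are the same function of h, so directional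
    derivatives pull back without any differentiability. *)
Lemma derive_comp_line (V W : normedModType R) (j : V -> W) (v a : V) (w : W) (f : W -> R) :
  (forall h : R, j (h *: v + a) = h *: w + j a) ->
  'D_v (fun x => f (j x)) a = 'D_w f (j a) /\
  (derivable f (j a) w -> derivable (fun x => f (j x)) a v).
Proof.
move=> ja.
have E : (fun h : R => h^-1 *: (((fun x => f (j x)) \o shift a) (h *: v) - f (j a))) =
    (fun h : R => h^-1 *: ((f \o shift (j a)) (h *: w) - f (j a))).
  by apply/funext => h /=; rewrite ja.
by rewrite /derive /derivable E.
Qed.

Lemma smooth_continuous (V : normedModType R) (f : V -> R) : smooth f -> continuous f.
Proof. by move=> /(_ [::])[]. Qed.

Lemma smooth_derivable (V : normedModType R) (f : V -> R) x v : smooth f -> derivable f x v.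
Proof. by move=> /(_ [::])[_]; exact. Qed.

Lemma iter_derive_rcons (V : normedModType R) (s : seq V) v (f : V -> R) :
  iter_derive (rcons s v) f = iter_derive s (fun x => 'D_v f x).
Proof. by rewrite /iter_derive foldr_rcons. Qed.

Lemma smooth_derive (V : normedModType R) (f : V -> R) v : smooth f -> smooth (fun x => 'D_v f x).
Proof. by move=> sf s; have := sf (rcons s v); rewrite iter_derive_rcons. Qed.

Lemma iter_derive_cat (V : normedModType R) (s t : seq V) (f : V -> R) :
  iter_derive (s ++ t) f = iter_derive s (iter_derive t f).
Proof. by rewrite /iter_derive foldr_cat. Qed.

Lemma smooth_iter_derive (V : normedModType R) (f : V -> R) s : smooth f -> smooth (iter_derive s f).
Proof. by move=> sf t; have := sf (t ++ s); rewrite iter_derive_cat. Qed.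

Lemma iter_derive_comp_line (V W : normedModType R) (j : V -> W) (l : V -> W) (f : W -> R) :
  (forall v a (h : R), j (h *: v + a) = h *: l v + j a) -> smooth f ->
  forall s, iter_derive s (fun x => f (j x)) = (fun x => iter_derive (map l s) f (j x)).
Proof.
move=> jl sf; elim=> [//|v s IH].
rewrite /iter_derive/= -/(iter_derive s _) IH; apply/funext => x.
exact: (derive_comp_line (iter_derive (map l s) f) (fun h => jl v x h)).1.
Qed.

Lemma smooth_comp_line (V W : normedModType R) (j : V -> W) (l : V -> W) (f : W -> R) :
  (forall v a (h : R), j (h *: v + a) = h *: l v + j a) -> continuous j -> smooth f ->
  smooth (fun x => f (j x)).
Proof.
move=> jl cj sf s; rewrite (iter_derive_comp_line jl sf); have [cs ds] := sf (map l s); split.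
  by move=> x; apply: (cvg_comp j); [exact: cj|exact: cs].
move=> x v; exact: (derive_comp_line (iter_derive (map l s) f) (fun h => jl v x h)).2 (ds _ _).
Qed.

Lemma derive_off_closed (V : normedModType R) (K : set V) (f : V -> R) v : closed K ->
  (forall x, ~ K x -> f x = 0) -> forall x, ~ K x -> 'D_v f x = 0.
Proof.
move=> cK f0 x nKx; rewrite (@near_eq_derive _ _ _ f (cst 0)).
  by rewrite derive_cst.
have : open_nbhs x (~` K) by split => //; exact: closed_openC.
by move=> /open_nbhs_nbhs; apply: filterS => y /f0.
Qed.

Lemma iter_derive_off_closed (V : normedModType R) (K : set V) (f : V -> R) s : closed K ->
  (forall x, ~ K x -> f x = 0) -> forall x, ~ K x -> iter_derive s f x = 0.
Proof.
move=> cK f0; elim: s => [//|v s IH].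
exact: derive_off_closed.
Qed.

End derivatives.

Section box.
Context {R : realType}.
Local Notation TR := (measurableTypeR R).

Definition box N (M : R) : set 'rV[R]_N := [set x | forall i, x ord0 i \in `[- M, M]].

Lemma boxP N (M : R) (x : 'rV[R]_N) : box M x <-> forall i, `|x ord0 i| <= M.
Proof. by split=> h i; have := h i; rewrite in_itv/= ler_norml. Qed.

Lemma measurable_box N M : measurable (@box N M).
Proof.
have -> : @box N M = \bigcap_(i in [set: 'I_N]) ((fun v : 'rV[R]_N => v ord0 i) @^-1` `[- M, M]).
  by apply/seteqP; split => [x h i _|x h i]; [exact: h|exact: (h i I)].
apply: fin_bigcap_measurable => // i _.
by rewrite -[X in measurable X]setTI; apply: measurable_rV_coord => //; exact: measurable_itv.
Qed.

Lemma box_lty N M : (lebesgue_rV N (@box N M) < +oo)%E.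
Proof.
rewrite /box (lebesgue_rV_box (A := fun=> `[- M, M]%classic)); last by move=> i; exact: measurable_itv.
have : (\prod_(i < N) lebesgue_measure `[(- M)%R, M] : \bar R)%E \is a fin_num.
  elim/big_ind: _ => [//|a b|i _]; first exact: fin_numM.
  by rewrite lebesgue_measure_itv/=; case: ifP.
by rewrite fin_numElt => /andP[].
Qed.

Lemma closed_box N M : closed (@box N M).
Proof.
have -> : @box N M = \bigcap_(i in [set: 'I_N]) ((fun v : 'rV[R]_N => v ord0 i) @^-1` `[- M, M]).
  by apply/seteqP; split => [x h i _|x h i]; [exact: h|exact: (h i I)].
apply: closed_bigI => i _; apply: preimage_closed; last exact: itv_closed.
by move=> x _; exact: coord_continuous.
Qed.

Lemma compact_in_box N (K : set 'rV[R]_N) : compact K -> exists2 M : R, 0 <= M & K `<=` @box N M.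
Proof.
move=> /compact_bounded [A [Areal HA]]; exists (`|A| + 1); first by rewrite addr_ge0.
move=> x Kx; apply/boxP => i; apply: (le_trans (mx_norm_ge x i)); apply: HA => //.
by rewrite (le_lt_trans (ler_norm A))// ltrDl.
Qed.

Lemma compact_box N M : compact (@box N M).
Proof.
apply: bounded_closed_compact; last exact: closed_box.
exists `|M|; split; first exact: num_real.
move=> B MB x /boxP xM; apply: mx_norm_le => [|i]; first by rewrite ltW// (le_lt_trans _ MB).
by rewrite (le_trans (xM i))// (le_trans (ler_norm _))// ltW.
Qed.

Lemma bounded_box_integrable N (f : 'rV[R]_N -> R) (M B : R) : measurable_fun [set: 'rV[R]_N] f ->
  (forall x, ~ @box N M x -> f x = 0) -> (forall x, `|f x| <= B) ->
  (lebesgue_rV N).-integrable [set: 'rV[R]_N] (EFin \o f).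
Proof.
move=> mf f0 fB; have mB := measurable_box (N := N) M.
have i1 : (lebesgue_rV N).-integrable (@box N M) (EFin \o f).
  apply: measurable_bounded_integrable => //; first exact: box_lty.
    exact: measurable_funTS.
  by exists B; split; [exact: num_real|move=> C BC x _ /=; rewrite (le_trans (fB x))// ltW].
have := (integrable_mkcond (EFin \o f) mB).1 i1.
suff -> : (EFin \o f) \_ (@box N M) = EFin \o f by [].
apply/funext => x; rewrite patchE; case: ifPn => // /negP h /=; rewrite f0// => h'.
by apply: h; rewrite inE.
Qed.

Lemma continuous_supported_bounded N (f : 'rV[R]_N -> R) M : continuous f ->
  (forall x, ~ @box N M x -> f x = 0) -> exists B, forall x, `|f x| <= B.
Proof.
move=> cf f0.
have : compact (f @` @box N M).
  by apply: continuous_compact; [exact: continuous_subspaceT|exact: compact_box].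
move=> /compact_bounded [A [Areal HA]]; exists (`|A| + 1) => x.
have A1 : A < `|A| + 1 by rewrite (le_lt_trans (ler_norm A))// ltrDl.
have [bx|nbx] := pselect (@box N M x); first by apply: HA => //; exists x.
by rewrite f0// normr0 addr_ge0.
Qed.

Lemma continuous_supported_integrable N (f : 'rV[R]_N -> R) M : continuous f ->
  (forall x, ~ @box N M x -> f x = 0) ->
  (lebesgue_rV N).-integrable [set: 'rV[R]_N] (EFin \o f).
Proof.
move=> cf f0; have [B fB] := continuous_supported_bounded cf f0.
exact: bounded_box_integrable (continuous_measurable_rV cf) f0 fB.
Qed.

Lemma Rint_lebesgue_rVS N (f : 'rV[R]_N.+1 -> R) :
  (lebesgue_rV N.+1).-integrable [set: 'rV[R]_N.+1] (EFin \o f) ->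
  (lebesgue_measure \x lebesgue_rV N)%E.-integrable setT (EFin \o (fun z => f (rV_cons z))) /\
  \int[lebesgue_rV N.+1]_x f x = \int[(lebesgue_measure \x lebesgue_rV N)%E]_z f (rV_cons z).
Proof.
move=> iF; have mF := measurable_int _ iF.
have mc := @measurable_rV_cons R N.
have i2 : (lebesgue_measure \x lebesgue_rV N)%E.-integrable setT (EFin \o (fun z => f (rV_cons z))).
  apply/integrableP; split; first exact: (measurableT_comp mF mc).
  move/integrableP: iF => [_]; apply: le_lt_trans.
  have mA : measurable_fun setT (fun x => `|(EFin \o f) x|)%E by exact: measurableT_comp.
  have := @ge0_integral_pushforward _ _ _ _ R (@rV_cons R N) mc (lebesgue_measure \x lebesgue_rV N)%E setT _ measurableT mA.
  move=> /(_ (fun x _ => abse_ge0 _)); rewrite preimage_setT => h.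
  by rewrite [leRHS]h.
split => //; rewrite /Rintegral; congr fine.
have := @integral_pushforward _ _ _ _ R (@rV_cons R N) mc (lebesgue_measure \x lebesgue_rV N)%E setT (EFin \o f) mF.
by rewrite preimage_setT => /(_ i2 measurableT).
Qed.

Lemma rV_cons_tail N (x0 : R) (v a : 'rV[R]_N) (h : R) :
  rV_cons (x0, h *: v + a) = h *: rV_cons (0, v) + rV_cons (x0, a).
Proof.
apply/rowP => i; rewrite !mxE; case: (unliftP ord0 i) => [j|] _ /=; rewrite ?mxE//.
by rewrite mulr0 add0r.
Qed.

Lemma rV_cons_head N (y : 'rV[R]_N) (h a : R) (v : R) :
  rV_cons (h *: v + a, y) = h *: rV_cons (v, 0 : 'rV[R]_N) + rV_cons (a, y).
Proof.
apply/rowP => i; rewrite !mxE; case: (unliftP ord0 i) => [j|] _ /=; rewrite ?mxE//.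
by rewrite mulr0 add0r.
Qed.

Lemma rV_cons_basis0 N : rV_cons (1, 0 : 'rV[R]_N) = basis_vec ord0.
Proof.
apply/rowP => i; rewrite !mxE eqxx /=; case: (unliftP ord0 i) => [j|] -> /=; rewrite ?mxE ?eqxx//.
Qed.

Lemma rV_cons_basisS N (j : 'I_N) : rV_cons (0, basis_vec j : 'rV[R]_N) = basis_vec (lift ord0 j).
Proof.
apply/rowP => i; rewrite !mxE eqxx /=; case: (unliftP ord0 i) => [k|] -> /=; rewrite ?mxE ?eqxx/=.
  by rewrite (inj_eq lift_inj).
by [].
Qed.

Lemma nonexpansive_continuous (V W : normedModType R) (f : V -> W) :
  (forall x y, `|f x - f y| <= `|x - y|) -> continuous f.
Proof.
move=> lf x; apply/cvgrPdist_lt => eps eps0.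
have /cvgrPdist_lt /(_ _ eps0) : y @[y --> x] --> x by exact: cvg_id.
by apply: filterS => y; exact: le_lt_trans.
Qed.

Lemma continuous_rV_cons_tail N (x0 : R) : continuous (fun y : 'rV[R]_N => rV_cons (x0, y)).
Proof.
apply: (@nonexpansive_continuous 'rV[R]_N 'rV[R]_N.+1) => y y'.
apply: mx_norm_le => // i; rewrite !mxE.
case: (unliftP ord0 i) => [j|] _ /=; last by rewrite subrr normr0.
by have := mx_norm_ge (y - y') j; rewrite !mxE.
Qed.

Lemma continuous_rV_cons_head N (y : 'rV[R]_N) : continuous (fun x0 : R => rV_cons (x0, y)).
Proof.
apply: (@nonexpansive_continuous R 'rV[R]_N.+1) => x x'.
apply: mx_norm_le => // i; rewrite !mxE.
by case: (unliftP ord0 i) => [j|] _ //=; rewrite subrr normr0.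
Qed.

Lemma box_cons N M (x0 : R) (y : 'rV[R]_N) : @box N.+1 M (rV_cons (x0, y)) -> `|x0| <= M /\ @box N M y.
Proof.
move=> /boxP h; split; first by have := h ord0; rewrite mxE unlift_none.
by apply/boxP => i; have := h (lift ord0 i); rewrite mxE liftK.
Qed.

Lemma Rint_derivative0 (g g' : R -> R) M : (forall t : R, is_derive t 1 g (g' t)) -> continuous g' ->
  (forall t, M < `|t| -> g t = 0) -> (forall t, M < `|t| -> g' t = 0) ->
  \int[@lebesgue_measure R]_t g' t = 0.
Proof.
move=> dg cg' g0 g'0; pose B := `|M| + 1.
have B0 : - B < B by have := normr_ge0 M; rewrite /B; lra.
have BM : M < B by rewrite /B (le_lt_trans (ler_norm M))// ltrDl.
have cg t : {for t, continuous g}.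
  by apply: differentiable_continuous; apply/derivable1_diffP; exact: ex_derive.
rewrite /Rintegral.
have -> : (fun t : R => (g' t)%:E) = (EFin \o g') \_ `[- B, B].
  apply/funext => t; rewrite patchE; case: ifPn => // /negP h /=; rewrite g'0//.
  rewrite ltNge; apply/negP => tM; apply: h; rewrite inE/= in_itv/= -ler_norml.
  by rewrite (le_trans tM)// ltW.
rewrite -integral_mkcond (@continuous_FTC2 _ g' g (- B) B B0)//.
- have B1 : 0 <= B by rewrite addr_ge0.
  by rewrite (g0 B) ?(ger0_norm B1)// (g0 (- B)) ?normrN ?(ger0_norm B1)// subee.
- exact: continuous_subspaceT.
- split.
  + by move=> t _; exact: ex_derive.
  + by apply: cvg_at_right_filter; exact: cg.
  + by apply: cvg_at_left_filter; exact: cg.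
- by move=> t _; rewrite derive1E; exact: derive_val.
Qed.

(** Induction on the dimension after splitting off the first coordinate. A derivative in that
    coordinate integrates to 0 on every line by compact support; any other one is treated on the
    slices. *)
Lemma Rint_partial0 N (i : 'I_N) (F : 'rV[R]_N -> R) (M : R) : continuous F ->
  (forall x, derivable F x (basis_vec i)) -> continuous (fun x => 'D_(basis_vec i) F x) ->
  (forall x, ~ @box N M x -> F x = 0) ->
  \int[lebesgue_rV N]_x 'D_(basis_vec i) F x = 0.
Proof.
elim: N i F => [[]//|N IH] i F cF dF cD F0.
have D0 : forall x, ~ @box N.+1 M x -> 'D_(basis_vec i) F x = 0.
  exact: derive_off_closed (@closed_box N.+1 M) F0.
have [i2 ->] := Rint_lebesgue_rVS (continuous_supported_integrable cD D0).
case: (unliftP ord0 i) => [j|] iE; last first.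
  rewrite (Rint_prod21 i2) (_ : (fun x => _) = fun=> 0); first by rewrite /Rintegral integral0.
  apply/funext => y.
  have lineE (t : R) : 'D_1 (fun t : R => F (rV_cons (t, y))) t = 'D_(basis_vec i) F (rV_cons (t, y)) /\
     (derivable F (rV_cons (t, y)) (basis_vec i) -> derivable (fun t : R => F (rV_cons (t, y))) t 1).
    apply: (@derive_comp_line _ _ _ (fun t : R => rV_cons (t, y))) => h.
    by rewrite iE -rV_cons_basis0; exact: (rV_cons_head y h t 1).
  apply: (@Rint_derivative0 (fun t => F (rV_cons (t, y))) _ M).
  - move=> t; apply: DeriveDef; [exact: (lineE t).2|exact: (lineE t).1].
  - by move=> t; exact: (cvg_comp (fun t : R => rV_cons (t, y)) (fun x => 'D_(basis_vec i) F x) (continuous_rV_cons_head (y := y) (x := t)) (cD _)).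
  - by move=> t Mt; apply: F0 => /box_cons[]; rewrite leNgt Mt.
  - by move=> t Mt; apply: D0 => /box_cons[]; rewrite leNgt Mt.
rewrite (Rint_prod12 i2) (_ : (fun t => _) = fun=> 0); first by rewrite /Rintegral integral0.
apply/funext => t.
have lineE (y : 'rV[R]_N) : 'D_(basis_vec j) (fun y => F (rV_cons (t, y))) y = 'D_(basis_vec i) F (rV_cons (t, y)) /\
   (derivable F (rV_cons (t, y)) (basis_vec i) -> derivable (fun y => F (rV_cons (t, y))) y (basis_vec j)).
  apply: (@derive_comp_line _ _ _ (fun y : 'rV[R]_N => rV_cons (t, y))) => h.
  by rewrite iE -rV_cons_basisS; exact: rV_cons_tail.
have -> : (fun x => 'D_(basis_vec i) F (rV_cons (t, x))) = (fun y => 'D_(basis_vec j) (fun y => F (rV_cons (t, y))) y).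
  by apply/funext => y; rewrite (lineE y).1.
apply: IH.
- by move=> y; exact: (cvg_comp (fun y : 'rV[R]_N => rV_cons (t, y)) F (continuous_rV_cons_tail (x0 := t) (x := y)) (cF _)).
- by move=> y; exact: (lineE y).2.
- have -> : (fun y => 'D_(basis_vec j) (fun y => F (rV_cons (t, y))) y) = (fun x => 'D_(basis_vec i) F (rV_cons (t, x))).
    by apply/funext => y; rewrite (lineE y).1.
  by move=> y; exact: (cvg_comp (fun y : 'rV[R]_N => rV_cons (t, y)) (fun x => 'D_(basis_vec i) F x) (continuous_rV_cons_tail (x0 := t) (x := y)) (cD _)).
- by move=> y nb; apply: F0 => /box_cons[_].
Qed.

End box.

(** * Weak derivatives *)

Section by_parts.
Context {R : realType} {N : nat}.
Local Notation E := 'rV[R]_N.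
Local Notation leb := (lebesgue_rV N).

Lemma Rint_ibp (i : 'I_N) (phi psi : E -> R) M : smooth phi -> smooth psi ->
  (forall x, ~ box M x -> psi x = 0) ->
  \int[leb]_x (phi x * 'D_(basis_vec i) psi x) = - \int[leb]_x ('D_(basis_vec i) phi x * psi x).
Proof.
move=> sp sq q0; set v := basis_vec i.
have cp := smooth_continuous sp; have cq := smooth_continuous sq.
have cDp := smooth_continuous (smooth_derive v sp); have cDq := smooth_continuous (smooth_derive v sq).
have Dq0 := derive_off_closed v (@closed_box R N M) q0.
have DM x : 'D_v (phi * psi) x = phi x * 'D_v psi x + 'D_v phi x * psi x.
  rewrite deriveM; [|exact: smooth_derivable|exact: smooth_derivable].
  by rewrite /GRing.scale/= [psi x * _]mulrC.
have c1 : continuous (fun x => phi x * 'D_v psi x) by move=> x; exact: (cvgM (cp x) (cDq x)).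
have c2 : continuous (fun x => 'D_v phi x * psi x) by move=> x; exact: (cvgM (cDp x) (cq x)).
have i1 : leb.-integrable [set: E] (EFin \o (fun x => phi x * 'D_v psi x)).
  by apply: (continuous_supported_integrable (M := M) c1) => x nb; rewrite Dq0// mulr0.
have i2 : leb.-integrable [set: E] (EFin \o (fun x => 'D_v phi x * psi x)).
  by apply: (continuous_supported_integrable (M := M) c2) => x nb; rewrite q0// mulr0.
have DE : (fun x => 'D_v (phi * psi) x) = (fun x => phi x * 'D_v psi x + 'D_v phi x * psi x).
  by apply/funext => x; rewrite DM.
have h : \int[leb]_x 'D_v (phi * psi) x = 0.
  apply: (@Rint_partial0 R N i (phi * psi) M).
  - by move=> x; exact: (cvgM (cp x) (cq x)).
  - by move=> x; apply: derivableM; exact: smooth_derivable.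
  - by rewrite DE => x; exact: (cvgD (c1 x) (c2 x)).
  - move=> x nb; have -> : (phi * psi) x = phi x * psi x by [].
    by rewrite q0// mulr0.
by move/eqP: h; rewrite DE RintegralD// addr_eq0 => /eqP.
Qed.

Lemma test_fun_box (psi : E -> R) : test_fun psi ->
  exists2 M, 0 <= M & forall x, ~ box M x -> psi x = 0.
Proof.
move=> [_ [K cK K0]]; have [M M0 KM] := compact_in_box cK.
by exists M => // x nb; apply: K0 => Kx; apply: nb; exact: KM.
Qed.

(** Integration by parts moves the outermost derivative of the test function first, and it becomes
    the innermost one on [phi]. The list is therefore reversed, and symmetry of mixed derivatives is
    not called upon. *)
Lemma weak_derivative_smooth (s : seq 'I_N) (phi : E -> R) : smooth phi ->
  weak_derivative s phi (iter_derive (rev (map basis_vec s)) phi).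
Proof.
move=> sp psi tp; have [M _ q0] := test_fun_box tp; have sq := tp.1.
elim: s phi sp => [|i s IH] phi sp; first by rewrite /= expr0 mul1r.
rewrite /iter_derive /= -/(iter_derive (map basis_vec s) psi).
have -> : \int[leb]_x (phi x * 'D_(basis_vec i) (iter_derive (map basis_vec s) psi) x) =
    - \int[leb]_x ('D_(basis_vec i) phi x * iter_derive (map basis_vec s) psi x).
  apply: (@Rint_ibp i phi _ M sp); first exact: smooth_iter_derive.
  exact: iter_derive_off_closed (@closed_box R N M) q0.
rewrite (IH _ (smooth_derive (basis_vec i) sp)) rev_cons -/(iter_derive (rcons _ _) phi) iter_derive_rcons.
by rewrite exprS mulN1r mulNr.
Qed.

End by_parts.

(** * Smooth bumps *)

Section flat.
Context {R : realType}.

(** The powers of 1/u make the family of the classical exp(-1/u) closed under differentiation, up to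
    linear combinations. *)
Definition flat (k : nat) (u : R) : R := if 0 < u then u^-1 ^+ k * expR (- u^-1) else 0.

Lemma flat_neg k u : u <= 0 -> flat k u = 0.
Proof. by move=> u0; rewrite /flat ltNge u0. Qed.

(** With y = 1/u, the (k+1)-st power of y/(k+1) <= exp(y/(k+1)) bounds y^(k+1) by a constant times
    exp y. This linear bound at 0 gives differentiability there. *)
Lemma flat_le k u : `|flat k u| <= k.+1%:R ^+ k.+1 * `|u|.
Proof.
rewrite /flat; case: ifPn => u0; last by rewrite normr0 mulr_ge0// exprn_ge0.
have y0 : 0 < u^-1 by rewrite invr_gt0.
rewrite ger0_norm; last by rewrite mulr_ge0 ?expR_ge0// exprn_ge0// ltW.
rewrite (ger0_norm (ltW u0)) -(invrK u) invrK; set y := u^-1 in y0 *.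
have k0 : 0 < k.+1%:R :> R by rewrite ltr0n.
have h : (y / k.+1%:R) ^+ k.+1 <= expR y.
  have -> : y = k.+1%:R * (y / k.+1%:R) by field; rewrite addrC natr1 gt_eqF.
  rewrite expRM_natl lerXn2r ?nnegrE ?expR_ge0//.
    by rewrite mulrCA divff ?gt_eqF// mulr1 divr_ge0// ltW.
  rewrite mulrCA divff ?gt_eqF// mulr1.
  by apply: le_trans (expR_ge1Dx _); rewrite lerDr.
rewrite expRN ler_pdivrMr ?expR_gt0// -(ler_pM2r y0) -exprSr.
have -> : k.+1%:R ^+ k.+1 * y^-1 * expR y * y = k.+1%:R ^+ k.+1 * expR y by field; rewrite gt_eqF.
rewrite expr_div_n in h; rewrite mulrC -ler_pdivrMr ?exprn_gt0//.
Qed.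

Let is_derive_invX k (u : R) : u != 0 -> is_derive u 1 (fun x : R => x^-1 ^+ k) (- (k%:R * u^-1 ^+ k.+1)).
Proof.
move=> u0; have h : is_derive u 1 (fun x : R => x^-1) (- u ^- 2).
  have := @is_deriveV R id u 1 1 u0 (is_derive_id _ _).
  by rewrite /GRing.scale/= mulr1.
have -> : (fun x : R => x^-1 ^+ k) = (fun x : R => x^-1) ^+ k by apply/funext => x; rewrite exprfctE.
have := @is_deriveX _ _ (fun x : R => x^-1) k u 1 _ h => h'.
apply: is_derive_eq; rewrite /GRing.scale/=; case: k {h'} => [|k]; first by rewrite !mul0r oppr0.
by rewrite mulrN -exprVn -mulrA -exprD addn2.
Qed.

Lemma is_derive_flat k (u : R) : is_derive u 1 (flat k) (flat k.+2 u - k%:R * flat k.+1 u).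
Proof.
have [u0|u0|->] := ltgtP u 0.
- rewrite !flat_neg ?(ltW u0)// mulr0 subr0.
  have dc : is_derive u 1 (cst 0 : R -> R) 0 := is_derive_cst 0 u 1.
  apply: near_eq_is_derive dc.
  have : \forall x \near u, x < 0 by exact: lt_nbhsl.
  by apply: filterS => x x0; rewrite flat_neg// ltW.
- have un : u != 0 by rewrite gt_eqF.
  have h1 := is_derive_invX k un.
  have h2 : is_derive u 1 (fun x : R => - x^-1) (u^-1 ^+ 2).
    have := is_deriveN (is_derive_invX 1 un); rewrite opprK mul1r.
    by have -> : - (fun x : R => x^-1 ^+ 1) = (fun x : R => - x^-1) by apply/funext => x.
  have h3 := @is_derive1_comp _ (@expR R) (fun x : R => - x^-1) u _ _ (is_derive_expR _) h2.
  have D : is_derive u 1 ((fun x : R => x^-1 ^+ k) * (expR \o (fun x : R => - x^-1))) (flat k.+2 u - k%:R * flat k.+1 u).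
    have h4 := is_deriveM h1 h3; apply: is_derive_eq.
    rewrite /GRing.scale/= /flat u0 !exprS; ring.
  apply: near_eq_is_derive D.
  have : \forall x \near u, 0 < x by exact: lt_nbhsr.
  by apply: filterS => x x0; rewrite /flat x0.
(* At 0 the difference quotient of [flat k] is [flat k.+1], which tends to 0 by [flat_le]. *)
- rewrite !flat_neg// mulr0 subr0.
  have H : (fun h : R => h^-1 *: ((flat k \o shift 0) (h *: 1) - flat k 0)) @ 0^' --> (0 : R).
    apply/cvgrPdist_le => eps eps0; pose c : R := k.+2%:R ^+ k.+2 + 1.
    have c0 : 0 < c by rewrite ltr_wpDl// exprn_ge0.
    have : \forall h \near (0 : R)^', `|h| < eps / c by apply: dnbhs0_lt; rewrite divr_gt0.
    apply: filterS2 (nbhs_dnbhs_neq (0 : R)) => h hn hc.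
    have F0 : flat k 0 = 0 by exact: flat_neg.
    rewrite sub0r normrN F0 subr0 /= /shift/= addr0 /GRing.scale/= mulr1.
    have E : h^-1 * flat k h = flat k.+1 h.
      by rewrite /flat; case: ifP => h0; rewrite ?mulr0// mulrA -exprS.
    rewrite E (le_trans (flat_le _ _))//.
    apply: (@le_trans _ _ (c * `|h|)); first by rewrite ler_wpM2r// lerDl.
    by rewrite mulrC -ler_pdivlMr// ltW.
  exact: DeriveDef (cvgP _ H) (cvg_lim (@Rhausdorff R) H).
Qed.

Lemma continuous_flat k : continuous (flat k).
Proof.
move=> u; apply: differentiable_continuous; apply/derivable1_diffP.
by have h := is_derive_flat k u; exact: ex_derive.
Qed.

Lemma flat0_le1 u : 0 <= flat 0 u <= 1.
Proof.
rewrite /flat; case: ifPn => u0; last by rewrite lexx ler01.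
by rewrite expr0 mul1r expR_ge0 /= -expR0 ler_expR oppr_le0 invr_ge0 ltW.
Qed.

Lemma flat0_cvg (u : nat -> R) (d : R) : 0 < d -> (forall n, n.+1%:R * d <= u n) ->
  flat 0 (u n) @[n --> \oo] --> (1 : R).
Proof.
move=> d0 un.
apply: (@squeeze_cvgr _ _ _ _ (fun n => 1 - d^-1 * n.+1%:R^-1) (fun=> 1)).
- apply: nearW => n; have /andP[_ ->] := flat0_le1 (u n); rewrite andbT.
  have n0 : 0 < n.+1%:R * d by rewrite mulr_gt0// ltr0n.
  have u0 := lt_le_trans n0 (un n).
  rewrite /= /flat u0 expr0 mul1r; apply: le_trans (expR_ge1Dx _); rewrite lerD2l lerN2.
  by rewrite -invfM lef_pV2 ?posrE// mulrC.
- rewrite -[X in _ --> X]subr0; apply: cvgB; first exact: cvg_cst.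
  by rewrite -[X in _ --> X](mulr0 d^-1); apply: cvgMr; exact: cvg_harmonic.
- exact: cvg_cst.
Qed.

Context {N : nat}.
Local Notation E := 'rV[R]_N.

(** A class that contains the bumps and is closed under directional derivatives; smoothness then
    needs first derivatives only, and an induction over the list of directions. *)
Inductive flat_algebra : (E -> R) -> Prop :=
| flat_cst c : flat_algebra (fun=> c)
| flat_coord k (s a : R) i : flat_algebra (fun x => flat k (s * (x ord0 i - a)))
| flat_add f g : flat_algebra f -> flat_algebra g -> flat_algebra (f + g)
| flat_mul f g : flat_algebra f -> flat_algebra g -> flat_algebra (f * g).

Lemma flat_algebra_derive f : flat_algebra f -> continuous f /\
  forall v, (forall x, derivable f x v) /\ flat_algebra (fun x => 'D_v f x).
Proof.
elim=> {f} [c|k s a i|f g _ [cf df] _ [cg dg]|f g af [cf df] ag [cg dg]].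
- split; first exact: cst_continuous.
  move=> v; split; first by move=> x; exact: derivable_cst.
  have -> : (fun x => 'D_v (fun=> c) x) = (fun=> 0) by apply/funext => x; exact: derive_cst.
  exact: flat_cst.
- pose j (x : E) := s * (x ord0 i - a).
  have cj : continuous j.
    have c1 : continuous (fun t : R => s * (t - a)).
      by move=> t; apply: cvgMr; apply: cvgB; [exact: cvg_id|exact: cvg_cst].
    move=> x; exact: (cvg_comp (fun x : E => x ord0 i) _ (@coord_continuous R 1 N ord0 i x) (c1 _)).
  split; first by move=> x; exact: (cvg_comp j (flat k) (cj x) (@continuous_flat k _)).
  move=> v.
  have lineE x : 'D_v (fun x => flat k (j x)) x = 'D_(s * v ord0 i) (flat k) (j x) /\
     (derivable (flat k) (j x) (s * v ord0 i) -> derivable (fun x => flat k (j x)) x v).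
    by apply: (@derive_comp_line R E R j) => h; rewrite /j !mxE /GRing.scale/=; ring.
  have dk y : differentiable (flat k) y.
    by apply/derivable1_diffP; have h := is_derive_flat k y; exact: ex_derive.
  split; first by move=> x; apply: (lineE x).2; exact: diff_derivable.
  have -> : (fun x => 'D_v (fun x => flat k (j x)) x) =
      (fun=> s * v ord0 i) * ((fun x => flat k.+2 (j x)) + (fun=> - k%:R) * (fun x => flat k.+1 (j x))).
    apply/funext => x; rewrite (lineE x).1 deriveE//.
    have -> : s * v ord0 i = (s * v ord0 i) *: (1 : R) by rewrite /GRing.scale/= mulr1.
    rewrite linearZ -deriveE//; have h := is_derive_flat k (j x).
    by rewrite derive_val /GRing.scale/= mulr1 mulNr.
  apply: flat_mul; first exact: flat_cst.
  apply: flat_add; first exact: flat_coord.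
  by apply: flat_mul; [exact: flat_cst|exact: flat_coord].
- split; first by move=> x; exact: (cvgD (cf x) (cg x)).
  move=> v; have [d1 a1] := df v; have [d2 a2] := dg v.
  split; first by move=> x; exact: derivableD.
  have -> : (fun x => 'D_v (f + g) x) = (fun x => 'D_v f x) + (fun x => 'D_v g x).
    by apply/funext => x; exact: deriveD.
  exact: flat_add.
- split; first by move=> x; exact: (cvgM (cf x) (cg x)).
  move=> v; have [d1 a1] := df v; have [d2 a2] := dg v.
  split; first by move=> x; exact: derivableM.
  have -> : (fun x => 'D_v (f * g) x) = f * (fun x => 'D_v g x) + g * (fun x => 'D_v f x).
    by apply/funext => x; exact: deriveM.
  by apply: flat_add; exact: flat_mul.
Qed.

Lemma flat_algebra_smooth f : flat_algebra f -> smooth f.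
Proof.
move=> af s; have {}af : flat_algebra (iter_derive s f).
  elim: s => [//|v s IH]; exact: ((flat_algebra_derive IH).2 v).2.
by have [c d] := flat_algebra_derive af; split => // x v; exact: (d v).1.
Qed.

Lemma flat_algebra_prod (F : 'I_N -> E -> R) : (forall i, flat_algebra (F i)) ->
  flat_algebra (fun x => \prod_i F i x).
Proof.
move=> aF; elim: (index_enum _) => [|i l IH].
  by have -> : (fun x => \prod_(i <- [::]) F i x) = (fun=> 1)
    by [apply/funext => x; rewrite big_nil|]; exact: flat_cst.
have -> : (fun x => \prod_(j <- i :: l) F j x) = F i * (fun x => \prod_(j <- l) F j x).
  by apply/funext => x; rewrite big_cons.
exact: flat_mul.
Qed.

End flat.

(** * A bounded function orthogonal to all test functions vanishes *)

Section fundamental_lemma.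
Context {R : realType}.

(** Dynkin's lemma for vanishing integrals. The map [phi] and the fixed set [S0] allow one side of a
    rectangle to be generalised while the others are kept. *)
Lemma dynkin_Rint d (X : measurableType d) (mu : {measure set X -> \bar R}) d' (Y : measurableType d')
    (phi : X -> Y) (G : set (set Y)) (S0 : set X) (h : X -> R) :
  mu.-integrable [set: X] (EFin \o h) -> measurable S0 -> measurable_fun [set: X] phi ->
  @measurable _ Y = <<s G >> -> setI_closed G ->
  \int[mu]_(x in S0) h x = 0 -> (forall B, G B -> \int[mu]_(x in S0 `&` phi @^-1` B) h x = 0) ->
  forall B, measurable B -> \int[mu]_(x in S0 `&` phi @^-1` B) h x = 0.
Proof.
move=> ih mS mphi GE GI h0 hG.
have mpre B : measurable B -> measurable (S0 `&` phi @^-1` B).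
  by move=> mB; apply: measurableI => //; rewrite -[X in measurable X]setTI; exact: mphi.
have sub A : measurable A -> mu.-integrable A (EFin \o h).
  by move=> mA; exact: (integrableS measurableT mA).
move=> B mB; move: (mB); rewrite GE; apply: (@dynkin_induction _ _ G (fun B => \int[mu]_(x in S0 `&` phi @^-1` B) h x = 0) GE GI) => //.
- by rewrite preimage_setT setIT.
- move=> C mC PC.
  have := @Rintegral_setU _ _ _ mu _ _ h (mpre _ mC) (mpre _ (measurableC mC)).
  have -> : (S0 `&` phi @^-1` C) `|` (S0 `&` phi @^-1` (~` C)) = S0.
    by rewrite -setIUr preimage_setC setUv setIT.
  move=> /(_ (sub _ mS)); rewrite h0 PC add0r => <-//.
  apply/disj_setPS => x [[_ Cx] [_ nCx]]; exact: nCx.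
- move=> F mF tF PF; rewrite preimage_bigcup setI_bigcupr /Rintegral.
  rewrite integral_bigcup.
  + rewrite eseries0// => n _ _.
    have := PF n; rewrite /Rintegral => PFn.
    by rewrite -[LHS]fineK ?PFn//; apply: integrable_fin_num => //; [exact: mpre|exact/sub/mpre].
  + apply/trivIsetP => i j _ _ ij; rewrite setIACA setIid -preimage_setI.
    by rewrite (trivIsetP.1 tF i j)// preimage_set0 setI0.
  + by move=> k; exact: mpre.
  + by apply: sub; apply: bigcup_measurable => k _; exact: mpre.
Qed.

Context {N : nat}.
Local Notation E := 'rV[R]_N.
Local Notation leb := (lebesgue_rV N).

Definition rect (A : 'I_N -> set R) : set E := [set x | forall i, A i (x ord0 i)].

Lemma measurable_rect (A : 'I_N -> set (measurableTypeR R)) : (forall i, measurable (A i)) -> measurable (rect A).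
Proof.
move=> mA; have -> : rect A = \bigcap_(i in [set: 'I_N]) ((fun v : E => v ord0 i) @^-1` A i).
  by apply/seteqP; split => [x h i _|x h i]; [exact: h|exact: (h i I)].
apply: fin_bigcap_measurable => // i _.
by rewrite -[X in measurable X]setTI; apply: measurable_rV_coord => //; exact: mA.
Qed.

Variables (h : E -> R) (C : R).
Hypothesis mh : measurable_fun [set: E] h.
Hypothesis hC : {ae leb, forall x, `|h x| <= C}.
Hypothesis htest : forall psi, test_fun psi -> \int[leb]_x (h x * psi x) = 0.

(** The factors vanish for x_i <= a_i and for x_i >= b_i + 1/n, and the limit is the indicator of a
    half-open box. The factor n^2 is what makes the second argument at least n at the included end
    point b_i. *)
Let bump (a b : 'I_N -> R) n (x : E) : R := \prod_i (flat 0 (n%:R * (x ord0 i - a i)) *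
  flat 0 (n%:R ^+ 2 * (b i + n%:R^-1 - x ord0 i))).

Let pbox a b := rect (fun i => `]a i, b i]%classic).

Let bM (a b : 'I_N -> R) : R := \sum_i (`|a i| + (`|b i| + 1)).

Let bump_off a b n x : ~ box (bM a b) x -> bump a b n.+1 x = 0.
Proof.
apply: contra_notP => /eqP/prodf_neq0 nz; apply/boxP => i.
have := nz i isT; rewrite mulf_eq0 negb_or => /andP[n1 n2].
have n0 : 0 < n.+1%:R :> R by rewrite ltr0n.
have xa : a i < x ord0 i.
  rewrite ltNge; apply: contra_neqN n1 => xa; rewrite flat_neg//.
  by rewrite pmulr_rle0// subr_le0.
have xb : x ord0 i < b i + n.+1%:R^-1.
  rewrite ltNge; apply: contra_neqN n2 => xb; rewrite flat_neg//.
  by rewrite pmulr_rle0 ?exprn_gt0// subr_le0.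
have n1' : n.+1%:R^-1 <= 1 :> R by rewrite invf_le1// ler1n.
apply: (@le_trans _ _ (`|a i| + (`|b i| + 1))).
  have := ler_norm (- a i); have := ler_norm (b i); rewrite normrN => h1 h2.
  have := normr_ge0 (a i); have := normr_ge0 (b i) => h3 h4.
  move: xb n1'; set w := n.+1%:R^-1 => xb n1'.
  by rewrite ler_norml; apply/andP; split; move: (x ord0 i) xa xb => y xa xb; lra.
by rewrite /bM (bigD1 i)//= lerDl sumr_ge0// => j _; rewrite !addr_ge0.
Qed.

Let bump_test a b n : test_fun (bump a b n.+1).
Proof.
split.
- apply: flat_algebra_smooth; apply: flat_algebra_prod => i.
  have -> : (fun x : E => flat 0 (n.+1%:R * (x ord0 i - a i)) * flat 0 (n.+1%:R ^+ 2 * (b i + n.+1%:R^-1 - x ord0 i))) =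
    (fun x : E => flat 0 (n.+1%:R * (x ord0 i - a i))) * (fun x : E => flat 0 (- n.+1%:R ^+ 2 * (x ord0 i - (b i + n.+1%:R^-1)))).
    apply/funext => x; rewrite fctE/=; congr (_ * flat 0 _); ring.
  by apply: flat_mul; exact: flat_coord.
- exists (box (bM a b)); [exact: compact_box|exact: bump_off].
Qed.

Let bump_bound a b n x : `|bump a b n.+1 x| <= \1_(box (bM a b)) x.
Proof.
have [bx|nbx] := pselect (box (bM a b) x); last by rewrite bump_off// normr0.
rewrite indicE mem_set// ger0_norm.
- apply: prodr_ile1 => i _; have /andP[h1 h2] := flat0_le1 (n.+1%:R * (x ord0 i - a i)).
  have /andP[h3 h4] := flat0_le1 (n.+1%:R ^+ 2 * (b i + n.+1%:R^-1 - x ord0 i)).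
  by rewrite mulr_ge0//= mulr_ile1.
- apply: prodr_ge0 => i _; have /andP[h1 h2] := flat0_le1 (n.+1%:R * (x ord0 i - a i)).
  have /andP[h3 h4] := flat0_le1 (n.+1%:R ^+ 2 * (b i + n.+1%:R^-1 - x ord0 i)).
  exact: mulr_ge0.
Qed.

Let bump_cvg a b x : bump a b n.+1 x @[n --> \oo] --> (\1_(pbox a b) x : R).
Proof.
have [xb|nxb] := pselect (pbox a b x).
  rewrite indicE mem_set//= /bump.
  elim: (index_enum _) => [|i l IH].
    by under eq_fun do rewrite big_nil; exact: cvg_cst.
  under eq_fun do rewrite big_cons.
  have := xb i; rewrite /= in_itv/= => /andP[xa xib].
  have c1 : flat 0 (n.+1%:R * (x ord0 i - a i)) @[n --> \oo] --> (1 : R).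
    by apply: (flat0_cvg (d := x ord0 i - a i)); rewrite ?subr_gt0.
  have c2 : flat 0 (n.+1%:R ^+ 2 * (b i + n.+1%:R^-1 - x ord0 i)) @[n --> \oo] --> (1 : R).
    apply: (flat0_cvg (d := 1)) => // n; rewrite mulr1.
    have n0 : 0 < n.+1%:R :> R by rewrite ltr0n.
    have -> : n.+1%:R ^+ 2 * (b i + n.+1%:R^-1 - x ord0 i) = n.+1%:R + n.+1%:R ^+ 2 * (b i - x ord0 i) :> R.
      by field; rewrite addrC natr1 gt_eqF.
    by rewrite lerDl mulr_ge0 ?exprn_ge0 ?subr_ge0// ltW.
  have h' := cvgM (cvgM c1 c2) IH; rewrite !mulr1 in h'; exact: h'.
rewrite indicE memNset//=; apply: cvg_near_cst.
move/existsNP: nxb => [i]; rewrite /= in_itv/= => /negP; rewrite negb_and -!leNgt -ltNge => /orP[xa|xb].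
  apply: nearW => n; rewrite /bump (bigD1 i)//= flat_neg ?mul0r//.
  by rewrite mulr_ge0_le0// subr_le0.
have d0 : 0 < x ord0 i - b i by rewrite subr_gt0.
have : \forall n \near \oo, `|0 - n.+1%:R^-1 : R| < x ord0 i - b i.
  have /cvgrPdist_lt : (n.+1%:R^-1 : R) @[n --> \oo] --> 0 by exact: cvg_harmonic.
  by move=> /(_ _ d0).
apply: filterS => n; rewrite sub0r normrN ger0_norm ?invr_ge0// => hn.
rewrite /bump (bigD1 i)//= [X in _ * X * _]flat_neg ?mulr0 ?mul0r//.
rewrite mulr_ge0_le0 ?exprn_ge0//; move: hn; set w := n.+1%:R^-1; move: (x ord0 i) => y; lra.
Qed.

Let mpbox a b : measurable (pbox a b).
Proof. by apply: measurable_rect => i; exact: measurable_itv. Qed.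

Let Rint_restrict (A : set E) (f : E -> R) : measurable A ->
  \int[leb]_(x in A) f x = \int[leb]_x (f x * \1_A x).
Proof.
move=> mA; rewrite /Rintegral integral_mkcond; congr (fine (integral _ _ _)).
apply/funext => x; rewrite patchE /= indicE; case: ifP => _; rewrite ?mulr1 ?mulr0//.
Qed.

Lemma Rint_pbox0 a b : \int[leb]_(x in pbox a b) h x = 0.
Proof.
rewrite Rint_restrict//.
have c : \int[leb]_x (h x * bump a b n.+1 x) @[n --> \oo] --> \int[leb]_x (h x * \1_(pbox a b) x).
  apply: (@Rint_dominated _ _ _ _ _ _ (fun x => `|C| * \1_(box (bM a b)) x)).
  - move=> n; apply: measurable_funM => //; apply: continuous_measurable_rV.
    exact: smooth_continuous (bump_test a b n).1.
  - by apply: measurable_funM => //; exact: measurable_indic.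
  - by apply: aeW => x; apply: cvgMr; exact: bump_cvg.
  - apply: (@bounded_box_integrable R N _ (bM a b) `|C|).
    + by apply: measurable_funM => //; apply: measurable_indic; exact: measurable_box.
    + by move=> x nb; rewrite indicE memNset// mulr0.
    + by move=> x; rewrite normrM normr_id indicE; case: (_ \in _); rewrite ?normr1 ?normr0 ?mulr1 ?mulr0.
  - move=> n; apply: filterS hC => x hx; rewrite normrM ler_pM//.
    exact: le_trans hx (ler_norm _).
have z : (fun n => \int[leb]_x (h x * bump a b n.+1 x)) = fun=> 0.
  by apply/funext => n; exact: htest.
rewrite z in c; exact: (cvg_unique (@Rhausdorff R) c (cvg_cst _)).
Qed.

Let D (M : R) := pbox (fun=> - M) (fun=> M).
Let hM M x := h x * \1_(D M) x.

Let ihM M : leb.-integrable [set: E] (EFin \o hM M).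
Proof.
have i1 : leb.-integrable [set: E] (EFin \o (fun x => `|C| * \1_(D M) x)).
  apply: (@bounded_box_integrable R N _ M `|C|).
  + by apply: measurable_funM => //; apply: measurable_indic; exact: mpbox.
  + move=> x nb; rewrite indicE memNset ?mulr0// => Dx; apply: nb; apply/boxP => i.
    by have := Dx i; rewrite /= in_itv/= => /andP[h1 h2]; rewrite ler_norml h2 ltW.
  + by move=> x; rewrite normrM normr_id indicE; case: (_ \in _); rewrite ?normr1 ?normr0 ?mulr1 ?mulr0.
have mhM : measurable_fun [set: E] (hM M).
  by apply: measurable_funM => //; apply: measurable_indic; exact: mpbox.
apply/Lfun1P; apply: (Lfun_le _ mhM ((Lfun1P _ _).2 i1)); first by [].
apply: filterS hC => x hx; rewrite /hM !normrM normr_id ler_wpM2r//.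
exact: le_trans hx (ler_norm _).
Qed.

Let rectU (A : 'I_N -> set (measurableTypeR R)) (i0 : 'I_N) (B : set (measurableTypeR R)) i :=
  if i == i0 then B else A i.

Let rectUE A i0 B : rect (rectU A i0 setT) `&` (fun x : E => x ord0 i0) @^-1` B = rect (rectU A i0 B).
Proof.
apply/seteqP; split => [x [h0 hB] i|x h0]; last first.
  split; last by have := h0 i0; rewrite /rectU eqxx.
  by move=> i; have := h0 i; rewrite /rectU; case: eqP.
by have := h0 i; rewrite /rectU; case: eqP => [->|].
Qed.

Let mocitv (B : set (measurableTypeR R)) : ocitv B -> measurable B.
Proof. by move=> oB; exact: sub_sigma_algebra. Qed.

(** Induction on the number k of leading coordinates whose side is an arbitrary measurable set
    instead of a half-open interval, one application of [dynkin_Rint] per coordinate. For k = 0 the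
    rectangle meets the cube [D M] in a box of [Rint_pbox0]. *)
Let rect_ocitv M k (A : 'I_N -> set (measurableTypeR R)) :
  (forall i : 'I_N, (i < k)%N -> measurable (A i)) -> (forall i : 'I_N, (k <= i)%N -> ocitv (A i)) ->
  \int[leb]_(x in rect A) hM M x = 0.
Proof.
elim: k A => [|k IH] A mA oA.
  have ab i : {ab : R * R | A i `&` `]- M, M]%classic = `]ab.1, ab.2]%classic}.
    by apply: cid; have [ab _ <-] := ocitvI (oA i isT) (is_ocitv (- M) M); exists ab.
  have mrA : measurable (rect A) by apply: measurable_rect => i; apply: mocitv; exact: oA.
  rewrite Rint_restrict// -[RHS](Rint_pbox0 (fun i => (sval (ab i)).1) (fun i => (sval (ab i)).2)).
  rewrite [RHS]Rint_restrict//; apply: eq_Rintegral => x _.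
  rewrite /hM -mulrA; congr (_ * _).
  have -> : pbox (fun i => (sval (ab i)).1) (fun i => (sval (ab i)).2) = D M `&` rect A.
    apply/seteqP; split => [y hy|y [Dy Ay] i].
      by split=> i; have := hy i; rewrite /= -/(`]_, _]%classic _) -(svalP (ab i)) => -[].
    by rewrite /= -/(`]_, _]%classic _) -(svalP (ab i)); split; [exact: Ay|exact: Dy].
  by rewrite indicI.
have [kN|Nk] := ltnP k N; last first.
  apply: IH => i ik; last by have := leq_trans Nk ik; rewrite leqNgt ltn_ord.
  by apply: mA; rewrite ltnS ltnW.
pose i0 := Ordinal kN.
have IHU B : ocitv B -> \int[leb]_(x in rect (rectU A i0 B)) hM M x = 0.
  move=> oB; apply: IH => i; rewrite /rectU; case: eqP => [->|/eqP ii0] ik //.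
  - by rewrite ltnn in ik.
  - by apply: mA; rewrite ltnS ltnW.
  - by apply: oA; rewrite ltn_neqAle ik andbT eq_sym -(inj_eq val_inj) in ii0 *.
have mU B : measurable B -> measurable (rect (rectU A i0 B)).
  move=> mB; apply: measurable_rect => i; rewrite /rectU; case: eqP => // /eqP ii0.
  by have [ik|ki] := ltnP i k.+1; [exact: mA|apply: mocitv; exact: oA].
have -> : rect A = rect (rectU A i0 setT) `&` (fun x : E => x ord0 i0) @^-1` (A i0).
  by rewrite rectUE; congr rect; apply/funext => i; rewrite /rectU; case: eqP => // ->.
apply: (@dynkin_Rint _ _ _ _ _ _ (@ocitv R)) => //.
- exact: mU.
- exact: measurable_rV_coord.
- exact: ocitvI.
(* The whole line is not a bounded half-open interval, but inside the cube [D M] it may be replaced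
   by ]-M, M]. *)
- rewrite -[RHS](IHU _ (is_ocitv (- M) M)) Rint_restrict; last exact: mU.
  have mMM : measurable (`]- M, M]%classic : set (measurableTypeR R)) by exact: measurable_itv.
  rewrite [RHS]Rint_restrict; last exact: (mU _ mMM).
  apply: eq_Rintegral => x _; rewrite /hM.
  have [Dx|nDx] := pselect (D M x); last by rewrite indicE memNset// mulr0 !mul0r.
  congr (_ * _); rewrite !indicE; congr (_%:R); congr nat_of_bool.
  apply/idP/idP => /set_mem hx; apply/mem_set => i; have := hx i; rewrite /rectU; case: eqP => // -> _.
- by move=> B oB; rewrite rectUE; exact: IHU.
- by apply: mA => /=.
Qed.

(** Measurable rectangles are the case k = N of [rect_ocitv]; they generate the sigma-algebra and
    are stable under intersection, so Dynkin's lemma reaches every measurable set. *)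
Let hM0 M : {ae leb, forall x, hM M x = 0}.
Proof.
pose G : set (set E) := [set S | exists2 A : 'I_N -> set (measurableTypeR R), (forall i, measurable (A i)) & S = rect A].
have GE : @measurable _ E = <<s G >>.
  apply/seteqP; split; last first.
    apply: smallest_sub; first exact: sigma_algebra_measurable.
    by move=> S [A mA ->]; exact: measurable_rect.
  apply: smallest_sub; first exact: smallest_sigma_algebra.
  rewrite -bigcup_seq/=; apply: bigcup_sub => i _ S [B mB <-].
  apply: sub_sigma_algebra; rewrite setTI; exists (fun j => if j == i then B else setT).
    by move=> j; case: eqP.
  apply/seteqP; split => [x Bx j|x /(_ i)]; last by rewrite eqxx.
  by case: eqP => [->|].
have GI : setI_closed G.
  move=> S S' [A mA ->] [A' mA' ->]; exists (fun i => A i `&` A' i).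
    by move=> i; exact: measurableI.
  by apply/seteqP; split => [x [h1 h2] i|x hx]; [split; [exact: h1|exact: h2]|split=> i; have [] := hx i].
have G0 S : G S -> \int[leb]_(x in S) hM M x = 0.
  move=> [A mA ->]; apply: (@rect_ocitv M N) => i iN; first exact: mA.
  by have := leq_ltn_trans iN (ltn_ord i); rewrite ltnn.
have all0 S : measurable S -> \int[leb]_(x in S) hM M x = 0.
  move=> mS; rewrite -[S]setTI; apply: (@dynkin_Rint _ _ _ _ _ id G) => //.
    apply: G0; exists (fun=> setT) => //; apply/seteqP; split => //.
  by move=> B GB; rewrite setTI; exact: G0.
have := @integral_ae_eq _ _ _ leb _ measurableT (cst 0%E) _ (ihM M) (measurable_cst _).
move=> /(_ _)/wrap[S _ mS|].
  have iS : leb.-integrable S (EFin \o hM M) by exact: (integrableS measurableT mS).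
  rewrite integral0; have := all0 S mS; rewrite /Rintegral => h0.
  by rewrite -[LHS]fineK ?h0//; apply: integrable_fin_num.
by apply: filterS => x /(_ I) [].
Qed.

(** The cutoff to a cube, made for integrability, is removed along the integers, as each point lies
    in some cube. *)
Lemma test_fun_separating : {ae leb, forall x, h x = 0}.
Proof.
have := ae_foralln (fun n : nat => hM0 n%:R); apply: filterS => x hx.
have := hx (Num.truncn `|x|).+1; rewrite /hM indicE mem_set ?mulr1// => i.
have := mx_norm_ge x i; have := truncnS_gt `|x| => h1 h2.
rewrite /= in_itv/=; have : `|x ord0 i| < (Num.truncn `|x|).+1%:R by exact: le_lt_trans h1.
by rewrite ltr_norml => /andP[-> /ltW ->].
Qed.

End fundamental_lemma.

Section sobolev.
Context {R : realType} {N : nat}.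
Local Notation E := 'rV[R]_N.
Local Notation leb := (lebesgue_rV N).

Lemma weak_derivative_unique (s : seq 'I_N) (phi g g' : E -> R) (B : R) :
  g \in Lfun leb +oo%E -> measurable_fun [set: E] g' -> (forall x, `|g' x| <= B) ->
  weak_derivative s phi g -> weak_derivative s phi g' -> {ae leb, forall x, g x = g' x}.
Proof.
move=> gL mg' g'B wg wg'; have mg := Lfun_meas gL.
have : {ae leb, forall x, g x - g' x = 0}.
  apply: (@test_fun_separating R N _ (lpn leb +oo%E g + B)).
  - exact: measurable_funB.
  - apply: filterS (Lfun_infty gL) => x gx; apply: (le_trans (ler_normB _ _)); exact: lerD.
  - move=> psi tpsi; have [M _ p0] := test_fun_box tpsi.
    have cp := smooth_continuous tpsi.1; have mp := continuous_measurable_rV cp.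
    have pL : psi \in Lfun leb 1%E by apply/Lfun1P; exact: continuous_supported_integrable cp p0.
    have [i1 _] := integrable_infty_mul gL pL.
    have B0 : 0 <= B by apply: le_trans (g'B 0).
    have [g'L _] := lpn_infty_le B0 mg' (aeW leb g'B).
    have [i2 _] := integrable_infty_mul g'L pL.
    have -> : \int[leb]_x ((g x - g' x) * psi x) = \int[leb]_x ((g \* psi) x - (g' \* psi) x).
      by apply: eq_Rintegral => x _ /=; rewrite mulrBl.
    rewrite RintegralB//; have := wg psi tpsi; rewrite (wg' psi tpsi) => /eqP.
    rewrite -subr_eq0 -mulrBr mulf_eq0 signr_eq0 /= => /eqP h.
    by rewrite -opprB h oppr0.
by apply: filterS => x /eqP; rewrite subr_eq0 => /eqP.
Qed.

(** [sobolev_infty_norm] is a supremum over all weak derivatives, so each of them is first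
    identified with a classical derivative by [weak_derivative_unique]. *)
Lemma smooth_sobolev m (K : set E) (phi : E -> R) (B : R) : smooth phi -> (forall x, ~ K x -> phi x = 0) ->
  (forall s, (size s <= m)%N -> forall x, `|iter_derive (map basis_vec s) phi x| <= B) ->
  sobolev_supported m K phi /\ (sobolev_infty_norm m phi <= B%:E)%E.
Proof.
move=> sp p0 pB.
have B0 : 0 <= B by apply: le_trans (pB [::] _ 0).
have gB s : (size s <= m)%N -> forall x, `|iter_derive (rev (map basis_vec s)) phi x| <= B.
  by move=> sm x; rewrite -map_rev; apply: pB; rewrite size_rev.
have mg s : measurable_fun [set: E] (iter_derive s phi).
  by apply: continuous_measurable_rV; exact: (smooth_continuous (smooth_iter_derive s sp)).
split.
  split; last by apply: aeW.
  split; first by have [] := lpn_infty_le B0 (mg [::]) (aeW leb (pB [::] isT)).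
  move=> s sm; exists (iter_derive (rev (map basis_vec s)) phi); last exact: weak_derivative_smooth.
  by have [] := lpn_infty_le B0 (mg _) (aeW leb (gB s sm)).
apply: ge_ereal_sup => _ [g [gL [s sm wg]] <-].
have ge := weak_derivative_unique gL (mg _) (gB s sm) wg (weak_derivative_smooth s sp).
rewrite lpnE// lee_fin.
have [_ le] := lpn_infty_le B0 (mg _) (aeW leb (gB s sm)).
apply: le_trans le; rewrite le_eqVlt; apply/orP; left; apply/eqP.
have [g'L _] := lpn_infty_le B0 (mg _) (aeW leb (gB s sm)).
exact: (lpn_ae (leey _) (Lfun_meas gL) g'L ge).
Qed.

End sobolev.

(** * Jointly measurable versions *)

Section lipschitz_family.
Context d (X : measurableType d) (R : realType).
Variable m2 : {sigma_finite_measure set X -> \bar R}.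
Local Notation P := (@period_measure R).
Local Notation TR := (measurableTypeR R).
Variables (q : \bar R) (ell : R -> X -> R) (A : R).
Hypothesis q1 : (1 <= q)%E.
Hypothesis ellL : forall t, ell t \in Lfun m2 q.
Hypothesis A0 : 0 <= A.
Hypothesis lip : forall t s, lpn m2 q (fun x => ell t x - ell s x) <= A * `|t - s|.

Let F n (z : TR * X) := ell (dyad n (dfloor n z.1)) z.2.

(* The values at dyadic times determine the version, because ell is Lipschitz in
   time although each ell t is defined only up to a null set. *)
Definition family_version (z : TR * X) : R := flim (F ^~ z).

Let mF n : measurable_fun [set: TR * X] (F n).
Proof.
apply: (@measurable_glue _ _ _ (fun z : TR * X => dfloor n z.1) _ _ (fun k z => ell (dyad n k) z.2)).
  move=> k; have -> : (fun z : TR * X => dfloor n z.1) @^-1` [set k] = (dfloor n @^-1` [set k]) `*` setT.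
    by apply/seteqP; split => [[t x] /= ->|[t x] /= []].
  by apply: measurableX => //; exact: measurable_dfloor.
by move=> k; apply: (measurableT_comp (Lfun_meas (ellL _))); exact: measurable_snd.
Qed.

Lemma measurable_family_version : measurable_fun [set: TR * X] family_version.
Proof. exact: measurable_flim. Qed.

Let h2 : 0 <= (2^-1 : R). Proof. by rewrite invr_ge0. Qed.

Let rhalf : 0 <= (2^-1 : R) < 1. Proof. by rewrite h2 invf_lt1 ?ltr1n. Qed.

(** Along the dyadic approximations of t the Lipschitz bound makes the family geometrically Cauchy
    in L^q, with limit [ell t] in norm; the limit defining the version has to agree with it almost
    everywhere. *)
Lemma family_version_slice t : {ae m2, forall x, family_version (t, x) = ell t x}.
Proof.
pose u n x := F n (t, x).
have uL n : u n \in Lfun m2 q by exact: (ellL (dyad n (dfloor n t))).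
have mu n : measurable_fun [set: X] (u n) by exact: Lfun_meas (uL n).
have NmP := banach_norm_Lnorm m2 q1.
have uN n : ('N[m2]_q[(fun z => `|(u n.+1 z - u n z)%:E|)] <= (2 * A * 2^-1 ^+ n)%:E)%E.
  have dL := Lfun_sub q1 (uL n.+1) (uL n).
  have -> : (fun z => `|(u n.+1 z - u n z)%:E|%E) = abse \o (EFin \o (fun z => u n.+1 z - u n z)) by [].
  rewrite Lnorm_abse lpnE// lee_fin; apply: (le_trans (lip (dyad n.+1 (dfloor n.+1 t)) (dyad n (dfloor n t)))).
  rewrite [2 * A]mulrC -mulrA ler_wpM2l// mulr_natl mulr2n.
  rewrite -[X in `|X|](subrKA t) (le_trans (ler_normD _ _))// lerD//; last exact: dyad_dist.
  rewrite distrC (le_trans (dyad_dist _ _))// exprS ler_piMl ?exprn_ge0//.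
  by case/andP: rhalf => _ /ltW.
have A2 : 0 <= 2 * A by rewrite mulr_ge0.
have vL : (fun x => family_version (t, x)) \in Lfun m2 q.
  apply/LfunP'; split; first by apply: measurableT_comp; [exact: measurable_family_version|exact: measurable_pair1].
  have := riesz_fischer_lty NmP mu A2 rhalf uN; rewrite -/(abse \o (EFin \o (fun x => flim (u^~ x)))) Lnorm_abse; apply.
  have -> : (fun z => `|(u 0%N z)%:E|%E) = abse \o (EFin \o u 0%N) by [].
  by rewrite Lnorm_abse lpnE// ltry.
have dL := Lfun_sub q1 vL (ellL t).
suff h : lpn m2 q (fun x => family_version (t, x) - ell t x) = 0.
  by apply: filterS (lpn_eq0 q1 dL h) => x /eqP; rewrite subr_eq0 => /eqP.
(* The constant is 4 + 1: a geometric series of ratio 1/2 that starts at 2 A 2^-n, and the distance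
   from t to its dyadic approximation. *)
have le n : lpn m2 q (fun x => family_version (t, x) - ell t x) <= 5 * A * 2^-1 ^+ n.
  have d1 := Lfun_sub q1 vL (uL n); have d2 := Lfun_sub q1 (uL n) (ellL t).
  have -> : (fun x => family_version (t, x) - ell t x) = (fun x => (family_version (t, x) - u n x) + (u n x - ell t x)).
    by apply/funext => x; rewrite subrKA.
  apply: (le_trans (lpnD q1 d1 d2)).
  have := riesz_fischer_le NmP mu A2 rhalf uN n.
  have -> : (fun z => `|(flim (u^~ z) - u n z)%:E|%E) = abse \o (EFin \o (fun x => family_version (t, x) - u n x)) by [].
  rewrite Lnorm_abse lpnE// lee_fin => k1.
  have k2 : lpn m2 q (fun x => u n x - ell t x) <= A * 2^-1 ^+ n.
    apply: (le_trans (lip (dyad n (dfloor n t)) t)); rewrite ler_wpM2l// distrC; exact: dyad_dist.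
  apply: (le_trans (lerD k1 k2)); rewrite le_eqVlt; apply/orP; left; apply/eqP; by field.
apply/eqP; rewrite eq_le lpn_ge0 andbT.
have c : 5 * A * 2^-1 ^+ n @[n --> \oo] --> (0 : R).
  by rewrite -[X in _ --> X](mulr0 (5 * A)); apply: cvgMr; exact: half_cvg0.
apply/ler_addgt0Pr => eps eps0; rewrite add0r.
move/cvgrPdist_lt: c => /(_ _ eps0) [n _ hn]; apply: (le_trans (le n)).
by have := hn n (leqnn n); rewrite sub0r normrN => h; apply: le_trans (ltW h); exact: ler_norm.
Qed.

Variable r : R.
Hypothesis r1 : 1 < r.
Let r0 : 0 < r. Proof. exact: lt_trans r1. Qed.
Let r1e : (1 <= r%:E)%E. Proof. by rewrite lee_fin ltW. Qed.

Lemma mixN_le_ae_time (W V : TR * X -> R) : measurable_fun [set: TR * X] W -> measurable_fun [set: TR * X] V ->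
  {ae P, forall t, forall x, `|W (t, x)| <= `|V (t, x)|} ->
  (mixN P m2 r q (EFin \o W) <= mixN P m2 r q (EFin \o V))%E.
Proof.
move=> mW mV WV.
have mW' : measurable_fun [set: TR * X] (EFin \o W) by exact/measurable_EFinP.
have mV' : measurable_fun [set: TR * X] (EFin \o V) by exact/measurable_EFinP.
apply: Lnorm_le_ae => //; [exact: measurable_inner|exact: measurable_inner|].
apply: aeW => x; rewrite !gee0_abs ?Lnorm_ge0//; apply: Lnorm_le_ae => //.
- exact: measurable_slice.
- exact: measurable_slice.
- by apply: filterS WV => t h; rewrite lee_fin; exact: h.
Qed.

Let cell n k : set TR := dfloor n @^-1` [set k].

Let cellP n k : (P (cell n k) <= (2^-1 ^+ n)%:E)%E.
Proof.
have mc : measurable (cell n k) by exact: measurable_dfloor.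
rewrite period_measureE//.
apply: (@le_trans _ _ (lebesgue_measure `[dyad n k, (dyad n k + 2^-1 ^+ n : R)])).
  apply: le_measure; rewrite ?inE; [exact: measurableI|exact: measurable_itv|].
  move=> t [<- _] /=; rewrite in_itv/=; have /andP[-> /ltW ->] := dyad_floor n t; done.
rewrite lebesgue_measure_itv/=; case: ifP => _; last by rewrite lee_fin exprn_ge0.
by rewrite -EFinD lee_fin addrAC subrr add0r.
Qed.

Let cell_Lfun n k : (\1_(cell n k) : TR -> R) \in Lfun P r%:E /\
  lpn P r%:E (\1_(cell n k)) <= (2^-1 ^+ n) `^ r^-1.
Proof.
have mc : measurable (cell n k) by exact: measurable_dfloor.
have mi : measurable_fun [set: TR] (\1_(cell n k) : TR -> R) by exact: measurable_indic.
have E t : `|\1_(cell n k) t : R| `^ r = \1_(cell n k) t.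
  rewrite indicE; case: (_ \in _); first by rewrite normr1 powR1E.
  by rewrite normr0 powR0 ?gt_eqF.
have IE : (\int[P]_t (`|\1_(cell n k) t : R| `^ r)%:E = P (cell n k))%E.
  under eq_integral do rewrite E.
  by rewrite integral_indic// setIT.
have L : (\1_(cell n k) : TR -> R) \in Lfun P r%:E.
  by apply/(Lfun_powRP _ r0) => //; rewrite IE; apply: le_lt_trans (cellP n k) (ltry _).
split => //; apply: (lpn_le_pow r0 (exprn_ge0 n h2) L).
have fP : P (cell n k) \is a fin_num by rewrite ge0_fin_numE//; apply: le_lt_trans (cellP n k) (ltry _).
by rewrite /Rintegral IE -lee_fin fineK//; exact: cellP.
Qed.

Let NmP : banach_norm (P \x m2)%E (mixN P m2 r q).
Proof. by apply: banach_norm_mixN => //; exact: ltW. Qed.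

Let cell_mixed n k (g : X -> R) : g \in Lfun m2 q ->
  (mixN P m2 r q (EFin \o (fun z => `|\1_(cell n k) z.1 * g z.2|)%R) <= ((2^-1 ^+ n) `^ r^-1 * lpn m2 q g)%:E)%E.
Proof.
move=> gL; have [cL cle] := cell_Lfun n k; set c := (2^-1 ^+ n) `^ r^-1 in cle *.
have c0 : 0 <= c by exact: powR_ge0.
have mc : measurable_fun [set: TR] (\1_(cell n k) : TR -> R) by exact: Lfun_meas cL.
have kL := Lfun_scal c q1 gL.
apply: (@le_trans _ _ ('N[m2]_q[EFin \o (fun x => c * g x)%R])%E); last first.
  by rewrite lpnE// lee_fin lpnZ// ger0_norm.
apply: Lnorm_le_ae => //.
- apply: measurable_inner; apply/measurable_EFinP; apply: measurableT_comp => //.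
  apply: measurable_funM; first by apply: (measurableT_comp mc); exact: measurable_fst.
  by apply: (measurableT_comp (Lfun_meas gL)); exact: measurable_snd.
- exact: Lfun_emeas kL.
apply: aeW => x; rewrite gee0_abs ?Lnorm_ge0//.
have L1 := Lfun_scal (g x) r1e cL.
have -> : 'N[P]_r%:E[(fun t => (EFin \o (fun z : TR * X => `|\1_(cell n k) z.1 * g z.2|)%R) (t, x))]%E =
   'N[P]_r%:E[abse \o (EFin \o (fun t => g x * \1_(cell n k) t)%R)]%E.
  by congr (Lnorm _ _ _); apply/funext => t /=; rewrite mulrC.
rewrite Lnorm_abse lpnE// lpnZ//= lee_fin normrM mulrC (ger0_norm c0).
exact: ler_wpM2r.
Qed.

Let mcell n M (g : nat -> X -> R) : (forall k, g k \in Lfun m2 q) ->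
  measurable_fun [set: TR * X] (fun z => \sum_(0 <= k < M) `|\1_(cell n k%:Z) z.1 * g k z.2|).
Proof.
move=> gL; apply: measurable_sum => k; apply: measurableT_comp => //.
apply: measurable_funM; first by apply: (measurableT_comp (Lfun_meas (cell_Lfun n k%:Z).1)); exact: measurable_fst.
by apply: (measurableT_comp (Lfun_meas (gL k))); exact: measurable_snd.
Qed.

Let step_mixed n M (g : nat -> X -> R) : (forall k, g k \in Lfun m2 q) ->
  (mixN P m2 r q (EFin \o (fun z => (\sum_(0 <= k < M) `|\1_(cell n k%:Z) z.1 * g k z.2|)%R)) <=
   ((2^-1 ^+ n) `^ r^-1 * \sum_(0 <= k < M) lpn m2 q (g k))%:E)%E.
Proof.
move=> gL; elim: M => [|M IH].
  rewrite big_geq// mulr0.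
  have -> : EFin \o (fun z : TR * X => \sum_(0 <= k < 0) `|\1_(cell n k%:Z) z.1 * g k z.2|) = (fun z => `|\1_(cell n 0) z.1 * (0 * g 0%N z.2)|%:E).
    by apply/funext => z /=; rewrite big_geq// mul0r mulr0 normr0.
  have := cell_mixed n 0 (Lfun_scal 0 q1 (gL 0%N)).
  by rewrite lpnZ// normr0 mul0r mulr0.
rewrite big_nat_recr//= mulrDr EFinD.
have -> : EFin \o (fun z : TR * X => \sum_(0 <= k < M.+1) `|\1_(cell n k%:Z) z.1 * g k z.2|) =
   (fun z => ((EFin \o (fun z : TR * X => (\sum_(0 <= k < M) `|\1_(cell n k%:Z) z.1 * g k z.2|)%R)) z + (EFin \o (fun z : TR * X => (`|\1_(cell n M%:Z) z.1 * g M z.2|)%R)) z)%E).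
  by apply/funext => z /=; rewrite big_nat_recr.
apply: (le_trans (bn_D NmP _ _ _ _)).
- by apply/measurable_EFinP; exact: mcell.
- apply/measurable_EFinP; apply: measurableT_comp => //.
  apply: measurable_funM; first by apply: (measurableT_comp (Lfun_meas (cell_Lfun n M%:Z).1)); exact: measurable_fst.
  by apply: (measurableT_comp (Lfun_meas (gL M))); exact: measurable_snd.
- by move=> z /=; rewrite lee_fin sumr_ge0.
- by move=> z /=; rewrite lee_fin.
by apply: leeD => //; exact: cell_mixed.
Qed.

(** Refining the grid keeps the left end point of a cell or moves it by half a cell, so on the cell
    k the increment of [F] is 0 or one fixed function of x. *)
Let dyad_next n (t : R) : dyad n.+1 (dfloor n.+1 t) = dyad n (dfloor n t) :> R \/
  dyad n.+1 (dfloor n.+1 t) = dyad n (dfloor n t) + 2^-1 ^+ n.+1 :> R.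
Proof.
have := floor_itv (2 ^+ n * t); rewrite -/(dfloor n t) intrD; set k := dfloor n t => /andP[hk1 hk2].
have E : 2 ^+ n.+1 * t = 2 * (2 ^+ n * t) by rewrite exprS mulrA.
have p0 : 2 ^+ n != 0 :> R by rewrite expf_neq0.
have [h|h] := ltP (2 ^+ n.+1 * t) (2 * k%:~R + 1).
- left; have -> : dfloor n.+1 t = 2 * k.
    by apply: floor_def; rewrite !intrD !intrM; move: h; rewrite E; lra.
  by rewrite /dyad intrM exprS; field; rewrite p0.
- right; have -> : dfloor n.+1 t = 2 * k + 1.
    by apply: floor_def; rewrite !intrD !intrM; move: h; rewrite E; lra.
  by rewrite /dyad intrD intrM exprVn exprS; field; rewrite p0.
Qed.

Let K := (Num.truncn (2 * pi : R)).+1.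

Let ae_period : {ae P, forall t : R, 0 <= t < K%:R}.
Proof.
exists (~` `[0, 2 * pi[%classic); split.
- by apply: measurableC; exact: measurable_itv.
- by rewrite period_measureE ?setICl ?measure0//; apply: measurableC; exact: measurable_itv.
move=> t /= h It; apply: h; move: It; rewrite in_itv/= => /andP[-> /= tp].
by apply: lt_trans tp _; exact: truncnS_gt.
Qed.

Let cell_index n (t : R) : 0 <= t < K%:R -> exists2 k, (k < K * 2 ^ n)%N & dfloor n t = k%:Z.
Proof.
move=> /andP[t0 tK]; have k0 : (0 <= dfloor n t)%R by rewrite floor_ge0 mulr_ge0// exprn_ge0.
exists `|dfloor n t|%N; last by rewrite gez0_abs.
rewrite -ltz_nat gez0_abs// -(ltr_int R) (le_lt_trans (floor_le _))//.
by rewrite -pmulrn natrM natrX mulrC ltr_pM2r ?exprn_gt0.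
Qed.

Let cell_sum n M k (t : R) (g : nat -> X -> R) x : (k < M)%N -> dfloor n t = k%:Z ->
  `|g k x| <= `|\sum_(0 <= k < M) `|\1_(cell n k%:Z) t * g k x| |.
Proof.
move=> kM tk; rewrite [leRHS]ger0_norm ?sumr_ge0// (bigD1_seq k)/= ?mem_index_iota ?iota_uniq//.
by rewrite indicE mem_set// mul1r lerDl sumr_ge0.
Qed.

(** Bounds in L^q at each time do not directly control a norm with time inside. The increment at
    level n is split over K 2^n cells, each contributing (2^-n)^(1/r) times A 2^(-n-1); the total (K
    A / 2) 2^(-n/r) is summable. *)
Lemma family_version_mixed : (mixN P m2 r q (EFin \o family_version) < +oo)%E.
Proof.
pose rho : R := 2^-1 `^ r^-1.
have rho01 : 0 <= rho < 1.
  rewrite powR_ge0 /= -[X in _ < X](powR1E r^-1); apply: gt0_ltr_powR; rewrite ?nnegrE ?invr_gt0//.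
  by case/andP: rhalf.
have rhoE n : (2^-1 ^+ n) `^ r^-1 = rho ^+ n.
  elim: n => [|n IH]; first by rewrite !expr0 powR1E.
  by rewrite !exprS powRM ?exprn_ge0// IH.
pose C : R := K%:R * A / 2.
have C0 : 0 <= C by rewrite divr_ge0// mulr_ge0.
have FN n : (mixN P m2 r q (fun z => `|(F n.+1 z - F n z)%:E|) <= (C * rho ^+ n)%:E)%E.
  rewrite mixN_abse.
  pose g k x := ell (dyad n k%:Z + 2^-1 ^+ n.+1) x - ell (dyad n k%:Z) x.
  have gL k : g k \in Lfun m2 q by exact: Lfun_sub.
  apply: (@le_trans _ _ (mixN P m2 r q (EFin \o (fun z => (\sum_(0 <= k < K * 2 ^ n) `|\1_(cell n k%:Z) z.1 * g k z.2|)%R)))).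
    apply: mixN_le_ae_time; [exact: measurable_funB|exact: mcell|].
    have [B [mB PB sub]] := ae_period; exists B; split => // t nt; apply: sub => tK; apply: nt => x.
    have [k kK tk] := cell_index n tK.
    apply: le_trans (cell_sum g x kK tk).
    rewrite /F /g /= -tk; case: (dyad_next n t) => -> //.
    by rewrite subrr normr0.
  apply: (le_trans (step_mixed n (K * 2 ^ n) gL)); rewrite lee_fin rhoE mulrC.
  have rn : 0 <= rho ^+ n by rewrite exprn_ge0//; case/andP: rho01.
  apply: ler_wpM2r => //.
  apply: (@le_trans _ _ (\sum_(0 <= k < K * 2 ^ n) A * 2^-1 ^+ n.+1)).
    apply: ler_sum => k _; apply: (le_trans (lip _ _)).
    by rewrite addrAC subrr add0r ger0_norm ?exprn_ge0.
  have sE (k : nat) : \sum_(0 <= i < k * 2 ^ n) A * 2^-1 ^+ n.+1 = k%:R * A / 2 :> R.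
    rewrite sumr_const_nat subn0 -(mulr_natr _ (k * 2 ^ n)) natrM natrX exprS exprVn.
    by field; rewrite expf_neq0.
  by rewrite sE.
have F0 : (mixN P m2 r q (fun z => `|(F 0%N z)%:E|) < +oo)%E.
  rewrite mixN_abse; pose g (k : nat) x := ell (dyad 0 k%:Z) x.
  have gL k : g k \in Lfun m2 q by exact: (ellL (dyad 0 k%:Z)).
  apply: le_lt_trans (le_lt_trans (step_mixed 0 (K * 2 ^ 0) gL) (ltry _)).
  apply: mixN_le_ae_time; [exact: mF|exact: mcell|].
  have [B [mB PB sub]] := ae_period; exists B; split => // t nt; apply: sub => tK; apply: nt => x.
    have [k kK tk] := cell_index 0 tK.
  by apply: le_trans (cell_sum g x kK tk); rewrite /F /g /= tk.
have := riesz_fischer_lty NmP mF C0 rho01 FN F0.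
by rewrite mixN_abse.
Qed.

End lipschitz_family.

(** * Test functions on space-time *)

Section supported.
Context {R : realType} {N : nat}.
Local Notation E := 'rV[R]_N.
Local Notation leb := (lebesgue_rV N).
Local Notation TR := (measurableTypeR R).
Local Notation P := (@period_measure R).

Lemma box_indic_Lfun (q : \bar R) (M : R) : (1 <= q)%E ->
  (\1_(@box R N M) : E -> R) \in Lfun leb q.
Proof.
have mB := measurable_box (N := N) M.
have mi : measurable_fun [set: E] (\1_(@box R N M) : E -> R) by exact: measurable_indic.
case: q => [q||] q1; last by rewrite leeNy_eq in q1.
- have q0 : 0 < q by rewrite (lt_le_trans ltr01).
  apply/(Lfun_powRP _ q0) => //.
  have -> : (fun x => (`|\1_(@box R N M) x : R| `^ q)%:E) = (fun x => (\1_(@box R N M) x)%:E).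
    apply/funext => x; rewrite indicE; case: (_ \in _); first by rewrite normr1 powR1E.
    by rewrite normr0 powR0 ?gt_eqF.
  by rewrite integral_indic// setIT; exact: box_lty.
- have [] // := @lpn_infty_le _ _ _ leb (\1_(@box R N M) : E -> R) 1 ler01 mi.
  by apply: aeW => x; rewrite indicE; case: (_ \in _); rewrite ?normr1 ?normr0.
Qed.

Lemma bounded_box_mixed (r : R) (q : \bar R) (f : R * E -> R) (M B : R) : 1 <= r -> (1 <= q)%E ->
  measurable_fun [set: TR * E] f -> (forall z, `|f z| <= B) ->
  (forall t x, ~ box M x -> f (t, x) = 0) -> (mixN P leb r q (EFin \o f) < +oo)%E.
Proof.
move=> r1 q1 mf fB f0; have r1e : (1 <= r%:E)%E by rewrite lee_fin.
have B0 : 0 <= B by apply: le_trans (fB 0).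
have cL : (cst B : TR -> R) \in Lfun P r%:E by exact: Lfun_cst.
pose c := lpn P r%:E (cst B : TR -> R).
have gL := Lfun_scal c q1 (box_indic_Lfun M q1).
apply: le_lt_trans (_ : _ <= 'N[leb]_q[EFin \o (fun x => c * \1_(@box R N M) x)%R])%E _; last first.
  by rewrite lpnE ?ltry.
apply: Lnorm_le_ae => //.
- by apply: measurable_inner; exact/measurable_EFinP.
- exact: Lfun_emeas gL.
apply: aeW => x; rewrite gee0_abs ?Lnorm_ge0// /= ger0_norm ?mulr_ge0 ?lpn_ge0//.
have ms : measurable_fun [set: TR] (fun t => f (t, x)).
  by apply: (measurableT_comp mf); exact: measurable_pair2.
have [bx|nbx] := pselect (box M x).
  rewrite indicE mem_set// mulr1 -lpnE//; apply: Lnorm_le_ae => //.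
  - exact/measurable_EFinP.
  - exact: Lfun_emeas cL.
  by apply: aeW => t /=; rewrite lee_fin (ger0_norm B0).
have -> : (fun t => (EFin \o f) (t, x)) = (fun=> 0%E) by apply/funext => t /=; rewrite f0.
by rewrite Lnorm0 ?lee_fin ?mulr_ge0 ?lpn_ge0// gt_eqF// lte_fin (lt_le_trans ltr01).
Qed.

Lemma smooth_lin (V : normedModType R) (a : R) (f g : V -> R) : smooth f -> smooth g ->
  smooth (fun x => a * f x + g x) /\
  forall s, iter_derive s (fun x => a * f x + g x) =
    (fun x => a * iter_derive s f x + iter_derive s g x).
Proof.
move=> sf sg.
have EE s : iter_derive s (fun x => a * f x + g x) =
    (fun x => a * iter_derive s f x + iter_derive s g x).
  elim: s => [//|v s IH]; rewrite /iter_derive/= -!/(iter_derive s _) IH; apply/funext => x.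
  have df := (sf s).2 x v; have dg := (sg s).2 x v.
  have daf : derivable (a *: iter_derive s f) x v by exact: derivableZ.
  have -> : (fun x => a * iter_derive s f x + iter_derive s g x) = a *: iter_derive s f + iter_derive s g by [].
  by rewrite deriveD// deriveZ.
split; last exact: EE.
move=> s; rewrite EE; split.
  move=> x; have c1 := (sf s).1 x; have c2 := (sg s).1 x.
  have c3 : a * iter_derive s f y @[y --> x] --> a * iter_derive s f x by exact: cvgMr.
  exact: (cvgD c3 c2).
move=> x v; have df := (sf s).2 x v; have dg := (sg s).2 x v.
have daf : derivable (a *: iter_derive s f) x v by exact: derivableZ.
exact: (derivableD daf dg).
Qed.

Lemma mvt_lipschitz (f f' : R -> R) (B : R) : (forall t : R, is_derive t 1 f (f' t)) ->
  (forall t, `|f' t| <= B) -> forall t s, `|f t - f s| <= B * `|t - s|.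
Proof.
move=> df f'B.
have cf t : {for t, continuous f}.
  by apply: differentiable_continuous; apply/derivable1_diffP; exact: ex_derive.
have le t s : s <= t -> `|f t - f s| <= B * `|t - s|.
  move=> st; have [c _ ->] := @MVT_segment R f f' s t st (fun x _ => df x) (continuous_subspaceT cf).
  by rewrite normrM ler_wpM2r.
move=> t s; have [|/ltW] := leP s t; first exact: le.
by move=> /le; rewrite distrC (distrC s).
Qed.

Section spacetime.
Variables (f : R * E -> R) (M : R).
Hypothesis sf : smooth f.
Hypothesis fp : forall t x, f (t + 2 * pi, x) = f (t, x).
Hypothesis f0 : forall t x, ~ box M x -> f (t, x) = 0.

(** Periodicity brings every time into [0, 2 pi], and the product of this interval with the box is
    compact. *)
Lemma smooth_supported_bounded : exists B, forall z, `|f z| <= B.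
Proof.
have cf := smooth_continuous sf.
pose A : set (R * E) := `[0, 2 * pi]%classic `*` @box R N M.
have : compact (f @` A).
  apply: continuous_compact; first exact: continuous_subspaceT.
  by apply: compact_setX; [exact: segment_compact|exact: compact_box].
move=> /compact_bounded [a [areal Ha]]; exists (`|a| + 1) => -[t x].
have a1 : a < `|a| + 1 by rewrite (le_lt_trans (ler_norm a))// ltrDl.
have [bx|nbx] := pselect (box M x); last by rewrite f0// normr0 addr_ge0.
have pi0 := @pi2_gt0 R.
pose n := Num.floor (t / (2 * pi)).
have -> : f (t, x) = f (t + (- n)%:~R * (2 * pi), x).
  by rewrite (@periodicz _ (fun t => f (t, x)) (fp ^~ x)).
apply: Ha => //; exists (t + (- n)%:~R * (2 * pi), x) => //; split => //=.
have /andP[n1 n2] := floor_itv (t / (2 * pi)); rewrite -/n in n1 n2.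
rewrite in_itv/= mulrNz mulNr; move: n1 n2; rewrite ler_pdivlMr// ltr_pdivrMr// intrD mulrDl mul1r.
by move=> h1 h2; apply/andP; split; lra.
Qed.

Lemma iter_derive_periodic s t x : iter_derive s f (t + 2 * pi, x) = iter_derive s f (t, x).
Proof.
pose j (z : R * E) : R * E := (z.1 + 2 * pi, z.2).
have jl v a (h : R) : j (h *: v + a) = h *: (id v) + j a.
  by case: v a => [v1 v2] [a1 a2]; rewrite /j /=; congr pair; rewrite addrA.
have := iter_derive_comp_line jl sf s; rewrite map_id.
have -> : (fun x => f (j x)) = f by apply/funext => -[t' x']; exact: fp.
by move=> /(congr1 (@^~ (t, x))).
Qed.

Lemma iter_derive_box s t x : ~ box M x -> iter_derive s f (t, x) = 0.
Proof.
move=> nb; apply: (@iter_derive_off_closed _ _ (snd @^-1` @box R N M)) => //.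
  apply: (@closed_comp _ _ snd) => //; last exact: closed_box.
  by move=> z _; exact: cvg_snd.
by case=> t' x' /=; exact: f0.
Qed.

Lemma is_derive_time s t x : is_derive (t : R) 1 (fun t => iter_derive s f (t, x))
  (iter_derive ((1, 0) :: s) f (t, x)).
Proof.
have h (k : R) : (k *: (1 : R) + t, x) = k *: ((1, 0) : R * E) + (t, x).
  by congr pair; rewrite /= scaler0 add0r.
have [e1 e2] := @derive_comp_line _ _ _ (fun t : R => (t, x)) 1 t (1, 0) (iter_derive s f) h.
by apply: DeriveDef; [apply: e2; exact: (sf s).2|exact: e1].
Qed.

End spacetime.

Lemma sobolev_infty_norm_ge0 m (phi : E -> R) : phi \in Lfun leb +oo%E -> (0 <= sobolev_infty_norm m phi)%E.
Proof.
move=> pL; apply: le_trans (Lnorm_ge0 leb +oo%E (EFin \o phi)) _.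
apply: ereal_sup_ubound; exists phi => //; split => //; exists [::] => // psi _.
by rewrite expr0 mul1r.
Qed.

Lemma iter_derive_slice (f : R * E -> R) s t : smooth f -> smooth (fun y => f (t, y)) /\
  iter_derive s (fun y => f (t, y)) = (fun y => iter_derive (map (fun v : E => (0 : R, v)) s) f (t, y)).
Proof.
move=> sf; have jl (v a : E) (h : R) : (t, h *: v + a) = h *: ((0 : R), v) + (t, a).
  by congr pair; rewrite /= scaler0 add0r.
split; last exact: (iter_derive_comp_line jl sf).
apply: (smooth_comp_line jl) sf.
apply: nonexpansive_continuous => y z.
by rewrite prod_normE/= subrr normr0 ge_max normr_ge0 lexx.
Qed.

Section version.
Variables (L : (E -> R) -> (E -> R)) (m : nat) (q : \bar R) (Phi : R * E -> R).
Hypothesis q1 : (1 <= q)%E.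
Hypothesis LP : locally_bounded_linear m q L.
Hypothesis tP : spacetime_test_fun Phi.

Lemma spacetime_test_box : exists2 M, 0 <= M & forall t x, ~ @box R N M x -> Phi (t, x) = 0.
Proof.
have [_ _ [K cK K0]] := tP; have [M M0 KM] := compact_in_box cK.
by exists M => // t x nb; apply: K0 => Kx; apply: nb; exact: KM.
Qed.

Lemma iter_derive_bounded w : exists B, forall z, `|iter_derive w Phi z| <= B.
Proof.
have [M M0 P0] := spacetime_test_box; have [sP pP _] := tP.
apply: (@smooth_supported_bounded _ M (smooth_iter_derive w sP)).
- by move=> t x; exact: iter_derive_periodic.
- by move=> t x; exact: iter_derive_box.
Qed.

(** The spatial derivatives of order at most m are indexed by finitely many tuples; the sum of their
    bounds serves as a common one. *)
Lemma iter_derive_uniform w : exists2 B, 0 <= B & forall s : seq 'I_N, (size s <= m)%N ->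
  forall z, `|iter_derive (w ++ map (fun i => (0 : R, basis_vec i)) s) Phi z| <= B.
Proof.
pose D (s : seq 'I_N) := iter_derive (w ++ map (fun i => (0 : R, basis_vec i)) s) Phi.
have [B BP] := choice (fun s : seq 'I_N => iter_derive_bounded (w ++ map (fun i => (0 : R, basis_vec i)) s)).
have B0 s : 0 <= B s by apply: le_trans (BP s 0).
exists (\sum_(k < m.+1) \sum_(u : k.-tuple 'I_N) B u).
  by apply: sumr_ge0 => k _; apply: sumr_ge0.
move=> s sm z; apply: (le_trans (BP s z)).
have ks : (size s < m.+1)%N by [].
rewrite (bigD1 (Ordinal ks))//= (bigD1 (in_tuple s))//= -addrA lerDl.
by rewrite addr_ge0// sumr_ge0// => k _; rewrite sumr_ge0.
Qed.

Let ell t := L (fun y => Phi (t, y)).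

(** By the mean value theorem in time, all spatial derivatives of a difference of two slices are
    O(|t - s|). This bounds its W^{m,oo} norm, and the continuity of [L] on functions supported in
    one box does the rest. *)
Lemma time_slices_lipschitz : (forall t, ell t \in Lfun leb q) /\
  exists2 A, 0 <= A & forall t s, lpn leb q (fun x => ell t x - ell s x) <= A * `|t - s|.
Proof.
have [M M0 P0] := spacetime_test_box; have [sP pP _] := tP.
have [LL Llin [C LC]] := LP (@compact_box R N M).
have [B0 B00 BP0] := iter_derive_uniform [::].
have [B1 B10 BP1] := iter_derive_uniform [:: (1, 0)].
have mapE (s : seq 'I_N) : map (fun v : E => (0 : R, v)) (map basis_vec s) = map (fun i => (0 : R, basis_vec i)) s.
  by rewrite -map_comp.
have sup t : sobolev_supported m (@box R N M) (fun y => Phi (t, y)).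
  have [] // := @smooth_sobolev R N m (@box R N M) (fun y => Phi (t, y)) B0.
  - exact: (iter_derive_slice [::] t sP).1.
  - by move=> x; exact: P0.
  - by move=> s sm x; rewrite (iter_derive_slice _ t sP).2 mapE; exact: BP0.
have eL t : ell t \in Lfun leb q by exact: LL.
split => //; exists (`|C| * B1); first by rewrite mulr_ge0.
(* The coefficient -1 comes first to match the form of the linearity assumption on [L]. *)
move=> t s; pose phi y := -1 * Phi (s, y) + Phi (t, y).
have [sphi dphi] := smooth_lin (-1) (iter_derive_slice [::] s sP).1 (iter_derive_slice [::] t sP).1.
have [supp nle] : sobolev_supported m (@box R N M) phi /\ (sobolev_infty_norm m phi <= (B1 * `|t - s|)%:E)%E.
  apply: smooth_sobolev => //.
    by move=> x nb; rewrite /phi !P0// mulr0 addr0.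
  move=> u um x; rewrite dphi (iter_derive_slice _ t sP).2 (iter_derive_slice _ s sP).2 mapE mulN1r addrC.
  apply: (mvt_lipschitz (f := fun t => iter_derive (map (fun i => (0 : R, basis_vec i)) u) Phi (t, x))
     (fun t => is_derive_time sP (map (fun i => (0 : R, basis_vec i)) u) t x)).
  by move=> t'; exact: BP1.
have -> : lpn leb q (fun x => ell t x - ell s x) = lpn leb q (L phi).
  apply: lpn_ae => //; first by apply: measurable_funB; exact: Lfun_meas (eL _).
    exact: LL.
  by apply: filterS (Llin (-1) _ _ (sup s) (sup t)) => x /(_ I) ->; rewrite mulN1r addrC.
rewrite -lee_fin -lpnE; last exact: LL.
apply: (le_trans (LC _ supp)); rewrite -mulrA EFinM.
have n0 := sobolev_infty_norm_ge0 m supp.1.1.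
apply: (@le_trans _ _ (`|C|%:E * sobolev_infty_norm m phi)%E).
  by apply: lee_wpmul2r => //; rewrite lee_fin ler_norm.
by apply: lee_wpmul2l.
Qed.

Lemma spacetime_version_mixed (r : R) : 1 < r -> exists2 Psi, spacetime_version L Phi Psi &
  (mixN P leb r q (EFin \o Psi) < +oo)%E.
Proof.
move=> r1; have [eL [A A0 lip]] := time_slices_lipschitz.
exists (family_version ell); last exact: (family_version_mixed q1 eL A0 lip r1).
split; first exact: (measurable_family_version eL).
by move=> t; exact: (family_version_slice q1 eL A0 lip).
Qed.

Lemma dttE z : dtt Phi z = iter_derive [:: (1 : R, 0 : E); (1 : R, 0 : E)] Phi z.
Proof.
have [sP _ _] := tP; case: z => t x; rewrite /dtt.
have h s : derive1 (fun t : R => iter_derive s Phi (t, x)) = (fun t => iter_derive ((1, 0) :: s) Phi (t, x)).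
  apply/funext => t'; rewrite derive1E.
  by have [_ ->] := is_derive_time sP s t' x.
by rewrite /derive1n/= (h [::]) (h [:: (1, 0)]).
Qed.

End version.

End supported.

Section mixed_space.
Context d1 (T : measurableType d1) d2 (X : measurableType d2) (R : realType).
Variable m1 : {finite_measure set T -> \bar R}.
Variable m2 : {sigma_finite_measure set X -> \bar R}.
Variables (p r : R) (q : \bar R).
Hypotheses (p1 : 1 < p) (r1 : 1 < r) (pr : p^-1 + r^-1 = 1) (q1 : (1 <= q)%E).
Let m := (m1 \x m2)%E.

Lemma mixN_le_lty (W V : T * X -> R) : measurable_fun [set: T * X] W -> measurable_fun [set: T * X] V ->
  (forall z, `|W z| <= `|V z|) -> (mixN m1 m2 p q (EFin \o V) < +oo)%E ->
  (mixN m1 m2 p q (EFin \o W) < +oo)%E.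
Proof.
move=> mW mV WV; apply: le_lt_trans; rewrite -(mixN_abse m1 m2 p q W) -(mixN_abse m1 m2 p q V).
by apply: (bn_le (banach_norm_mixN m1 m2 (ltW p1) q1)) => //;
  apply: measurableT_comp => //; exact/measurable_EFinP.
Qed.

Lemma mixN_add_lty (W V : T * X -> R) : measurable_fun [set: T * X] W -> measurable_fun [set: T * X] V ->
  (mixN m1 m2 p q (EFin \o W) < +oo)%E -> (mixN m1 m2 p q (EFin \o V) < +oo)%E ->
  (mixN m1 m2 p q (EFin \o (fun z => W z + V z)%R) < +oo)%E.
Proof.
move=> mW mV; rewrite -(mixN_abse m1 m2 p q W) -(mixN_abse m1 m2 p q V) -(mixN_abse m1 m2 p q (fun z => W z + V z)).
have NmP := banach_norm_mixN m1 m2 (ltW p1) q1.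
have mW' : measurable_fun [set: T * X] (fun z => `|(W z)%:E|)%E by apply: measurableT_comp => //; exact/measurable_EFinP.
have mV' : measurable_fun [set: T * X] (fun z => `|(V z)%:E|)%E by apply: measurableT_comp => //; exact/measurable_EFinP.
move=> NW NV; apply: le_lt_trans (_ : _ <= mixN m1 m2 p q (fun z => `|(W z)%:E| + `|(V z)%:E|)%E)%E _.
  apply: (bn_le NmP) => //.
  - by apply: measurableT_comp => //; apply/measurable_EFinP; exact: measurable_funD.
  - exact: emeasurable_funD.
  - by move=> z; rewrite -EFinD lee_fin ler_normD.
apply: le_lt_trans (bn_D NmP mW' mV' _ _) _ => //.
by rewrite lte_add_pinfty.
Qed.

Lemma mixN_snd_lty (h : X -> R) : h \in Lfun m2 q ->
  (mixN m1 m2 p q (EFin \o (fun z => h z.2)%R) < +oo)%E.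
Proof.
move=> hL; have p1e : (1 <= p%:E)%E by rewrite lee_fin ltW.
have cL : (cst 1 : T -> R) \in Lfun m1 p%:E by exact: Lfun_cst.
pose c := lpn m1 p%:E (cst 1 : T -> R).
have gL := Lfun_scal c q1 hL.
apply: le_lt_trans (_ : _ <= 'N[m2]_q[EFin \o (fun x => c * h x)%R])%E _; last by rewrite lpnE ?ltry.
apply: Lnorm_le_ae => //.
- apply: measurable_inner; apply/measurable_EFinP; apply: (measurableT_comp (Lfun_meas hL)).
  exact: measurable_snd.
- exact: Lfun_emeas gL.
apply: aeW => x; rewrite gee0_abs ?Lnorm_ge0//.
have -> : (fun t => (EFin \o (fun z : T * X => h z.2)%R) (t, x)) = EFin \o (fun t => h x * cst 1 t)%R.
  by apply/funext => t /=; rewrite mulr1.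
by rewrite lpnE ?lpnZ ?Lfun_scal//= lee_fin normrM mulrC (ger0_norm (lpn_ge0 _ _ _)).
Qed.

Lemma mixed_integrable (W V : T * X -> R) : measurable_fun [set: T * X] W -> measurable_fun [set: T * X] V ->
  (mixN m1 m2 p q (EFin \o W) < +oo)%E -> (mixN m1 m2 r (hoelder_conjugate q) (EFin \o V) < +oo)%E ->
  m.-integrable [set: T * X] (EFin \o (fun z => W z * V z)).
Proof.
move=> mW mV NW NV; apply/integrableP; split; first by apply/measurable_EFinP; exact: measurable_funM.
apply: le_lt_trans (mixed_hoelder (lt_trans ltr01 p1) (lt_trans ltr01 r1) pr q1 mW mV NW NV) _.
by rewrite lte_mul_pinfty ?Lnorm_ge0// ge0_fin_numE ?Lnorm_ge0.
Qed.

End mixed_space.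

(** * One mode tested against a space-time function *)

Section pairing.
Context {R : realType} {N : nat}.
Local Notation E := 'rV[R]_N.
Local Notation leb := (lebesgue_rV N).
Local Notation TR := (measurableTypeR R).
Local Notation P := (@period_measure R).
Local Notation stm := (P \x leb)%E.
Variables (p r : R) (q : \bar R).
Hypotheses (p1 : 1 < p) (r1 : 1 < r) (pr : p^-1 + r^-1 = 1) (q1 : (1 <= q)%E).
Local Notation q' := (hoelder_conjugate q).
Variables (L : (E -> R) -> (E -> R)) (Phi Psi : R * E -> R).
Hypothesis LL : forall t, L (fun y => Phi (t, y)) \in Lfun leb q'.
Hypothesis tP : spacetime_test_fun Phi.
Hypothesis PsiP : spacetime_version L Phi Psi.
Hypothesis NPsi : (mixN P leb r q' (EFin \o Psi) < +oo)%E.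

Let q'1 : (1 <= q')%E. Proof. exact: hoelder_conj_ge1. Qed.

Lemma test_bounded_mixed w (p0 : R) (q0 : \bar R) : 1 <= p0 -> (1 <= q0)%E ->
  measurable_fun [set: TR * E] (iter_derive w Phi) /\
  (mixN P leb p0 q0 (EFin \o iter_derive w Phi) < +oo)%E.
Proof.
move=> p01 q01; have [M M0 P0] := spacetime_test_box tP; have [sP _ _] := tP.
have mD : measurable_fun [set: TR * E] (iter_derive w Phi).
  exact: continuous_measurable_spacetime (smooth_continuous (smooth_iter_derive w sP)).
split => //; have [B BP] := iter_derive_bounded tP w.
by apply: (bounded_box_mixed p01 q01 mD BP (M := M)) => t x; exact: iter_derive_box.
Qed.

Lemma dtt_mixed (p0 : R) (q0 : \bar R) : 1 <= p0 -> (1 <= q0)%E ->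
  measurable_fun [set: TR * E] (dtt Phi) /\ (mixN P leb p0 q0 (EFin \o dtt Phi) < +oo)%E.
Proof.
move=> p01 q01; have -> : dtt Phi = iter_derive [:: (1 : R, 0 : E); (1 : R, 0 : E)] Phi.
  by apply/funext => z; exact: (dttE tP).
exact: test_bounded_mixed.
Qed.

Lemma dtt_trig b k x : \int[P]_t (dtt Phi (t, x) * trig b k t) = - k%:R ^+ 2 * fcoef (fun t => Phi (t, x)) b k.
Proof.
have [sP pP _] := tP.
apply: (@period_ibp _ b k (fun t => Phi (t, x)) (fun t => iter_derive [:: (1 : R, 0 : E)] Phi (t, x))).
- by move=> t; exact: (is_derive_time sP [::] t x).
- by move=> t; rewrite (dttE tP); exact: (is_derive_time sP [:: (1 : R, 0 : E)] t x).
- have -> : (fun t => dtt Phi (t, x)) = (fun t => iter_derive [:: (1 : R, 0 : E); (1 : R, 0 : E)] Phi (t, x)).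
    by apply/funext => t; exact: (dttE tP).
  move=> t; apply: differentiable_continuous; apply/derivable1_diffP.
  by have [h _] := is_derive_time sP [:: (1 : R, 0 : E); (1 : R, 0 : E)] t x.
- by move=> t; exact: pP.
- by move=> t; exact: iter_derive_periodic.
Qed.

Variables (b : bool) (k : nat) (u f : E -> R).
Hypotheses (uL : u \in Lfun leb q) (fL : f \in Lfun leb q').
Hypothesis uf : forall phi, test_fun phi ->
  \int[leb]_x (u x * (L phi x - k%:R ^+ 2 * phi x)) = \int[leb]_x (f x * phi x).

Let e : R -> R := trig b k.
Let mue : measurable_fun [set: TR * E] (fun z : TR * E => u z.2 * e z.1).
Proof.
apply: measurable_funM; first by apply: (measurableT_comp (Lfun_meas uL)); exact: measurable_snd.
by apply: (measurableT_comp (measurable_trig b k)); exact: measurable_fst.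
Qed.

Let Nue : (mixN P leb p q (EFin \o (fun z => u z.2 * e z.1)%R) < +oo)%E.
Proof.
have mu2 : measurable_fun [set: TR * E] (fun z : TR * E => u z.2).
  by apply: (measurableT_comp (Lfun_meas uL)); exact: measurable_snd.
apply: (mixN_le_lty p1 q1 mue mu2); last exact: (mixN_snd_lty _ p1 q1 uL).
by move=> z; rewrite normrM -[leRHS]mulr1 ler_wpM2l// trig_norm.
Qed.

(** At fixed x two integrations by parts in time replace the second time derivative by -k^2; at
    fixed t the slice of Phi is a spatial test function, to which [uf] applies. Fubini's theorem is
    used in both orders. *)
Lemma mode_pairing : \int[stm]_z (u z.2 * e z.1 * (dtt Phi z + Psi z)) =
  \int[leb]_x (f x * fcoef (fun t => Phi (t, x)) b k).
Proof.
have [sP pP [K cK K0]] := tP; have [mPsi PsiE] := PsiP.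
have r1' := ltW r1.
have [mD ND] := dtt_mixed r1' q'1.
have [mPhi NPhi] := test_bounded_mixed [::] r1' q'1.
have iA := mixed_integrable p1 r1 pr q1 mue mD Nue ND.
have iB := mixed_integrable p1 r1 pr q1 mue mPsi Nue NPsi.
have iC := mixed_integrable p1 r1 pr q1 mue mPhi Nue NPhi.
have ie x : P.-integrable [set: TR] (EFin \o (fun t => Phi (t, x) * e t)).
  have [B BP] := iter_derive_bounded tP [::].
  apply: (@bounded_integrable _ _ _ P _ B).
    apply: measurable_funM; last exact: measurable_trig.
    by apply: (measurableT_comp mPhi); exact: measurable_pair2.
  move=> t; rewrite normrM -[leRHS]mulr1; exact: (ler_pM (normr_ge0 _) (normr_ge0 _) (BP (t, x)) (trig_norm b k t)).
have ied x : P.-integrable [set: TR] (EFin \o (fun t => dtt Phi (t, x) * e t)).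
  have [B BP] := iter_derive_bounded tP [:: (1 : R, 0 : E); (1 : R, 0 : E)].
  apply: (@bounded_integrable _ _ _ P _ B).
    apply: measurable_funM; last exact: measurable_trig.
    by apply: (measurableT_comp mD); exact: measurable_pair2.
  move=> t; rewrite (dttE tP) normrM -[leRHS]mulr1; exact: (ler_pM (normr_ge0 _) (normr_ge0 _) (BP (t, x)) (trig_norm b k t)).
have iC' : stm.-integrable [set: TR * E] (EFin \o (fun z : TR * E => - k%:R ^+ 2 * (u z.2 * e z.1 * Phi z))).
  by have := integrableZl measurableT (- k%:R ^+ 2) iC; apply: eq_integrable.
have EA : \int[stm]_z (u z.2 * e z.1 * dtt Phi z) = \int[stm]_z (- k%:R ^+ 2 * (u z.2 * e z.1 * Phi z)).
  rewrite (Rint_prod21 iA) (Rint_prod21 iC'); apply: eq_Rintegral => x _ /=.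
  have -> : (fun t => u x * e t * dtt Phi (t, x)) = (fun t => u x * (dtt Phi (t, x) * e t)).
    by apply/funext => t; ring.
  have -> : (fun t => - k%:R ^+ 2 * (u x * e t * Phi (t, x))) = (fun t => (u x * - k%:R ^+ 2) * (Phi (t, x) * e t)).
    by apply/funext => t; ring.
  rewrite RintegralZl ?RintegralZl//.
  by rewrite dtt_trig -mulrA.
have -> : \int[stm]_z (u z.2 * e z.1 * (dtt Phi z + Psi z)) =
    \int[stm]_z (u z.2 * e z.1 * dtt Phi z) + \int[stm]_z (u z.2 * e z.1 * Psi z).
  by rewrite -RintegralD//; apply: eq_Rintegral => z _; rewrite mulrDr.
rewrite EA -RintegralD//.
pose F (z : TR * E) := - k%:R ^+ 2 * (u z.2 * e z.1 * Phi z) + u z.2 * e z.1 * Psi z.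
have iF : stm.-integrable [set: TR * E] (EFin \o F).
  by have := integrableD measurableT iC' iB; apply: eq_integrable.
rewrite -/F (Rint_prod12 iF).
have mf2 : measurable_fun [set: TR * E] (fun z : TR * E => f z.2).
  by apply: (measurableT_comp (Lfun_meas fL)); exact: measurable_snd.
have mPe : measurable_fun [set: TR * E] (fun z : TR * E => Phi z * e z.1).
  by apply: measurable_funM => //; apply: (measurableT_comp (measurable_trig b k)); exact: measurable_fst.
have iG : stm.-integrable [set: TR * E] (EFin \o (fun z : TR * E => Phi z * e z.1 * f z.2)).
  apply: (mixed_integrable p1 r1 pr q1 mPe mf2); last exact: (mixN_snd_lty _ r1 q'1 fL).
  have [mPhi' NPhi'] := test_bounded_mixed [::] (ltW p1) q1.
  apply: (mixN_le_lty p1 q1 mPe mPhi' _ NPhi') => z.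
  by rewrite normrM -[leRHS]mulr1 ler_wpM2l// trig_norm.
transitivity (\int[stm]_z (Phi z * e z.1 * f z.2)); last first.
  rewrite (Rint_prod21 iG); apply: eq_Rintegral => x _ /=.
  have -> : (fun t => Phi (t, x) * e t * f x) = (fun t => f x * (Phi (t, x) * e t)).
    by apply/funext => t; ring.
  by rewrite RintegralZl//; exact: ie.
rewrite (Rint_prod12 iG); apply: eq_Rintegral => t _ /=.
have [spt _] := iter_derive_slice (f := Phi) [::] t sP.
have tPt : test_fun (fun y => Phi (t, y)) by split => //; exists K => // x; exact: K0.
have PtL q0 : (1 <= q0)%E -> (fun y => Phi (t, y)) \in Lfun leb q0.
  move=> q01; have [M M0 P0] := spacetime_test_box tP; have [B BP] := iter_derive_bounded tP [::].
  have B0 : 0 <= B by apply: le_trans (BP 0).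
  apply: (Lfun_le q01 _ (Lfun_scal B q01 (box_indic_Lfun M q01))).
    exact: continuous_measurable_rV (smooth_continuous spt).
  apply: aeW => x; have [bx|nbx] := pselect (box M x); last by rewrite P0// normr0.
  by rewrite indicE mem_set// mulr1 (ger0_norm B0); exact: (BP (t, x)).
have dL : (fun x => L (fun y => Phi (t, y)) x - k%:R ^+ 2 * Phi (t, x)) \in Lfun leb q'.
  by apply: Lfun_sub => //; apply: Lfun_scal => //; exact: PtL.
have [iud _] := hoelder_Lfun q1 uL dL.
have [ifp _] := hoelder_Lfun q1 (PtL q q1) fL.
transitivity (e t * \int[leb]_x (u x * (L (fun y => Phi (t, y)) x - k%:R ^+ 2 * Phi (t, x)))).
  rewrite -RintegralZl//; apply: eq_Rint_ae.
  - by apply: (measurableT_comp ((measurable_EFinP _ _).1 (measurable_int _ iF))); exact: measurable_pair1.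
  - by apply: measurable_funM => //; apply/measurable_EFinP; exact: (measurable_int _ iud).
  by apply: filterS (PsiE t) => x; rewrite /F /= => ->; ring.
rewrite uf//.
have -> : \int[leb]_x (f x * Phi (t, x)) = \int[leb]_x (Phi (t, x) * f x).
  by apply: eq_Rintegral => x _; rewrite mulrC.
by rewrite -RintegralZl//; apply: eq_Rintegral => x _; rewrite mulrA (mulrC (e t)).
Qed.

End pairing.

(** * Breathers *)

Lemma integrable_Rint_inner d1 (T : measurableType d1) d2 (X : measurableType d2) (R : realType)
    (m1 : {sigma_finite_measure set T -> \bar R}) (m2 : {sigma_finite_measure set X -> \bar R})
    (f : T * X -> R) : (m1 \x m2)%E.-integrable [set: T * X] (EFin \o f) ->
  m2.-integrable [set: X] (EFin \o (fun x => \int[m1]_t f (t, x))).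
Proof.
move=> iF; have mG := measurable_fubini_G iF.
have mI : measurable_fun [set: X] (EFin \o (fun x => \int[m1]_t f (t, x))).
  by apply/measurable_EFinP; apply: measurableT_comp => //; exact: mG.
apply/integrableP; split => //.
apply: le_lt_trans ((integrable21ltyP _ _ (measurable_int _ iF)).1 iF).
apply: ge0_le_integral => //.
- exact: measurableT_comp.
- apply: (@measurable_fun_fubini_tonelli_G _ _ _ _ _ m1 (abse \o (EFin \o f))); last by move=> z; exact: abse_ge0.
  by apply: measurableT_comp => //; exact: measurable_int iF.
move=> x _; apply: le_trans (le_abse_integral m1 measurableT _); last first.
  by apply: measurableT_comp (measurable_int _ iF) _ => //; exact: measurable_pair2.
rewrite /= /Rintegral; set y := (\int[m1]_t _)%E.
by case: y => [y||] //=; rewrite normr0 leey.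
Qed.

(** The symmetry holds at every point, whether or not the series converges there, because [flim] is
    odd. *)
Lemma mode_op_symmetry d1 (T : measurableType d1) d2 (X : measurableType d2) (R : realType)
    (m1 : {finite_measure set T -> \bar R}) (e : nat -> T -> R) (ka : R) G V (n : nat) t t' x :
  (forall j, e j t' = (-1) ^+ n * e j t) ->
  mode_op m1 e ka G V (t', x) = (-1) ^+ n * mode_op (X := X) m1 e ka G V (t, x).
Proof.
move=> et; have E i : partial_mode m1 e ka G i V (t', x) = (-1) ^+ n * partial_mode m1 e ka G i V (t, x).
  rewrite /partial_mode /mode_sum mulr_sumr; apply: eq_bigr => j _ /=.
  by rewrite et mulrCA.
rewrite /mode_op; under eq_fun do rewrite E.
rewrite -signr_odd; case: (odd n); rewrite ?expr0 ?expr1 ?mul1r ?mulN1r.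
- rewrite -flimN; congr flim; apply/funext => i; exact: mulN1r.
- by congr flim; apply/funext => i; rewrite mul1r.
Qed.

Section solution.
Context {R : realType} {N : nat}.
Local Notation E := 'rV[R]_N.
Local Notation leb := (lebesgue_rV N).
Local Notation TR := (measurableTypeR R).
Local Notation P := (@period_measure R).
Local Notation stm := (P \x leb)%E.
Variables (p : R) (q : \bar R) (L : (E -> R) -> (E -> R)) (Q : E -> R).
Variable Rk : int -> (E -> R) -> (E -> R).
Hypotheses (p2 : 2 < p) (pq : (p%:E <= q)%E).
Local Notation q' := (hoelder_conjugate q).
Variables (b : bool) (m mL : nat).
Hypothesis m0 : (0 < m)%N.
Let kk j := (m * j.*2.+1)%N.
Hypothesis Rlin : forall j, bounded_linear q' q (Rk (kk j)%:Z).
Hypothesis Rsym : forall j, symmetric_op q' (Rk (kk j)%:Z).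
Variables (alpha C : R).
Hypotheses (alpha_gt : 1 - 2 / p < alpha) (C0 : 0 < C).
Hypothesis Rnorm : forall j f, f \in Lfun leb q' ->
  ('N[leb]_q[EFin \o Rk (kk j)%:Z f] <=
   (C * ((kk j)%:R ^+ 2 + 1) `^ (- (alpha / 2)))%:E * 'N[leb]_q'[EFin \o f])%E.
Hypothesis Rinv : forall j f phi, f \in Lfun leb q' -> test_fun phi ->
  \int[leb]_x (Rk (kk j)%:Z f x * (L phi x - (kk j)%:R ^+ 2 * phi x)) = \int[leb]_x (f x * phi x).
Hypothesis LP : locally_bounded_linear mL q' L.
Let Qt x := Q x `^ p^-1.
Let r : R := (1 - p^-1)^-1.
Hypothesis mQ : measurable_fun [set: E] Q.
Hypothesis mQt : measurable_fun [set: E] Qt.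
Hypothesis Q0 : {ae leb, forall x, 0 <= Q x}.
Hypothesis Rcpt : forall j, compact_op (hoelder_conjugate p%:E) p%:E (weighted p Q (Rk (kk j)%:Z)).
Variable cQ : R.
Hypothesis cQ0 : 0 <= cQ.
Hypothesis QtR : forall v, v \in Lfun leb r%:E -> (fun x => Qt x * v x) \in Lfun leb q' /\
  lpn leb q' (fun x => Qt x * v x) <= cQ * lpn leb r%:E v.
Hypothesis QtP : forall u, u \in Lfun leb q -> (fun x => Qt x * u x) \in Lfun leb p%:E /\
  lpn leb p%:E (fun x => Qt x * u x) <= cQ * lpn leb q u.
Variable om : E -> R.
Hypothesis omL : om \in Lfun leb r%:E.
Hypothesis ompos : 0 < \int[leb]_x (om x * weighted p Q (Rk (kk 0)%:Z) om x).

Let p0 : 0 < p. Proof. by move: p2; lra. Qed.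
Let p1 : 1 < p. Proof. by move: p2; lra. Qed.
Let p1e : (1 <= p%:E)%E. Proof. by rewrite lee_fin ltW. Qed.
Let q1 : (1 <= q)%E. Proof. exact: le_trans p1e pq. Qed.
Let q'1 : (1 <= q')%E. Proof. exact: hoelder_conj_ge1. Qed.
Let pr : p^-1 + r^-1 = 1. Proof. by rewrite /r invrK; ring. Qed.
Let i0 : 0 < p^-1. Proof. by rewrite invr_gt0. Qed.
Let i1 : p^-1 < 1. Proof. by rewrite invf_lt1//; move: p2; lra. Qed.
Let r0 : 0 < r. Proof. by rewrite invr_gt0 subr_gt0. Qed.
Let r1 : 1 < r. Proof. by rewrite /r -[ltLHS]invr1 ltf_pV2 ?posrE ?subr_gt0//; move: i0; lra. Qed.
Let r1e : (1 <= r%:E)%E. Proof. by rewrite lee_fin ltW. Qed.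
Let rpE : (r - 1) * (p - 1) = 1.
Proof. rewrite /r; field; rewrite !gt_eqF//=; move: p2; lra. Qed.
Let conjp : @hoelder_conjugate R p%:E = r%:E.
Proof.
by apply/esym/hoelder_conjugateP; [rewrite ltNyr|rewrite eqe gt_eqF|];
  rewrite ?inver ?gt_eqF// -EFinD pr.
Qed.
Let e j : R -> R := trig b (kk j).
Let G j (v : E -> R) : E -> R := Rk (kk j)%:Z (fun x => Qt x * v x).
Let kappa j := C * ((kk j)%:R ^+ 2 + 1) `^ (- (alpha / 2)) * cQ.
(** Cost 2^(1 - 2/p) against gain 2^(-alpha) per dyadic block; below 1 exactly by the assumption on
    alpha. The next constant carries the factor m^(-alpha). *)
Let rho : R := 2 `^ (1 - 2 / p - alpha).
Let Lam := C * cQ * (pi^-1 * (pi `^ p^-1) ^+ 2) * m%:R `^ (- alpha).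

Let me j : measurable_fun [set: TR] (e j). Proof. exact: measurable_trig. Qed.
Let e1 j t : `|e j t| <= 1. Proof. exact: trig_norm. Qed.
Let kk0 j : (0 < kk j)%N. Proof. by rewrite muln_gt0 m0. Qed.
Let eo i j : \int[P]_t (e i t * e j t) = if i == j then pi else 0.
Proof.
have := @trig_orth R b _ _ 0 (kk0 i) (kk0 j); under eq_Rintegral do rewrite !subr0.
by rewrite /kk eqn_pmul2l// eqSS (inj_eq double_inj).
Qed.
Let pi0 : 0 < pi :> R. Proof. exact: pi_gt0. Qed.
Let alpha0 : 0 < alpha.
Proof.
apply: le_lt_trans alpha_gt; rewrite subr_ge0 ler_pdivrMr// mul1r ltW//.
Qed.

Let GL j v : v \in Lfun leb r%:E -> G j v \in Lfun leb q.
Proof. by move=> vL; have [h _ _] := Rlin j; apply: h; have [] := QtR vL. Qed.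

Let Glin j (a : R) v w : v \in Lfun leb r%:E -> w \in Lfun leb r%:E ->
  {ae leb, forall x, G j (fun x => a * v x + w x) x = a * G j v x + G j w x}.
Proof.
move=> vL wL; have [_ h _] := Rlin j.
have [vL' _] := QtR vL; have [wL' _] := QtR wL.
have := h a _ _ vL' wL'; rewrite /G.
have -> : (fun x => Qt x * (a * v x + w x)) = (fun x => a * (Qt x * v x) + Qt x * w x).
  by apply/funext => x; ring.
by apply: filterS => x /(_ I).
Qed.

Let Gbd j v : v \in Lfun leb r%:E -> lpn leb q (G j v) <= kappa j * lpn leb r%:E v.
Proof.
move=> vL; have [fL fle] := QtR vL; have := Rnorm j fL.
have GL' : Rk (kk j)%:Z (fun x => Qt x * v x) \in Lfun leb q by exact: GL.
rewrite (lpnE GL') (lpnE fL) -EFinM lee_fin => /le_trans; apply.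
by rewrite /kappa -mulrA; apply: ler_wpM2l => //; rewrite mulr_ge0 ?powR_ge0// ltW.
Qed.

Let Lam0 : 0 <= Lam.
Proof. by rewrite !mulr_ge0 ?powR_ge0 ?invr_ge0 ?sqr_ge0// ltW. Qed.

Let rho01 : 0 <= rho < 1.
Proof.
rewrite powR_ge0/= /rho -opprB powRN invf_lt1 ?powR_gt0//.
by rewrite -[ltLHS](powR1E (alpha - (1 - 2 / p))); apply: gt0_ltr_powR; rewrite ?nnegrE ?subr_gt0// ltr1n.
Qed.

(** On the n-th block 2^n <= j + 1 <= 2 j + 1, so the frequency is at least m 2^n and the bound of
    R_k splits into m^(-alpha) and 2^(-n alpha). *)
Let kapP n j : (2 ^ n - 1 <= j < 2 ^ n.+1 - 1)%N ->
  kappa j * (pi^-1 * block_const pi p (2 ^ n) ^+ 2) <= Lam * rho ^+ n.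
Proof.
move=> /andP[nj _]; pose y : R := 2 ^+ n.
have y0 : 0 < y by rewrite exprn_gt0.
have mR : 0 < m%:R :> R by rewrite ltr0n.
have my0 : 0 < m%:R * y by rewrite mulr_gt0.
have ky : m%:R * y <= (kk j)%:R.
  rewrite /y -natrX -natrM ler_nat /kk leq_mul2l; apply/orP; right.
  by rewrite leq_subLR add1n in nj; apply: (leq_trans nj); rewrite ltnS -addnn leq_addr.
have E1 : ((kk j)%:R ^+ 2 + 1) `^ (- (alpha / 2)) <= m%:R `^ (- alpha) * y `^ (- alpha).
  have k1 : 0 < (kk j)%:R ^+ 2 + 1 :> R by rewrite ltr_wpDl// sqr_ge0.
  rewrite -powRM ?(ltW mR) ?(ltW y0)// !powRN lef_pV2 ?posrE ?powR_gt0//.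
  have -> : (m%:R * y) `^ alpha = ((m%:R * y) ^+ 2) `^ (alpha / 2).
    by rewrite -powR_mulrn ?(ltW my0)// -powRrM; congr (_ `^ _); field.
  apply: ge0_ler_powR; rewrite ?nnegrE ?divr_ge0 ?(ltW alpha0) ?sqr_ge0// ?addr_ge0 ?sqr_ge0//.
  by apply: (@le_trans _ _ ((kk j)%:R ^+ 2)); [rewrite lerXn2r ?nnegrE// ltW|rewrite lerDl].
have E2 : y `^ (- alpha) * (y `^ (2^-1 - p^-1)) ^+ 2 = rho ^+ n.
  rewrite -!powR_mulrn ?powR_ge0// -!powRrM -powRD ?(gt_eqF y0) ?implybT//.
  by rewrite /y -powR_mulrn// -powRrM; congr (_ `^ _); field; rewrite gt_eqF.
rewrite /block_const natrX -/y exprMn.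
apply: (@le_trans _ _ (C * (m%:R `^ (- alpha) * y `^ (- alpha)) * cQ * (pi^-1 * ((pi `^ p^-1) ^+ 2 * (y `^ (2^-1 - p^-1)) ^+ 2)))).
  apply: ler_wpM2r; first by rewrite !mulr_ge0 ?invr_ge0 ?exprn_ge0 ?powR_ge0// ltW.
  by apply: ler_wpM2r => //; apply: ler_wpM2l => //; exact: ltW.
by rewrite -E2 /Lam le_eqVlt; apply/orP; left; apply/eqP; ring.
Qed.

Let Gsym j v w : v \in Lfun leb r%:E -> w \in Lfun leb r%:E ->
  \int[leb]_x (Qt x * G j v x * w x) = \int[leb]_x (v x * (Qt x * G j w x)).
Proof.
move=> vL wL; have [fL _] := QtR vL; have [gL _] := QtR wL.
have := Rsym j fL gL => h.
transitivity (\int[leb]_x (G j v x * (Qt x * w x))); first by apply: eq_Rintegral => x _; rewrite mulrCA mulrA.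
by rewrite h; apply: eq_Rintegral => x _; rewrite mulrCA mulrA.
Qed.

Let Gcpt j (v : nat -> E -> R) (M : R) : (forall n, v n \in Lfun leb r%:E) ->
  (forall n, lpn leb r%:E (v n) <= M) ->
  exists sigma, {homo sigma : i k / (i < k)%N} /\ exists2 g, g \in Lfun leb p%:E &
  lpn leb p%:E (fun x => Qt x * G j (v (sigma n)) x - g x) @[n --> \oo] --> 0.
Proof.
move=> vL vM; have [_ h] := Rcpt j; rewrite conjp in h.
have [|sigma [hs [g gL gc]]] := h v vL.
  by exists M => n; rewrite lpnE// lee_fin.
exists sigma; split => //; exists g => //.
exact: (fine_cvg gc).
Qed.

Local Notation Lr := (Lfun stm r%:E).
Let D := cQ * Lam / (1 - rho).

Let ground : exists V : TR * E -> R,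
  [/\ V \in Lr, {ae stm, forall z, weighted_op P e pi Qt G V z = spow r (V z)},
    1 <= D * lpn stm r%:E V `^ (2 - r) &
    ((lpn stm r%:E V `^ (r - 1))%:E <= cQ%:E * mixN P leb p q (EFin \o mode_op P e pi G V))%E].
Proof.
exact: (weighted_ground_state me e1 pi0 eo p2 pr pq mQt cQ0 QtP GL Glin Gbd Lam0 rho01 kapP Gsym Gcpt omL ompos).
Qed.

(** * From the dual ground state to the wave equation *)

Section equation.
Variable V : TR * E -> R.
Hypothesis VL : V \in Lr.
Hypothesis VE : {ae stm, forall z, weighted_op P e pi Qt G V z = spow r (V z)}.
Let U : R * E -> R := mode_op P e pi G V.
(** A representative of V, obtained by inverting the duality map. Unlike V it inherits the time
    symmetries of U at every point, which the slicewise Fourier argument requires. *)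
Let W (z : R * E) : R := spow p (Qt z.2 * U z).

Let e_shift j t : e j (t + pi / m%:R) = (-1) ^+ 1 * e j t.
Proof.
rewrite /e trigD.
(* The phase is an odd multiple of pi because the frequency is an odd multiple of m. *)
have -> : (kk j)%:R * (pi / m%:R) = pi + j%:R * (2 * pi) :> R.
  rewrite /kk natrM -addn1 natrD -muln2 natrM; field.
  by rewrite pnatr_eq0 -lt0n.
by rewrite cos2piD sin2piD cospi sinpi expr1 mulr0 mul0r subr0.
Qed.

Lemma solution_shift t x : U (t + pi / m%:R, x) = - U (t, x).
Proof. by rewrite /U (@mode_op_symmetry _ _ _ _ _ P e pi G V 1 t)// expr1 mulN1r. Qed.

Lemma solution_opp t x : U (- t, x) = (-1) ^+ b * U (t, x).
Proof. by apply: mode_op_symmetry => j; exact: trigN. Qed.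

Lemma solution_periodic t x : U (t + 2 * pi, x) = U (t, x).
Proof.
rewrite /U (@mode_op_symmetry _ _ _ _ _ P e pi G V 0 t) ?expr0 ?mul1r// => j.
by rewrite mul1r; exact: trig2pi.
Qed.

Lemma measurable_solution : measurable_fun [set: TR * E] U.
Proof. exact: (measurable_mode_op me e1 pi0 p2 pr GL VL). Qed.

Lemma solution_mixed : (mixN P leb p q (EFin \o U) <= (Lam * lpn stm r%:E V / (1 - rho))%:E)%E.
Proof. exact: (mode_op_le me e1 pi0 eo p2 pr pq GL Gbd Lam0 rho01 kapP VL). Qed.

Let mU := measurable_solution.
Let NU : (mixN P leb p q (EFin \o U) < +oo)%E.
Proof. exact: le_lt_trans solution_mixed (ltry _). Qed.

Let mQ2 : measurable_fun [set: TR * E] (fun z : TR * E => Qt z.2).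
Proof. by apply: (measurableT_comp mQt); exact: measurable_snd. Qed.

Let mW : measurable_fun [set: TR * E] W.
Proof. by apply: (measurableT_comp (measurable_spow p)); exact: measurable_funM. Qed.

Let WV : {ae stm, forall z, W z = V z}.
Proof. by apply: filterS VE => z; rewrite /weighted_op -/U /W => ->; rewrite spowK. Qed.

Let WL : W \in Lr. Proof. exact: Lfun_ae VL WV. Qed.

Let cV j : coef P e pi j V \in Lfun leb r%:E. Proof. exact: (coef_Lfun me e1 pi0 p2 pr). Qed.

(** Coefficients do not see null sets: [coef_block] is applied to the difference, whose norm is
    0. *)
Let coef_WV j : {ae leb, forall x, coef P e pi j V x = coef P e pi j W x}.
Proof.
pose d (z : TR * E) := -1 * V z + W z.
have dL : d \in Lr by apply: Lfun_add => //; exact: Lfun_scal.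
have d0 : lpn stm r%:E d = 0.
  have -> : 0 = lpn stm r%:E (fun z => 0 * V z) by rewrite lpnZ// normr0 mul0r.
  have dV : {ae stm, forall z, d z = 0 * V z}.
    have [B [mB B0 sub]] := WV; exists B; split => // z nz; apply: sub => zE; apply: nz.
    by move: zE; rewrite /d /= => ->; ring.
  exact: (lpn_ae r1e (Lfun_meas dL) (Lfun_scal 0 r1e VL) dV).
have := coef_block me e1 pi0 eo p2 pr j j.+1 dL; rewrite d0 mulr0 big_nat1 sqrtr_sqr => n0.
have cd0 : lpn leb r%:E (coef P e pi j d) = 0.
  by apply/eqP; rewrite -normr_le0.
have cd : {ae leb, forall x, coef P e pi j d x = 0}.
  by apply: (lpn_eq0 r1e _ cd0); exact: (coef_Lfun me e1 pi0 p2 pr).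
apply: filterS2 cd (coef_lin pi me e1 p2 pr j (-1) VL WL) => x; rewrite -/d => -> /eqP.
by rewrite mulN1r eq_sym addrC subr_eq0 => /eqP.
Qed.

Section test.
Variables (Phi Psi : R * E -> R).
Hypothesis tP : spacetime_test_fun Phi.
Hypothesis PsiP : spacetime_version L Phi Psi.
Hypothesis NPsi : (mixN P leb r q' (EFin \o Psi) < +oo)%E.

Let LLt t : L (fun y => Phi (t, y)) \in Lfun leb q'.
Proof. exact: (time_slices_lipschitz q'1 LP tP).1. Qed.

Let Th z := dtt Phi z + Psi z.
Let mTh : measurable_fun [set: TR * E] Th.
Proof.
have [mD _] := dtt_mixed tP (ltW r1) q'1.
by apply: measurable_funD => //; have [] := PsiP.
Qed.

Let NTh : (mixN P leb r q' (EFin \o Th) < +oo)%E.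
Proof.
have [mD ND] := dtt_mixed tP (ltW r1) q'1.
by apply: mixN_add_lty => //; have [] := PsiP.
Qed.

Let iUT : stm.-integrable [set: TR * E] (EFin \o (fun z : TR * E => U z * Th z)).
Proof. exact: (mixed_integrable p1 r1 pr q1 mU mTh NU NTh). Qed.

Let S n : TR * E -> R := partial_mode P e pi G n V.

Let iuT j : stm.-integrable [set: TR * E] (EFin \o (fun z : TR * E => G j (coef P e pi j V) z.2 * e j z.1 * Th z)).
Proof.
have uL := GL j (cV j).
have mu2 : measurable_fun [set: TR * E] (fun z : TR * E => G j (coef P e pi j V) z.2).
  by apply: (measurableT_comp (Lfun_meas uL)); exact: measurable_snd.
have mue : measurable_fun [set: TR * E] (fun z : TR * E => G j (coef P e pi j V) z.2 * e j z.1).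
  by apply: measurable_funM => //; apply: (measurableT_comp (me j)); exact: measurable_fst.
apply: (mixed_integrable p1 r1 pr q1 mue mTh _ NTh).
apply: (mixN_le_lty p1 q1 mue mu2); last exact: (mixN_snd_lty _ p1 q1 uL).
by move=> z; rewrite normrM -[leRHS]mulr1 ler_wpM2l.
Qed.

Let fc j x := fcoef (fun t => Phi (t, x)) b (kk j).

Let partial_pairing n : stm.-integrable [set: TR * E] (EFin \o (fun z : TR * E => S n z * Th z)) /\
  \int[stm]_z (S n z * Th z) =
  \sum_(0 <= j < 2 ^ n - 1) \int[leb]_x (Qt x * coef P e pi j V x * fc j x).
Proof.
have SE : (fun z => S n z * Th z) = (fun z => \sum_(0 <= j < 2 ^ n - 1) (G j (coef P e pi j V) z.2 * e j z.1 * Th z)).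
  by apply/funext => z; rewrite /S /partial_mode /mode_sum mulr_suml.
have [iS sS] := @Rintegral_sum_nat _ _ _ stm
  (fun j z => G j (coef P e pi j V) z.2 * e j z.1 * Th z) 0 (2 ^ n - 1) (fun j _ => iuT j).
rewrite SE; split => //; rewrite sS; apply: eq_big_nat => j _.
have [fL _] := QtR (cV j).
exact: (@mode_pairing R N p r q p1 r1 pr q1 L Phi Psi LLt tP PsiP NPsi b (kk j) _ _ (GL j (cV j)) fL (fun phi => Rinv j fL)).
Qed.

(** The tail of U is geometrically small in the mixed norm and is paired with [Th] by the mixed
    Hoelder inequality. *)
Let lhs_cvg : \int[stm]_z (S n z * Th z) @[n --> \oo] --> \int[stm]_z (U z * Th z).
Proof.
pose K := fine (mixN P leb r q' (EFin \o Th)).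
have KE : mixN P leb r q' (EFin \o Th) = K%:E by rewrite fineK// ge0_fin_numE ?Lnorm_ge0//; exact: NTh.
have K0 : 0 <= K by rewrite fine_ge0 ?Lnorm_ge0.
have mS n : measurable_fun [set: TR * E] (S n).
  by apply: (measurable_mode_sum me) => j _; exact: Lfun_meas (GL j (cV j)).
pose c := Lam * lpn stm r%:E V / (1 - rho) * K.
have le n : `|\int[stm]_z (U z * Th z) - \int[stm]_z (S n z * Th z)| <= c * rho ^+ n.
  have iD : stm.-integrable [set: TR * E] (EFin \o (fun z : TR * E => (U z - S n z) * Th z)).
    have := integrableB measurableT iUT (partial_pairing n).1; apply: eq_integrable => // z _ /=.
    by rewrite mulrBl.
  have -> : \int[stm]_z (U z * Th z) - \int[stm]_z (S n z * Th z) = \int[stm]_z ((U z - S n z) * Th z).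
    by rewrite -RintegralB//; [apply: eq_Rintegral => z _; rewrite mulrBl|exact: (partial_pairing n).1].
  apply: (le_trans (le_normr_Rintegral measurableT iD)).
  have pl := partial_mode_le me e1 pi0 eo p2 pr pq GL Gbd Lam0 rho01 kapP n VL.
  have := mixed_hoelder p0 r0 pr q1 (measurable_funB mU (mS n)) mTh (le_lt_trans pl (ltry _)) NTh.
  rewrite -lee_fin /Rintegral fineK; last first.
    by rewrite ge0_fin_numE ?integral_ge0//; have /integrableP[] := iD.
  move=> /le_trans; apply; rewrite KE.
  apply: (@le_trans _ _ ((Lam * lpn stm r%:E V * rho ^+ n / (1 - rho))%:E * K%:E)%E).
    by apply: lee_wpmul2r => //; rewrite lee_fin.
  by rewrite -EFinM lee_fin le_eqVlt; apply/orP; left; apply/eqP; rewrite /c; ring.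
apply/cvgrPdist_le => eps eps0.
have rc : c * rho ^+ n @[n --> \oo] --> 0.
  rewrite -[X in _ --> X](mulr0 c); apply: cvgMr; apply: cvg_expr.
  by case/andP: rho01 => h0 h1; rewrite ger0_norm.
move/cvgrPdist_le: rc => /(_ _ eps0); apply: filterS => n; rewrite sub0r normrN => h.
exact: le_trans (le n) (le_trans (ler_norm _) h).
Qed.

Let fct k x : P.-integrable [set: TR] (EFin \o (fun t => Phi (t, x) * trig b k t)) /\
  measurable_fun [set: E] (fun x => fcoef (fun t => Phi (t, x)) b k).
Proof.
have [B BP] := iter_derive_bounded tP [::].
have [mPhi _] := test_bounded_mixed tP [::] (ltW r1) q'1.
split.
  apply: (@bounded_integrable _ _ _ P _ B).
    apply: measurable_funM; last exact: measurable_trig.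
    by apply: (measurableT_comp mPhi); exact: measurable_pair2.
  by move=> t; rewrite normrM -[leRHS]mulr1; exact: (ler_pM (normr_ge0 _) (normr_ge0 _) (BP (t, x)) (trig_norm b k t)).
have := @measurable_coef _ _ _ _ _ P (fun=> trig b k) 1 (fun=> measurable_trig b k) 0 Phi mPhi.
by apply: eq_measurable_fun => y _; rewrite /coef invr1 mul1r.
Qed.

Let ifc j (w : E -> R) : w \in Lfun leb r%:E ->
  leb.-integrable [set: E] (EFin \o (fun x => Qt x * w x * fc j x)).
Proof.
move=> wL; have [fL _] := QtR wL; set f := (fun x => Qt x * w x) in fL.
have [mPhi NPhi] := test_bounded_mixed tP [::] (ltW p1) q1.
have mf2 : measurable_fun [set: TR * E] (fun z : TR * E => f z.2).
  by apply: (measurableT_comp (Lfun_meas fL)); exact: measurable_snd.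
have mPe : measurable_fun [set: TR * E] (fun z : TR * E => Phi z * e j z.1).
  by apply: measurable_funM => //; apply: (measurableT_comp (me j)); exact: measurable_fst.
have iG : stm.-integrable [set: TR * E] (EFin \o (fun z : TR * E => Phi z * e j z.1 * f z.2)).
  apply: (mixed_integrable p1 r1 pr q1 mPe mf2); last exact: (mixN_snd_lty _ r1 q'1 fL).
  apply: (mixN_le_lty p1 q1 mPe mPhi _ NPhi) => z.
  by rewrite normrM -[leRHS]mulr1 ler_wpM2l.
have := integrable_Rint_inner iG; apply: eq_integrable => // x _ /=.
congr EFin; rewrite -/(f x) /fc /fcoef -RintegralZl//; last exact: (fct _ _).1.
by apply: eq_Rintegral => t _; rewrite mulrC.
Qed.

Let F n x := \sum_(0 <= j < n) (Qt x * coef P e pi j W x * fc j x).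

Let cW j : coef P e pi j W \in Lfun leb r%:E. Proof. exact: (coef_Lfun me e1 pi0 p2 pr). Qed.

Let mF n : measurable_fun [set: E] (F n).
Proof.
apply: measurable_sum => j; apply: measurable_funM; last exact: (fct _ 0).2.
by apply: measurable_funM => //; exact: Lfun_meas (cW j).
Qed.

Let partial_pairingF n : \int[stm]_z (S n z * Th z) = \int[leb]_x F (2 ^ n - 1) x.
Proof.
have [_ ->] := @Rintegral_sum_nat _ _ _ leb (fun j x => Qt x * coef P e pi j W x * fc j x) 0 (2 ^ n - 1)
  (fun j _ => ifc j (cW j)).
rewrite (partial_pairing n).2; apply: eq_big_nat => j _; apply: eq_Rint_ae.
- by apply/measurable_EFinP; exact: (measurable_int _ (ifc j (cV j))).
- by apply/measurable_EFinP; exact: (measurable_int _ (ifc j (cW j))).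
by apply: filterS (coef_WV j) => x ->.
Qed.

Let g x t := Qt x * W (t, x).

Let W_slice : {ae leb, forall x, P.-integrable [set: TR] (EFin \o (fun t => W (t, x)))}.
Proof.
apply: filterS (slice_Lfun (ltW r1) WL) => x; exact: Lfun_fin_integrable (ltW r1).
Qed.

Let FE : {ae leb, forall x, P.-integrable [set: TR] (EFin \o g x) /\
  forall n, F n x = fpair b m (g x) (fun t => Phi (t, x)) n}.
Proof.
apply: filterS W_slice => x ix; split.
  by have := integrableZl measurableT (Qt x) ix; apply: eq_integrable.
move=> n; rewrite /F /fpair mulr_sumr; apply: eq_bigr => j _.
have iWe : P.-integrable [set: TR] (EFin \o (fun t => W (t, x) * e j t)) by exact: (integrable_mul_e me e1 j ix).
have -> : \int[P]_t (g x t * trig b (m * j.*2.+1) t) = Qt x * \int[P]_t (W (t, x) * e j t).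
  by rewrite -RintegralZl//; apply: eq_Rintegral => t _; rewrite /g -mulrA.
by rewrite /coef /fc /kk; ring.
Qed.

Let W_shift t x : W (t + pi / m%:R, x) = - W (t, x).
Proof. by rewrite /W /= solution_shift mulrN spowN. Qed.

Let W_opp t x : W (- t, x) = (-1) ^+ b * W (t, x).
Proof. by rewrite /W /= solution_opp; case: b; rewrite ?expr1 ?expr0 ?mul1r ?mulN1r// mulrN spowN. Qed.

Let W_periodic t x : W (t + 2 * pi, x) = W (t, x).
Proof. by rewrite /W /= solution_periodic. Qed.

Let weight_integrable (H : R * E -> R) : measurable_fun [set: TR * E] H -> (mixN P leb p q (EFin \o H) < +oo)%E ->
  stm.-integrable [set: TR * E] (EFin \o (fun z : TR * E => Qt z.2 * H z * W z)).
Proof.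
move=> mH NH; have [QHL _] := weight_mixed p2 pq mQt QtP mH NH.
have WL' : W \in Lfun stm (hoelder_conjugate p%:E) by rewrite conjp.
by have [] := hoelder_Lfun p1e QHL WL'.
Qed.

Let h x := \int[P]_t (Qt x * Phi (t, x) * W (t, x)).

Let iPhi : stm.-integrable [set: TR * E] (EFin \o (fun z : TR * E => Qt z.2 * Phi z * W z)).
Proof. by have [mPhi NPhi] := test_bounded_mixed tP [::] (ltW p1) q1; exact: weight_integrable. Qed.

Let mh : measurable_fun [set: E] h.
Proof. by apply/measurable_EFinP; exact: (measurable_int _ (integrable_Rint_inner iPhi)). Qed.

(** At almost every x the sums [F] are the truncated pairings [fpair] of the slice of Q^(1/p) W with
    that of Phi and converge by [fpair_cvg]; [fpair_bound] provides the majorant for dominated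
    convergence in x. *)
Let rhs_cvg : \int[leb]_x F (2 ^ n - 1) x @[n --> \oo] --> \int[stm]_z (Qt z.2 * Phi z * W z).
Proof.
rewrite (Rint_prod21 iPhi) -/h.
have [sP pP _] := tP.
have [c c0 cP] := @lip_sin_half R.
have [B BP] := iter_derive_bounded tP [::].
have [K KP] := iter_derive_bounded tP [:: (1 : R, 0 : E)].
have K0 : 0 <= K by apply: le_trans (KP 0).
have B0 : 0 <= B by apply: le_trans (BP 0).
have [M M0 P0] := spacetime_test_box tP.
have lip x t s : `|Phi (t, x) - Phi (s, x)| <= K * `|t - s|.
  apply: (mvt_lipschitz (f := fun t => Phi (t, x)) (f' := fun t => iter_derive [:: (1 : R, 0 : E)] Phi (t, x))).
  - by move=> t'; exact: (is_derive_time sP [::] t' x).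
  - by move=> t'; exact: KP.
have cPx x := cP (fun t => Phi (t, x)) K K0 (fun t => pP t x) (lip x).
have bPx x t : `|Phi (t, x)| <= B by exact: BP (t, x).
have gp x t : g x (t + 2 * pi) = g x t by rewrite /g W_periodic.
have gs x t : g x (t + pi / m%:R) = - g x t by rewrite /g W_shift mulrN.
have gr x t : g x (- t) = (-1) ^+ b * g x t by rewrite /g W_opp mulrCA.
(* Every slice pairing vanishes off the support of Phi; inserting the indicator of a box into the
   majorant makes it integrable in x. *)
pose H (z : R * E) : R := \1_(@box R N M) z.2.
have mH : measurable_fun [set: TR * E] H.
  by apply: (measurableT_comp (Lfun_meas (box_indic_Lfun M q1))); exact: measurable_snd.
have iH := weight_integrable mH (mixN_snd_lty P p1 q1 (box_indic_Lfun M q1)).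
have iHn : stm.-integrable [set: TR * E] (EFin \o (fun z : TR * E => `|Qt z.2 * H z * W z|)).
  exact: integrable_norm.
have iG0 : leb.-integrable [set: E] (EFin \o (fun x => (B + c * K) * \int[P]_t `|Qt x * H (t, x) * W (t, x)|)).
  by have := integrableZl measurableT (B + c * K) (integrable_Rint_inner iHn); apply: eq_integrable.
apply: (Rint_dominated _ mh _ iG0) => //.
- apply: filterS FE => x [ig FEx].
  have -> : (fun n => F (2 ^ n - 1) x) = (fun n => fpair b m (g x) (fun t => Phi (t, x)) (2 ^ n - 1)).
    by apply/funext => n; exact: FEx.
  have -> : h x = \int[P]_t (g x t * Phi (t, x)).
    by apply: eq_Rintegral => t _; rewrite /g; ring.
  have := fpair_cvg m0 ig (gp x) (gs x) (gr x) K0 (lip x) (bPx x) c0 (cPx x).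
  apply: (@cvg_comp _ _ _ (fun n => 2 ^ n - 1)%N).
  move=> Z [A _ ZA]; exists A => // n /= An; apply: ZA => /=; apply: (leq_trans An).
  by rewrite -ltnS subn1 prednK ?expn_gt0// ltn_expl.
- move=> n; apply: filterS FE => x [ig ->].
  have [bx|nbx] := pselect (@box R N M x).
    apply: (le_trans (fpair_bound m0 ig (gp x) (gs x) (gr x) K0 (lip x) (bPx x) c0 (cPx x) _)).
    rewrite le_eqVlt; apply/orP; left; apply/eqP; congr (_ * _).
    by apply: eq_Rintegral => t _; rewrite /H /= indicE mem_set// mulr1.
  rewrite /fpair big1 ?mulr0 ?normr0; last first.
    move=> j _; rewrite /fcoef; under [X in _ * X]eq_Rintegral do rewrite P0// mul0r.
    by rewrite Rintegral_cst// mul0r mulr0.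
  apply: mulr_ge0; first by rewrite addr_ge0// mulr_ge0// ltW.
  by apply: fine_ge0; apply: integral_ge0.
Qed.

(** Both sides are limits of one sequence: tested mode by mode, the partial sums of U give the
    partial pairings of Q^(1/p) W with Phi. *)
Lemma weak_equation :
  let lhs := fun z : TR * E => U z * (dtt Phi z + Psi z) in
  let rhs := fun z : TR * E => Q z.2 * `|U z| `^ (p - 2) * U z * Phi z in
  [/\ stm.-integrable setT (EFin \o lhs), stm.-integrable setT (EFin \o rhs) &
      \int[stm]_z lhs z = \int[stm]_z rhs z].
Proof.
move=> lhs rhs.
have rE z : rhs z = Q z.2 * spow p (U z) * Phi z by rewrite /rhs spow_abs !mulrA.
have [mPhi _] := test_bounded_mixed tP [::] (ltW p1) q1.
have mr : measurable_fun [set: TR * E] rhs.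
  rewrite (_ : rhs = fun z => Q z.2 * spow p (U z) * Phi z); last by apply/funext.
  apply: measurable_funM => //; apply: measurable_funM.
    by apply: (measurableT_comp mQ); exact: measurable_snd.
  by apply: (measurableT_comp (measurable_spow p)).
have ae : {ae stm, forall z : TR * E, Qt z.2 * Phi z * W z = rhs z}.
  apply: filterS (ae_snd P Q0) => z Qz; rewrite rE /W spow_scale ?powR_ge0//.
  (* For Q >= 0 the weight splits as Q^(1/p) (Q^(1/p))^(p-1), the second factor being the one that
     the duality map produces. *)
  have -> : Q z.2 = Qt z.2 * Qt z.2 `^ (p - 1).
    by rewrite mulr_powRB1 ?powR_ge0// /Qt -powRrM mulVf ?gt_eqF// powRr1.
  ring.
have ir : stm.-integrable setT (EFin \o rhs).
  apply/integrableP; split; first exact/measurable_EFinP.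
  have /integrableP[mi] := iPhi; apply: le_lt_trans; rewrite le_eqVlt; apply/orP; left; apply/eqP.
  apply: ae_eq_integral => //.
  - by apply: measurableT_comp => //; exact/measurable_EFinP.
  - exact: measurableT_comp.
  by apply: filterS ae => z zE _ /=; rewrite zE.
split => //.
transitivity (\int[stm]_z (Qt z.2 * Phi z * W z)).
  apply: (cvg_unique _ lhs_cvg) => //.
  by rewrite /=; under eq_fun do rewrite partial_pairingF; exact: rhs_cvg.
by apply: eq_Rint_ae => //; apply/measurable_EFinP; exact: measurable_int iPhi.
Qed.

End test.

Lemma solution_distributional : distributional_solution p L Q U.
Proof.
move=> Phi tP; have [Psi PsiP NPsi] := spacetime_version_mixed q'1 LP tP r1.
by exists Psi => //; exact: weak_equation.
Qed.

End equation.

(** The last clause keeps n = |V| and makes the dependence on m explicit: the remaining constants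
    are common to all m, as the comparison of different base frequencies requires. *)
Lemma breather : exists U : R * E -> R,
  [/\ measurable_fun [set: TR * E] U,
      forall t x, U (t + 2 * pi, x) = U (t, x),
      (mixed_norm p q U < +oo)%E &
      (forall t x, U (t + pi / m%:R, x) = - U (t, x)) /\ forall t x, U (- t, x) = (-1) ^+ b * U (t, x)] /\
  distributional_solution p L Q U /\
  exists2 n : R, 0 <= n & 1 <= cQ * (C * cQ * (pi^-1 * (pi `^ p^-1) ^+ 2)) / (1 - rho) * m%:R `^ (- alpha) * n `^ (2 - r) /\
    ((n `^ (r - 1))%:E <= cQ%:E * mixed_norm p q U)%E.
Proof.
have [V [VL VE D1 le]] := ground; exists (mode_op P e pi G V); split.
  split; [exact: measurable_solution|exact: solution_periodic| |split].
  - exact: le_lt_trans (solution_mixed VL) (ltry _).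
  - exact: solution_shift.
  - exact: solution_opp.
split; first exact: solution_distributional.
exists (lpn stm r%:E V); first exact: lpn_ge0.
split => //; apply: le_trans D1 _; rewrite le_eqVlt; apply/orP; left; apply/eqP.
by rewrite /D /Lam; congr (_ * _); ring.
Qed.

End solution.

(** Odd multiples of a positive number keep its parity and are never 0, so all frequencies of the
    construction stay in [freq s] once the base is even for s = 4 and odd for s = 5. *)
Definition base_freq (s j : nat) : nat :=
  match s with 4 => j.+1.*2 | 5 => j.*2.+1 | _ => j.+1 end%N.

Lemma base_freq_gt s j : (j < base_freq s j)%N.
Proof. by case: s => [|[|[|[|[|[|s]]]]]] //=; rewrite ?doubleS ltnS -addnn ?ltnS ?leqW ?leq_addr. Qed.

Lemma freq_base_freq s j i : freq s (base_freq s j * i.*2.+1)%N%:Z.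
Proof.
case: s => [|[|[|[|[|[|s]]]]]] //=.
- by rewrite dvdzE/= dvdn_mulr// dvdn2 odd_double.
- by rewrite dvdzE/= dvdn2 oddM /= !odd_double.
Qed.

(** For s = 4 and s = 5 the symmetry is the sign of the shift by pi, decided by the parity of the
    base frequency; for s = 2 and s = 3 it is the parity of cosine or sine. *)
Lemma base_freq_symmetric (R : realType) (N : nat) s j (U : R * 'rV[R]_N -> R) :
  (forall t x, U (t + pi, x) = (-1) ^+ base_freq s j * U (t, x)) ->
  (forall t x, U (- t, x) = (-1) ^+ (s == 3%N) * U (t, x)) -> time_symmetric s U.
Proof.
case: s => [|[|[|[|[|[|s]]]]]] //= hs ho.
- by apply: aeW => -[t x] /=; rewrite ho expr0 mul1r.
- by apply: aeW => -[t x] /=; rewrite ho expr1 mulN1r opprK.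
- by apply: aeW => -[t x] /=; rewrite hs -signr_odd odd_double expr0 mul1r.
- by apply: aeW => -[t x] /=; rewrite hs -signr_odd /= odd_double expr1 mulN1r.
Qed.

Theorem theorem1 (R : realType) (N : nat) (p : R) (q : \bar R) (s : nat)
    (L : ('rV[R]_N -> R) -> ('rV[R]_N -> R))
    (Rk : int -> ('rV[R]_N -> R) -> ('rV[R]_N -> R))
    (Q : 'rV[R]_N -> R) :
  (0 < N)%N -> 2 < p -> (1 <= s <= 5)%N -> (p%:E <= q)%E ->
  cond_A1 s p q L Rk -> cond_A2 s p q Q Rk -> cond_A3 s p Q Rk ->
  exists U : nat -> R * 'rV[R]_N -> R,
    (forall j, mixed_space s p q (U j) /\ distributional_solution p L Q (U j)) /\
    ereal_sup [set mixed_norm p q (U j) | j in [set: nat]] = +oo%E.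
Proof.
move=> _ p2 _ pq [[mL _ LP] HR [alpha alpha_gt [C C0 RN]] RI] [QL Q0 _ Rc] HA3.
pose r : R := (1 - p^-1)^-1; pose rho : R := 2 `^ (1 - 2 / p - alpha).
have p0 : 0 < p by lra.
have i0 : 0 < p^-1 by rewrite invr_gt0.
have i1 : p^-1 < 1 by rewrite invf_lt1//; lra.
have pr : p^-1 + r^-1 = 1 by rewrite /r invrK; ring.
have rE : r = p / (p - 1) by rewrite /r; field; rewrite !gt_eqF//=; lra.
have r1 : 1 < r by rewrite rE ltr_pdivlMr; lra.
have r2 : r < 2 by rewrite rE ltr_pdivrMr; lra.
have conjp : @hoelder_conjugate R p%:E = r%:E.
  by apply/esym/hoelder_conjugateP; [rewrite ltNyr|rewrite eqe gt_eqF|];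
    rewrite ?inver ?gt_eqF// -?EFinD ?pr//; lra.
have mQ := Lfun_meas QL.
have mQt := measurable_weight (p := p) QL.
have [cQ cQ0 [QtR QtP]] := weight_bounded p2 pr pq QL Q0.
pose b := s == 3%N; pose ms := base_freq s.
have ms0 j : (j < ms j)%N by exact: base_freq_gt.
have frq j i : freq s (ms j * i.*2.+1)%N%:Z by exact: freq_base_freq.
have sol j : exists U : R * 'rV[R]_N -> R,
  [/\ measurable_fun [set: measurableTypeR R * 'rV[R]_N] U,
      forall t x, U (t + 2 * pi, x) = U (t, x),
      (mixed_norm p q U < +oo)%E &
      (forall t x, U (t + pi / (ms j)%:R, x) = - U (t, x)) /\ forall t x, U (- t, x) = (-1) ^+ b * U (t, x)] /\
  distributional_solution p L Q U /\
  exists2 n : R, 0 <= n & 1 <= cQ * (C * cQ * (pi^-1 * (pi `^ p^-1) ^+ 2)) / (1 - rho) * (ms j)%:R `^ (- alpha) * n `^ (2 - r) /\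
    ((n `^ (r - 1))%:E <= cQ%:E * mixed_norm p q U)%E.
  have [om omL ompos] := HA3 _ (frq j 0%N); rewrite conjp in omL.
  have m0 : (0 < ms j)%N by exact: leq_ltn_trans (ms0 j).
  apply: (@breather R N p q L Q Rk p2 pq b (ms j) mL m0 _ _ alpha C alpha_gt C0 _ _ LP mQ mQt Q0 _ cQ cQ0 QtR QtP om omL ompos).
  - by move=> i; have [] := HR _ (frq j i).
  - by move=> i; have [] := HR _ (frq j i).
  - by move=> i f; exact: (RN _ f (frq j i)).
  - by move=> i f phi; exact: (RI _ f phi (frq j i)).
  - by move=> i; exact: Rc.
have [U UP] := choice sol.
exists U; split=> [j|].
  have [[mU pU NU [sU oU]] [dU _]] := UP j; split => //; split => //.
  have m0 : (0 < ms j)%N by exact: leq_ltn_trans (ms0 j).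
  (* A shift by pi consists of m shifts by pi/m, each changing the sign. *)
  have shift k t x : U j (t + k%:R * (pi / (ms j)%:R), x) = (-1) ^+ k * U j (t, x).
    elim: k => [|k IH]; first by rewrite mul0r addr0 expr0 mul1r.
    by rewrite -natr1 mulrDl mul1r addrA sU IH exprS mulN1r mulNr.
  have shift_pi t x : U j (t + pi, x) = (-1) ^+ ms j * U j (t, x).
    rewrite -shift; congr (U j (_ + _, x)); rewrite mulrC divfK//.
    by rewrite pnatr_eq0 -lt0n.
  exact: base_freq_symmetric shift_pi oU.
apply/eqP; rewrite -leye_eq leNgt; apply/negP => lt.
set S := ereal_sup _ in lt.
have US j : (mixed_norm p q (U j) <= S)%E by apply: ereal_sup_ubound; exists j.
have S0 : (0 <= S)%E by apply: le_trans (US 0%N); exact: Lnorm_ge0.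
pose B := fine S; have SE : S = B%:E by rewrite fineK// ge0_fin_numE.
(* If all norms were at most B, then n^(r-1) <= cQ B would bound n by this K for every base
   frequency, and m^alpha would stay below the constant [D]. *)
pose K := (cQ * B) `^ (r - 1)^-1.
have r10 : 0 < r - 1 by lra.
have cB0 : 0 <= cQ * B by rewrite mulr_ge0// fine_ge0.
pose D := cQ * (C * cQ * (pi^-1 * (pi `^ p^-1) ^+ 2)) / (1 - rho) * K `^ (2 - r).
have rho1 : 0 < 1 - rho.
  rewrite subr_gt0 /rho -opprB powRN invf_lt1 ?powR_gt0//.
  by rewrite -[ltLHS](powR1E (alpha - (1 - 2 / p))); apply: gt0_ltr_powR; rewrite ?nnegrE ?subr_gt0// ltr1n.
have alpha0 : 0 < alpha.
  by apply: le_lt_trans alpha_gt; rewrite subr_ge0 ler_pdivrMr// mul1r ltW.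
have mD j : (ms j)%:R `^ alpha <= D.
  have [_ [_ [n n0 [n1 nU]]]] := UP j.
  have mj : 0 < (ms j)%:R `^ alpha :> R by rewrite powR_gt0// ltr0n (leq_ltn_trans _ (ms0 j)).
  have nK : n <= K.
    apply: (le_powRW r10 n0 (powR_ge0 _ _)).
    rewrite -powRrM mulVf ?gt_eqF// powRr1// -lee_fin EFinM -SE.
    by apply: le_trans nU _; apply: lee_wpmul2l => //; rewrite lee_fin.
  rewrite powRN mulrAC ler_pdivlMr// mul1r in n1; apply: (le_trans n1).
  apply: ler_wpM2l; first by rewrite !mulr_ge0 ?invr_ge0 ?exprn_ge0 ?powR_ge0 ?pi_ge0// ltW.
  by apply: ge0_ler_powR; rewrite ?nnegrE ?powR_ge0//; lra.
have D0 : 0 <= D by apply: le_trans (mD 0%N); exact: powR_ge0.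
have [j jD] : exists j : nat, D `^ alpha^-1 < j%:R.
  exists (Num.truncn (D `^ alpha^-1)).+1; exact: truncnS_gt.
have := mD j; rewrite leNgt => /negP; apply.
have -> : D = (D `^ alpha^-1) `^ alpha by rewrite -powRrM mulVf ?gt_eqF// powRr1.
apply: gt0_ltr_powR; rewrite ?nnegrE ?powR_ge0//.
by apply: (lt_le_trans jD); rewrite ler_nat ltnW.
Qed.
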